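(* Let $H_{\mathbb R}$ be a real Hilbert space and $q\in(-1,1)$. The $q$-Gaussian von Neumann algebra $\Gamma_q(H_{\mathbb R})$ is QWEP.
   Context: QWEP: a $C^*$-algebra $B$ has the weak expectation property (WEP) if the canonical inclusion $B\to B^{**}$ factorizes completely contractively through some $B(K)$, $K$ a Hilbert space. A $C^*$-algebra is QWEP if it is a quotient, by a closed (two-sided) ideal, of a $C^*$-algebra with the WEP. $q$-Gaussian algebra: let $H_{\mathbb C}$ be the complexification of $H_{\mathbb R}$. The $q$-Fock space $\mathcal F_q(H_{\mathbb C})=\mathbb C\Omega\oplus\bigoplus_{n\ge1}H_{\mathbb C}^{\otimes n}$ is the Hilbert space completion of the algebraic direct sum of algebraic tensor powers for the inner product $\langle h_1\otimes\dots\otimes h_n,g_1\otimes\dots\otimes g_m\rangle_q=\delta_{n,m}\sum_{\pi\in S_n}q^{\mathrm{inv}(\pi)}\prod_{i=1}^n\langle h_i,g_{\pi(i)}\rangle$, where $\mathrm{inv}(\pi)$ is the number of inversions of $\pi$. For $h\in H_{\mathbb C}$, $a^*(h)$ is the bounded operator with $a^*(h)\Omega=h$, $a^*(h)(h_1\otimes\dots\otimes h_n)=h\otimes h_1\otimes\dots\otimes h_n$, and $a(h)$ is its adjoint. For $f\in H_{\mathbb R}$, $G(f)=a^*(f)+a(f)$. $\Gamma_q(H_{\mathbb R})$ is the von Neumann algebra generated by $\{G(f):f\in H_{\mathbb R}\}$ in $B(\mathcal F_q(H_{\mathbb C}))$. *)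

(* Defs.v *)
From HB Require Import structures.
From mathcomp Require Import all_boot all_order all_algebra all_fingroup.
From mathcomp Require Import sesquilinear complex.
From mathcomp Require Import all_classical all_reals all_analysis.

Set Implicit Arguments.
Unset Strict Implicit.
Unset Printing Implicit Defensive.

Import Order.TTheory GRing.Theory Num.Theory numFieldNormedType.Exports.

Local Open Scope classical_set_scope.
Local Open Scope ring_scope.
Local Open Scope complex_scope.

(* [theta] is [idfun] over the reals and [Num.conj] over the complexes; the
   inner product is linear in its first argument. *)
Record hilbertSpace (K : numFieldType) (theta : K -> K) := HilbertSpace {
  hilbert_sort :> completeNormedModType K;
  inner : {dot hilbert_sort for theta};
  norm_inner : forall x : hilbert_sort, `|x| ^+ 2 = inner x x }.

Arguments inner {K theta} h.

Notation realHilbert R := (@hilbertSpace R idfun).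
Notation complexHilbert R := (@hilbertSpace R[i] Num.conj).

Section BoundedOperators.
Variables (K : numFieldType) (theta : K -> K) (H : hilbertSpace theta).

Definition bounded_operator : {pred (H -> H)} :=
  fun T => `[< linear T /\ continuous T >].

Record bop := Bop { bop_fun :> H -> H; bopP : bop_fun \in bounded_operator }.

HB.instance Definition _ := [isSub for bop_fun].
HB.instance Definition _ := [Choice of bop by <:].

Lemma bounded_operator_submod : submod_closed bounded_operator.
Proof.
split=> [|a S T /asboolP[linS cS] /asboolP[linT cT]]; apply/asboolP; split.
- by move=> k x y; rewrite /= scaler0 addr0.
- exact: cst_continuous.
- move=> k x y; rewrite !fctE linS linT /= !scalerDr !scalerA mulrC.
  exact: addrACA.
- by move=> x; apply: cvgD; [apply: cvgZr; exact: cS|exact: cT].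
Qed.

HB.instance Definition _ :=
  GRing.isSubmodClosed.Build K (H -> H) bounded_operator
    bounded_operator_submod.
HB.instance Definition _ := [SubChoice_isSubLmodule of bop by <:].

Lemma id_bounded : (@idfun H) \in bounded_operator.
Proof. by apply/asboolP; split=> // x; exact: cvg_id. Qed.

Definition bop_id : bop := Bop id_bounded.

Lemma comp_bounded (S T : bop) : (S \o T) \in bounded_operator.
Proof.
have /asboolP[linS cS] := bopP S; have /asboolP[linT cT] := bopP T.
apply/asboolP; split=> [k x y|x]; first by rewrite /= linT linS.
by apply: continuous_comp; [exact: cT|exact: cS].
Qed.

Definition bop_comp (S T : bop) : bop := Bop (comp_bounded S T).

Definition adjoint (S T : bop) : Prop :=
  forall x y : H, inner H (S x) y = inner H x (T y).

(* Unital *-subalgebras of B(H), closed in B(H) for the strong operator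
   topology, which is the topology of pointwise convergence on H. *)
Definition von_neumann_algebra (M : set bop) : Prop :=
  [/\ M bop_id,
      (forall (a : K) S T, M S -> M T -> M (a *: S + T)),
      (forall S T, M S -> M T -> M (bop_comp S T)),
      (forall S, M S -> exists2 T, M T & adjoint S T) &
      (forall T : bop,
         closure (bop_fun @` M : set {ptws H -> H}) (T : H -> H) -> M T)].

Definition von_neumann_generated (S : set bop) : set bop :=
  smallest von_neumann_algebra S.

End BoundedOperators.

(* Not necessarily unital. *)
Record cstarAlgebra (R : realType) := CstarAlgebra {
  cstar_sort :> completeNormedModType R[i];
  cmul : cstar_sort -> cstar_sort -> cstar_sort;
  cstar : cstar_sort -> cstar_sort;
  cmulA : associative cmul;
  cmul_linearl : forall y, linear (cmul^~ y);
  cmul_linearr : forall x, linear (cmul x);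
  cstarK : involutive cstar;
  cstar_antilinear : forall (a : R[i]) x y,
    cstar (a *: x + y) = Num.conj a *: cstar x + cstar y;
  cstar_mul : forall x y, cstar (cmul x y) = cmul (cstar y) (cstar x);
  cmul_norm_le : forall x y, `|cmul x y| <= `|x| * `|y|;
  cstar_norm : forall x, `|cmul (cstar x) x| = `|x| ^+ 2 }.

(* A matricially normed space is given by the closed unit balls of the
   spaces of n x n matrices over it. *)

Record opSpace (R : realType) := OpSpace {
  op_sort :> lmodType R[i];
  mball : forall n, ('I_n -> 'I_n -> op_sort) -> Prop }.

Arguments mball {R} o n x.

Definition completely_contractive (R : realType) (X Y : opSpace R)
    (u : X -> Y) : Prop :=
  linear u /\
  forall n (x : 'I_n -> 'I_n -> X),
    mball X n x -> mball Y n (fun i j => u (x i j)).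

(* B(K): an n x n matrix of operators acts on the Hilbert sum K^n. *)
Definition bop_opSpace (R : realType) (K : complexHilbert R) : opSpace R :=
  @OpSpace R (bop K) (fun n x => forall v : 'I_n -> K,
    \sum_i `|\sum_j x i j (v j)| ^+ 2 <= \sum_j `|v j| ^+ 2).

(* [e] identifies the *-algebra of n x n matrices over A with the C*-algebra
   M; the norm it induces on matrices is the unique C*-norm. *)
Definition matrix_cstar (R : realType) (A : cstarAlgebra R) n
    (M : cstarAlgebra R) (e : ('I_n -> 'I_n -> A) -> M) : Prop :=
  [/\ linear e, bijective e,
      (forall x y, e (fun i j => \sum_k cmul (x i k) (y k j))
                   = cmul (e x) (e y)) &
      (forall x, e (fun i j => cstar (x j i)) = cstar (e x))].

Definition cstar_opSpace (R : realType) (A : cstarAlgebra R) : opSpace R :=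
  @OpSpace R A (fun n x =>
    exists (M : cstarAlgebra R) (e : ('I_n -> 'I_n -> A) -> M), matrix_cstar e /\ `|e x| <= 1).

(* Scalar matrices of norm at most 1 as operators on the Hilbert space C^I. *)
Definition scalar_contraction (R : realType) (I : finType)
    (a : I -> I -> R[i]) : Prop :=
  forall v : I -> R[i],
    \sum_i `|\sum_j a i j * v j| ^+ 2 <= \sum_j `|v j| ^+ 2.

Section Dual.
Variables (R : realType) (X : opSpace R).

(* The norm of X is that of its 1 x 1 matrices. *)
Definition bounded_functional : {pred (X -> R[i]^o)} :=
  fun f => `[< linear f /\ exists c : R[i],
    forall x, mball X 1 (fun _ _ => x) -> `|f x| <= c >].

Record dual := Dual {
  dual_fun :> X -> R[i]^o; dualP : dual_fun \in bounded_functional }.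

HB.instance Definition _ := [isSub for dual_fun].
HB.instance Definition _ := [Choice of dual by <:].

Lemma bounded_functional_submod : submod_closed bounded_functional.
Proof.
split=> [|a f g /asboolP[linf [c fc]] /asboolP[ling [d gd]]]; apply/asboolP.
  split; first by move=> k x y; rewrite /= scaler0 addr0.
  by exists 0 => x _; rewrite normr0.
split=> [k x y|].
  rewrite !fctE linf ling /= !scalerDr !scalerA mulrC; exact: addrACA.
exists (`|a| * c + d) => x bx; rewrite !fctE (le_trans (ler_normD _ _))//.
by rewrite normrM lerD ?gd// ler_wpM2l ?fc.
Qed.

HB.instance Definition _ :=
  GRing.isSubmodClosed.Build R[i] (X -> R[i]^o) bounded_functional
    bounded_functional_submod.
HB.instance Definition _ := [SubChoice_isSubLmodule of dual by <:].

(* The standard operator space dual: an m x m matrix over the dual is normed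
   as the completely bounded map it defines from X to the m x m matrices. *)
Definition dual_opSpace : opSpace R :=
  @OpSpace R dual (fun m f => forall n (x : 'I_n -> 'I_n -> X),
    mball X n x ->
    scalar_contraction
      (fun p r : 'I_m * 'I_n => f p.1 r.1 (x p.2 r.2) : R[i])).

End Dual.

Definition WEP (R : realType) (B : cstarAlgebra R) : Prop :=
  exists (K : complexHilbert R)
         (u : cstar_opSpace B -> bop_opSpace K)
         (v : bop_opSpace K -> dual_opSpace (dual_opSpace (cstar_opSpace B))),
    [/\ completely_contractive u, completely_contractive v &
        forall (b : cstar_opSpace B) (f : dual_opSpace (cstar_opSpace B)),
          v (u b) f = f b].

Definition closed_ideal (R : realType) (B : cstarAlgebra R) (J : set B) :=
  [/\ closed J, J 0,
      (forall (a : R[i]) x y, J x -> J y -> J (a *: x + y)) &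
      (forall b x, J x -> J (cmul b x) /\ J (cmul x b))].

Definition star_morphism (R : realType) (A B : cstarAlgebra R) (p : A -> B) :=
  [/\ linear p, (forall x y, p (cmul x y) = cmul (p x) (p y)) &
      (forall x, p (cstar x) = cstar (p x))].

(* [p] induces a *-isomorphism from B / J onto A. *)
Definition is_quotient (R : realType) (B : cstarAlgebra R) (J : set B)
    (A : cstarAlgebra R) (p : B -> A) : Prop :=
  [/\ star_morphism p, range p = setT & forall x, J x <-> p x = 0].

Definition QWEP (R : realType) (A : cstarAlgebra R) : Prop :=
  exists (B : cstarAlgebra R) (J : set B) (p : B -> A),
    [/\ WEP B, closed_ideal J & is_quotient J p].

(* [A] is the set of operators M, viewed as an abstract C*-algebra through
   the *-isomorphism [iota]; [iota] is then automatically isometric. *)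
Definition is_operator_algebra (R : realType) (H : complexHilbert R)
    (M : set (bop H)) (A : cstarAlgebra R) (iota : A -> bop H) : Prop :=
  [/\ linear iota, injective iota, range iota = M,
      (forall x y, iota (cmul x y) = bop_comp (iota x) (iota y)) &
      (forall x, adjoint (iota x) (iota (cstar x)))].

Definition QWEP_operator_algebra (R : realType) (H : complexHilbert R)
    (M : set (bop H)) : Prop :=
  exists (A : cstarAlgebra R) (iota : A -> bop H),
    is_operator_algebra M iota /\ QWEP A.

Section Complexification.
Variables (R : realType) (H : realHilbert R).

(* The pair (x, y) stands for x + i y. *)
Definition complexification : Type := (H * H)%type.

HB.instance Definition _ := GRing.Zmodule.on complexification.

Definition complexification_scale (a : R[i]) (h : complexification) :
    complexification :=
  (complex.Re a *: h.1 - complex.Im a *: h.2,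
   complex.Re a *: h.2 + complex.Im a *: h.1).

Lemma complexification_scaleA a b h :
  complexification_scale a (complexification_scale b h)
  = complexification_scale (a * b) h.
Proof.
case: a b h => [a a'] [b b'] [x y]; congr pair => /=.
  rewrite scalerBr scalerDr !scalerA scalerBl scalerDl !opprD.
  by rewrite [X in _ + X = _]addrC addrACA.
rewrite scalerBr scalerDr !scalerA scalerBl scalerDl.
by rewrite [X in _ + X = _]addrC addrACA.
Qed.

Lemma complexification_scale1 : left_id 1 complexification_scale.
Proof. by case=> x y; congr pair; rewrite /= !scale1r !scale0r ?subr0 ?addr0. Qed.

Lemma complexification_scaleDr :
  right_distributive complexification_scale +%R.
Proof.
move=> [a a'] [x y] [z t]; congr pair => /=; rewrite !scalerDr ?opprD.
  exact: addrACA.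
exact: addrACA.
Qed.

Lemma complexification_scaleDl h :
  {morph complexification_scale^~ h : a b / a + b}.
Proof.
case: h => x y [a a'] [b b']; congr pair => /=; rewrite !scalerDl ?opprD.
  exact: addrACA.
exact: addrACA.
Qed.

HB.instance Definition _ := GRing.Zmodule_isLmodule.Build R[i] complexification
  complexification_scaleA complexification_scale1
  complexification_scaleDr complexification_scaleDl.

Definition complexification_inner (h g : complexification) : R[i] :=
  (inner H h.1 g.1 + inner H h.2 g.2) +i* (inner H h.2 g.1 - inner H h.1 g.2).

Definition of_real (f : H) : complexification := (f, 0).

End Complexification.

Definition inversions n (s : 'S_n) : nat :=
  #|[set p : 'I_n * 'I_n | (p.1 < p.2)%N && (s p.2 < s p.1)%N]|.

Section Fock.
Variables (R : realType) (H : realHilbert R) (q : R).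

(* The list [:: h1; ...; hn] stands for the elementary tensor h1 (x) ... (x) hn,
   and the empty list for the vacuum vector. *)
Definition q_inner (s t : seq (complexification H)) : R[i] :=
  if size s == size t then
    \sum_(p : 'S_(size s)) q%:C ^+ inversions p *
      \prod_(i < size s) complexification_inner s`_i t`_(p i)
  else 0.

(* A Hilbert space completion of the algebraic direct sum of the tensor powers
   of the complexification: [tensor] gives the images of the elementary tensors
   under a linear isometric map with dense range from that direct sum, a linear
   map on a tensor power being the same as a multilinear map. *)
Record fockSpace := FockSpace {
  fock_sort :> complexHilbert R;
  tensor : seq (complexification H) -> fock_sort;
  tensor_linear : forall s t, linear (fun h => tensor (s ++ h :: t));
  tensor_inner : forall s t,
    inner fock_sort (tensor s) (tensor t) = q_inner s t;
  tensor_dense : dense [set x : fock_sort |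
    exists n (c : 'I_n -> R[i]) (s : 'I_n -> seq (complexification H)),
      x = \sum_i c i *: tensor (s i)] }.

Variable F : fockSpace.

(* The equation at s = [::] reads a*(h) Omega = h; density of the span of the
   tensors makes T unique. *)
Definition is_creation (h : complexification H) (T : bop F) : Prop :=
  forall s, T (tensor F s) = tensor F (h :: s).

(* The operators a*(f) + a(f), for f in the real Hilbert space. *)
Definition gaussians : set (bop F) :=
  [set G | exists (f : H) (T S : bop F),
     [/\ is_creation (of_real f) T, adjoint T S & G = T + S]].

Definition q_gaussian_algebra : set (bop F) := von_neumann_generated gaussians.

End Fock.

Arguments q_gaussian_algebra {R H q} F.

(* Main.v *)
(** The q-Gaussian operators have matrix models.  On the space with orthonormal
    basis the subsets of {1, ..., m}, creation and annihilation operators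
    twisted by signs e(i, j) commute or anticommute; for independent random
    signs of mean q, combinations with many small coefficients satisfy the
    q-commutation relations up to a small error in L2 on vectors of bounded
    degree.  So some choice of signs gives hermitian matrices whose moments in
    the normalized trace approximate any finite set of vacuum moments of the
    Gaussians.

    Along an ultrafilter these models realize the von Neumann algebra N as
    follows.  In the C*-algebra of block diagonal operators on a Hilbert sum of
    matrix algebras, let C be the subalgebra of the bounded sequences that
    converge, in the normalized Hilbert-Schmidt norms, to an operator T of N.
    Then T is a *-morphism of C onto N: contractions lift because the function
    2 y (1 + y^* y)^-1 maps polynomials to contractions.  The ideal J of the
    sequences tending to 0 has an approximate unit of projections e, and the
    limit of e x e + (1 - e) a (1 - e), where a lifts the conditional
    expectation onto N of x, factors C into its bidual through B(K).  Hence C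
    has the WEP. *)

(* The models match moments only and carry no uniform bound on operator norms, so a polynomial in
   the Gaussians is not represented by a bounded sequence; this obstacle shapes the lifting. Every
   strict contraction T of N is [2 S (1 + S^* S)^-1] for some S in N, found as a fixed point. If Y
   is a polynomial near S at the vacuum, Y' its adjoint, [Z = (1 + Y' Y)^-1] and [X = 2 Y Z], then
   for all R and Q one has [X - R = (2 Y - R - Q Y) Z + (Q - R Y') X / 2]. As X and Z are
   contractions, X is near R as soon as two polynomial expressions are small in L2, however large Y
   is. The same identity for operators shows that N, introduced as a commutant, is generated by the
   Gaussians.

   In the bidual of C the projections e converge to the central projection that splits it into the
   biduals of J and of N: [e x e] extends the first summand to B(K), the lifted expectation the
   second. The splitting itself is never constructed. Centrality becomes the statement that every
   bounded functional tends to 0 on the corners [e a (1 - e)], which holds because n such corners,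
   for suitable successive e, have a sum of norm O(sqrt n). *)
From HB Require Import structures.
Require Import Defs.
From mathcomp Require Import all_boot all_order all_algebra all_fingroup.
From mathcomp Require Import sesquilinear complex spectral.
From mathcomp Require Import all_classical all_reals all_analysis.
From mathcomp Require Import finmap.
From mathcomp Require Import ring lra.
Set Implicit Arguments.
Unset Strict Implicit.
Unset Printing Implicit Defensive.
Import Order.TTheory GRing.Theory Num.Theory numFieldNormedType.Exports.
Local Open Scope classical_set_scope.
Local Open Scope ring_scope.
Local Open Scope complex_scope.

(* Reflection for identities in a [zmodType], where [ring] does not apply. *)
Inductive zterm := ZVar of nat | ZAdd of zterm & zterm | ZOpp of zterm | ZNil.

Fixpoint zeval (V : zmodType) (e : seq V) t : V :=
  match t with
  | ZVar i => nth 0 e i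
  | ZAdd t u => zeval e t + zeval e u
  | ZOpp t => - zeval e t
  | ZNil => 0
  end.

Fixpoint zcoef t (i : nat) : int :=
  match t with
  | ZVar j => (i == j)%:Z
  | ZAdd t u => zcoef t i + zcoef u i
  | ZOpp t => - zcoef t i
  | ZNil => 0
  end.

Lemma zevalE (V : zmodType) (e : seq V) t :
  zeval e t = \sum_(i < size e) e`_i *~ zcoef t i.
Proof.
elim: t => [j|t IHt u IHu|t IHt|] /=; rewrite ?IHt ?IHu.
- have [lt|ge] := ltnP j (size e); last first.
    rewrite nth_default// big1// => i _.
    by rewrite (ltn_eqF (leq_trans (ltn_ord i) ge)) mulr0z.
  rewrite (bigD1 (Ordinal lt))//= eqxx mulr1z big1 ?addr0// => i.
  by rewrite -val_eqE /= => /negbTE ->; rewrite mulr0z.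
- by rewrite -big_split; apply: eq_bigr => i _; rewrite mulrzDr.
- by rewrite -sumrN; apply: eq_bigr => i _; rewrite mulrNz.
- by rewrite big1// => i _; rewrite mulr0z.
Qed.

Lemma zeval_eq (V : zmodType) (e : seq V) t u :
  all (fun i => zcoef t i == zcoef u i) (iota 0 (size e)) -> zeval e t = zeval e u.
Proof.
move=> /allP h; rewrite !zevalE; apply: eq_bigr => i _; congr (_ *~ _).
by apply/eqP; apply: h; rewrite mem_iota add0n ltn_ord.
Qed.

(** Atoms are compared with [unify] rather than syntactically, so that convertible occurrences of
    one term count as the same atom. *)
Ltac z_index a l :=
  match l with
  | cons ?b ?r =>
    match constr:(ltac:(first [unify a b; exact true | exact false])) with
    | true => constr:(O)
    | false => let n := z_index a r in constr:(S n)
    end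
  end.
Ltac z_mem a l :=
  match l with
  | nil => constr:(false)
  | cons ?b ?r =>
    match constr:(ltac:(first [unify a b; exact true | exact false])) with
    | true => constr:(true)
    | false => z_mem a r
    end
  end.
Ltac z_atoms t l :=
  match t with
  | (?a + ?b)%R => let l := z_atoms a l in z_atoms b l
  | (- ?a)%R => z_atoms a l
  | 0%R => l
  | _ => match z_mem t l with true => l | false => constr:(cons t l) end
  end.
Ltac z_quote t l :=
  match t with
  | (?a + ?b)%R => let a := z_quote a l in let b := z_quote b l in constr:(ZAdd a b)
  | (- ?a)%R => let a := z_quote a l in constr:(ZOpp a)
  | 0%R => constr:(ZNil)
  | _ => let n := z_index t l in constr:(ZVar n)
  end.
Ltac zmodule :=
  match goal with
  | |- @eq ?T ?x ?y =>
    let l := z_atoms x (@nil T) in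
    let l := z_atoms y l in
    let tx := z_quote x l in
    let ty := z_quote y l in
    refine (@zeval_eq _ l tx ty _); vm_compute; reflexivity
  end.

Lemma ex_choice (X Y : Type) (P : X -> Y -> Prop) :
  (forall x, exists y, P x y) -> exists f : X -> Y, forall x, P x (f x).
Proof. by move=> /choice[f Pf]; exists f. Qed.

Lemma le_eps (R : realType) (x y : R) :
  (forall e : R, 0 < e -> x <= y + e) -> x <= y.
Proof. by move=> h; apply/ler_addgt0Pr. Qed.

(** * Real-valued norms and completeness *)

Section RealNorm.
Variables (R : realType) (V : normedZmodType R[i]).
Implicit Types x y : V.

(** Norms over [R[i]] take values in [R[i]]; the real part brings all estimates into the ordered
    field [R], where [lra] applies. *)
Definition nr x : R := complex.Re `|x|.

Lemma norm_nr x : `|x| = (nr x)%:C.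
Proof.
have := normr_ge0 x; rewrite /nr; case: `|x| => a b.
by rewrite lecE /= => /andP[/eqP -> _].
Qed.

Lemma nr_ge0 x : 0 <= nr x.
Proof. by rewrite -lecR -norm_nr normr_ge0. Qed.

Lemma nr0 : nr 0 = 0.
Proof. by rewrite /nr normr0. Qed.

Lemma nr_eq0 x : (nr x == 0) = (x == 0).
Proof. by rewrite -[RHS]normr_eq0 norm_nr (inj_eq (@complexI R)). Qed.

Lemma nrN x : nr (- x) = nr x.
Proof. by rewrite /nr normrN. Qed.

Lemma nrBC x y : nr (x - y) = nr (y - x).
Proof. by rewrite /nr distrC. Qed.

Lemma ler_nrD x y : nr (x + y) <= nr x + nr y.
Proof. by rewrite -lecR rmorphD /= -!norm_nr ler_normD. Qed.

Lemma ler_nrB x y : nr (x - y) <= nr x + nr y.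
Proof. by rewrite -(nrN y) ler_nrD. Qed.

Lemma ler_nrT z x y : nr (x - y) <= nr (x - z) + nr (z - y).
Proof. by rewrite -(subrKA z) ler_nrD. Qed.

Lemma ler_nr_sum (I : Type) (r : seq I) (P : pred I) (F : I -> V) :
  nr (\sum_(i <- r | P i) F i) <= \sum_(i <- r | P i) nr (F i).
Proof.
elim/big_rec2: _ => [|i y z _ h]; first by rewrite nr0.
by rewrite (le_trans (ler_nrD _ _))// lerD2l.
Qed.

Lemma ler_nr_dist x y : `|nr x - nr y| <= nr (x - y).
Proof.
rewrite ler_norml lerNl opprB; apply/andP; split.
  by rewrite lerBlDr nrBC (le_trans _ (ler_nrD _ _))// subrK.
by rewrite lerBlDr (le_trans _ (ler_nrD _ _))// subrK.
Qed.

End RealNorm.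

Lemma nrZ (R : realType) (V : normedModType R[i]) (a : R[i]) (x : V) :
  nr (a *: x) = nr a * nr x.
Proof. by apply: (@complexI R); rewrite rmorphM /= -!norm_nr normrZ. Qed.

Section ComplexNorm.
Variable R : realType.
Implicit Types z : R[i].

Lemma nrM z w : nr (z * w) = nr z * nr w.
Proof. by apply: (@complexI R); rewrite rmorphM /= -!norm_nr normrM. Qed.

Lemma nr1 : nr (1 : R[i]) = 1 :> R.
Proof. by rewrite /nr normr1. Qed.

Lemma nr_real (a : R) : nr a%:C = `|a|.
Proof. by rewrite /nr normc_def /= expr0n /= addr0 sqrtr_sqr. Qed.

Lemma nr_conj z : nr (Num.conj z) = nr z.
Proof. by rewrite /nr norm_conjC. Qed.

Lemma nr_sqr z : nr z ^+ 2 = complex.Re z ^+ 2 + complex.Im z ^+ 2.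
Proof. by rewrite /nr normc_def /= sqr_sqrtr// addr_ge0// sqr_ge0. Qed.

Lemma mulCJ z : z * Num.conj z = (nr z ^+ 2)%:C.
Proof. by rewrite -normCK norm_nr rmorphXn. Qed.

Lemma ler_Re_nr z : complex.Re z <= nr z.
Proof.
rewrite (le_trans (ler_norm _))// -(ler_pXn2r (n := 2)) ?nnegrE ?nr_ge0//.
by rewrite nr_sqr real_normK ?num_real// lerDl sqr_ge0.
Qed.

Lemma ler_normRe_nr z : `|complex.Re z| <= nr z.
Proof.
rewrite -(ler_pXn2r (n := 2)) ?nnegrE ?nr_ge0//.
by rewrite nr_sqr real_normK ?num_real// lerDl sqr_ge0.
Qed.

Lemma ler_normIm_nr z : `|complex.Im z| <= nr z.
Proof.
rewrite -(ler_pXn2r (n := 2)) ?nnegrE ?nr_ge0//.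
by rewrite nr_sqr real_normK ?num_real// lerDr sqr_ge0.
Qed.

Lemma ler_nr_ReIm z : nr z <= `|complex.Re z| + `|complex.Im z|.
Proof.
rewrite -(ler_pXn2r (n := 2)) ?nnegrE ?nr_ge0 ?addr_ge0//.
rewrite nr_sqr sqrrD !real_normK ?num_real//.
by rewrite addrAC lerDl mulrn_wge0// mulr_ge0.
Qed.

Lemma cReD z w : complex.Re (z + w) = complex.Re z + complex.Re w.
Proof. by case: z w => [? ?] [? ?]. Qed.

Lemma cImD z w : complex.Im (z + w) = complex.Im z + complex.Im w.
Proof. by case: z w => [? ?] [? ?]. Qed.

Lemma cReN z : complex.Re (- z) = - complex.Re z.
Proof. by case: z. Qed.

Lemma cImN z : complex.Im (- z) = - complex.Im z.
Proof. by case: z. Qed.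

Lemma cReB z w : complex.Re (z - w) = complex.Re z - complex.Re w.
Proof. by rewrite cReD cReN. Qed.

Lemma cImB z w : complex.Im (z - w) = complex.Im z - complex.Im w.
Proof. by rewrite cImD cImN. Qed.

Lemma cRe_conj z : complex.Re (Num.conj z) = complex.Re z.
Proof. by case: z. Qed.

Lemma cReMr (a : R) z : complex.Re (a%:C * z) = a * complex.Re z.
Proof. by case: z => x y /=; rewrite mul0r subr0. Qed.

Lemma conj_real (a : R) : Num.conj (a%:C) = a%:C.
Proof. by rewrite /Num.conj /= oppr0. Qed.

Lemma cRe_sum (I : Type) (r : seq I) (P : pred I) (F : I -> R[i]) :
  complex.Re (\sum_(i <- r | P i) F i) = \sum_(i <- r | P i) complex.Re (F i).
Proof. by elim/big_ind2: _ => // ? x ? y <- <-; rewrite cReD. Qed.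

(** Rotating by [u] turns bounds on real parts into bounds on moduli. *)
Lemma phase_exists z : exists2 u : R[i], nr u = 1 & u * z = (nr z)%:C.
Proof.
have [->|z0] := eqVneq z 0.
  by exists 1; rewrite ?nr1// mulr0 nr0.
have nz0 : nr z != 0 by rewrite nr_eq0.
exists ((nr z)^-1%:C * Num.conj z).
  rewrite nrM nr_conj nr_real ger0_norm ?invr_ge0 ?nr_ge0// mulVf//.
rewrite -mulrA [Num.conj z * z]mulrC mulCJ -rmorphM /= expr2 mulrA mulVf//.
by rewrite mul1r.
Qed.

End ComplexNorm.

Section Completeness.
Variables (R : realType).

Lemma complete_seq (V : completeNormedModType R[i]) (u : nat -> V) :
  (forall e : R, 0 < e -> exists n0, forall m n, (n0 <= m)%N -> (n0 <= n)%N ->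
     nr (u m - u n) < e) ->
  exists l, forall e : R, 0 < e -> exists n0, forall n, (n0 <= n)%N ->
     nr (u n - l) < e.
Proof.
move=> cu.
have : cauchy (u @ \oo).
  apply/cauchy_ballP => e e0.
  have [e' e'E] : exists e' : R, e = e'%:C.
    exists (complex.Re e); move: e0; rewrite ltcE; case: e => a b /= /andP[/eqP -> _] //.
  move: e0; rewrite e'E (ltcR 0) => e'0.
  have [n0 hn] := cu _ e'0.
  exists ((u @` [set n | (n0 <= n)%N]), (u @` [set n | (n0 <= n)%N])).
    by split; exists n0 => // n /= h; exists n.
  move=> [x y] [/= [m hm <-] [n hn' <-]].
  by rewrite -ball_normE /= norm_nr ltcR hn.
move=> /cauchy_cvg /cvg_ex[l /cvgrPdist_lt cl]; exists l => e e0.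
have e0' : 0 < e%:C by rewrite (ltcR 0).
have [n0 _ hn] := cl _ e0'.
by exists n0 => n /hn /=; rewrite norm_nr ltcR nrBC.
Qed.

End Completeness.

Section MkCompleteNormedModule.
Variables (R : realType) (V : lmodType R[i]) (N : V -> R).
Hypothesis ND : forall x y, N (x + y) <= N x + N y.
Hypothesis NZ : forall (a : R[i]) x, N (a *: x) = nr a * N x.
Hypothesis N0 : forall x, N x = 0 -> x = 0.
Hypothesis Ncomplete : forall u : nat -> V,
  (forall e : R, 0 < e -> exists n0, forall m n, (n0 <= m)%N -> (n0 <= n)%N ->
     N (u m - u n) < e) ->
  exists l, forall e : R, 0 < e -> exists n0, forall n, (n0 <= n)%N ->
     N (u n - l) < e.

(** The body mentions the hypotheses on [N] so that they become parameters of the alias; the normed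
    and complete structures can then be attached to it. *)
Definition cnm : Type := let _ := (ND, NZ, N0, Ncomplete) in V.

HB.instance Definition _ := GRing.Lmodule.on cnm.

Let cN (x : cnm) : R[i] := (N x)%:C.

Let cND x y : cN (x + y) <= cN x + cN y.
Proof. by rewrite /cN -rmorphD /= lecR ND. Qed.

Let cNZ (a : R[i]) (x : cnm) : cN (a *: x) = `|a| * cN x.
Proof. by rewrite /cN norm_nr -rmorphM /= NZ. Qed.

Let cN0 (x : cnm) : cN x = 0 -> x = 0.
Proof. by move=> /(@complexI R) /N0. Qed.

HB.instance Definition _ := Lmodule_isNormed.Build R[i] cnm cND cNZ cN0.

Lemma nr_cnm (x : cnm) : nr x = N x. Proof. by []. Qed.

(** Sequential completeness suffices: a Cauchy filter contains sets of diameter below [1 / (n + 1)],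
    and points chosen in them form a Cauchy sequence whose limit is the limit of the filter. *)
Let cnm_complete (F : set_system cnm) : ProperFilter F -> cauchy F -> cvg F.
Proof.
move=> FF /cauchy_ballP cF.
have [A hA] : exists A : nat -> set cnm, forall n, F (A n) /\
    forall x y, A n x -> A n y -> nr (x - y) < n.+1%:R^-1.
  apply: (@ex_choice _ _ (fun n (B : set cnm) => F B /\
    forall x y, B x -> B y -> nr (x - y) < n.+1%:R^-1)) => n.
  have e0 : (0 : R[i]) < (n.+1%:R^-1 : R)%:C by rewrite (ltcR 0) invr_gt0.
  have [[B C] [/= FB FC] BC] := cF _ e0.
  exists (B `&` C); split; first exact: filterI.
  move=> x y [Bx _] [_ Cy]; have := BC (x, y) (conj Bx Cy).
  by rewrite -ball_normE /= norm_nr ltcR.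
have [u hu] : exists u : nat -> cnm, forall n, A n (u n).
  apply: (@ex_choice _ _ (fun n x => A n x)) => n.
  have [x] := filter_ex (hA n).1; by exists x.
have eps (e : R) : 0 < e -> exists n, n.+1%:R^-1 < e.
  move=> e0; exists (Num.truncn e^-1).
  by rewrite invf_plt ?posrE// truncnS_gt.
have mono (m n : nat) : (m <= n)%N -> n.+1%:R^-1 <= m.+1%:R^-1 :> R.
  by move=> mn; rewrite lef_pV2 ?posrE// ler_nat ltnS.
have dA m n : nr (u m - u n) < m.+1%:R^-1 + n.+1%:R^-1.
  have [x [xm xn]] := filter_ex (filterI (hA m).1 (hA n).1).
  rewrite (le_lt_trans (ler_nrT x _ _))// ltrD//.
    exact: (hA m).2.
  exact: (hA n).2.
have [l hl] : exists l, forall e : R, 0 < e -> exists n0, forall n, (n0 <= n)%N ->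
     N (u n - l) < e.
  apply: Ncomplete => e e0.
  have [n0 hn0] := eps (e / 2) (divr_gt0 e0 (ltr0Sn _ 1)).
  exists n0 => m n hm hn; rewrite -nr_cnm (lt_le_trans (dA _ _))//.
  rewrite (splitr e) lerD// ltW// (le_lt_trans _ hn0)// mono//.
apply/cvg_ex; exists (l : cnm); apply/cvgrPdist_lt => e e0.
have eE : e = (complex.Re e)%:C.
  by move: e0; rewrite ltcE; case: e => a b /= /andP[/eqP -> _].
move: e0; rewrite eE (ltcR 0); set e' := complex.Re e => e0.
have [n1 hn1] := eps (e' / 2) (divr_gt0 e0 (ltr0Sn _ 1)).
have [n2 hn2] := hl (e' / 2) (divr_gt0 e0 (ltr0Sn _ 1)).
pose n := maxn n1 n2.
apply: filterS (hA n).1 => x Ax; rewrite norm_nr ltcR.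
rewrite (le_lt_trans (ler_nrT (u n) _ _))// (splitr e') addrC ltrD//.
  by rewrite (lt_trans ((hA n).2 _ _ (hu n) Ax))// (le_lt_trans _ hn1)// mono// leq_maxl.
by rewrite nrBC nr_cnm hn2// leq_maxr.
Qed.

HB.instance Definition _ := Uniform_isComplete.Build cnm cnm_complete.

Definition mk_cnm : completeNormedModType R[i] := cnm.

End MkCompleteNormedModule.

(** * Hilbert spaces and bounded operators *)

Section Limits.
Variables (R : realType) (V : normedZmodType R[i]).

Definition tends (u : nat -> V) (l : V) := forall e : R, 0 < e ->
  exists n0, forall n, (n0 <= n)%N -> nr (u n - l) < e.

Lemma inv_nat_lt (e : R) : 0 < e -> exists n, n.+1%:R^-1 < e.
Proof.
move=> e0; exists (Num.truncn e^-1).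
by rewrite invf_plt ?posrE// truncnS_gt.
Qed.

Lemma inv_nat_mono (m n : nat) : (m <= n)%N -> n.+1%:R^-1 <= m.+1%:R^-1 :> R.
Proof. by move=> mn; rewrite lef_pV2 ?posrE// ler_nat ltnS. Qed.

Lemma tends_uniq u l l' : tends u l -> tends u l' -> l = l'.
Proof.
move=> ul ul'; apply/eqP; rewrite -subr_eq0 -nr_eq0 eq_le nr_ge0 andbT leNgt.
apply/negP => d0; have d2 : 0 < nr (l - l') / 2 by rewrite divr_gt0.
have [n1 h1] := ul _ d2; have [n2 h2] := ul' _ d2.
have := ler_nrT (u (maxn n1 n2)) l l'; rewrite leNgt => /negP; apply.
by rewrite [ltRHS]splitr ltrD ?h2 ?leq_maxr// nrBC h1 ?leq_maxl.
Qed.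

Lemma tendsD u v l m : tends u l -> tends v m -> tends (fun n => u n + v n) (l + m).
Proof.
move=> ul vm e e0; have e2 : 0 < e / 2 by rewrite divr_gt0.
have [n1 h1] := ul _ e2; have [n2 h2] := vm _ e2.
exists (maxn n1 n2) => n; rewrite geq_max => /andP[/h1 h /h2 h'].
by rewrite opprD addrACA (le_lt_trans (ler_nrD _ _))// (splitr e) ltrD.
Qed.

Lemma tends_nr u l e : 0 < e -> tends u l ->
  exists n0, forall n, (n0 <= n)%N -> `|nr (u n) - nr l| < e.
Proof.
by move=> e0 /(_ _ e0)[n0 h]; exists n0 => n /h; apply: le_lt_trans (ler_nr_dist _ _).
Qed.

Lemma tends_nr_le u l c : tends u l -> (forall n, nr (u n) <= c) -> nr l <= c.
Proof.
move=> ul uc; apply: le_eps => e e0.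
have [n0 h] := ul _ e0; have := h _ (leqnn _); rewrite nrBC => h'.
rewrite -(subrK (u n0) l) (le_trans (ler_nrD _ _))// addrC lerD// ltW//.
Qed.

End Limits.

Lemma tendsZ (R : realType) (V : normedModType R[i]) (a : R[i]) (u : nat -> V) l :
  tends u l -> tends (fun n => a *: u n) (a *: l).
Proof.
move=> ul e e0; have d0 : 0 < nr a + 1 by rewrite ltr_wpDl ?nr_ge0.
have [n0 h] := ul _ (divr_gt0 e0 d0).
exists n0 => n /h; rewrite -scalerBr nrZ ltr_pdivlMr// => h'.
by rewrite (le_lt_trans _ h')// mulrC ler_wpM2l ?nr_ge0// lerDl.
Qed.

Lemma small_zero (R : realType) (V : normedZmodType R[i]) (x : V) :
  (forall e : R, 0 < e -> nr x <= e) -> x = 0.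
Proof.
move=> h; apply/eqP; rewrite -nr_eq0 eq_le nr_ge0 andbT.
by apply: le_eps => e /h; rewrite add0r.
Qed.

Section Hilbert.
Variables (R : realType) (H : complexHilbert R).
Local Notation ip := (inner H).
Implicit Types (x y z : H) (a : R[i]).

Lemma ipDl x y z : ip (x + y) z = ip x z + ip y z.
Proof. exact: linearDl. Qed.

Lemma ipDr x y z : ip z (x + y) = ip z x + ip z y.
Proof. exact: linearD. Qed.

Lemma ipZl a x z : ip (a *: x) z = a * ip x z.
Proof. exact: linearZl_LR. Qed.

Lemma ipZr a x z : ip z (a *: x) = Num.conj a * ip z x.
Proof. exact: linearZ. Qed.

Lemma ipC x y : ip x y = Num.conj (ip y x).
Proof. by rewrite (@hermC _ false Num.conj) expr0 mul1r. Qed.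

Lemma ipNl x z : ip (- x) z = - ip x z.
Proof. by rewrite -scaleN1r ipZl mulN1r. Qed.

Lemma ipNr x z : ip z (- x) = - ip z x.
Proof. by rewrite ipC ipNl rmorphN /= -ipC. Qed.

Lemma ipBl x y z : ip (x - y) z = ip x z - ip y z.
Proof. by rewrite ipDl ipNl. Qed.

Lemma ipBr x y z : ip z (x - y) = ip z x - ip z y.
Proof. by rewrite ipDr ipNr. Qed.

Lemma ip0l z : ip 0 z = 0.
Proof. by rewrite -(subrr 0) ipBl subrr. Qed.

Lemma ip0r z : ip z 0 = 0.
Proof. by rewrite -(subrr 0) ipBr subrr. Qed.

Lemma ip_suml I (r : seq I) (P : pred I) (F : I -> H) z :
  ip (\sum_(i <- r | P i) F i) z = \sum_(i <- r | P i) ip (F i) z.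
Proof. by elim/big_rec2: _ => [|i y1 y2 _ <-]; rewrite ?ip0l ?ipDl. Qed.

Lemma ip_sumr I (r : seq I) (P : pred I) (F : I -> H) z :
  ip z (\sum_(i <- r | P i) F i) = \sum_(i <- r | P i) ip z (F i).
Proof. by elim/big_rec2: _ => [|i y1 y2 _ <-]; rewrite ?ip0r ?ipDr. Qed.

Lemma ipxx x : ip x x = (nr x ^+ 2)%:C.
Proof. by rewrite -norm_inner norm_nr rmorphXn. Qed.

Lemma nr_sqr_ip x : nr x ^+ 2 = complex.Re (ip x x).
Proof. by rewrite ipxx. Qed.

Lemma Re_ipC x y : complex.Re (ip x y) = complex.Re (ip y x).
Proof. by rewrite ipC cRe_conj. Qed.

Lemma nr_sqrD x y :
  nr (x + y) ^+ 2 = nr x ^+ 2 + nr y ^+ 2 + 2 * complex.Re (ip x y).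
Proof.
by rewrite !nr_sqr_ip ipDl !ipDr !cReD (Re_ipC y x); ring.
Qed.

Lemma nr_sqrB x y :
  nr (x - y) ^+ 2 = nr x ^+ 2 + nr y ^+ 2 - 2 * complex.Re (ip x y).
Proof. by rewrite nr_sqrD nrN ipNr cReN mulrN. Qed.

Lemma parallelogram x y :
  nr (x + y) ^+ 2 + nr (x - y) ^+ 2 = 2 * nr x ^+ 2 + 2 * nr y ^+ 2.
Proof. by rewrite nr_sqrD nr_sqrB; ring. Qed.

Lemma Re_ip_le x y : complex.Re (ip x y) <= nr x * nr y.
Proof.
have [->|y0] := eqVneq y 0; first by rewrite ip0r nr0 mulr0.
have [->|x0] := eqVneq x 0; first by rewrite ip0l nr0 mul0r.
have ny : 0 < nr y by rewrite lt_def nr_ge0 nr_eq0 y0.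
have nx : 0 < nr x by rewrite lt_def nr_ge0 nr_eq0 x0.
have := sqr_ge0 (nr ((nr y)%:C *: x - (nr x)%:C *: y)).
rewrite nr_sqrB !nrZ !nr_real !ger0_norm ?nr_ge0// ipZl ipZr conj_real !cReMr => h.
have h2 : 0 <= 2 * (nr x * nr y) * (nr x * nr y - complex.Re (ip x y)) by lra.
by move: h2; rewrite pmulr_rge0 ?subr_ge0// mulr_gt0// mulr_gt0.
Qed.

Lemma cauchy_schwarz x y : nr (ip x y) <= nr x * nr y.
Proof.
have [u u1 hu] := phase_exists (ip x y).
have := Re_ip_le (u *: x) y.
by rewrite ipZl hu /= nrZ u1 mul1r.
Qed.

Lemma ip_ext x y : (forall z, ip x z = ip y z) -> x = y.
Proof.
move=> h; apply/eqP; rewrite -subr_eq0 -nr_eq0 -sqrf_eq0 nr_sqr_ip.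
by rewrite ipBl h subrr.
Qed.

Lemma tends_ipl (u : nat -> H) l z : tends u l ->
  tends (fun n => ip (u n) z) (ip l z).
Proof.
move=> ul e e0; have d0 : 0 < nr z + 1 by rewrite ltr_wpDl ?nr_ge0.
have [n0 h] := ul _ (divr_gt0 e0 d0).
exists n0 => n /h; rewrite ltr_pdivlMr// => h'.
rewrite -ipBl (le_lt_trans (cauchy_schwarz _ _))// (le_lt_trans _ h')//.
by rewrite ler_wpM2l ?nr_ge0// lerDl.
Qed.

(* The functional is given by its graph G; the representing vector minimizes
   |x|^2 - 2 Re a over G x a. *)
Lemma riesz (G : H -> R[i] -> Prop) (c : R) :
  0 <= c -> G 0 0 -> (forall a x y s t, G x s -> G y t -> G (a *: x + y) (a * s + t)) ->
  (forall x s, G x s -> nr s <= c * nr x) ->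
  exists2 y, nr y <= c & forall x s, G x s -> s = ip x y.
Proof.
move=> c0 G0 GL Gc.
pose J (x : H) (s : R[i]) := nr x ^+ 2 - 2 * complex.Re s.
have Jc x s : G x s -> - c ^+ 2 <= J x s.
  move=> /Gc h; rewrite /J; have := ler_Re_nr s => h'.
  have := sqr_ge0 (nr x - c); rewrite sqrrB => h''; lra.
pose S := [set J p.1 p.2 | p in [set p : H * R[i] | G p.1 p.2]].
have Slb : has_lbound S by exists (- c ^+ 2) => _ [[x s] /= /Jc h <-].
have S0 : S !=set0 by exists (J 0 0); exists (0, 0).
pose m := inf S.
have mJ x s : G x s -> m <= J x s by move=> h; apply: ge_inf => //; exists (x, s).
have [u hu] : exists u : nat -> H * R[i], forall n,
    G (u n).1 (u n).2 /\ J (u n).1 (u n).2 < m + n.+1%:R^-1.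
  apply: (@ex_choice _ _ (fun n (p : H * R[i]) =>
     G p.1 p.2 /\ J p.1 p.2 < m + n.+1%:R^-1)) => n.
  have [|_ [[x s] /= Gxs <-] h] := @inf_adherent _ S n.+1%:R^-1 _ (conj S0 Slb).
    by rewrite invr_gt0.
  by exists (x, s).
(* The midpoint stays in the graph, so the parallelogram law bounds the distance of two
   near-minimizers of [J]: minimizing sequences are Cauchy. *)
have par x s y t : G x s -> G y t ->
    nr (x - y) ^+ 2 <= 2 * (J x s - m) + 2 * (J y t - m).
  move=> Gx Gy; have Gh : G ((2^-1)%:C *: x + ((2^-1)%:C *: y + 0))
      ((2^-1)%:C * s + ((2^-1)%:C * t + 0)) by apply: (GL) => //; exact: GL.
  have := mJ _ _ Gh; rewrite /J !addr0 -scalerDr nrZ nr_real cReD !cReMr.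
  rewrite ger0_norm ?invr_ge0// exprMn; have := parallelogram x y; lra.
have [y hy] : exists y, tends (fun n => (u n).1) y.
  apply: complete_seq => e e0.
  have [n0 hn0] := inv_nat_lt (divr_gt0 (exprn_gt0 2 e0) (ltr0Sn R 3)).
  exists n0 => i j hi hj; rewrite -(ltr_pXn2r (n := 2)) ?nnegrE ?nr_ge0 ?(ltW e0)//.
  apply: (le_lt_trans (par _ _ _ _ (hu i).1 (hu j).1)).
  have := inv_nat_mono R hi; have := inv_nat_mono R hj.
  have := (hu i).2; have := (hu j).2; move: hn0.
  by move: (n0.+1%:R^-1) (j.+1%:R^-1) (i.+1%:R^-1) => A B C; lra.
have eqRe x s : G x s -> complex.Re s = complex.Re (ip x y).
  move=> Gx; pose d := complex.Re (ip y x) - complex.Re s.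
  (* Comparing the near-minimizers with their translates by [t x] leaves a quadratic in [t] that is
     nonnegative everywhere, so its linear coefficient [d] vanishes. *)
  have pos (t : R) : 0 <= t ^+ 2 * nr x ^+ 2 + 2 * (t * d).
    apply: le_eps => e e0.
    have [n1 h1] := inv_nat_lt (divr_gt0 e0 (ltr0Sn R 1)).
    have e' : 0 < e / (4 * (`|t| + 1)).
      by rewrite divr_gt0// mulr_gt0// ltr_wpDl.
    have [n2 h2] := tends_ipl x hy e'.
    pose n := maxn n1 n2.
    have Gn := GL (t%:C) _ _ _ _ Gx (hu n).1.
    have := mJ _ _ Gn; rewrite /J nr_sqrD nrZ nr_real exprMn real_normK ?num_real//.
    rewrite cReD !cReMr ipZl cReMr (Re_ipC x).
    have := (hu n).2; rewrite /J.
    have := h2 n (leq_maxr _ _) => h3 h4 h5.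
    have h6 : t * (complex.Re (ip (u n).1 x) - complex.Re (ip y x)) <= e / 4.
      rewrite (le_trans (ler_norm _))// normrM -cReB.
      have h7 := le_lt_trans (ler_normRe_nr _) h3.
      have h8 : (`|t| + 1) * (e / (4 * (`|t| + 1))) = e / 4.
        by field; rewrite gt_eqF ?ltr_wpDl//.
      rewrite -h8 ler_pM ?normr_ge0// ?lerDl//; exact: ltW.
    have h9 := le_lt_trans (inv_nat_mono R (leq_maxl n1 n2)) h1.
    move: h4 h5 h6 h9; rewrite /d -/n.
    move: (complex.Re (ip (u n).1 x)) (complex.Re (ip y x)) => P Q.
    move: (n.+1%:R^-1) => iN; set A := nr (u n).1 ^+ 2; set B := complex.Re (u n).2.
    lra.
  rewrite Re_ipC; apply/eqP; rewrite eq_sym -subr_eq0 -/d; apply/eqP.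
  have nx1 : 0 < nr x ^+ 2 + 1 by rewrite ltr_wpDl ?sqr_ge0.
  have := pos (- d / (nr x ^+ 2 + 1)).
  have -> : (- d / (nr x ^+ 2 + 1)) ^+ 2 * nr x ^+ 2 +
     2 * (- d / (nr x ^+ 2 + 1) * d) =
     - (d ^+ 2 * ((nr x ^+ 2 + 2) / (nr x ^+ 2 + 1) ^+ 2)).
    by field; rewrite gt_eqF.
  rewrite oppr_ge0 pmulr_lle0 ?divr_gt0 ?exprn_gt0 ?ltr_wpDl ?sqr_ge0//.
  by move=> h; apply/eqP; rewrite -sqrf_eq0 eq_le h sqr_ge0.
have eqG x s : G x s -> s = ip x y.
  move=> Gx; apply/eqP; rewrite eq_complex (eqRe _ _ Gx) eqxx /=.
  (* The identity of real parts, applied to [- i x], gives that of imaginary parts. *)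
  have Gi : G ((- 'i) *: x + 0) ((- 'i) * s + 0) by exact: GL.
  have := eqRe _ _ Gi; rewrite !addr0 ipZl.
  have iE (z : R[i]) : complex.Re (- 'i * z) = complex.Im z.
    by case: z => ? ? /=; rewrite oppr0 mul0r mulN1r opprK add0r.
  by rewrite !iE => ->.
exists y => //.
have [->|y0] := eqVneq y 0; first by rewrite nr0.
have ny : 0 < nr y by rewrite lt_def nr_ge0 nr_eq0 y0.
(* Along the minimizing sequence the functional takes the values [<u_n, y>]; passing to the limit in
   the bound by [c |u_n|] gives [|y|^2 <= c |y|]. *)
rewrite -(ler_pM2r ny) -expr2 nr_sqr_ip.
apply: le_eps => e e0; have e2 : 0 < e / 2 by rewrite divr_gt0.
have d0 : 0 < c + 1 by rewrite ltr_wpDl.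
have [n1 h1] := tends_ipl y hy e2.
have [n2 h2] := tends_nr (divr_gt0 e2 d0) hy.
pose n := maxn n1 n2.
have := h1 n (leq_maxl _ _); have := h2 n (leq_maxr _ _).
have := Gc _ _ (hu n).1; have := eqG _ _ (hu n).1 => <- h3 h4 h5.
have h6 := le_lt_trans (ler_normRe_nr _) h5.
have h7 := le_lt_trans (ler_norm _) h4.
have h8 : c * (nr (u n).1 - nr y) <= e / 2.
  have [d|d] := leP 0 (nr (u n).1 - nr y); last first.
    by rewrite (le_trans _ (ltW e2))// mulr_ge0_le0// ltW.
  have : (c + 1) * (nr (u n).1 - nr y) <= e / 2 by rewrite mulrC -ler_pdivlMr// ltW.
  by apply: le_trans; rewrite ler_wpM2r// lerDl.
move: h6; rewrite cReB ltr_norml => /andP[h6 h9].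
have := ler_Re_nr (u n).2; lra.
Qed.

(* The map on the dense subspace is given by its graph. *)
Lemma dense_extension (H' : complexHilbert R) (G : H -> H' -> Prop) (c : R) :
  0 <= c ->
  (forall a x y s t, G x s -> G y t -> G (a *: x + y) (a *: s + t)) ->
  (forall x s, G x s -> nr s <= c * nr x) ->
  (forall x (e : R), 0 < e -> exists y s, G y s /\ nr (x - y) < e) ->
  exists T : H -> H', [/\ linear T, (forall x, nr (T x) <= c * nr x) &
    forall x s, G x s -> T x = s].
Proof.
move=> c0 GL Gc Gd.
have d0 : 0 < c + 1 by rewrite ltr_wpDl.
have GB x y s t : G x s -> G y t -> nr (s - t) <= c * nr (x - y).
  move=> Gx Gy; apply: Gc.
  by have := GL (-1) _ _ _ _ Gy Gx; rewrite !scaleN1r addrC (addrC (- t)).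
(* This single estimate determines [T x]; it gives the extension property, the bound and, by
   approximation, linearity. *)
have [T hT] : exists T : H -> H', forall x, forall y s, G y s ->
    nr (T x - s) <= c * nr (x - y).
  apply: (@ex_choice _ _ (fun (x : H) (z : H') => forall y s, G y s ->
    nr (z - s) <= c * nr (x - y))) => x.
  have [u hu] : exists u : nat -> H * H', forall n,
      G (u n).1 (u n).2 /\ nr (x - (u n).1) < n.+1%:R^-1.
    apply: (@ex_choice _ _ (fun n (p : H * H') =>
      G p.1 p.2 /\ nr (x - p.1) < n.+1%:R^-1)) => n.
    have n0 : 0 < n.+1%:R^-1 :> R by rewrite invr_gt0.
    by have [y [s [Gy h]]] := Gd x _ n0; exists (y, s).
  have [z hz] : exists z : H', tends (fun n => (u n).2) z.
    apply: complete_seq => e e0.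
    have [n0 hn0] := inv_nat_lt (divr_gt0 (divr_gt0 e0 (ltr0Sn R 1)) d0).
    exists n0 => i j hi hj.
    apply: (le_lt_trans (GB _ _ _ _ (hu i).1 (hu j).1)).
    have h : nr ((u i).1 - (u j).1) < e / (c + 1).
      rewrite (le_lt_trans (ler_nrT x _ _))// nrBC.
      have := (hu i).2; have := (hu j).2.
      have := inv_nat_mono R hi; have := inv_nat_mono R hj.
      have -> : e / (c + 1) = e / 2 / (c + 1) + e / 2 / (c + 1) by rewrite -mulrDl -splitr.
      by move: hn0; move: (n0.+1%:R^-1) (j.+1%:R^-1) (i.+1%:R^-1) => A B C; lra.
    rewrite (le_lt_trans _ (_ : (c + 1) * nr ((u i).1 - (u j).1) < e))//.
      by rewrite ler_wpM2r ?nr_ge0// lerDl.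
    by rewrite mulrC -ltr_pdivlMr.
  exists z => y s Gy; apply: le_eps => e e0; have e2 : 0 < e / 2 by rewrite divr_gt0.
  have [n1 h1] := hz _ e2; have [n2 h2] := inv_nat_lt (divr_gt0 e2 d0).
  pose n := maxn n1 n2; rewrite (le_trans (ler_nrT (u n).2 _ _))//.
  have hA : nr (z - (u n).2) <= e / 2 by rewrite nrBC ltW// h1// leq_maxl.
  have hB : nr ((u n).1 - y) <= nr (x - y) + nr (x - (u n).1).
    by rewrite [leRHS]addrC (nrBC x (u n).1); exact: ler_nrT.
  have hC : c * nr (x - (u n).1) <= e / 2.
    have h : (c + 1) * nr (x - (u n).1) <= e / 2.
      rewrite mulrC -ler_pdivlMr// ltW// (lt_trans (hu n).2)//.
      by rewrite (le_lt_trans _ h2)// inv_nat_mono// leq_maxr.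
    by apply: le_trans h; rewrite ler_wpM2r ?nr_ge0// lerDl.
  have hD := GB _ _ _ _ (hu n).1 Gy.
  have hE : c * nr ((u n).1 - y) <= c * nr (x - y) + c * nr (x - (u n).1).
    by rewrite -mulrDr ler_wpM2l.
  lra.
have TG x s : G x s -> T x = s.
  move=> Gx; apply/eqP; rewrite -subr_eq0 -nr_eq0 eq_le nr_ge0 andbT.
  by rewrite (le_trans (hT _ _ _ Gx))// subrr nr0 mulr0.
have bd x : nr (T x) <= c * nr x.
  apply: le_eps => e e0.
  have e4 : 0 < e / (2 * (c + 1)) by rewrite divr_gt0// mulr_gt0.
  have [y [s [Gy h]]] := Gd x _ e4.
  have h1 := hT x _ _ Gy; have h2 := Gc _ _ Gy.
  have h3 : nr (T x) <= nr (T x - s) + nr s.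
    by rewrite -[X in nr X <= _](subrK s) ler_nrD.
  have h4 : c * nr y <= c * nr x + c * nr (x - y).
    by rewrite -mulrDr ler_wpM2l// addrC nrBC -[X in nr X <= _](subrK x) ler_nrD.
  have h5 : 2 * (c * nr (x - y)) <= e.
    rewrite (le_trans (_ : _ <= 2 * ((c + 1) * nr (x - y))))//.
      by rewrite ler_wpM2l// ler_wpM2r ?nr_ge0// lerDl.
    rewrite mulrA mulrC -ler_pdivlMr ?mulr_gt0// ltW//.
  lra.
exists T; split=> // a x y; apply: subr0_eq; apply: small_zero => e e0.
pose k := (c + 1) * (2 * (nr a + 1)).
have a0 : 0 < nr a + 1 by rewrite ltr_wpDl ?nr_ge0.
have k0 : 0 < k by rewrite !mulr_gt0.
have e4 : 0 < e / (2 * k) by rewrite divr_gt0// mulr_gt0.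
have [x' [s [Gx hx]]] := Gd x _ e4; have [y' [t [Gy hy]]] := Gd y _ e4.
have Gz := GL a _ _ _ _ Gx Gy.
have h1 := hT (a *: x + y) _ _ Gz; have h2 := hT x _ _ Gx; have h3 := hT y _ _ Gy.
have h4 : nr (a *: x + y - (a *: x' + y')) <= nr a * nr (x - x') + nr (y - y').
  by rewrite opprD addrACA -scalerBr (le_trans (ler_nrD _ _))// nrZ.
have h5 : nr (T (a *: x + y) - (a *: T x + T y)) <=
    nr (T (a *: x + y) - (a *: s + t)) + (nr a * nr (T x - s) + nr (T y - t)).
  rewrite (le_trans (ler_nrT (a *: s + t) _ _))// lerD2l nrBC opprD addrACA -scalerBr.
  by rewrite (le_trans (ler_nrD _ _))// nrZ.
have h6 : nr a * nr (T x - s) <= nr a * (c * nr (x - x')) by rewrite ler_wpM2l ?nr_ge0.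
have h7 : c * nr (a *: x + y - (a *: x' + y')) <= c * (nr a * nr (x - x') + nr (y - y')).
  by rewrite ler_wpM2l.
have h8 : nr a * nr (x - x') + nr (y - y') <= (nr a + 1) * (e / (2 * k)).
  by rewrite mulrDl mul1r lerD// ?ler_wpM2l ?nr_ge0// ltW.
have h9 : c * (nr a * nr (x - x') + nr (y - y')) <= e / 2.
  rewrite (le_trans (_ : _ <= (c + 1) * ((nr a + 1) * (e / (2 * k)))))//.
    rewrite ler_pM// ?lerDl// addr_ge0 ?mulr_ge0 ?nr_ge0//.
  have -> : (c + 1) * ((nr a + 1) * (e / (2 * k))) = e / 4.
    by rewrite /k; field; rewrite !gt_eqF.
  lra.
lra.
Qed.

End Hilbert.

Section Bop.
Variables (R : realType).
Implicit Types H K : complexHilbert R.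

Section One.
Variable H : complexHilbert R.
Local Notation ip := (inner H).
Implicit Types (S T : bop H) (x y : H) (a : R[i]).

Lemma bop_linear T : linear T.
Proof. by have /asboolP[] := bopP T. Qed.

Lemma bopP2 T a x y : T (a *: x + y) = a *: T x + T y.
Proof. exact: bop_linear. Qed.

Lemma bopD T x y : T (x + y) = T x + T y.
Proof. by rewrite -[x]scale1r bopP2 !scale1r. Qed.

Lemma bop0 T : T 0 = 0.
Proof. by apply: (addrI (T 0)); rewrite -bopD !addr0. Qed.

Lemma bopZ T a x : T (a *: x) = a *: T x.
Proof. by rewrite -[a *: x]addr0 bopP2 bop0 addr0. Qed.

Lemma bopN T x : T (- x) = - T x.
Proof. by rewrite -scaleN1r bopZ scaleN1r. Qed.

Lemma bopB T x y : T (x - y) = T x - T y.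
Proof. by rewrite bopD bopN. Qed.

Lemma bop_sum T I (r : seq I) (P : pred I) (F : I -> H) :
  T (\sum_(i <- r | P i) F i) = \sum_(i <- r | P i) T (F i).
Proof. by elim/big_rec2: _ => [|i y1 y2 _ <-]; rewrite ?bop0 ?bopD. Qed.

Lemma bop_ext S T : (forall x, S x = T x) -> S = T.
Proof. by move=> h; apply: val_inj; apply/funext => x; exact: h. Qed.

Lemma addbE S T x : (S + T) x = S x + T x.
Proof. by []. Qed.

Lemma scalebE a T x : (a *: T) x = a *: T x.
Proof. by []. Qed.

Lemma subbE S T x : (S - T) x = S x - T x.
Proof. by []. Qed.

Lemma zerobE x : (0 : bop H) x = 0.
Proof. by []. Qed.

Lemma sumbE I (r : seq I) (P : pred I) (F : I -> bop H) x :
  (\sum_(i <- r | P i) F i) x = \sum_(i <- r | P i) F i x.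
Proof. by elim/big_rec2: _ => [|i y1 y2 _ <-]; rewrite ?addbE. Qed.

Lemma mkbop_subproof (f : H -> H) (c : R) :
  linear f -> (forall x, nr (f x) <= c * nr x) -> f \in @bounded_operator _ _ H.
Proof.
move=> lf bf; apply/asboolP; split=> // x; apply/cvgrPdist_lt => e e0.
have eE : e = (complex.Re e)%:C.
  by move: e0; rewrite ltcE; case: e => a b /= /andP[/eqP -> _].
move: e0; rewrite eE (ltcR 0); set e' := complex.Re e => e0.
have fB y z : f y - f z = f (y - z).
  by rewrite -[in RHS](addrC (- z)) -[- z]scaleN1r lf scaleN1r addrC.
have c1 : 0 < `|c| + 1 by rewrite ltr_wpDl.
have d0 : (0 : R[i]) < (e' / (`|c| + 1))%:C by rewrite (ltcR 0) divr_gt0.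
have : (fun z : H => z) @ x --> x by [].
move=> /cvgrPdist_lt /(_ _ d0); apply: filterS => y.
rewrite !norm_nr !ltcR fB => h.
rewrite (le_lt_trans (bf _))// (le_lt_trans (_ : _ <= (`|c| + 1) * nr (x - y)))//.
  by rewrite ler_wpM2r ?nr_ge0// (le_trans (ler_norm c))// lerDl.
by rewrite mulrC -ltr_pdivlMr.
Qed.

Lemma mkbop (f : H -> H) (c : R) :
  linear f -> (forall x, nr (f x) <= c * nr x) ->
  exists T : bop H, forall x, T x = f x.
Proof. by move=> lf bf; exists (Bop (mkbop_subproof lf bf)). Qed.

Lemma bop_bounded T : exists2 c : R, 0 <= c & forall x, nr (T x) <= c * nr x.
Proof.
have /asboolP[lT cT] := bopP T.
pose f : {linear H -> H} := HB.pack (bop_fun T) (GRing.isLinear.Build _ _ _ _ _ lT).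
have := @continuous_linear_bounded _ _ _ 0 f (cT 0).
move=> /linear_boundedP /pinfty_ex_gt0[r r0 h].
have rE : r = (complex.Re r)%:C.
  by move: r0; rewrite ltcE; case: (r) => a b /= /andP[/eqP -> _].
exists (complex.Re r); first by move: r0; rewrite rE (ltcR 0) => /ltW.
by move=> x; have := h x; rewrite rE !norm_nr -rmorphM lecR.
Qed.

Lemma adjoint_exists T : exists S, adjoint T S.
Proof.
have [c c0 hc] := bop_bounded T.
have h y : exists z : H, nr z <= c * nr y /\ forall x, ip (T x) y = ip x z.
  have [||||z hz hz'] := @riesz _ H (fun x s => s = ip (T x) y) (c * nr y).
  - by rewrite mulr_ge0 ?nr_ge0.
  - by rewrite bop0 ip0l.
  - by move=> a x x' s t -> ->; rewrite bopP2 ipDl ipZl.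
  - move=> x s ->; rewrite (le_trans (cauchy_schwarz _ _))// mulrAC.
    by rewrite ler_wpM2r ?nr_ge0.
  - by exists z; split=> // x; exact: hz'.
have [f hf] := ex_choice h.
have lf : linear f.
  move=> a x y; apply: ip_ext => z.
  rewrite ipC -(hf _).2 ipDl ipZl [ip (f x) z]ipC [ip (f y) z]ipC -!(hf _).2.
  by rewrite ipDr ipZr rmorphD rmorphM /= conjCK.
have [S hS] := mkbop lf (fun x => (hf x).1).
by exists S => x y; rewrite hS (hf y).2.
Qed.

Definition adj T := projT1 (cid (adjoint_exists T)).

Lemma adjP T x y : ip (T x) y = ip x (adj T y).
Proof. by rewrite /adj; case: cid. Qed.

Lemma adjP' T x y : ip x (T y) = ip (adj T x) y.
Proof. by rewrite ipC adjP -ipC. Qed.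

Lemma adjoint_adj T : adjoint T (adj T).
Proof. exact: adjP. Qed.

Lemma adjoint_uniq S T : adjoint S T -> T = adj S.
Proof.
move=> h; apply: bop_ext => x; apply: ip_ext => y.
by rewrite ipC -h [RHS]ipC -adjP.
Qed.

Lemma adjbK T : adj (adj T) = T.
Proof. by apply/esym/adjoint_uniq => x y; rewrite -adjP'. Qed.

Lemma adjbD S T : adj (S + T) = adj S + adj T.
Proof.
by apply/esym/adjoint_uniq => x y; rewrite !addbE ipDl ipDr !adjP.
Qed.

Lemma adjbZ a T : adj (a *: T) = Num.conj a *: adj T.
Proof.
by apply/esym/adjoint_uniq => x y; rewrite !scalebE ipZl ipZr conjCK adjP.
Qed.

Lemma adjbM S T : adj (bop_comp S T) = bop_comp (adj T) (adj S).
Proof. by apply/esym/adjoint_uniq => x y; rewrite /= !adjP. Qed.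

Lemma adjb1 : adj (bop_id H) = bop_id H.
Proof. by apply/esym/adjoint_uniq => x y. Qed.

Lemma adjb0 : adj 0 = 0 :> bop H.
Proof. by apply/esym/adjoint_uniq => x y; rewrite !zerobE ip0l ip0r. Qed.

Lemma adjb_sum I (r : seq I) (P : pred I) (F : I -> bop H) :
  adj (\sum_(i <- r | P i) F i) = \sum_(i <- r | P i) adj (F i).
Proof. by elim/big_rec2: _ => [|i y1 y2 _ <-]; rewrite ?adjb0 ?adjbD. Qed.

Lemma compbDl S T U : bop_comp (S + T) U = bop_comp S U + bop_comp T U.
Proof. exact: bop_ext. Qed.

Lemma compbDr S T U : bop_comp U (S + T) = bop_comp U S + bop_comp U T.
Proof. by apply: bop_ext => x; exact: bopD. Qed.

Lemma compbZl a S U : bop_comp (a *: S) U = a *: bop_comp S U.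
Proof. exact: bop_ext. Qed.

Lemma compbZr a S U : bop_comp U (a *: S) = a *: bop_comp U S.
Proof. by apply: bop_ext => x; exact: bopZ. Qed.

Lemma comp0b U : bop_comp (0 : bop H) U = 0.
Proof. exact: bop_ext. Qed.

Lemma compb0 U : bop_comp U (0 : bop H) = 0.
Proof. by apply: bop_ext => x; exact: bop0. Qed.

Lemma compb_suml I (r : seq I) (P : pred I) (F : I -> bop H) U :
  bop_comp (\sum_(i <- r | P i) F i) U = \sum_(i <- r | P i) bop_comp (F i) U.
Proof. by elim/big_rec2: _ => [|i y1 y2 _ <-]; rewrite ?comp0b ?compbDl. Qed.

Lemma compb_sumr I (r : seq I) (P : pred I) (F : I -> bop H) U :
  bop_comp U (\sum_(i <- r | P i) F i) = \sum_(i <- r | P i) bop_comp U (F i).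
Proof. by elim/big_rec2: _ => [|i y1 y2 _ <-]; rewrite ?compb0 ?compbDr. Qed.

Lemma compbA S T U : bop_comp S (bop_comp T U) = bop_comp (bop_comp S T) U.
Proof. exact: bop_ext. Qed.

(* The dense subspace carrying the form B is presented as the image of [v]. *)
Lemma form_bop (I : Type) (v : I -> H) (B : I -> I -> R[i]) (c : R) : 0 <= c ->
  (forall x (e : R), 0 < e -> exists i, nr (x - v i) < e) ->
  (forall a i j, exists k, [/\ v k = a *: v i + v j,
     forall l, B k l = a * B i l + B j l &
     forall l, B l k = Num.conj a * B l i + B l j]) ->
  (forall i j, nr (B i j) <= c * nr (v i) * nr (v j)) ->
  exists T : bop H, (forall i j, ip (T (v i)) (v j) = B i j) /\
    forall x, nr (T x) <= c * nr x.
Proof.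
move=> c0 vd vL Bc.
have [i0 [v0 B0l B0r]] : exists i, [/\ v i = 0, forall l, B i l = 0 & forall l, B l i = 0].
  have [i _] := vd 0 1 ltr01; have [k [vk Bl Br]] := vL (-1) i i.
  exists k; split=> [|l|l]; rewrite ?vk ?Bl ?Br ?scaleN1r ?mulN1r ?addNr//.
  by rewrite rmorphN rmorph1 mulN1r addNr.
have h i : exists z, nr z <= c * nr (v i) /\ forall j, ip z (v j) = B i j.
  have [||||z hz hz'] := @riesz _ H
    (fun x s => exists2 j, x = v j & s = Num.conj (B i j)) (c * nr (v i)).
  - by rewrite mulr_ge0 ?nr_ge0.
  - by exists i0; rewrite ?B0r ?rmorph0.
  - move=> a x y s t [j -> ->] [k -> ->]; have [l [vl Bl Br]] := vL a j k.
    by exists l; rewrite // Br rmorphD rmorphM /= conjCK.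
  - by move=> x s [j -> ->]; rewrite nr_conj Bc.
  - exists z; split=> // j; rewrite ipC -(hz' (v j) (Num.conj (B i j))) ?conjCK//.
    by exists j.
have [w hw] := ex_choice h.
have wL a i j k : v k = a *: v i + v j -> (forall l, B k l = a * B i l + B j l) ->
    w k = a *: w i + w j.
  move=> vk Bk; apply: ip_ext => z; apply: subr0_eq; apply: small_zero => e e0.
  set d := w k - (a *: w i + w j); rewrite -ipBl -/d.
  have d1 : 0 < nr d + 1 by rewrite ltr_wpDl ?nr_ge0.
  have [l hl] := vd z _ (divr_gt0 e0 d1).
  have d0 : ip d (v l) = 0 by rewrite ipBl ipDl ipZl !(hw _).2 Bk subrr.
  have -> : ip d z = ip d (z - v l) by rewrite ipBr d0 subr0.
  rewrite (le_trans (cauchy_schwarz _ _))//.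
  rewrite (le_trans (_ : _ <= (nr d + 1) * nr (z - v l)))//.
    by rewrite ler_wpM2r ?nr_ge0// lerDl.
  by rewrite mulrC -ler_pdivlMr// ltW.
have wU i j : v i = v j -> w i = w j.
  move=> vij; have [k [vk Bl _]] := vL (-1) i j.
  have := wL _ _ _ _ vk Bl; rewrite scaleN1r => wk.
  have : nr (w k) <= 0.
    by rewrite (le_trans (hw k).1)// vk vij scaleN1r addNr nr0 mulr0.
  rewrite le_eqVlt ltNge nr_ge0 orbF nr_eq0 wk addrC subr_eq0 => /eqP -> //.
have [||||T [lT bT TE]] := @dense_extension R H H (fun x s => exists2 i, x = v i & s = w i) c.
- exact: c0.
- move=> a x y s t [i -> ->] [j -> ->]; have [k [vk Bl _]] := vL a i j.
  by exists k; rewrite ?(wL a i j k).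
- by move=> x s [i -> ->]; exact: (hw i).1.
- by move=> x e /(vd x)[i hi]; exists (v i), (w i); split=> //; exists i.
have [T' T'E] := mkbop lT bT.
exists T'; split=> [i j|x]; rewrite T'E//.
by rewrite (TE _ (w i)) ?(hw i).2//; exists i.
Qed.
End One.
End Bop.

Section L2.
Variables (R : realType) (K : complexHilbert R) (n : nat).
Local Notation ip := (inner K).
Implicit Types v w : 'I_n -> K.

Definition l2 v : R := Num.sqrt (\sum_i nr (v i) ^+ 2).

Definition ip2 v w : R[i] := \sum_i ip (v i) (w i).

Lemma sum_sqr_ge0 v : 0 <= \sum_i nr (v i) ^+ 2.
Proof. by apply: sumr_ge0 => i _; exact: sqr_ge0. Qed.

Lemma l2_ge0 v : 0 <= l2 v.
Proof. exact: sqrtr_ge0. Qed.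

Lemma l2_sqr v : l2 v ^+ 2 = \sum_i nr (v i) ^+ 2.
Proof. by rewrite sqr_sqrtr// sum_sqr_ge0. Qed.

Lemma l2_ip v : l2 v ^+ 2 = complex.Re (ip2 v v).
Proof. by rewrite l2_sqr cRe_sum; apply: eq_bigr => i _; rewrite nr_sqr_ip. Qed.

Lemma l2_eq0 v : l2 v = 0 -> forall i, v i = 0.
Proof.
move=> h i; apply/eqP; rewrite -nr_eq0 -sqrf_eq0 eq_le sqr_ge0 andbT.
have : l2 v ^+ 2 = 0 by rewrite h expr0n.
rewrite l2_sqr => <-; rewrite (bigD1 i)//= lerDl sumr_ge0// => j _.
exact: sqr_ge0.
Qed.

Lemma nr_le_l2 v i : nr (v i) <= l2 v.
Proof.
rewrite -(ler_pXn2r (n := 2)) ?nnegrE ?nr_ge0 ?l2_ge0// l2_sqr.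
by rewrite (bigD1 i)//= lerDl sumr_ge0// => j _; exact: sqr_ge0.
Qed.

Lemma l2_le_sum v : l2 v <= \sum_i nr (v i).
Proof.
have s0 : 0 <= \sum_i nr (v i) by apply: sumr_ge0 => i _; exact: nr_ge0.
rewrite -(ler_pXn2r (n := 2)) ?nnegrE ?l2_ge0//.
rewrite l2_sqr expr2 mulr_suml ler_sum// => i _.
rewrite expr2 ler_wpM2l ?nr_ge0// (bigD1 i)//= lerDl.
by rewrite sumr_ge0// => j _; exact: nr_ge0.
Qed.

Lemma l2Z (a : R[i]) v : l2 (fun i => a *: v i) = nr a * l2 v.
Proof.
rewrite /l2 -[in RHS](ger0_norm (nr_ge0 a)) -sqrtr_sqr -sqrtrM ?sqr_ge0// mulr_sumr.
by congr Num.sqrt; apply: eq_bigr => i _; rewrite nrZ exprMn.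
Qed.

Lemma eq_l2 v w : (forall i, v i = w i) -> l2 v = l2 w.
Proof. by move=> vw; congr l2; apply/funext. Qed.

Lemma l2_sqrB v w (a b : R) :
  l2 (fun i => a%:C *: v i - b%:C *: w i) ^+ 2 =
  a ^+ 2 * l2 v ^+ 2 + b ^+ 2 * l2 w ^+ 2 - 2 * (a * b * complex.Re (ip2 v w)).
Proof.
rewrite !l2_sqr cRe_sum !mulr_sumr -big_split /= -sumrB; apply: eq_bigr => i _.
rewrite nr_sqrB !nrZ !nr_real !exprMn !real_normK ?num_real//.
by rewrite ipZl ipZr conj_real !cReMr mulrA.
Qed.

Lemma Re_ip2_le v w : complex.Re (ip2 v w) <= l2 v * l2 w.
Proof.
have [w0|w0] := eqVneq (l2 w) 0.
  have -> : ip2 v w = 0 by rewrite /ip2 big1// => i _; rewrite (l2_eq0 w0) ip0r.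
  by rewrite w0 mulr0.
have [v0|v0] := eqVneq (l2 v) 0.
  have -> : ip2 v w = 0 by rewrite /ip2 big1// => i _; rewrite (l2_eq0 v0) ip0l.
  by rewrite v0 mul0r.
have nw : 0 < l2 w by rewrite lt_def l2_ge0 w0.
have nv : 0 < l2 v by rewrite lt_def l2_ge0 v0.
have := sqr_ge0 (l2 (fun i => (l2 w)%:C *: v i - (l2 v)%:C *: w i)).
rewrite l2_sqrB => h.
have h2 : 0 <= 2 * (l2 v * l2 w) * (l2 v * l2 w - complex.Re (ip2 v w)) by lra.
by move: h2; rewrite pmulr_rge0 ?subr_ge0// mulr_gt0// mulr_gt0.
Qed.

Lemma l2D v w : l2 (fun i => v i + w i) <= l2 v + l2 w.
Proof.
rewrite -(ler_pXn2r (n := 2)) ?nnegrE ?addr_ge0 ?l2_ge0//.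
have -> : l2 (fun i => v i + w i) ^+ 2 =
    l2 v ^+ 2 + l2 w ^+ 2 + 2 * complex.Re (ip2 v w).
  rewrite !l2_sqr cRe_sum !mulr_sumr -!big_split /=; apply: eq_bigr => i _.
  exact: nr_sqrD.
by have := Re_ip2_le v w; rewrite sqrrD; lra.
Qed.

Lemma ip2C v w : ip2 v w = Num.conj (ip2 w v).
Proof. by rewrite /ip2 rmorph_sum; apply: eq_bigr => i _; exact: ipC. Qed.

Definition act (x : 'I_n -> 'I_n -> bop K) v : 'I_n -> K :=
  fun i => \sum_j x i j (v j).

Implicit Types x y : 'I_n -> 'I_n -> bop K.

Lemma actD x v w i : act x (fun j => v j + w j) i = act x v i + act x w i.
Proof. by rewrite /act -big_split; apply: eq_bigr => j _; rewrite bopD. Qed.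

Lemma act_adj x v w : ip2 (act x v) w = ip2 v (act (fun i j => adj (x j i)) w).
Proof.
rewrite /ip2 /act.
transitivity (\sum_i \sum_j ip (x i j (v j)) (w i)).
  by apply: eq_bigr => i _; rewrite ip_suml.
rewrite exchange_big; apply: eq_bigr => j _ /=; rewrite ip_sumr.
by apply: eq_bigr => i _; rewrite adjP.
Qed.

Lemma act_mul x y v i :
  act (fun i j => \sum_k bop_comp (x i k) (y k j)) v i = act x (act y v) i.
Proof.
rewrite /act; transitivity (\sum_j \sum_k x i k (y k j (v j))).
  by apply: eq_bigr => j _; rewrite sumbE.
by rewrite exchange_big; apply: eq_bigr => k _ /=; rewrite bop_sum.
Qed.

Lemma act_bounded x : exists2 c : R, 0 <= c & forall v, l2 (act x v) <= c * l2 v.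
Proof.
have [c hc] : exists c : 'I_n * 'I_n -> R, forall p, 0 <= c p /\
    forall y : K, nr (x p.1 p.2 y) <= c p * nr y.
  apply: (@ex_choice _ _ (fun p (d : R) => 0 <= d /\
    forall y : K, nr (x p.1 p.2 y) <= d * nr y)) => p.
  by have [d d0 h] := bop_bounded (x p.1 p.2); exists d.
exists (\sum_i \sum_j `|c (i, j)|).
  by apply: sumr_ge0 => i _; apply: sumr_ge0.
move=> v; apply: (le_trans (l2_le_sum _)); rewrite mulr_suml ler_sum// => i _.
rewrite (le_trans (ler_nr_sum _ _ _))// mulr_suml ler_sum// => j _.
have [c0 h] : 0 <= c (i, j) /\ forall y : K, nr (x i j y) <= c (i, j) * nr y.
  by have [] := hc (i, j).
by rewrite (le_trans (h _))// (ger0_norm c0) ler_wpM2l// nr_le_l2.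
Qed.

Definition mxnorm x : R :=
  inf [set c : R | 0 <= c /\ forall v, l2 (act x v) <= c * l2 v].

Lemma mxnorm_le x c : 0 <= c -> (forall v, l2 (act x v) <= c * l2 v) ->
  mxnorm x <= c.
Proof. by move=> c0 h; apply: ge_inf => //; exists 0 => d []. Qed.

Lemma mxnorm_ge0 x : 0 <= mxnorm x.
Proof.
have [c c0 h] := act_bounded x.
by apply: lb_le_inf; [exists c | move=> d []].
Qed.

Lemma mxnormP x v : l2 (act x v) <= mxnorm x * l2 v.
Proof.
have [c c0 h] := act_bounded x.
have [v0|v0] := eqVneq (l2 v) 0.
  by have := h v; rewrite v0 !mulr0.
have nv : 0 < l2 v by rewrite lt_def l2_ge0 v0.
rewrite -ler_pdivrMr//; apply: lb_le_inf; first by exists c.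
by move=> d [d0 /(_ v)]; rewrite ler_pdivrMr.
Qed.

Lemma mxnormD x y : mxnorm (fun i j => x i j + y i j) <= mxnorm x + mxnorm y.
Proof.
apply: mxnorm_le => [|v]; first by rewrite addr_ge0 ?mxnorm_ge0.
rewrite mulrDl (le_trans _ (lerD (mxnormP x v) (mxnormP y v)))//.
rewrite (le_trans _ (l2D _ _))// le_eqVlt (_ : _ == _)//.
by apply/eqP/eq_l2 => i; rewrite /act -big_split.
Qed.

Lemma mxnormZ (a : R[i]) x : mxnorm (fun i j => a *: x i j) = nr a * mxnorm x.
Proof.
have le_Z b y : mxnorm (fun i j => b *: y i j) <= nr b * mxnorm y.
  apply: mxnorm_le => [|v]; first by rewrite mulr_ge0 ?nr_ge0 ?mxnorm_ge0.
  rewrite (_ : l2 _ = l2 (fun i => b *: act y v i)).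
    by rewrite l2Z -mulrA ler_wpM2l ?nr_ge0// mxnormP.
  by apply: eq_l2 => i; rewrite /act scaler_sumr.
have [->|a0] := eqVneq a 0.
  apply/eqP; rewrite eq_le le_Z nr0 mul0r; exact: mxnorm_ge0.
apply/eqP; rewrite eq_le le_Z /=.
have := le_Z a^-1 (fun i j => a *: x i j).
rewrite (_ : (fun i j => a^-1 *: (a *: x i j)) = x); last first.
  by apply/funext => i; apply/funext => j; rewrite scalerA mulVf// scale1r.
have na : 0 < nr a by rewrite lt_def nr_ge0 nr_eq0 a0.
have -> : nr a^-1 = (nr a)^-1.
  by apply: (mulfI (lt0r_neq0 na)); rewrite -nrM (divff a0) nr1 divff// lt0r_neq0.
by rewrite ler_pdivlMl.
Qed.

Lemma nr_entry_le x i j (w : K) : nr (x i j w) <= mxnorm x * nr w.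
Proof.
pose v k : K := if k == j then w else 0.
have -> : x i j w = act x v i.
  rewrite /act (bigD1 j)//= /v eqxx big1 ?addr0// => k /negbTE ->.
  exact: bop0.
have -> : nr w = l2 v.
  rewrite /l2 (bigD1 j)//= /v eqxx big1 ?addr0 => [|k /negbTE ->].
    by rewrite sqrtr_sqr ger0_norm ?nr_ge0.
  by rewrite nr0 expr0n.
exact: (le_trans (nr_le_l2 _ i) (mxnormP _ _)).
Qed.

Lemma mxnorm_entry x (e : R) : 0 <= e -> (forall i j (w : K), nr (x i j w) <= e * nr w) ->
  mxnorm x <= e * (n * n)%:R.
Proof.
move=> e0 h; apply: mxnorm_le => [|v]; first by rewrite mulr_ge0.
apply: (le_trans (l2_le_sum _)).
have -> : e * (n * n)%:R * l2 v = \sum_(i < n) \sum_(j < n) e * l2 v.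
  rewrite !sumr_const !card_ord -mulrnA -mulr_natr; ring.
rewrite ler_sum// => i _; rewrite (le_trans (ler_nr_sum _ _ _))// ler_sum// => j _.
by rewrite (le_trans (h _ _ _))// ler_wpM2l// nr_le_l2.
Qed.

Lemma mxnorm_eq0 x : mxnorm x = 0 -> forall i j, x i j = 0.
Proof.
move=> h i j; apply: bop_ext => w; apply/eqP; rewrite -nr_eq0 eq_le nr_ge0 andbT.
by rewrite (le_trans (nr_entry_le _ _ _ _))// h mul0r.
Qed.

Lemma mxnormM x y :
  mxnorm (fun i j => \sum_k bop_comp (x i k) (y k j)) <= mxnorm x * mxnorm y.
Proof.
apply: mxnorm_le => [|v]; first by rewrite mulr_ge0 ?mxnorm_ge0.
rewrite (eq_l2 (act_mul x y v)) (le_trans (mxnormP _ _))// -mulrA.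
by rewrite ler_wpM2l ?mxnorm_ge0// mxnormP.
Qed.

Lemma mxnorm_adj_le x : mxnorm (fun i j => adj (x j i)) <= mxnorm x.
Proof.
apply: mxnorm_le => [|v]; first exact: mxnorm_ge0.
set y := fun i j => adj (x j i).
have [z|z] := eqVneq (l2 (act y v)) 0.
  by rewrite z mulr_ge0 ?mxnorm_ge0 ?l2_ge0.
have nz : 0 < l2 (act y v) by rewrite lt_def l2_ge0 z.
rewrite -(ler_pM2l nz) -expr2 l2_ip {1}ip2C cRe_conj -act_adj -/y.
have := ler_wpM2r (l2_ge0 v) (mxnormP x (act y v)).
have := Re_ip2_le (act x (act y v)) v; lra.
Qed.

Lemma mxnorm_adj x : mxnorm (fun i j => adj (x j i)) = mxnorm x.
Proof.
apply/eqP; rewrite eq_le mxnorm_adj_le /=.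
rewrite (le_trans _ (mxnorm_adj_le _))// le_eqVlt (_ : _ == _)//.
by apply/eqP; congr mxnorm; apply/funext => i; apply/funext => j; rewrite adjbK.
Qed.

Lemma mxnorm_cstar x :
  mxnorm (fun i j => \sum_k bop_comp (adj (x k i)) (x k j)) = mxnorm x ^+ 2.
Proof.
apply/eqP; rewrite eq_le; apply/andP; split.
  by rewrite (le_trans (mxnormM (fun i k => adj (x k i)) x))// mxnorm_adj.
set z := fun i j => _.
rewrite -[leRHS]sqr_sqrtr ?mxnorm_ge0// ler_pXn2r ?nnegrE ?mxnorm_ge0 ?sqrtr_ge0//.
apply: mxnorm_le => [|v]; first exact: sqrtr_ge0.
rewrite -(ler_pXn2r (n := 2)) ?nnegrE ?mulr_ge0 ?l2_ge0 ?sqrtr_ge0//.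
rewrite exprMn (sqr_sqrtr (mxnorm_ge0 z)) {1}l2_ip act_adj.
have -> : ip2 v (act (fun i j => adj (x j i)) (act x v)) = ip2 v (act z v).
  by apply: eq_bigr => i _; rewrite /z (act_mul (fun i k => adj (x k i)) x).
by rewrite (le_trans (Re_ip2_le _ _))// mulrC expr2 mulrA ler_wpM2r ?l2_ge0// mxnormP.
Qed.

End L2.

(** * C*-algebras of matrices of operators *)

(** A concrete C*-algebra, [opa_closed] being closedness in operator norm. It is instantiated by N,
    by the algebra C of convergent sequences and by generated von Neumann algebras. *)
Record opAlgebra (R : realType) (K : complexHilbert R) := OpAlgebra {
  opa_set :> bop K -> Prop;
  opa0 : opa_set 0;
  opaL : forall (a : R[i]) S T, opa_set S -> opa_set T -> opa_set (a *: S + T);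
  opaM : forall S T, opa_set S -> opa_set T -> opa_set (bop_comp S T);
  opaJ : forall S, opa_set S -> opa_set (adj S);
  opa_closed : forall T : bop K, (forall e : R, 0 < e -> exists2 S, opa_set S &
    forall x : K, nr (T x - S x) <= e * nr x) -> opa_set T }.

Section MatrixAlgebra.
Variables (R : realType) (K : complexHilbert R) (A : opAlgebra K) (n : nat).

Lemma opaD S T : A S -> A T -> A (S + T).
Proof. by move=> AS AT; rewrite -[S]scale1r; exact: opaL. Qed.

Lemma opaZ a S : A S -> A (a *: S).
Proof. by move=> AS; rewrite -[_ *: _]addr0; apply: opaL => //; exact: opa0. Qed.

Lemma opaB S T : A S -> A T -> A (S - T).
Proof. by move=> AS AT; rewrite addrC -scaleN1r; exact: opaL. Qed.

Lemma opa_sum I (r : seq I) (P : pred I) (F : I -> bop K) :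
  (forall i, A (F i)) -> A (\sum_(i <- r | P i) F i).
Proof.
by move=> h; elim/big_rec: _ => [|i x _ Ax]; [exact: opa0 | exact: opaD].
Qed.

Definition mxop_pred : {pred ('I_n -> 'I_n -> bop K)} :=
  fun x => `[< forall i j, A (x i j) >].

Record mxop := Mxop { mxop_fun :> 'I_n -> 'I_n -> bop K;
                      mxopP : mxop_fun \in mxop_pred }.

HB.instance Definition _ := [isSub for mxop_fun].
HB.instance Definition _ := [Choice of mxop by <:].

Lemma mxop_submod : submod_closed mxop_pred.
Proof.
split=> [|a x y /asboolP Ax /asboolP Ay]; apply/asboolP => i j.
  exact: opa0.
exact: opaL.
Qed.

HB.instance Definition _ :=
  GRing.isSubmodClosed.Build R[i] ('I_n -> 'I_n -> bop K) mxop_pred mxop_submod.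
HB.instance Definition _ := [SubChoice_isSubLmodule of mxop by <:].

Lemma mxop_in (x : mxop) i j : A (x i j).
Proof. by have /asboolP := mxopP x. Qed.

Lemma mk_mxop_subproof (x : 'I_n -> 'I_n -> bop K) :
  (forall i j, A (x i j)) -> x \in mxop_pred.
Proof. by move=> h; apply/asboolP. Qed.

Definition mk_mxop x (h : forall i j, A (x i j)) : mxop := Mxop (mk_mxop_subproof h).

Lemma mxop_ext (x y : mxop) : (forall i j, x i j = y i j) -> x = y.
Proof.
move=> h; apply: val_inj; apply/funext => i; apply/funext => j; exact: h.
Qed.

Lemma mxopE (a : R[i]) (x y : mxop) i j : (a *: x + y) i j = a *: x i j + y i j.
Proof. by []. Qed.

Definition mxopM (x y : mxop) : mxop :=
  mk_mxop (fun i j => opa_sum (index_enum 'I_n) xpredT (fun k => opaM (mxop_in x i k) (mxop_in y k j))).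

Definition mxopJ (x : mxop) : mxop :=
  mk_mxop (fun i j => opaJ (mxop_in x j i)).

Let N (x : mxop) := mxnorm x.

Lemma mxop_complete (u : nat -> mxop) :
  (forall e : R, 0 < e -> exists n0, forall p q, (n0 <= p)%N -> (n0 <= q)%N ->
     N (u p - u q) < e) ->
  exists l, forall e : R, 0 < e -> exists n0, forall p, (n0 <= p)%N ->
     N (u p - l) < e.
Proof.
move=> cu.
have eu i j p q (w : K) : nr (u p i j w - u q i j w) <= N (u p - u q) * nr w.
  exact: (nr_entry_le (u p - u q)).
have [f hf] : exists f : 'I_n * 'I_n * K -> K, forall x,
    tends (fun p => u p x.1.1 x.1.2 x.2) (f x).
  apply: (@ex_choice _ _ (fun x l => tends (fun p => u p x.1.1 x.1.2 x.2) l)).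
  move=> [[i j] w] /=; apply: complete_seq => e e0.
  have w1 : 0 < nr w + 1 by rewrite ltr_wpDl ?nr_ge0.
  have [n0 h] := cu _ (divr_gt0 e0 w1).
  exists n0 => p q hp hq; rewrite (le_lt_trans (eu _ _ _ _ _))//.
  have := h _ _ hp hq; rewrite ltr_pdivlMr//; apply: le_lt_trans.
  by rewrite ler_wpM2l ?mxnorm_ge0// lerDl.
have close (e : R) : 0 < e -> exists n0, forall p, (n0 <= p)%N -> forall i j w,
    nr (u p i j w - f (i, j, w)) <= e * nr w.
  move=> e0; have [n0 h] := cu _ e0; exists n0 => p hp i j w.
  apply: le_eps => d d0.
  have [n1 h1] := hf (i, j, w) _ d0.
  pose q := maxn n0 n1.
  rewrite (le_trans (ler_nrT (u q i j w) _ _))// lerD//; last first.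
    by rewrite ltW// h1// leq_maxr.
  rewrite (le_trans (eu _ _ _ _ _))// ler_wpM2r ?nr_ge0// ltW// h//.
  exact: leq_maxl.
have lf i j : linear (fun w => f (i, j, w)).
  move=> a x y; apply: (tends_uniq (hf (i, j, a *: x + y))).
  have -> : (fun p => u p (i, j, a *: x + y).1.1 (i, j, a *: x + y).1.2
      (i, j, a *: x + y).2) = (fun p => a *: u p i j x + u p i j y).
    by apply/funext => p; rewrite bopP2.
  by apply: tendsD; [apply: tendsZ; exact: (hf (i, j, x)) | exact: (hf (i, j, y))].
have [n1 hn1] := close 1 ltr01.
have bf i j w : nr (f (i, j, w)) <= (1 + N (u n1)) * nr w.
  rewrite -[f _](subrK (u n1 i j w)) (le_trans (ler_nrD _ _))// mulrDl.
  by rewrite lerD ?nr_entry_le// nrBC hn1.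
have [g hg] : exists g : 'I_n * 'I_n -> bop K, forall x w, g x w = f (x, w).
  apply: (@ex_choice _ _ (fun x (T : bop K) => forall w, T w = f (x, w))).
  by move=> [i j]; exact: mkbop (lf i j) (bf i j).
have Ag i j : A (g (i, j)).
  apply: opa_closed => e e0; have [n0 h] := close _ e0.
  exists (u n0 i j); first exact: mxop_in.
  by move=> x; rewrite nrBC hg h.
exists (mk_mxop Ag) => e e0.
have nn : 0 < (n * n).+1%:R :> R by [].
have [n0 h] := close _ (divr_gt0 e0 nn).
exists n0 => p hp.
have := @mxnorm_entry _ _ _ (u p - mk_mxop Ag) _ (ltW (divr_gt0 e0 nn)) _.
rewrite -/(N _) => /(_ (fun i j w => _)) h2.
apply: le_lt_trans (h2 _) _; first by move=> i j w; have := h p hp i j w; rewrite -hg.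
by rewrite mulrAC ltr_pdivrMr// ltr_pM2l// ltr_nat.
Qed.

Lemma mxopN0 (x : mxop) : N x = 0 -> x = 0.
Proof. by move=> h; apply: mxop_ext => i j; rewrite (mxnorm_eq0 h). Qed.

Definition mxop_cnm : completeNormedModType R[i] :=
  @mk_cnm R mxop N (fun x y => mxnormD x y) (fun a x => mxnormZ a x) mxopN0 mxop_complete.

Lemma mxopMA : associative mxopM.
Proof.
move=> x y z; apply: mxop_ext => i j /=.
transitivity (\sum_k \sum_l bop_comp (x i k) (bop_comp (y k l) (z l j))).
  by apply: eq_bigr => k _; rewrite compb_sumr.
rewrite exchange_big; apply: eq_bigr => l _ /=; rewrite compb_suml.
by apply: eq_bigr => k _; rewrite compbA.
Qed.

Lemma mxopM_linearl y : linear (mxopM^~ y : mxop_cnm -> mxop_cnm).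
Proof.
move=> a x x'; apply: mxop_ext => i j; rewrite [RHS]mxopE /= scaler_sumr -big_split.
by apply: eq_bigr => k _; rewrite /= -compbZl -compbDl.
Qed.

Lemma mxopM_linearr x : linear (mxopM x : mxop_cnm -> mxop_cnm).
Proof.
move=> a y y'; apply: mxop_ext => i j; rewrite [RHS]mxopE /= scaler_sumr -big_split.
by apply: eq_bigr => k _; rewrite /= -compbZr -compbDr.
Qed.

Lemma mxopJK : involutive mxopJ.
Proof. by move=> x; apply: mxop_ext => i j /=; rewrite adjbK. Qed.

Lemma mxopJ_antilinear (a : R[i]) (x y : mxop_cnm) :
  (mxopJ (a *: x + y) : mxop_cnm) = Num.conj a *: (mxopJ x : mxop_cnm) + mxopJ y.
Proof.
apply: mxop_ext => i j.
transitivity (Num.conj a *: adj ((x : mxop) j i) + adj ((y : mxop) j i)) => //.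
by rewrite -adjbZ -adjbD.
Qed.

Lemma mxopJM x y : mxopJ (mxopM x y) = mxopM (mxopJ y) (mxopJ x).
Proof.
apply: mxop_ext => i j /=; rewrite adjb_sum.
by apply: eq_bigr => k _; rewrite adjbM.
Qed.

Lemma mxop_norm_le (x y : mxop_cnm) : `|(mxopM x y : mxop_cnm)| <= `|x| * `|y|.
Proof. by rewrite !norm_nr -rmorphM lecR; exact: mxnormM. Qed.

Lemma mxop_cstar_norm (x : mxop_cnm) :
  `|(mxopM (mxopJ x) x : mxop_cnm)| = `|x| ^+ 2.
Proof. by rewrite !norm_nr -rmorphXn; congr (_%:C); exact: mxnorm_cstar. Qed.

Definition mxcstar : cstarAlgebra R :=
  @CstarAlgebra R mxop_cnm mxopM mxopJ mxopMA mxopM_linearl mxopM_linearr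
    mxopJK mxopJ_antilinear mxopJM mxop_norm_le mxop_cstar_norm.

End MatrixAlgebra.

Section Amplification.
Variables (R : realType) (K : complexHilbert R) (A : opAlgebra K).

(** The abstract C*-algebra of [A] is [mxcstar A 1], so that one construction supplies both the
    algebra and the norms of all matrix algebras over it. *)
Definition entry (x : mxcstar A 1) : bop K := (x : mxop A 1) ord0 ord0.

Lemma entry_in x : A (entry x).
Proof. exact: mxop_in. Qed.

Lemma entryL a x y : entry (a *: x + y) = a *: entry x + entry y.
Proof. by []. Qed.

Lemma entryM x y : entry (cmul x y) = bop_comp (entry x) (entry y).
Proof. by rewrite /entry /= big_ord1. Qed.

Lemma entryJ x : entry (cstar x) = adj (entry x).
Proof. by []. Qed.

Lemma entry_inj : injective entry.
Proof.
by move=> x y h; apply: mxop_ext => i j; rewrite !ord1; exact: h.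
Qed.

Lemma entry_surj T : A T -> exists x, entry x = T.
Proof.
move=> AT; exists (@mk_mxop _ _ A 1 (fun _ _ => T) (fun _ _ => AT)).
by [].
Qed.

Lemma entry_norm x (w : K) : nr (entry x w) <= nr x * nr w.
Proof. exact: nr_entry_le. Qed.

Lemma norm_entry_le x (c : R) : 0 <= c ->
  (forall w : K, nr (entry x w) <= c * nr w) -> nr x <= c.
Proof.
move=> c0 h; have := @mxnorm_entry _ _ _ (x : mxop A 1) c c0.
by rewrite muln1 mulr1; apply => i j w; rewrite !ord1; exact: h.
Qed.

Section Amp.
Variable n : nat.

Definition amp (x : 'I_n -> 'I_n -> mxcstar A 1) : mxcstar A n :=
  mk_mxop (fun i j => entry_in (x i j)).

Lemma amp_matrix : matrix_cstar amp.
Proof.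
split.
- by move=> a x y; apply: mxop_ext => i j.
- have [g hg] : exists g : mxcstar A n -> 'I_n -> 'I_n -> mxcstar A 1,
      forall y i j, entry (g y i j) = (y : mxop A n) i j.
    have [g hg] : exists g : mxcstar A n * 'I_n * 'I_n -> mxcstar A 1,
        forall p, entry (g p) = (p.1.1 : mxop A n) p.1.2 p.2.
      apply: (@ex_choice _ _ (fun (p : mxcstar A n * 'I_n * 'I_n) z =>
        entry z = (p.1.1 : mxop A n) p.1.2 p.2)) => p.
      exact: entry_surj (mxop_in _ _ _).
    by exists (fun y i j => g (y, i, j)) => y i j; rewrite hg.
  exists g => [x|y].
    by apply/funext => i; apply/funext => j; apply: entry_inj; rewrite hg.
  by apply: mxop_ext => i j; exact: hg.
- move=> x y; apply: mxop_ext => i j /=.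
  rewrite [LHS](_ : _ = \sum_k entry (cmul (x i k) (y k j))).
    by apply: eq_bigr => k _; rewrite entryM.
  rewrite -[LHS]/(entry _).
  by elim/big_rec2: _ => // k u v _ <-.
- by move=> x; apply: mxop_ext => i j.
Qed.

(** The ball asks for some C*-algebra of matrices, and [mxcstar A n] is the witness. The converse
    inclusion, for an arbitrary witness, is the purpose of [star_rep_contractive]. *)
Lemma mball_amp (x : 'I_n -> 'I_n -> cstar_opSpace (mxcstar A 1)) :
  (forall v, l2 (act (fun i j => entry (x i j)) v) <= l2 v) ->
  mball (cstar_opSpace (mxcstar A 1)) n x.
Proof.
move=> h; exists (mxcstar A n), amp; split; first exact: amp_matrix.
rewrite norm_nr -(rmorph1 (real_complex R)) lecR.
by apply: mxnorm_le => // v; rewrite mul1r.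
Qed.

End Amp.
End Amplification.

(** * Fixed points and representations of C*-algebras *)

Section StarMorphism.
Variables (R : realType) (M : cstarAlgebra R).
Implicit Types x y g h : M.

Lemma cmulBl x x' y : cmul (x - x') y = cmul x y - cmul x' y.
Proof.
by have := cmul_linearl y (-1) x' x; rewrite !scaleN1r (addrC (- x')) (addrC (- cmul _ _)).
Qed.

Lemma cmulBr x y y' : cmul x (y - y') = cmul x y - cmul x y'.
Proof.
by have := cmul_linearr x (-1) y' y; rewrite !scaleN1r (addrC (- y')) (addrC (- cmul _ _)).
Qed.

Lemma cstarD x y : cstar (x + y) = cstar x + cstar y.
Proof. by have := cstar_antilinear 1 x y; rewrite rmorph1 !scale1r. Qed.

Lemma cstar0 : cstar (0 : M) = 0.
Proof. by apply: (addrI (cstar 0)); rewrite -cstarD !addr0. Qed.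

Lemma cstarZ a x : cstar (a *: x) = Num.conj a *: cstar x.
Proof. by have := cstar_antilinear a x 0; rewrite !addr0 cstar0 addr0. Qed.

Lemma cstarB x y : cstar (x - y) = cstar x - cstar y.
Proof. by rewrite -scaleN1r cstarD cstarZ rmorphN rmorph1 scaleN1r. Qed.

Lemma nr_cmul x y : nr (cmul x y) <= nr x * nr y.
Proof. by have := cmul_norm_le x y; rewrite !norm_nr -rmorphM lecR. Qed.

Lemma nr_cstar_mul x : nr (cmul (cstar x) x) = nr x ^+ 2.
Proof.
by apply: (@complexI R); rewrite rmorphXn /= -!norm_nr cstar_norm.
Qed.

Lemma nr_cstar_le x : nr x <= nr (cstar x).
Proof.
have [->|x0] := eqVneq x 0; first by rewrite nr0 nr_ge0.
have nx : 0 < nr x by rewrite lt_def nr_ge0 nr_eq0 x0.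
by rewrite -(ler_pM2r nx) -expr2 -nr_cstar_mul nr_cmul.
Qed.

Lemma nr_cstar x : nr (cstar x) = nr x.
Proof. by apply/eqP; rewrite eq_le nr_cstar_le -{2}(cstarK x) nr_cstar_le. Qed.

(** The contraction principle, iterated from 0, with a closed invariant property [P] carried to the
    limit. It produces square roots, preimages under Kaplansky's function and inverses, without
    spectral theory. *)
Lemma ball_fixpoint (r k : R) (f : M -> M) (P : M -> Prop) :
  0 <= k < 1 -> 0 <= r ->
  (forall x, nr x <= r -> nr (f x) <= r) ->
  (forall x y, nr x <= r -> nr y <= r -> nr (f x - f y) <= k * nr (x - y)) ->
  P 0 -> (forall x, P x -> P (f x)) ->
  (forall u l, tends u l -> (forall n, P (u n)) -> P l) ->
  exists x, [/\ f x = x, nr x <= r & P x].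
Proof.
move=> /andP[k0 k1] r0 fr fk P0 Pf Pl.
pose u n := iter n f (0 : M).
have ur n : nr (u n) <= r.
  by elim: n => [|n IH]; [rewrite /u /= nr0 | exact: fr].
have up n : P (u n) by elim: n => [|n IH]; [exact: P0 | exact: Pf].
have step m n : nr (u (m + n)%N - u m) <= k ^+ m * r.
  elim: m => [|m IH]; first by rewrite add0n expr0 mul1r /u /= subr0 ur.
  rewrite addSn exprS -mulrA (le_trans (fk _ _ (ur _) (ur _)))//.
  by rewrite ler_wpM2l.
have kto (e : R) : 0 < e -> exists n0, forall m, (n0 <= m)%N -> k ^+ m * r < e.
  move=> e0; have r1 : 0 < r + 1 by rewrite ltr_wpDl.
  have /cvgrPdist_lt /(_ _ (divr_gt0 e0 r1)) [n0 _ hn] : (k ^+ n @[n --> \oo] --> (0 : R)).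
    by apply: cvg_expr; rewrite ger0_norm.
  exists n0 => m hm; have := hn m hm; rewrite /= sub0r normrN ger0_norm ?exprn_ge0//.
  rewrite ltr_pdivlMr// => h; rewrite (le_lt_trans _ h)//.
  by rewrite ler_wpM2l ?exprn_ge0// lerDl.
have [x ux] : exists x, tends u x.
  apply: complete_seq => e e0; have [n0 hn] := kto _ e0.
  exists n0; have main p q : (n0 <= p)%N -> (p <= q)%N -> nr (u p - u q) < e.
    move=> hp hq; rewrite nrBC -(subnKC hq) (le_lt_trans (step _ _))// hn//.
  move=> p q hp hq; case: (leqP p q) => [pq|/ltnW qp]; first exact: main.
  by rewrite nrBC main.
have xr : nr x <= r by exact: tends_nr_le ux ur.
exists x; split=> //; last exact: Pl ux up.
apply: (@tends_uniq _ _ (fun n => f (u n))).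
  move=> e e0; have [n0 hn] := ux _ e0; exists n0 => n /hn h.
  rewrite (le_lt_trans (fk _ _ (ur _) xr))// (le_lt_trans _ h)//.
  by rewrite ler_piMl ?nr_ge0// ltW.
by move=> e /ux[n0 hn]; exists n0 => n hn'; exact: (hn n.+1 (leqW hn')).
Qed.

(* g is 1 - sqrt (1 - h), which makes sense without a unit. *)
Lemma sqrt_one_minus h : nr h < 1 -> cstar h = h ->
  exists2 g, cstar g = g & g + g - cmul g g = h.
Proof.
(* The ball of radius [r] is invariant because [(nr h + r ^ 2) / 2 <= (nr h + 1) / 2], and on it the
   map contracts by the factor [r]. *)
move=> h1 hh; pose r := (1 + nr h) / 2.
have r1 : r < 1 by rewrite /r; lra.
have r0 : 0 <= r by have := nr_ge0 h; rewrite /r; lra.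
have [|||||||g [fg _ gg]] := @ball_fixpoint r r
  (fun g => (2^-1)%:C *: (h + cmul g g)) (fun g => cstar g = g).
- by rewrite r0 r1.
- exact: r0.
- move=> x xr; rewrite nrZ nr_real ger0_norm ?invr_ge0//.
  have h2 : nr (h + cmul x x) <= nr h + nr x ^+ 2.
    by rewrite (le_trans (ler_nrD _ _))// lerD2l expr2 nr_cmul.
  have h3 : nr x ^+ 2 <= r ^+ 2 by rewrite ler_pXn2r ?nnegrE ?nr_ge0.
  have h4 : r ^+ 2 <= 1 by rewrite expr2 mulr_ile1// ltW.
  rewrite mulrC /r; lra.
- move=> x y xr yr; rewrite -scalerBr nrZ nr_real ger0_norm ?invr_ge0//.
  have -> : h + cmul x x - (h + cmul y y) = cmul x (x - y) + cmul (x - y) y.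
    by rewrite opprD addrACA subrr add0r cmulBl cmulBr subrKA.
  have h1' := ler_nrD (cmul x (x - y)) (cmul (x - y) y).
  have h2' := nr_cmul x (x - y); have h3' := nr_cmul (x - y) y.
  have h4' := ler_wpM2r (nr_ge0 (x - y)) xr.
  have h5' := ler_wpM2l (nr_ge0 (x - y)) yr.
  rewrite mulrC; lra.
- exact: cstar0.
- by move=> x xx; rewrite cstarZ conj_real cstarD hh cstar_mul xx.
- move=> u l ul uP; apply: (tends_uniq _ ul).
  move=> e /ul[n0 hn]; exists n0 => n /hn.
  by rewrite -nr_cstar cstarB uP.
exists g => //.
have : g + g = h + cmul g g.
  rewrite -{1 2}fg -scalerDl -rmorphD /= (_ : 2^-1 + 2^-1 = 1 :> R) ?scale1r//.
  by rewrite -div1r -splitr.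
by move=> ->; rewrite addrK.
Qed.

(* Writing 1 - x*x as (1 - g)^2 gives |v|^2 - |x v|^2 = |v - g v|^2. *)
Lemma star_rep_contractive (K : complexHilbert R) n
    (p : M -> 'I_n -> 'I_n -> bop K) :
  (forall a x y i j, p (a *: x + y) i j = a *: p x i j + p y i j) ->
  (forall x y i j, p (cmul x y) i j = \sum_k bop_comp (p x i k) (p y k j)) ->
  (forall x i j, p (cstar x) i j = adj (p x j i)) ->
  forall x, nr x <= 1 -> forall v, l2 (act (p x) v) <= l2 v.
Proof.
move=> pL pM pJ.
have actL a x y v i : act (p (a *: x + y)) v i = a *: act (p x) v i + act (p y) v i.
  by rewrite /act scaler_sumr -big_split; apply: eq_bigr => j _; rewrite pL.
have actM x y v i : act (p (cmul x y)) v i = act (p x) (act (p y) v) i.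
  by rewrite -act_mul /act; apply: eq_bigr => j _; rewrite pM.
have actJ x v w : ip2 (act (p x) v) w = ip2 v (act (p (cstar x)) w).
  rewrite act_adj; apply: eq_bigr => i _; congr (inner K _ _).
  by apply: eq_bigr => j _; rewrite pJ.
have lt1 x : nr x < 1 -> forall v, l2 (act (p x) v) <= l2 v.
  move=> x1 v.
  have [||g gg hg] := @sqrt_one_minus (cmul (cstar x) x).
  - by rewrite nr_cstar_mul expr_lt1// nr_ge0.
  - by rewrite cstar_mul cstarK.
  rewrite -(ler_pXn2r (n := 2)) ?nnegrE ?l2_ge0// -subr_ge0.
  have := sqr_ge0 (l2 (fun i => 1%:C *: v i - 1%:C *: act (p g) v i)).
  rewrite l2_sqrB !expr1n !mul1r.
  suff -> : l2 (act (p x) v) ^+ 2 = 2 * complex.Re (ip2 v (act (p g) v))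
     - l2 (act (p g) v) ^+ 2 by lra.
  rewrite l2_ip actJ (l2_ip (act (p g) v)) actJ gg.
  have -> : ip2 v (act (p (cstar x)) (act (p x) v)) =
      ip2 v (act (p g) v) + ip2 v (act (p g) v) - ip2 v (act (p g) (act (p g) v)).
    rewrite /ip2 -big_split -sumrB; apply: eq_bigr => i _ /=.
    rewrite -actM -hg.
    have -> : g + g - cmul g g = (-1) *: cmul g g + (1 *: g + g).
      by rewrite scaleN1r scale1r addrC.
    by rewrite !actL actM scaleN1r scale1r -ipDr -ipBr addrC.
  by rewrite cReB cReD; ring.
move=> x x1 v; apply: le_eps => e e0.
have d0 : 0 < l2 v + 1 by rewrite ltr_wpDl ?l2_ge0.
(* Norm exactly one is treated by scaling with [t < 1]; the condition on [t] keeps the loss in the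
   final estimate below [e]. *)
have [t t1 ht] : exists2 t : R, 0 < t < 1 & (1 - t) * l2 v <= e * t.
  have k0 : 0 < l2 v + 1 + e by rewrite addr_gt0.
  exists ((l2 v + 1) / (l2 v + 1 + e)).
    by rewrite divr_gt0// ltr_pdivrMr// mul1r ltrDl.
  have -> : 1 - (l2 v + 1) / (l2 v + 1 + e) = e / (l2 v + 1 + e).
    by field; rewrite gt_eqF.
  have -> : e * ((l2 v + 1) / (l2 v + 1 + e)) = e / (l2 v + 1 + e) * (l2 v + 1).
    by ring.
  by rewrite ler_wpM2l ?lerDl// ltW// divr_gt0.
case/andP: t1 => t0 t1.
have := lt1 (t%:C *: x) _ v; rewrite nrZ nr_real (gtr0_norm t0).
have tx : t * nr x < 1 by rewrite (le_lt_trans _ t1)// ler_piMr// ltW.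
move=> /(_ tx).
(* Homogeneity is extracted from [pL], which must first show that the action of [p 0] is zero. *)
rewrite (eq_l2 (w := fun i => t%:C *: act (p x) v i)); last first.
  move=> i; have := actL t%:C x 0 v i; rewrite addr0 => ->.
  have := actL 1 (- x) x v i; rewrite scale1r addNr => ->.
  have := actL (-1) x 0 v i; rewrite addr0 !scaleN1r => ->.
  have := actL 1 0 0 v i; rewrite scaler0 addr0 scale1r.
  set z := act (p 0) v i => /(canLR (addrK _)) <-.
  by rewrite subrr addr0 scale1r addNr addr0.
rewrite l2Z nr_real (gtr0_norm t0) => h.
rewrite -(ler_pM2l t0) mulrDr; move: h ht; lra.
Qed.

End StarMorphism.

(** * Ultralimits and constructions of Hilbert spaces *)

Section UltraLimit.
Variables (R : realType) (T : Type).

Lemma ultra_of_base (I : Type) (D : I -> set T) (i0 : I) :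
  (forall i j, exists k, D k `<=` D i `&` D j) ->
  (forall i, D i !=set0) ->
  exists U : set_system T, UltraFilter U /\ forall i, U (D i).
Proof.
move=> Dd D0.
have FF : Filter (filter_from setT D).
  apply: filter_from_filter; first by exists i0.
  by move=> i j _ _; have [k] := Dd i j; exists k.
have PF : ProperFilter (filter_from setT D).
  by apply: filter_from_proper => i _; exact: D0.
have [U [UU sU]] := ultraFilterLemma PF.
by exists U; split=> // i; apply: sU; exists i.
Qed.

Variables (U : set_system T) (UU : UltraFilter U).

Lemma ultra_ex (A : set T) : U A -> exists t, A t.
Proof. by move=> UA; have [t] := filter_ex UA; exists t. Qed.

Lemma ultraC (A : set T) : ~ U A -> U (~` A).
Proof. by case: (in_ultra_setVsetC A UU). Qed.

Section Normed.
Variable V : normedZmodType R[i].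
Implicit Types f g : T -> V.

Definition ucvg f (l : V) := forall e : R, 0 < e -> U [set t | nr (f t - l) < e].

Lemma ucvg_near f g l : U [set t | f t = g t] -> ucvg f l -> ucvg g l.
Proof.
move=> fg fl e /fl; apply: filterS2 fg => t /= ->; exact.
Qed.

Lemma ucvg_uniq f l l' : ucvg f l -> ucvg f l' -> l = l'.
Proof.
move=> fl fl'; apply: subr0_eq; apply: small_zero => e e0.
have e2 : 0 < e / 2 by rewrite divr_gt0.
have [t [h h']] := ultra_ex (filterI (fl _ e2) (fl' _ e2)).
rewrite (le_trans (ler_nrT (f t) _ _))// (splitr e) lerD// ltW//.
by rewrite nrBC.
Qed.

Lemma ucvg_cst l : ucvg (fun=> l) l.
Proof. by move=> e e0; apply: filterS filterT => t _ /=; rewrite subrr nr0. Qed.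

Lemma ucvgD f g l m : ucvg f l -> ucvg g m -> ucvg (fun t => f t + g t) (l + m).
Proof.
move=> fl gm e e0; have e2 : 0 < e / 2 by rewrite divr_gt0.
apply: filterS2 (fl _ e2) (gm _ e2) => t /= h h'.
by rewrite opprD addrACA (le_lt_trans (ler_nrD _ _))// (splitr e) ltrD.
Qed.

Lemma ucvgN f l : ucvg f l -> ucvg (fun t => - f t) (- l).
Proof. by move=> fl e /fl; apply: filterS => t /=; rewrite -opprD nrN. Qed.

Lemma ucvgB f g l m : ucvg f l -> ucvg g m -> ucvg (fun t => f t - g t) (l - m).
Proof. by move=> fl gm; apply: ucvgD fl (ucvgN gm). Qed.

Lemma ucvg_nr_le f l (c : R) : ucvg f l -> U [set t | nr (f t) <= c] -> nr l <= c.
Proof.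
move=> fl fc; apply: le_eps => e e0.
have [t /= [h h']] := ultra_ex (filterI (fl _ e0) fc).
rewrite -(subrK (f t) l) (le_trans (ler_nrD _ _))// addrC lerD//.
by rewrite nrBC ltW.
Qed.

Lemma ucvg_sum I (r : seq I) (F : I -> T -> V) (L : I -> V) :
  (forall i, ucvg (F i) (L i)) ->
  ucvg (fun t => \sum_(i <- r) F i t) (\sum_(i <- r) L i).
Proof.
move=> h; elim: r => [|i r IH].
  rewrite big_nil; apply: ucvg_near (ucvg_cst 0).
  by apply: filterS filterT => t _ /=; rewrite big_nil.
rewrite big_cons; apply: ucvg_near (ucvgD (h i) IH).
by apply: filterS filterT => t _ /=; rewrite big_cons.
Qed.

End Normed.

Implicit Types f g : T -> R[i].

Lemma ucvgM a f l : ucvg f l -> ucvg (fun t => a * f t) (a * l).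
Proof.
move=> fl e e0; have d0 : 0 < nr a + 1 by rewrite ltr_wpDl ?nr_ge0.
apply: filterS (fl _ (divr_gt0 e0 d0)) => t /=; rewrite -mulrBr nrM ltr_pdivlMr// => h.
by rewrite (le_lt_trans _ h)// mulrC ler_wpM2l ?nr_ge0// lerDl.
Qed.

Lemma ucvg_conj f l : ucvg f l -> ucvg (fun t => Num.conj (f t)) (Num.conj l).
Proof. by move=> fl e /fl; apply: filterS => t /=; rewrite -rmorphB nr_conj. Qed.

Lemma ucvg_Re_ge f l (c : R) : ucvg f l -> U [set t | c <= complex.Re (f t)] ->
  c <= complex.Re l.
Proof.
move=> fl fc; apply: le_eps => e e0.
have [t /= [h h']] := ultra_ex (filterI (fl _ e0) fc).
have := ler_Re_nr (f t - l); rewrite cReB; lra.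
Qed.

Lemma ucvg_Re_le f l (c : R) : ucvg f l -> U [set t | complex.Re (f t) <= c] ->
  complex.Re l <= c.
Proof.
move=> fl fc; rewrite -lerN2 -cReN; apply: (ucvg_Re_ge (ucvgN fl)).
by apply: filterS fc => t /=; rewrite cReN lerN2.
Qed.

(** The limit is the supremum of the numbers that lie below [f] on a set of [U]; just above it, the
    dichotomy of ultrafilters reverses the inequality. *)
Lemma ultra_sup (f : T -> R) (c : R) : U [set t | `|f t| <= c] ->
  exists l, forall e, 0 < e -> U [set t | `|f t - l| < e].
Proof.
move=> fc; pose E := [set x : R | U [set t | x <= f t]].
have Ec : E (- c) by apply: filterS fc => t /=; rewrite ler_norml => /andP[].
have ubE : ubound E c.
  move=> x Ex; have [t /= []] := ultra_ex (filterI Ex fc).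
  by rewrite ler_norml => h /andP[_]; exact: le_trans.
have hE : has_sup E by split; [exists (- c) | exists c].
exists (sup E) => e e0.
have [x Ex hx] := sup_adherent e0 hE.
have nE : ~ E (sup E + e / 2).
  by move=> /(ub_le_sup hE.2); rewrite leNgt ltrDl divr_gt0.
apply: filterS2 Ex (ultraC nE) => t /= h /negP; rewrite -ltNge => h'.
rewrite ltr_norml; lra.
Qed.

Lemma ucvg_exists f (c : R) : U [set t | nr (f t) <= c] -> exists l, ucvg f l.
Proof.
move=> fc.
have [|a ha] := @ultra_sup (fun t => complex.Re (f t)) c.
  by apply: filterS fc => t /=; exact: le_trans (ler_normRe_nr _).
have [|b hb] := @ultra_sup (fun t => complex.Im (f t)) c.
  by apply: filterS fc => t /=; exact: le_trans (ler_normIm_nr _).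
exists (a +i* b) => e e0; have e2 : 0 < e / 2 by rewrite divr_gt0.
apply: filterS2 (ha _ e2) (hb _ e2) => t /= h h'.
by rewrite (le_lt_trans (ler_nr_ReIm _))// cReB cImB (splitr e) ltrD.
Qed.

Definition ulim f : R[i] := xget 0 [set l | ucvg f l].

Lemma ulimE f l : ucvg f l -> ulim f = l.
Proof. by move=> fl; apply: xget_unique => // y fy; exact: ucvg_uniq fy fl. Qed.

Lemma ulimP f (c : R) : U [set t | nr (f t) <= c] -> ucvg f (ulim f).
Proof. by move=> /ucvg_exists[l fl]; rewrite (ulimE fl). Qed.

End UltraLimit.

(** A Cauchy sequence is bounded on a tail, so it has a limit along an ultrafilter containing all
    tails, and this is its limit. *)
Lemma complete_seqC (R : realType) (u : nat -> R[i]) :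
  (forall e : R, 0 < e -> exists n0, forall m n, (n0 <= m)%N -> (n0 <= n)%N ->
     nr (u m - u n) < e) -> exists l, tends u l.
Proof.
move=> cu.
have [||U [UU hU]] := @ultra_of_base nat nat (fun n => [set m | (n <= m)%N]) 0%N.
- move=> i j; exists (maxn i j) => m /=; rewrite geq_max => /andP[]; by split.
- by move=> i; exists i => /=.
have [n0 h0] := cu 1 ltr01.
have [l ul] : exists l, ucvg U u l.
  apply: (@ucvg_exists _ _ _ UU _ (1 + nr (u n0))).
  apply: filterS (hU n0) => n /= hn.
  rewrite -[X in nr X <= _](subrK (u n0)) (le_trans (ler_nrD _ _))// lerD2r ltW//.
  exact: h0.
exists l => e e0; have e2 : 0 < e / 2 by rewrite divr_gt0.
have [n1 h1] := cu _ e2; exists n1 => n hn.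
have [m /= [h hm]] := ultra_ex UU (filterI (ul _ e2) (hU n1)).
by rewrite (le_lt_trans (ler_nrT (u m) _ _))// (splitr e) ltrD// h1.
Qed.

Section SemiInner.
Variables (R : realType) (V : lmodType R[i]) (ip : V -> V -> R[i]).
Hypothesis ipL : forall a x y z, ip (a *: x + y) z = a * ip x z + ip y z.
Hypothesis ipH : forall x y, ip x y = Num.conj (ip y x).
Hypothesis ip_ge0 : forall x, 0 <= complex.Re (ip x x).

(** The form may be degenerate, as for the trace on matrices of size 0. The hypotheses occur in the
    body so that the lemmas can read them off the term. *)
Definition seminorm x : R := let _ := (ipL, ipH, ip_ge0) in
  Num.sqrt (complex.Re (ip x x)).
Local Notation N := seminorm.

Lemma semi_ip0 z : ip 0 z = 0.
Proof.
have /eqP := ipL 1 0 0 z; rewrite scaler0 addr0 mul1r.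
by rewrite -subr_eq0 opprD addrA subrr add0r oppr_eq0 => /eqP.
Qed.

Lemma semi_ipZ a x z : ip (a *: x) z = a * ip x z.
Proof. by have := ipL a x 0 z; rewrite !addr0 semi_ip0 addr0. Qed.

Lemma semi_ipD x y z : ip (x + y) z = ip x z + ip y z.
Proof. by have := ipL 1 x y z; rewrite scale1r mul1r. Qed.

Lemma semi_ipZr a x z : ip z (a *: x) = Num.conj a * ip z x.
Proof. by rewrite [LHS]ipH semi_ipZ rmorphM /= [in RHS]ipH. Qed.

Lemma semi_ipDr x y z : ip z (x + y) = ip z x + ip z y.
Proof. by rewrite [LHS]ipH semi_ipD rmorphD /= (ipH z x) (ipH z y). Qed.

Lemma semi_ip_real x : ip x x = (complex.Re (ip x x))%:C.
Proof.
have := ipH x x; case: (ip x x) => a b /= [].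
by move=> h; congr Complex; lra.
Qed.

Lemma seminorm_ge0 x : 0 <= N x. Proof. exact: sqrtr_ge0. Qed.

Lemma seminorm_sqr x : N x ^+ 2 = complex.Re (ip x x).
Proof. by rewrite sqr_sqrtr. Qed.

Lemma seminormZ a x : N (a *: x) = nr a * N x.
Proof.
rewrite /N semi_ipZ semi_ipZr mulrA mulCJ cReMr sqrtrM ?sqr_ge0//.
by rewrite sqrtr_sqr ger0_norm ?nr_ge0.
Qed.

Lemma seminormN x : N (- x) = N x.
Proof. by rewrite -scaleN1r seminormZ nrN nr1 mul1r. Qed.

Lemma seminorm_sqrD x y (t : R) :
  N (x + t%:C *: y) ^+ 2 =
  N x ^+ 2 + t ^+ 2 * N y ^+ 2 + 2 * (t * complex.Re (ip x y)).
Proof.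
rewrite !seminorm_sqr semi_ipD !semi_ipDr !semi_ipZ !semi_ipZr !conj_real !cReD !cReMr.
have -> : complex.Re (ip y x) = complex.Re (ip x y) by rewrite ipH cRe_conj.
by ring.
Qed.

Lemma Re_semi_cs x y : complex.Re (ip x y) <= N x * N y.
Proof.
set b := complex.Re _.
have pos t : 0 <= N x ^+ 2 + t ^+ 2 * N y ^+ 2 + 2 * (t * b).
  by rewrite -seminorm_sqrD sqr_ge0.
have [y0|y0] := eqVneq (N y) 0.
  rewrite y0 mulr0 leNgt; apply/negP => b0.
  (* When [N y = 0] the quadratic is affine in [t], and this [t] gives it the value [-1]. *)
  have := pos (- (N x ^+ 2 + 1) / (2 * b)).
  have -> : - (N x ^+ 2 + 1) / (2 * b) * b = - (N x ^+ 2 + 1) / 2.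
    by field; rewrite gt_eqF.
  rewrite y0 expr0n /= mulr0; lra.
have ny : 0 < N y ^+ 2 by rewrite exprn_gt0// lt_def seminorm_ge0 y0.
have [b0|b0] := leP b 0; first by rewrite (le_trans b0)// mulr_ge0// seminorm_ge0.
rewrite -(ler_pXn2r (n := 2)) ?nnegrE ?mulr_ge0 ?seminorm_ge0 ?(ltW b0)// exprMn.
have := pos (- b / N y ^+ 2); rewrite addrAC -addrA -/(N y).
move: ny; move: (N x ^+ 2) (N y ^+ 2) => X Y ny.
have -> : 2 * (- b / Y * b) + (- b / Y) ^+ 2 * Y = - (b ^+ 2 / Y).
  by field; rewrite gt_eqF.
by rewrite subr_ge0 ler_pdivrMr.
Qed.

Lemma semi_cs x y : nr (ip x y) <= N x * N y.
Proof.
have [u u1 hu] := phase_exists (ip x y).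
have := Re_semi_cs (u *: x) y.
by rewrite semi_ipZ hu /= seminormZ u1 mul1r.
Qed.

Lemma seminormD x y : N (x + y) <= N x + N y.
Proof.
rewrite -(ler_pXn2r (n := 2)) ?nnegrE ?addr_ge0 ?seminorm_ge0//.
have := seminorm_sqrD x y 1; rewrite !scale1r => ->.
by have := Re_semi_cs x y; rewrite sqrrD; lra.
Qed.

End SemiInner.

Section MkHilbert.
Variables (R : realType) (V : lmodType R[i]) (ip : V -> V -> R[i]).
Hypothesis ipL : forall a x y z, ip (a *: x + y) z = a * ip x z + ip y z.
Hypothesis ipH : forall x y, ip x y = Num.conj (ip y x).
Hypothesis ip_ge0 : forall x, 0 <= complex.Re (ip x x).
Hypothesis ip_eq0 : forall x, complex.Re (ip x x) = 0 -> x = 0.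

Let N x := Num.sqrt (complex.Re (ip x x)).

Hypothesis Ncomplete : forall u : nat -> V,
  (forall e : R, 0 < e -> exists n0, forall m n, (n0 <= m)%N -> (n0 <= n)%N ->
     N (u m - u n) < e) ->
  exists l, forall e : R, 0 < e -> exists n0, forall n, (n0 <= n)%N ->
     N (u n - l) < e.

Let N_eq0 x : N x = 0 -> x = 0.
Proof.
move=> h; apply: ip_eq0; rewrite -(seminorm_sqr ipL ipH ip_ge0).
by rewrite [seminorm _ _ _ _]h expr0n.
Qed.

Let ND x y : N (x + y) <= N x + N y.
Proof. exact: (seminormD ipL ipH ip_ge0). Qed.

Let NZ a x : N (a *: x) = nr a * N x.
Proof. exact: (seminormZ ipL ipH ip_ge0). Qed.

Let H : completeNormedModType R[i] := mk_cnm ND NZ N_eq0 Ncomplete.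

Let ipf : H -> H -> R[i] := ip.

Let ipf_bilin : bilinear_for *%R (Num.conj \; *%R) ipf.
Proof.
split=> [z a x y|z a x y]; first exact: ipL.
by rewrite /ipf (semi_ipDr ipL ipH) (semi_ipZr ipL ipH).
Qed.

Let ipf_herm : forall x y : H, ipf x y = (-1) ^+ false * Num.conj (ipf y x).
Proof. by move=> x y; rewrite expr0 mul1r; exact: ipH. Qed.

Let ipf_pos : forall x : H, x != 0 -> 0 < ipf x x.
Proof.
move=> x x0; rewrite /ipf (semi_ip_real ipH) (ltcR 0) lt_def ip_ge0 andbT.
by apply: contra_neq x0; exact: ip_eq0.
Qed.

Let dotH : {dot H for Num.conj} :=
  HB.pack ipf (bilinear_isBilinear.Build _ _ _ _ _ _ ipf ipf_bilin)
    (isHermitianSesquilinear.Build _ _ _ _ ipf ipf_herm)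
    (isDotProduct.Build _ _ ipf ipf_pos).

Let norm_dot (x : H) : `|x| ^+ 2 = dotH x x.
Proof.
rewrite norm_nr -rmorphXn /= nr_cnm.
by rewrite [N x ^+ 2](seminorm_sqr ipL ipH ip_ge0) -(semi_ip_real ipH).
Qed.

Definition mk_hilbert : complexHilbert R := @HilbertSpace _ _ H dotH norm_dot.

End MkHilbert.

Section Ell2.
Variables (R : realType) (S : choiceType).
Implicit Types (v w : S -> R[i]) (A B : {fset S}).

Definition psum v A : R := \sum_(s <- A) nr (v s) ^+ 2.

Lemma psum_ge0 v A : 0 <= psum v A.
Proof. by apply: sumr_ge0 => s _; exact: sqr_ge0. Qed.

Lemma fsum_mono (f : S -> R) A B : (forall s, 0 <= f s) -> (A `<=` B)%fset ->
  \sum_(s <- A) f s <= \sum_(s <- B) f s.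
Proof.
move=> f0 AB.
rewrite [leRHS](bigID (fun s => s \in A))/= -[leLHS]addr0 lerD ?sumr_ge0//.
have -> : \sum_(s <- A) f s = \sum_(s <- B | s \in A) f s; last by [].
rewrite -[RHS]big_filter; apply: perm_big.
apply: uniq_perm; rewrite ?filter_uniq ?fset_uniq// => s.
by rewrite mem_filter andbC; case sA: (s \in A) => //=; rewrite ?andbF//; rewrite (fsubsetP AB).
Qed.

Lemma psum_mono v A B : (A `<=` B)%fset -> psum v A <= psum v B.
Proof. by apply: fsum_mono => s; exact: sqr_ge0. Qed.

Definition ell2_pred : {pred (S -> R[i]^o)} :=
  fun v => `[< exists c : R, forall A, psum v A <= c >].

Record ell2 := Ell2 { ell2_fun :> S -> R[i]^o; ell2P : ell2_fun \in ell2_pred }.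

HB.instance Definition _ := [isSub for ell2_fun].
HB.instance Definition _ := [Choice of ell2 by <:].

Lemma nr_sqrD_le (z w : R[i]) : nr (z + w) ^+ 2 <= 2 * nr z ^+ 2 + 2 * nr w ^+ 2.
Proof.
have h : nr (z + w) ^+ 2 <= (nr z + nr w) ^+ 2.
  by rewrite ler_pXn2r ?nnegrE ?addr_ge0 ?nr_ge0// ler_nrD.
rewrite (le_trans h)//; have := sqr_ge0 (nr z - nr w); rewrite sqrrB sqrrD; lra.
Qed.

Lemma ell2_submod : submod_closed ell2_pred.
Proof.
split=> [|a v w /asboolP[c hc] /asboolP[d hd]]; apply/asboolP.
  by exists 0 => A; rewrite /psum big1// => s _; rewrite nr0 expr0n.
exists (2 * (nr a ^+ 2 * c) + 2 * d) => A.
rewrite (le_trans (_ : _ <= 2 * (nr a ^+ 2 * psum v A) + 2 * psum w A))//.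
  rewrite /psum !mulr_sumr -big_split ler_sum// => s _ /=.
  by rewrite (le_trans (nr_sqrD_le _ _))// nrM exprMn.
by rewrite lerD// ler_wpM2l// ler_wpM2l// sqr_ge0.
Qed.

HB.instance Definition _ :=
  GRing.isSubmodClosed.Build R[i] (S -> R[i]^o) ell2_pred ell2_submod.
HB.instance Definition _ := [SubChoice_isSubLmodule of ell2 by <:].

Lemma ell2_bounded (v : ell2) : exists c : R, forall A, psum v A <= c.
Proof. by have /asboolP := ell2P v. Qed.

Lemma mk_ell2_subproof v : (exists c : R, forall A, psum v A <= c) -> v \in ell2_pred.
Proof. by move=> h; apply/asboolP. Qed.

Definition mk_ell2 v h : ell2 := Ell2 (@mk_ell2_subproof v h).

Lemma ell2_ext (v w : ell2) : (forall s, v s = w s) -> v = w.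
Proof. by move=> h; apply: val_inj; apply/funext. Qed.

(** The ultrafilter refines the directed set of finite subsets: inner products over an arbitrary
    index set become ultralimits of finite sums, and their algebraic laws pass to the limit. *)
Lemma fset_ultra : exists U : set_system {fset S}, UltraFilter U /\
  forall A, U [set B | (A `<=` B)%fset].
Proof.
apply: (ultra_of_base (D := fun A => [set B | (A `<=` B)%fset]) fset0).
  move=> A B; exists (A `|` B)%fset => C /= h; split=> /=.
    exact: fsubset_trans (fsubsetUl _ _) h.
  exact: fsubset_trans (fsubsetUr _ _) h.
by move=> A; exists A => /=.
Qed.

Definition fultra := projT1 (cid fset_ultra).

Lemma fultraP : UltraFilter fultra.
Proof. by rewrite /fultra; case: cid => U []. Qed.

Lemma fultra_above A : fultra [set B | (A `<=` B)%fset].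
Proof. exact: (projT2 (cid fset_ultra)).2. Qed.

#[local] Existing Instance fultraP.

Definition pip v w A : R[i] := \sum_(s <- A) v s * Num.conj (w s).

Definition ell2_ip (v w : ell2) : R[i] := ulim fultra (pip v w).

Lemma pip_cvg (v w : ell2) : ucvg fultra (pip v w) (ell2_ip v w).
Proof.
have [c hc] := ell2_bounded v; have [d hd] := ell2_bounded w.
apply: (@ulimP _ _ _ fultraP _ (c + d)); apply: filterS filterT => A _ /=.
rewrite (le_trans (ler_nr_sum _ _ _))//.
rewrite (le_trans (_ : _ <= psum v A + psum w A))// ?lerD//.
rewrite /psum -big_split ler_sum// => s _ /=.
rewrite nrM nr_conj; have := sqr_ge0 (nr (v s) - nr (w s)); rewrite sqrrB.
have := sqr_ge0 (nr (v s)); have := sqr_ge0 (nr (w s)); lra.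
Qed.

Lemma pip_psum v A : pip v v A = (psum v A)%:C.
Proof. by rewrite /psum rmorph_sum; apply: eq_bigr => s _; rewrite mulCJ. Qed.

Lemma psum_le (v : ell2) A : psum v A <= complex.Re (ell2_ip v v).
Proof.
apply: (ucvg_Re_ge fultraP (pip_cvg v v)); apply: filterS (fultra_above A) => B /= AB.
by rewrite pip_psum /= psum_mono.
Qed.

Lemma ell2_ip_le (v : ell2) c : (forall A, psum v A <= c) ->
  complex.Re (ell2_ip v v) <= c.
Proof.
move=> h; apply: (ucvg_Re_le fultraP (pip_cvg v v)); apply: filterS filterT => A _ /=.
by rewrite pip_psum; exact: h.
Qed.

Lemma nr_coord_le (v : ell2) s : nr (v s) ^+ 2 <= complex.Re (ell2_ip v v).
Proof. by have := psum_le v [fset s]%fset; rewrite /psum big_seq_fset1. Qed.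

Lemma ell2_ipL a (x y z : ell2) : ell2_ip (a *: x + y) z = a * ell2_ip x z + ell2_ip y z.
Proof.
apply: (ulimE fultraP).
apply: (ucvg_near fultraP _ (ucvgD fultraP (ucvgM fultraP a (pip_cvg x z)) (pip_cvg y z))).
apply: filterS filterT => A _ /=; rewrite /pip mulr_sumr -big_split.
by apply: eq_bigr => s _; rewrite /= mulrA -mulrDl.
Qed.

Lemma ell2_ipH (x y : ell2) : ell2_ip x y = Num.conj (ell2_ip y x).
Proof.
apply: (ulimE fultraP).
apply: (ucvg_near fultraP _ (ucvg_conj fultraP (pip_cvg y x))).
apply: filterS filterT => A _ /=; rewrite /pip rmorph_sum.
by apply: eq_bigr => s _; rewrite rmorphM /= conjCK mulrC.
Qed.

Lemma ell2_ip_ge0 (x : ell2) : 0 <= complex.Re (ell2_ip x x).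
Proof. by rewrite (le_trans (psum_ge0 x fset0))// psum_le. Qed.

Lemma ell2_ip_eq0 (x : ell2) : complex.Re (ell2_ip x x) = 0 -> x = 0.
Proof.
move=> h; apply: ell2_ext => s; apply/eqP; rewrite -nr_eq0 -sqrf_eq0 eq_le sqr_ge0 andbT.
by rewrite -h nr_coord_le.
Qed.

Let N (x : ell2) := Num.sqrt (complex.Re (ell2_ip x x)).

Lemma ell2_complete (u : nat -> ell2) :
  (forall e : R, 0 < e -> exists n0, forall m n, (n0 <= m)%N -> (n0 <= n)%N ->
     N (u m - u n) < e) ->
  exists l, forall e : R, 0 < e -> exists n0, forall n, (n0 <= n)%N ->
     N (u n - l) < e.
Proof.
move=> cu.
have coord m n s : nr (u m s - u n s) <= N (u m - u n).
  rewrite -(ler_pXn2r (n := 2)) ?nnegrE ?nr_ge0 ?sqrtr_ge0// sqr_sqrtr ?ell2_ip_ge0//.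
  exact: (nr_coord_le (u m - u n)).
have [l hl] : exists l : S -> R[i], forall s, tends (fun n => u n s : R[i]) (l s).
  apply: (@ex_choice _ _ (fun s (z : R[i]) => tends (fun n => u n s : R[i]) z)) => s.
  apply: complete_seqC => e /cu[n0 h]; exists n0 => m n hm hn.
  exact: le_lt_trans (coord _ _ _) (h _ _ hm hn).
have close (e : R) : 0 < e -> exists n0, forall n, (n0 <= n)%N -> forall A,
    psum (fun s => u n s - l s) A <= 2 * e ^+ 2.
  move=> e0; have [n0 h] := cu _ e0; exists n0 => n hn A; apply: le_eps => d d0.
  have c0 : 0 < 2 * (size A).+1%:R :> R by rewrite mulr_gt0.
  (* The coordinate errors over the finite set [A] cost at most [d] in total; the cap by 1 lets a
     squared error be bounded by the error. *)
  have d1 : 0 < Num.min 1 (d / (2 * (size A).+1%:R)).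
    by rewrite lt_min ltr01 divr_gt0.
  have [k hk] := ex_choice (fun s => hl s _ d1).
  pose m := maxn n0 (\max_(s <- A) k s).
  rewrite (le_trans (_ : _ <= \sum_(s <- A) (2 * nr (u n s - u m s) ^+ 2 +
      2 * (d / (2 * (size A).+1%:R)))))//.
  - rewrite /psum big_seq [leRHS]big_seq ler_sum// => s sA.
    rewrite -(subrKA (u m s)) (le_trans (nr_sqrD_le _ _))// lerD2l ler_wpM2l//.
    have hs : nr (u m s - l s) < Num.min 1 (d / (2 * (size A).+1%:R)).
      by apply: hk; rewrite leq_max (leq_bigmax_seq s)// orbT.
    move: hs; rewrite lt_min => /andP[/ltW h1 /ltW h2].
    by rewrite (le_trans _ h2)// expr2 ler_piMl ?nr_ge0.
  - rewrite big_split /= lerD//.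
      rewrite -mulr_sumr ler_wpM2l// (le_trans (psum_le (u n - u m) A))//.
      rewrite -[leLHS]sqr_sqrtr ?ell2_ip_ge0// ler_pXn2r ?nnegrE ?sqrtr_ge0 ?(ltW e0)//.
      by rewrite ltW// h// leq_maxl.
    rewrite big_const_seq count_predT iter_addr addr0 -[leLHS]mulr_natr.
    have -> : 2 * (d / (2 * (size A).+1%:R)) * (size A)%:R =
        d * ((size A)%:R / (size A).+1%:R).
      have : (size A).+1%:R != 0 :> R by rewrite pnatr_eq0.
      by move: ((size A)%:R : R) ((size A).+1%:R : R) => x y y0; field.
    by rewrite ler_piMr ?(ltW d0)// ler_pdivrMr// mul1r ler_nat.
have [n1 h1] := close 1 ltr01.
have lP : exists c : R, forall A, psum l A <= c.
  have [c hc] := ell2_bounded (u n1).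
  exists (2 * (2 * 1 ^+ 2) + 2 * c) => A.
  rewrite (le_trans (_ : _ <= 2 * psum (fun s => u n1 s - l s) A + 2 * psum (u n1) A))//.
    rewrite /psum !mulr_sumr -big_split ler_sum// => s _ /=.
    rewrite -[X in nr X ^+ 2 <= _](subrK (u n1 s)) (le_trans (nr_sqrD_le _ _))//.
    by rewrite nrBC.
  by rewrite lerD// ler_wpM2l// h1.
exists (mk_ell2 lP) => e e0.
have e2 : 0 < e / 2 by rewrite divr_gt0.
have [n0 h] := close _ e2; exists n0 => n hn.
rewrite -(ltr_pXn2r (n := 2)) ?nnegrE ?sqrtr_ge0 ?(ltW e0)// sqr_sqrtr ?ell2_ip_ge0//.
rewrite (le_lt_trans (@ell2_ip_le (u n - mk_ell2 lP) _ (h n hn)))//.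
have -> : 2 * (e / 2) ^+ 2 = e ^+ 2 / 2 by field.
by have := exprn_gt0 2 e0; lra.
Qed.

Definition ell2H : complexHilbert R :=
  mk_hilbert ell2_ipL ell2_ipH ell2_ip_ge0 ell2_ip_eq0 ell2_complete.

Lemma ell2H_ip (v w : ell2H) : ucvg fultra (pip (v : ell2) (w : ell2)) (inner ell2H v w).
Proof. exact: pip_cvg. Qed.

End Ell2.

Lemma ler_sum_term (R : realType) (I : finType) (F : I -> R) i :
  (forall j, 0 <= F j) -> F i <= \sum_j F j.
Proof. by move=> F0; rewrite (bigD1 i)//= lerDl sumr_ge0. Qed.

(** * Matrices with the normalized Hilbert-Schmidt norm *)

Section NormalizedTrace.
Variables (R : realType) (d : nat).
Local Notation C := R[i].
Implicit Types (x y z : 'M[C]_d) (u v : 'cV[C]_d).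

Definition mh x : 'M[C]_d := map_mx Num.conj x^T.

Lemma mhE x a b : mh x a b = Num.conj (x b a).
Proof. by rewrite !mxE. Qed.

Lemma mhK x : mh (mh x) = x.
Proof. by apply/matrixP => a b; rewrite !mhE conjCK. Qed.

Lemma mhD x y : mh (x + y) = mh x + mh y.
Proof. by apply/matrixP => a b; rewrite !mxE rmorphD. Qed.

Lemma mhZ (c : C) x : mh (c *: x) = Num.conj c *: mh x.
Proof. by apply/matrixP => a b; rewrite !mxE rmorphM. Qed.

Lemma mhN x : mh (- x) = - mh x.
Proof. by apply/matrixP => a b; rewrite !mxE rmorphN. Qed.

Lemma mhM x y : mh (x *m y) = mh y *m mh x.
Proof.
apply/matrixP => a b; rewrite !mxE rmorph_sum; apply: eq_bigr => k _.
by rewrite rmorphM /= mulrC !mhE.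
Qed.

Lemma mh1 : mh 1%:M = 1%:M.
Proof. by apply/matrixP => a b; rewrite !mxE rmorph_nat eq_sym. Qed.

Lemma mh0 : mh 0 = 0.
Proof. by apply/matrixP => a b; rewrite !mxE rmorph0. Qed.

Definition tau x : C := (d%:R^-1 : R)%:C * \tr x.

Lemma tauD x y : tau (x + y) = tau x + tau y.
Proof. by rewrite /tau mxtraceD mulrDr. Qed.

Lemma tauZ (c : C) x : tau (c *: x) = c * tau x.
Proof. by rewrite /tau mxtraceZ mulrCA. Qed.

Lemma tau0 : tau 0 = 0.
Proof. by rewrite /tau mxtrace0 mulr0. Qed.

Lemma tau_sum I (r : seq I) (P : pred I) (f : I -> 'M[C]_d) :
  tau (\sum_(i <- r | P i) f i) = \sum_(i <- r | P i) tau (f i).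
Proof. by elim/big_rec2: _ => [|i a b _ <-]; rewrite ?tau0 ?tauD. Qed.

Lemma tauC x y : tau (x *m y) = tau (y *m x).
Proof. by rewrite /tau mxtrace_mulC. Qed.

Lemma tau_mh x : tau (mh x) = Num.conj (tau x).
Proof.
rewrite /tau rmorphM /= conj_real; congr (_ * _); rewrite /mxtrace rmorph_sum.
by apply: eq_bigr => a _; rewrite mhE.
Qed.

Definition mip x y : C := tau (mh y *m x).

Lemma mipL (a : C) x y z : mip (a *: x + y) z = a * mip x z + mip y z.
Proof. by rewrite /mip mulmxDr -scalemxAr tauD tauZ. Qed.

Lemma mipH x y : mip x y = Num.conj (mip y x).
Proof. by rewrite /mip -tau_mh mhM mhK. Qed.

Lemma mipxx x : mip x x = (d%:R^-1 * \sum_b \sum_a nr (x a b) ^+ 2)%:C.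
Proof.
rewrite /mip /tau rmorphM /=; congr (_ * _); rewrite rmorph_sum /mxtrace.
apply: eq_bigr => b _; rewrite mxE rmorph_sum; apply: eq_bigr => a _.
by rewrite mhE mulrC mulCJ.
Qed.

Lemma mip_ge0 x : 0 <= complex.Re (mip x x).
Proof.
rewrite mipxx /= mulr_ge0 ?invr_ge0// sumr_ge0// => b _.
by apply: sumr_ge0 => a _; exact: sqr_ge0.
Qed.

Definition n2 : 'M[C]_d -> R := seminorm mipL mipH mip_ge0.

Lemma n2_sqr x : n2 x ^+ 2 = d%:R^-1 * \sum_b \sum_a nr (x a b) ^+ 2.
Proof. by rewrite seminorm_sqr mipxx. Qed.

Lemma n2_ge0 x : 0 <= n2 x. Proof. exact: seminorm_ge0. Qed.

Lemma n2D x y : n2 (x + y) <= n2 x + n2 y. Proof. exact: seminormD. Qed.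

Lemma n2N x : n2 (- x) = n2 x. Proof. exact: seminormN. Qed.

Lemma n2B x y : n2 (x - y) <= n2 x + n2 y.
Proof. by rewrite -(n2N y) n2D. Qed.

Lemma n2T z x y : n2 (x - y) <= n2 (x - z) + n2 (z - y).
Proof. by rewrite -(subrKA z) n2D. Qed.

Lemma n2Z (a : C) x : n2 (a *: x) = nr a * n2 x.
Proof. exact: seminormZ. Qed.

Lemma n2_cs x y : nr (tau (mh y *m x)) <= n2 x * n2 y.
Proof. exact: (semi_cs mipL mipH mip_ge0 x y). Qed.

Lemma n2_mh x : n2 (mh x) = n2 x.
Proof.
apply/eqP; rewrite -(eqrXn2 (n := 2)) ?n2_ge0// !n2_sqr exchange_big.
by apply/eqP; congr (_ * _); apply: eq_bigr => a _; apply: eq_bigr => b _;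
  rewrite mhE nr_conj.
Qed.

Lemma n2_tau x : (n2 x ^+ 2)%:C = tau (mh x *m x).
Proof. by rewrite -[RHS]/(mip x x) mipxx n2_sqr. Qed.

Definition vn2 u : R := \sum_a nr (u a 0) ^+ 2.

Lemma vn2_ge0 u : 0 <= vn2 u.
Proof. by apply: sumr_ge0 => a _; exact: sqr_ge0. Qed.

(** For [c >= 0], this bounds the operator norm of [x] by [c]; it is squared to stay clear of
    roots. *)
Definition mbd x (c : R) := forall u, vn2 (x *m u) <= c ^+ 2 * vn2 u.

Lemma n2_col x : n2 x ^+ 2 = d%:R^-1 * \sum_b vn2 (col b x).
Proof.
rewrite n2_sqr; congr (_ * _); apply: eq_bigr => b _; apply: eq_bigr => a _.
by rewrite mxE.
Qed.

Lemma n2_mull x c y : 0 <= c -> mbd x c -> n2 (x *m y) <= c * n2 y.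
Proof.
move=> c0 xc; rewrite -(ler_pXn2r (n := 2)) ?nnegrE ?mulr_ge0 ?n2_ge0//.
rewrite exprMn !n2_col mulrCA ler_wpM2l ?invr_ge0// mulr_sumr ler_sum// => b _.
by rewrite !colE -mulmxA xc.
Qed.

Lemma vn2_sqrB u v : vn2 (u - v) = vn2 u + vn2 v - 2 * complex.Re (\sum_a u a 0 * Num.conj (v a 0)).
Proof.
rewrite cRe_sum mulr_sumr -big_split -sumrB; apply: eq_bigr => a _ /=.
rewrite !mxE; case: (u a 0) (v a 0) => [p q] [p' q']; rewrite !nr_sqr /=; ring.
Qed.

(** With [w = x^* u], expand [|c^2 u - x w|^2 >= 0] and use [|x w|^2 <= c^2 |w|^2]. The case [c = 0]
    is separate because [c ^ 2] is cancelled. *)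
Lemma mbd_mh x c : 0 <= c -> mbd x c -> mbd (mh x) c.
Proof.
move=> c0 xc u; set w := mh x *m u.
have e : complex.Re (\sum_a u a 0 * Num.conj ((x *m w) a 0)) = vn2 w.
  transitivity (complex.Re (\sum_a w a 0 * Num.conj (w a 0))); last first.
    by rewrite cRe_sum; apply: eq_bigr => a _; rewrite mulCJ.
  congr complex.Re.
  transitivity (\sum_a \sum_b u a 0 * Num.conj (x a b * w b 0)).
    by apply: eq_bigr => a _; rewrite mxE rmorph_sum mulr_sumr.
  rewrite exchange_big; apply: eq_bigr => b _ /=.
  rewrite {2}/w mxE mulr_suml; apply: eq_bigr => a _.
  by rewrite mhE rmorphM mulrCA mulrA.
have [c1|c1] := eqVneq c 0.
  have xw : vn2 (x *m w) = 0.
    apply/eqP; rewrite eq_le vn2_ge0 andbT (le_trans (xc w))//.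
    by rewrite c1 expr0n mul0r.
  have x0 a : (x *m w) a 0 = 0.
    apply/eqP; rewrite -nr_eq0 -sqrf_eq0 eq_le sqr_ge0 andbT -xw /vn2.
    by rewrite (bigD1 a)//= lerDl sumr_ge0// => b _; exact: sqr_ge0.
  rewrite -e big1 ?mulr_ge0 ?vn2_ge0 ?sqr_ge0// => a _.
  by rewrite x0 rmorph0 mulr0.
have c2 : 0 < c ^+ 2 by rewrite exprn_gt0// lt_def c0 c1.
have := vn2_ge0 ((c ^+ 2)%:C *: u - x *m w).
rewrite vn2_sqrB.
have -> : vn2 ((c ^+ 2)%:C *: u) = c ^+ 2 * (c ^+ 2 * vn2 u).
  rewrite /vn2 !mulr_sumr; apply: eq_bigr => a _.
  by rewrite mxE nrM nr_real ger0_norm ?sqr_ge0// exprMn; ring.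
have -> : complex.Re (\sum_a ((c ^+ 2)%:C *: u) a 0 * Num.conj ((x *m w) a 0)) =
    c ^+ 2 * vn2 w.
  rewrite -e !cRe_sum mulr_sumr; apply: eq_bigr => a _.
  by rewrite mxE -mulrA cReMr.
move=> h; have := xc w => h2.
have : 0 <= c ^+ 2 * (c ^+ 2 * vn2 u - vn2 w) by lra.
by rewrite pmulr_rge0// subr_ge0.
Qed.

Lemma n2_mulr x y c : 0 <= c -> mbd y c -> n2 (x *m y) <= c * n2 x.
Proof.
move=> c0 yc; rewrite -n2_mh mhM (le_trans (n2_mull _ c0 (mbd_mh c0 yc)))//.
by rewrite n2_mh.
Qed.

End NormalizedTrace.

(** * Kaplansky's function for matrices and block matrices *)

Section MatrixContraction.
Variables (R : realType) (d n : nat).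
Local Notation C := R[i].
Implicit Types (X Y : 'I_n -> 'I_n -> 'M[C]_d) (u v : 'I_n -> 'cV[C]_d).

Definition mact X u i : 'cV[C]_d := \sum_j X i j *m u j.

Definition mcb X (c : R) := forall u,
  \sum_i vn2 (mact X u i) <= c ^+ 2 * \sum_j vn2 (u j).

Lemma vn20 : vn2 (0 : 'cV[C]_d) = 0.
Proof. by rewrite /vn2 big1// => a _; rewrite mxE nr0 expr0n. Qed.

Lemma mcb_entry X c i j : mcb X c -> mbd (X i j) c.
Proof.
move=> Xc w; pose u k : 'cV[C]_d := if k == j then w else 0.
have := Xc u; rewrite (bigD1 i)//= [in leRHS](bigD1 j)//= [X in _ * (_ + X)]big1; last first.
  by move=> k /negbTE kj; rewrite /u kj vn20.
have -> : mact X u i = X i j *m w.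
  rewrite /mact (bigD1 j)//= /u eqxx big1 ?addr0// => k /negbTE ->.
  by rewrite mulmx0.
rewrite addr0 /u eqxx; apply: le_trans.
by rewrite lerDl sumr_ge0// => k _; exact: vn2_ge0.
Qed.

End MatrixContraction.

Section Kaplansky.
Variables (R : realType).
Local Notation C := R[i].

Section Square.
Variable m : nat.
Implicit Types (x y : 'M[C]_m) (u v w : 'cV[C]_m).

Definition cvip u v : C := \sum_a u a 0 * Num.conj (v a 0).

Lemma cvip_mh x u v : cvip (x *m u) v = cvip u (mh x *m v).
Proof.
rewrite /cvip; transitivity (\sum_a \sum_b x a b * u b 0 * Num.conj (v a 0)).
  by apply: eq_bigr => a _; rewrite mxE mulr_suml.
rewrite exchange_big; apply: eq_bigr => b _ /=; rewrite mxE rmorph_sum mulr_sumr.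
by apply: eq_bigr => a _; rewrite rmorphM /= mhE conjCK; ring.
Qed.

Lemma cvipxx u : cvip u u = (vn2 u)%:C.
Proof. by rewrite rmorph_sum; apply: eq_bigr => a _; rewrite mulCJ. Qed.

Lemma vn2_cvipB u v : vn2 (u - v) = vn2 u + vn2 v - 2 * complex.Re (cvip u v).
Proof. exact: vn2_sqrB. Qed.

Lemma vn2N u : vn2 (- u) = vn2 u.
Proof. by apply: eq_bigr => a _; rewrite mxE nrN. Qed.

Lemma cvipNr u v : cvip u (- v) = - cvip u v.
Proof. by rewrite -sumrN; apply: eq_bigr => a _; rewrite mxE rmorphN mulrN. Qed.

Lemma vn2_cvipD u v : vn2 (u + v) = vn2 u + vn2 v + 2 * complex.Re (cvip u v).
Proof. by rewrite -[v]opprK vn2_cvipB cvipNr vn2N opprK cReN; ring. Qed.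

Lemma vn2_eq0 u : vn2 u = 0 -> u = 0.
Proof.
move=> h; apply/colP => a; rewrite mxE; apply/eqP.
rewrite -nr_eq0 -sqrf_eq0 eq_le sqr_ge0 andbT -h /vn2.
by rewrite (bigD1 a)//= lerDl sumr_ge0// => b _; exact: sqr_ge0.
Qed.

(* x = 2 y z with z = (1 + y^* y)^-1; 4 |y w|^2 <= |w + y^* y w|^2. *)
Lemma kaplansky_square y : exists x z, [/\ x = 2%:R *: (y *m z),
  z + mh y *m y *m z = 1%:M, mbd x 1 & mbd z 1].
Proof.
pose z := 1%:M + mh y *m y.
have zE w : z *m w = w + mh y *m (y *m w) by rewrite mulmxDl mul1mx mulmxA.
have zre w : complex.Re (cvip w (mh y *m (y *m w))) = vn2 (y *m w).
  by rewrite -cvip_mh cvipxx.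
have zinj w : z *m w = 0 -> w = 0.
  move=> zw; apply: vn2_eq0; apply/eqP; rewrite eq_le vn2_ge0 andbT.
  have := vn2_cvipD w (mh y *m (y *m w)); rewrite -zE zw zre vn20.
  have := vn2_ge0 (mh y *m (y *m w)); have := vn2_ge0 (y *m w); lra.
have zu : z \in unitmx.
  rewrite -unitmx_tr -row_free_unit; apply: inj_row_free => v vz.
  by apply: trmx_inj; rewrite trmx0; apply: zinj; rewrite -[z]trmxK -trmx_mul vz trmx0.
exists (2%:R *: (y *m invmx z)), (invmx z); split=> [//||u|u].
- by rewrite -{1}[invmx z]mul1mx -mulmxDl -/z mulmxV.
- rewrite expr1n mul1r -scalemxAl -mulmxA; set w := invmx z *m u.
  have -> : u = z *m w by rewrite mulKVmx.
  rewrite zE vn2_cvipD zre.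
  have -> : vn2 (2%:R *: (y *m w)) = 4 * vn2 (y *m w).
    rewrite /vn2 mulr_sumr; apply: eq_bigr => a _.
    rewrite mxE nrM exprMn; congr (_ * _).
    by rewrite -(rmorph_nat (real_complex R)) nr_real ger0_norm// -natrX.
  have := vn2_ge0 (w - mh y *m (y *m w)); rewrite vn2_cvipB zre; lra.
- rewrite expr1n mul1r; set w := invmx z *m u.
  have -> : u = z *m w by rewrite mulKVmx.
  rewrite zE vn2_cvipD zre.
  have := vn2_ge0 (mh y *m (y *m w)); have := vn2_ge0 (y *m w); lra.
Qed.

End Square.

Section Blocks.
Variables (d n : nat).
Implicit Types (X Y : 'I_n -> 'I_n -> 'M[C]_d).
Local Notation J := ('I_n * 'I_d)%type.

Lemma block_sum (V : nmodType) (F : 'I_#|{: J}| -> V) :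
  \sum_p F p = \sum_i \sum_a F (enum_rank (i, a)).
Proof.
rewrite pair_bigA (reindex (@enum_rank J)) /=; last first.
  exact: onW_bij (enum_rank_bij _).
by apply: eq_bigr => -[i a] _.
Qed.

(** Flattening the blocks into one square matrix reduces the block case to [kaplansky_square]. *)
Definition bigm X : 'M[C]_#|{: J}| := \matrix_(p, q)
  X (enum_val p).1 (enum_val q).1 (enum_val p).2 (enum_val q).2.

Definition smallm (x : 'M[C]_#|{: J}|) i j : 'M[C]_d :=
  \matrix_(a, b) x (enum_rank (i, a)) (enum_rank (j, b)).

Lemma bigmE X i a j b : bigm X (enum_rank (i, a)) (enum_rank (j, b)) = X i j a b.
Proof. by rewrite mxE !enum_rankK. Qed.

Lemma bigmP (x y : 'M[C]_#|{: J}|) :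
  (forall i a j b, x (enum_rank (i, a)) (enum_rank (j, b)) =
                   y (enum_rank (i, a)) (enum_rank (j, b))) -> x = y.
Proof.
move=> h; apply/matrixP => p q; rewrite -(enum_valK p) -(enum_valK q).
by case: (enum_val p) (enum_val q) => i a [j b].
Qed.

Lemma smallmK x : bigm (smallm x) = x.
Proof. by apply: bigmP => i a j b; rewrite bigmE mxE. Qed.

Lemma bigmB X Y : bigm (fun i j => X i j - Y i j) = bigm X - bigm Y.
Proof. by apply: bigmP => i a j b; rewrite !mxE !enum_rankK. Qed.

Lemma bigmZ c X : bigm (fun i j => c *: X i j) = c *: bigm X.
Proof. by apply: bigmP => i a j b; rewrite bigmE [RHS]mxE !bigmE !mxE. Qed.

Lemma bigm_mh X : bigm (fun i j => mh (X j i)) = mh (bigm X).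
Proof. by apply: bigmP => i a j b; rewrite bigmE !mhE !bigmE. Qed.

Lemma bigmM X Y : bigm (fun i j => \sum_k X i k *m Y k j) = bigm X *m bigm Y.
Proof.
apply: bigmP => i a j b; rewrite bigmE [RHS]mxE block_sum summxE.
by apply: eq_bigr => k _; rewrite mxE; apply: eq_bigr => c _; rewrite !bigmE.
Qed.

Lemma mcb_bigm X c : mbd (bigm X) c -> mcb X c.
Proof.
move=> xc u; pose w : 'cV[C]_#|{: J}| := \col_p u (enum_val p).1 (enum_val p).2 0.
have wE j b : w (enum_rank (j, b)) 0 = u j b 0 by rewrite mxE !enum_rankK.
have := xc w; rewrite /vn2 !block_sum.
have -> : \sum_i \sum_a nr ((bigm X *m w) (enum_rank (i, a)) 0) ^+ 2 =
    \sum_i \sum_a nr (mact X u i a 0) ^+ 2.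
  apply: eq_bigr => i _; apply: eq_bigr => a _; congr (nr _ ^+ 2).
  rewrite mxE block_sum summxE; apply: eq_bigr => j _; rewrite mxE.
  by apply: eq_bigr => b _; rewrite bigmE wE.
have -> // : \sum_i \sum_a nr (w (enum_rank (i, a)) 0) ^+ 2 =
    \sum_i \sum_a nr (u i a 0) ^+ 2.
by apply: eq_bigr => i _; apply: eq_bigr => a _; rewrite wE.
Qed.

Lemma n2_bigm X : n2 (bigm X) ^+ 2 = n%:R^-1 * \sum_i \sum_j n2 (X i j) ^+ 2.
Proof.
have cE : #|{: J}|%:R^-1 = n%:R^-1 * d%:R^-1 :> R.
  by rewrite card_prod !card_ord natrM invfM.
rewrite n2_sqr cE -mulrA; congr (_ * _).
rewrite exchange_big /= block_sum.
transitivity (d%:R^-1 * \sum_i \sum_a \sum_j \sum_b nr (X i j a b) ^+ 2).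
  congr (_ * _); apply: eq_bigr => i _; apply: eq_bigr => a _.
  by rewrite block_sum; apply: eq_bigr => j _; apply: eq_bigr => b _; rewrite bigmE.
rewrite mulr_sumr; apply: eq_bigr => i _; rewrite exchange_big mulr_sumr /=.
by apply: eq_bigr => j _; rewrite n2_sqr exchange_big.
Qed.

Lemma n2_le_bigm X i j : n2 (X i j) <= n%:R * n2 (bigm X).
Proof.
have n0 : 0 < n%:R :> R by rewrite ltr0n (leq_ltn_trans _ (ltn_ord i)).
rewrite -(ler_pXn2r (n := 2)) ?nnegrE ?mulr_ge0 ?n2_ge0// exprMn n2_bigm.
rewrite expr2 -mulrA mulVKf ?gt_eqF//.
rewrite (le_trans (_ : _ <= \sum_i \sum_j n2 (X i j) ^+ 2))//.
  have h1 := @ler_sum_term R _ (fun j => n2 (X i j) ^+ 2) j (fun j => sqr_ge0 _).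
  apply: (le_trans h1); apply: (@ler_sum_term R _ (fun i => \sum_j n2 (X i j) ^+ 2) i) => k.
  by apply: sumr_ge0 => l _; exact: sqr_ge0.
rewrite ler_peMl ?ler1n -?(ltr0n R)//.
by apply: sumr_ge0 => k _; apply: sumr_ge0 => l _; exact: sqr_ge0.
Qed.

Lemma n2_bigm_le X : n2 (bigm X) <= \sum_i \sum_j n2 (X i j).
Proof.
have s0 (f : 'I_n -> R) : (forall i, 0 <= f i) -> \sum_i f i ^+ 2 <= (\sum_i f i) ^+ 2.
  move=> f0; rewrite [leRHS]expr2 mulr_suml ler_sum// => i _.
  by rewrite expr2 ler_wpM2l// (bigD1 i)//= lerDl sumr_ge0.
have r0 i : 0 <= \sum_j n2 (X i j) by apply: sumr_ge0 => j _; exact: n2_ge0.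
rewrite -(ler_pXn2r (n := 2)) ?nnegrE ?n2_ge0 ?sumr_ge0// n2_bigm.
rewrite (le_trans _ (s0 _ r0))//.
rewrite (le_trans (_ : _ <= \sum_i \sum_j n2 (X i j) ^+ 2))//.
  rewrite ler_piMl//; first by apply: sumr_ge0 => k _; apply: sumr_ge0 => l _; exact: sqr_ge0.
  by case: (n) => [|m]; rewrite ?invr0// invf_le1// ler1n.
by apply: ler_sum => i _; apply: s0 => j; exact: n2_ge0.
Qed.

(** With [x = 2 y z], [z = (1 + y^* y)^-1], and y, r, q the flattened [Y], [R0], [Q], one has [x - r
    = (2 y - r - q y) z + (q - r y^* ) x / 2]. Only the contractions x and z multiply the errors, so
    the size of [Y] does not enter. *)
Lemma kaplansky_block Y : exists2 X, mcb X 1 & forall R0 Q i j,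
  n2 (X i j - R0 i j) <= n%:R *
    (\sum_i \sum_j n2 (2%:R *: Y i j - R0 i j - \sum_l Q i l *m Y l j) +
     \sum_i \sum_l n2 (Q i l - \sum_k R0 i k *m mh (Y l k))).
Proof.
have [x [z [xE zE xc zc]]] := kaplansky_square (bigm Y).
exists (smallm x); first by apply: mcb_bigm; rewrite smallmK.
move=> R0 Q i j.
rewrite (le_trans (n2_le_bigm (fun i j => smallm x i j - R0 i j) i j))//.
rewrite bigmB smallmK ler_wpM2l//.
pose v := 2%:R *: bigm Y - bigm R0 - bigm Q *m bigm Y.
pose u := bigm Q - bigm R0 *m mh (bigm Y).
have -> : x - bigm R0 = v *m z + (2%:R)^-1 *: (u *m x).
  rewrite {2}xE -[in RHS]scalemxAr scalerA mulVf ?pnatr_eq0// scale1r.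
  rewrite /v /u !mulmxBl -!mulmxA -scalemxAl -xE.
  rewrite addrA subrK -addrA; congr (_ + _); rewrite -opprD; congr (- _).
  by rewrite -{1}[bigm R0]mulmx1 -zE mulmxDr !mulmxA.
rewrite (le_trans (n2D _ _))// lerD//.
  rewrite (le_trans (n2_mulr _ ler01 zc))// mul1r.
  have := n2_bigm_le (fun i j => 2%:R *: Y i j - R0 i j - \sum_l Q i l *m Y l j).
  by rewrite (bigmB (fun i j => 2%:R *: Y i j - R0 i j)) bigmB bigmZ bigmM.
rewrite n2Z (le_trans (ler_piMl _ _)) ?n2_ge0//.
  by rewrite -(rmorph_nat (real_complex R)) -fmorphV nr_real ger0_norm ?invr_ge0// invf_le1// ler1n.
rewrite (le_trans (n2_mulr _ ler01 xc))// mul1r.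
have := n2_bigm_le (fun i l => Q i l - \sum_k R0 i k *m mh (Y l k)).
by rewrite bigmB (bigmM R0 (fun k l => mh (Y l k))) bigm_mh.
Qed.

End Blocks.
End Kaplansky.

(** * Matricial microstates and the algebra they define *)

(** All that the operator-algebraic half needs to know about the Gaussians. Traciality of the vacuum
    state is not a field: it is inherited from the matrices through [microstate]. *)
Record matricial (R : realType) (F : complexHilbert R) := Matricial {
  gen : choiceType;
  genop : gen -> bop F;
  genop_adj : forall i, adj (genop i) = genop i;
  vac : F;
  vac_cyclic : forall x (e : R), 0 < e -> exists P : seq (R[i] * seq gen),
    nr (x - \sum_(p <- P) p.1 *: foldr (fun i T => bop_comp (genop i) T) (bop_id F) p.2 vac) < e;
  microstate : forall (L : seq (seq gen)) (n : nat), exists (d : nat)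
    (B : gen -> 'M[R[i]]_d), (forall i, mh (B i) = B i) /\
    forall w, w \in L ->
      nr (tau (foldr (fun i x => B i *m x) 1%:M w) -
          inner F (foldr (fun i T => bop_comp (genop i) T) (bop_id F) w vac) vac)
      < n.+1%:R^-1 }.

Arguments genop {R F} m i.
Arguments microstate {R F} m L n.

Section Models.
Variables (R : realType) (F : complexHilbert R) (M : matricial F).
Local Notation C := R[i].
Local Notation ip := (inner F).
Local Notation I := (gen M).
Local Notation Om := (vac M).

(** An index lists the words whose moments must match and the precision; its model is the one that
    [microstate] provides for these data. *)
Definition idx : choiceType := (seq (seq I) * nat)%type.

Definition dm (k : idx) : nat := projT1 (cid (microstate M k.1 k.2)).

Definition Bm (k : idx) : I -> 'M[C]_(dm k) :=
  projT1 (cid (projT2 (cid (microstate M k.1 k.2)))).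

Lemma BmP (k : idx) : (forall i, mh (Bm k i) = Bm k i) /\
  forall w, w \in k.1 -> nr (tau (foldr (fun i x => Bm k i *m x) 1%:M w) -
          ip (foldr (fun i T => bop_comp (genop M i) T) (bop_id F) w Om) Om)
      < k.2.+1%:R^-1.
Proof. exact: (projT2 (cid (projT2 (cid (microstate M k.1 k.2))))). Qed.

Definition bw (w : seq I) : bop F := foldr (fun i T => bop_comp (genop M i) T) (bop_id F) w.
Definition mw k (w : seq I) : 'M[C]_(dm k) := foldr (fun i x => Bm k i *m x) 1%:M w.

Lemma bw_cat u v : bw (u ++ v) = bop_comp (bw u) (bw v).
Proof.
elim: u => [|i u IH]; first exact: bop_ext.
by rewrite /= IH compbA.
Qed.

Lemma mw_cat k u v : mw k (u ++ v) = mw k u *m mw k v.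
Proof. by elim: u => [|i u IH]; rewrite ?mul1mx//= IH mulmxA. Qed.

Lemma bw_rev w : bw (rev w) = adj (bw w).
Proof.
elim: w => [|i w IH]; first by rewrite adjb1.
rewrite rev_cons -cats1 bw_cat IH /= adjbM genop_adj; congr bop_comp.
exact: bop_ext.
Qed.

Lemma mw_rev k w : mw k (rev w) = mh (mw k w).
Proof.
elim: w => [|i w IH]; first by rewrite mh1.
by rewrite rev_cons -cats1 mw_cat IH /= mhM (BmP k).1 mulmx1.
Qed.

(** Formal noncommutative polynomials, with no quotient: one list is evaluated both in the operators
    of [F] and in every model. *)
Definition ncpoly := seq (C * seq I).
Implicit Types P Q : ncpoly.

Definition pop P : bop F := \sum_(p <- P) p.1 *: bw p.2.
Definition pm k P : 'M[C]_(dm k) := \sum_(p <- P) p.1 *: mw k p.2.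
Definition pv P : F := pop P Om.

Lemma cyclic x (e : R) : 0 < e -> exists P, nr (x - pv P) < e.
Proof. by move=> /(vac_cyclic M x)[P hP]; exists P; rewrite /pv /pop sumbE. Qed.

Definition pscale (a : C) P : ncpoly := [seq (a * p.1, p.2) | p <- P].
Definition pmul P Q : ncpoly := [seq (p.1 * q.1, p.2 ++ q.2) | p <- P, q <- Q].
Definition pstar P : ncpoly := [seq (Num.conj p.1, rev p.2) | p <- P].

Lemma pop_cat P Q : pop (P ++ Q) = pop P + pop Q.
Proof. by rewrite /pop big_cat. Qed.

Lemma pm_cat k P Q : pm k (P ++ Q) = pm k P + pm k Q.
Proof. by rewrite /pm big_cat. Qed.

Lemma pop_scale a P : pop (pscale a P) = a *: pop P.
Proof. by rewrite /pop big_map scaler_sumr; apply: eq_bigr => p _; rewrite scalerA. Qed.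

Lemma pm_scale k a P : pm k (pscale a P) = a *: pm k P.
Proof. by rewrite /pm big_map scaler_sumr; apply: eq_bigr => p _; rewrite scalerA. Qed.

Lemma pop_mul P Q : pop (pmul P Q) = bop_comp (pop P) (pop Q).
Proof.
rewrite /pop /pmul big_allpairs_dep compb_suml; apply: eq_bigr => p _.
rewrite compb_sumr; apply: eq_bigr => q _ /=.
by rewrite bw_cat compbZl compbZr scalerA.
Qed.

Lemma pm_mul k P Q : pm k (pmul P Q) = pm k P *m pm k Q.
Proof.
rewrite /pm /pmul big_allpairs_dep mulmx_suml; apply: eq_bigr => p _.
rewrite mulmx_sumr; apply: eq_bigr => q _ /=.
by rewrite mw_cat -scalemxAl -scalemxAr scalerA.
Qed.

Lemma pop_star P : pop (pstar P) = adj (pop P).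
Proof.
by rewrite /pop big_map adjb_sum; apply: eq_bigr => p _; rewrite adjbZ bw_rev.
Qed.

Lemma pm_star k P : pm k (pstar P) = mh (pm k P).
Proof.
rewrite /pm big_map; elim: P => [|p P IH]; first by rewrite !big_nil mh0.
by rewrite !big_cons IH mhD mhZ mw_rev.
Qed.

Lemma pstarK P : pstar (pstar P) = P.
Proof.
by rewrite /pstar -map_comp map_id_in// => -[a w] _ /=; rewrite conjCK revK.
Qed.

Definition base (k : idx) : set idx :=
  [set j : idx | {subset k.1 <= j.1} /\ (k.2 <= j.2)%N].

Lemma base_ultra : exists U : set_system idx, UltraFilter U /\ forall k, U (base k).
Proof.
apply: (ultra_of_base (D := base) ([::], 0%N)).
  move=> i j; exists (i.1 ++ j.1, maxn i.2 j.2) => k [/= h1 h2]; split.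
    by split=> [w wi|]; [apply: h1; rewrite mem_cat wi | exact: leq_trans (leq_maxl _ _) h2].
  split=> [w wi|]; [apply: h1; rewrite mem_cat wi orbT| exact: leq_trans (leq_maxr _ _) h2].
  by [].
by move=> i; exists i; split.
Qed.

Definition ufilter : set_system idx := projT1 (cid base_ultra).

Local Notation U := ufilter.

Lemma ufilterP : UltraFilter U. Proof. exact: (projT2 (cid base_ultra)).1. Qed.

Lemma ufilter_base k : U (base k). Proof. exact: (projT2 (cid base_ultra)).2. Qed.

#[local] Existing Instance ufilterP.

Lemma ufilter_all (A : set idx) : (forall k, A k) -> U A.
Proof. by move=> h; apply: filterS filterT => k _; exact: h. Qed.

Lemma ufilter_idx n : U [set k | (n <= k.2)%N].
Proof. by apply: filterS (ufilter_base ([::], n)) => k []. Qed.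

Lemma tau_word_cvg w : ucvg U (fun k => tau (mw k w)) (ip (bw w Om) Om).
Proof.
move=> e e0; have [n hn] := inv_nat_lt e0.
apply: filterS (ufilter_base ([:: w], n)) => k [/= h1 h2].
have := (BmP k).2 w (h1 _ (mem_head _ _)) => /lt_trans; apply.
by rewrite (le_lt_trans _ hn)// inv_nat_mono.
Qed.

Lemma tau_cvg P : ucvg U (fun k => tau (pm k P)) (ip (pv P) Om).
Proof.
rewrite /pv /pop sumbE ip_suml.
apply: (ucvg_near ufilterP (f := fun k => \sum_(p <- P) p.1 * tau (mw k p.2))).
  by apply: ufilter_all => k /=; rewrite /pm tau_sum; apply: eq_bigr => p _; rewrite tauZ.
apply: (ucvg_sum ufilterP) => p; rewrite scalebE ipZl.
exact: (ucvgM ufilterP _ (tau_word_cvg _)).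
Qed.

(** Hence sending [P Om] to the sequence of the matrices [pm k P] is isometric from a dense subspace
    of [F] into the ultraproduct of the Hilbert-Schmidt spaces. *)
Lemma mip_cvg P Q : ucvg U (fun k => mip (pm k P) (pm k Q)) (ip (pv P) (pv Q)).
Proof.
have := tau_cvg (pmul (pstar Q) P); rewrite /pv pop_mul pop_star /= -adjP'.
by apply: (ucvg_near ufilterP); apply: ufilter_all => k /=; rewrite pm_mul pm_star.
Qed.

Lemma sqr_dist_le (a b : R) : 0 <= a -> 0 <= b -> `|a - b| ^+ 2 <= `|a ^+ 2 - b ^+ 2|.
Proof.
move=> a0 b0; rewrite subr_sqr normrM expr2 ler_wpM2l// (ger0_norm (addr_ge0 a0 b0)).
by rewrite ler_norml; lra.
Qed.

Lemma n2_cvg P (e : R) : 0 < e -> U [set k | `|n2 (pm k P) - nr (pv P)| < e].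
Proof.
move=> e0; apply: filterS (mip_cvg P P (exprn_gt0 2 e0)) => k /= h.
rewrite -(ltr_pXn2r (n := 2)) ?nnegrE ?(ltW e0)//.
apply: (le_lt_trans (sqr_dist_le (n2_ge0 _) (nr_ge0 _))).
apply: le_lt_trans h; rewrite mipxx ipxx -n2_sqr -rmorphB /= nr_real//.
Qed.

Lemma n2_lt P (e : R) : nr (pv P) < e -> U [set k | n2 (pm k P) < e].
Proof.
move=> h; have d0 : 0 < e - nr (pv P) by rewrite subr_gt0.
by apply: filterS (n2_cvg P d0) => k /=; rewrite ltr_norml; lra.
Qed.

Lemma pvB P Q : pv (P ++ pscale (-1) Q) = pv P - pv Q.
Proof. by rewrite /pv pop_cat pop_scale addbE scalebE scaleN1r. Qed.

Lemma pmB k P Q : pm k (P ++ pscale (-1) Q) = pm k P - pm k Q.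
Proof. by rewrite pm_cat pm_scale scaleN1r. Qed.

(** The identity is [n2_mh] in the models, carried over by the ultralimit; it is the first form of
    traciality. *)
Lemma nr_pstar P : nr (pv (pstar P)) = nr (pv P).
Proof.
apply/eqP; rewrite -subr_eq0 -normr_eq0 eq_le normr_ge0 andbT; apply: le_eps => e e0.
have e2 : 0 < e / 2 by rewrite divr_gt0.
have [k /= [h1 h2]] := ultra_ex ufilterP (filterI (n2_cvg P e2) (n2_cvg (pstar P) e2)).
move: h2; rewrite pm_star n2_mh => h2.
move: h1 h2; rewrite !ltr_norml ler_norml; lra.
Qed.

(** Right multiplication by [Q] is bounded because the star is isometric: [|P Q Om| = |Q^* P^* Om|],
    and [Q^*] acts on the left. *)
Lemma rop_exists Q : exists T : bop F, forall P, T (pv P) = pv (pmul P Q).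
Proof.
have [c c0 hc] := bop_bounded (pop (pstar Q)).
have bd P : nr (pv (pmul P Q)) <= c * nr (pv P).
  rewrite -(nr_pstar (pmul P Q)) -(nr_pstar P) (le_trans _ (hc _))//.
  by rewrite /pv !pop_star pop_mul adjbM.
have [||||T [lT bT TE]] := @dense_extension _ F F
    (fun x s => exists2 P, x = pv P & s = pv (pmul P Q)) c.
- exact: c0.
- move=> a x y s t [P -> ->] [P' -> ->]; exists (pscale a P ++ P').
    by rewrite /pv pop_cat pop_scale.
  by rewrite /pv !pop_mul pop_cat pop_scale.
- by move=> x s [P -> ->].
- move=> x e /(cyclic x)[P hP]; exists (pv P), (pv (pmul P Q)); split=> //.
  by exists P.
have [T' T'E] := mkbop lT bT.
by exists T' => P; rewrite T'E; apply: TE; exists P.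
Qed.

Definition rop Q : bop F := projT1 (cid (rop_exists Q)).

Lemma ropE Q P : rop Q (pv P) = pv (pmul P Q).
Proof. exact: (projT2 (cid (rop_exists Q))). Qed.

Definition pone : ncpoly := [:: (1, [::])].

Lemma pop_one : pop pone = bop_id F.
Proof. by rewrite /pop big_seq1 scale1r. Qed.

Lemma pm_one k : pm k pone = 1%:M.
Proof. by rewrite /pm big_seq1 scale1r. Qed.

Lemma pv_one : pv pone = Om.
Proof. by rewrite /pv pop_one. Qed.

Lemma rop_vac Q : rop Q Om = pv Q.
Proof. by rewrite -pv_one ropE /pv pop_mul pop_one. Qed.

Lemma bop_ext_pv (S T : bop F) : (forall P, S (pv P) = T (pv P)) -> S = T.
Proof.
move=> h; apply: bop_ext => x; apply: subr0_eq; apply: small_zero => e e0.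
have [c c0 hc] := bop_bounded (S - T).
have c1 : 0 < c + 1 by rewrite ltr_wpDl.
have [P hP] := cyclic x (divr_gt0 e0 c1).
rewrite -subbE; have -> : (S - T) x = (S - T) (x - pv P).
  by rewrite bopB [(S - T) (pv P)]subbE h subrr subr0.
rewrite (le_trans (hc _))// (le_trans (_ : _ <= (c + 1) * nr (x - pv P)))//.
  by rewrite ler_wpM2r ?nr_ge0// lerDl.
by rewrite mulrC -ler_pdivlMr// ltW.
Qed.

Lemma ip_ext_pv (x y : F) : (forall P, ip x (pv P) = ip y (pv P)) -> x = y.
Proof.
move=> h; apply: ip_ext => z; apply: subr0_eq; apply: small_zero => e e0.
have c1 : 0 < nr (x - y) + 1 by rewrite ltr_wpDl ?nr_ge0.
have [P hP] := cyclic z (divr_gt0 e0 c1).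
rewrite -ipBl; have -> : ip (x - y) z = ip (x - y) (z - pv P).
  by rewrite ipBr [ip _ (pv P)]ipBl h subrr subr0.
rewrite (le_trans (cauchy_schwarz _ _))//.
rewrite (le_trans (_ : _ <= (nr (x - y) + 1) * nr (z - pv P)))//.
  by rewrite ler_wpM2r ?nr_ge0// lerDl.
by rewrite mulrC -ler_pdivlMr// ltW.
Qed.

Lemma rop_adj Q : adj (rop Q) = rop (pstar Q).
Proof.
apply/esym/adjoint_uniq => x y.
suff -> : rop Q = adj (rop (pstar Q)) by rewrite -adjP'.
apply: bop_ext_pv => P; apply: ip_ext_pv => P'; rewrite -adjP' !ropE.
apply: (ucvg_uniq ufilterP (mip_cvg _ _)).
apply: (ucvg_near ufilterP _ (mip_cvg _ _)); apply: ufilter_all => k /=.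
rewrite /mip !pm_mul pm_star mhM mhK -mulmxA tauC.
by rewrite -!mulmxA.
Qed.

(** N is introduced as the commutant of the right multiplications. An element is then determined by
    its value at the vacuum, see [Nset_vac]; equality with the generated algebra is
    [generated_Nset]. *)
Definition Nset (T : bop F) : Prop := forall Q x, T (rop Q x) = rop Q (T x).

Implicit Types S T : bop F.

Lemma Nset_comm T : (forall Q P, T (rop Q (pv P)) = rop Q (T (pv P))) -> Nset T.
Proof.
move=> h Q x; have : bop_comp T (rop Q) = bop_comp (rop Q) T.
  by apply: bop_ext_pv => P; exact: h.
by move/(congr1 (fun S : bop F => S x)).
Qed.

Lemma Nset_pop P : Nset (pop P).
Proof.
apply: Nset_comm => Q P'; rewrite ropE.
have pvM A B : pop A (pv B) = pv (pmul A B) by rewrite /pv pop_mul.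
by rewrite !pvM ropE /pv !pop_mul.
Qed.

Lemma NsetJ T : Nset T -> Nset (adj T).
Proof.
move=> NT Q x; apply: ip_ext => y.
by rewrite -adjP' adjP rop_adj -NT adjP' -rop_adj -adjP.
Qed.

Lemma Nset_vac T P : Nset T -> T (pv P) = rop P (T Om).
Proof. by move=> NT; rewrite -rop_vac NT. Qed.

Lemma Nset0 : Nset 0.
Proof. by move=> Q x; rewrite !zerobE bop0. Qed.

Lemma NsetL (a : C) S T : Nset S -> Nset T -> Nset (a *: S + T).
Proof. by move=> NS NT Q x; rewrite !addbE !scalebE NS NT bopP2. Qed.

Lemma NsetM S T : Nset S -> Nset T -> Nset (bop_comp S T).
Proof. by move=> NS NT Q x; rewrite /= NT NS. Qed.

Lemma Nset1 : Nset (bop_id F).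
Proof. by []. Qed.

Lemma Nset_closed T : (forall e : R, 0 < e -> exists2 S, Nset S &
    forall x : F, nr (T x - S x) <= e * nr x) -> Nset T.
Proof.
move=> h Q x; apply: subr0_eq; apply: small_zero => e e0.
have [c c0 hc] := bop_bounded (rop Q).
pose k := (c + 1) * (nr x + 1).
have k0 : 0 < k by rewrite mulr_gt0 ?ltr_wpDl ?nr_ge0.
have [S NS hS] := h _ (divr_gt0 e0 (mulr_gt0 (ltr0Sn R 1) k0)).
have h1 := hS (rop Q x); have h2 := hc (T x - S x).
have h3 : nr (T x - S x) <= e / (2 * k) * nr x by [].
have h4 := hc x.
have q0 : 0 <= e / (2 * k) by rewrite ltW// divr_gt0// mulr_gt0.
have h5 := ler_wpM2l q0 h4; have h6 := ler_wpM2l c0 h3.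
have h7 : c * nr x <= k by rewrite /k ler_pM ?nr_ge0 ?lerDl.
have h8 : 2 * (e / (2 * k) * k) = e by field; rewrite gt_eqF.
have h9 := ler_wpM2l q0 h7.
have h10 := hc (S x - T x); rewrite (nrBC (S x)) in h10.
rewrite (le_trans (ler_nrT (S (rop Q x)) _ _))// NS -bopB.
rewrite NS in h1; move: h1 h5 h6 h8 h9 h10.
by move: (e / (2 * k)) => q; lra.
Qed.

Definition Nalg : opAlgebra F :=
  @OpAlgebra _ _ Nset Nset0 NsetL NsetM NsetJ Nset_closed.

(* The vacuum state is a trace on these operators. *)
Lemma nr_adj_vac T : Nset T -> nr (adj T Om) = nr (T Om).
Proof.
have le S : Nset S -> nr (S Om) <= nr (adj S Om).
  move=> NS; have [->|S0] := eqVneq (nr (S Om)) 0; first exact: nr_ge0.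
  have nS : 0 < nr (S Om) by rewrite lt_def nr_ge0 S0.
  rewrite -(ler_pM2l nS) -expr2; apply: le_eps => e e0.
  pose k := nr (S Om) + nr (adj S Om) + 1.
  have k0 : 0 < k by rewrite ltr_wpDl ?addr_ge0 ?nr_ge0.
  have [P hP] := cyclic (S Om) (divr_gt0 e0 k0).
  (* Traciality with one polynomial factor, obtained by commuting [adj S] with [rop P]. Density of
     the [pv P] near [S Om] then gives [|S Om|^2 <= |S Om| |S^* Om|]. *)
  have e1 : ip (S Om) (pv P) = ip (pv (pstar P)) (adj S Om).
    rewrite adjP (Nset_vac _ (NsetJ NS)) -rop_vac.
    by rewrite [RHS]adjP rop_adj pstarK.
  have h1 : nr (ip (S Om) (pv P)) <= nr (pv P) * nr (adj S Om).
    by rewrite e1 (le_trans (cauchy_schwarz _ _))// nr_pstar.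
  have h2 : nr (S Om) ^+ 2 = complex.Re (ip (S Om) (S Om - pv P)) + complex.Re (ip (S Om) (pv P)).
    by rewrite nr_sqr_ip -cReD -ipDr subrK.
  have h3 := Re_ip_le (S Om) (S Om - pv P).
  have h4 := ler_Re_nr (ip (S Om) (pv P)).
  have h5 : nr (pv P) <= nr (S Om) + nr (S Om - pv P).
    by rewrite -[X in nr X <= _](subKr (S Om)) ler_nrB.
  have h6 := ler_wpM2r (nr_ge0 (adj S Om)) h5.
  have h7 : (nr (S Om) + nr (adj S Om)) * nr (S Om - pv P) <= e.
    rewrite (le_trans (_ : _ <= k * nr (S Om - pv P)))//.
      by rewrite ler_wpM2r ?nr_ge0// lerDl.
    by rewrite mulrC -ler_pdivlMr// ltW.
  lra.
move=> NT; apply/eqP; rewrite eq_le le// andbT.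
by have := le _ (NsetJ NT); rewrite adjbK.
Qed.

(** Traciality allows the factor next to the vacuum to be estimated by its operator norm: pass from
    [T S Om] to [S^* T^* Om]. *)
Lemma nr_mul_vac S T c : Nset S -> Nset T -> 0 <= c ->
  (forall x, nr (adj S x) <= c * nr x) -> nr (T (S Om)) <= c * nr (T Om).
Proof.
move=> NS NT c0 h; rewrite -[T (S Om)]/(bop_comp T S Om) -nr_adj_vac; last exact: NsetM.
by rewrite adjbM -(nr_adj_vac NT) h.
Qed.

(* x in prod_k M_(dm k) converges to the vector T Om of the L2-space. *)
Definition s1 (x : forall k, 'M[C]_(dm k)) (T : bop F) := forall e : R, 0 < e ->
  exists P, nr (T Om - pv P) < e /\ U [set k | n2 (x k - pm k P) < e].

(** The common polynomial is hidden so that the closure lemmas can recognize a composite expression,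
    in matrices and operators at once, from its shape. *)
Definition polypair (x : forall k, 'M[C]_(dm k)) (T : bop F) :=
  exists P, (forall k, x k = pm k P) /\ T = pop P.

Lemma polypairD x y S T : polypair x S -> polypair y T ->
  polypair (fun k => x k + y k) (S + T).
Proof.
move=> [P [xP SP]] [Q [yQ TQ]]; exists (P ++ Q); split=> [k|].
  by rewrite pm_cat xP yQ.
by rewrite pop_cat SP TQ.
Qed.

Lemma polypairZ a x S : polypair x S -> polypair (fun k => a *: x k) (a *: S).
Proof.
move=> [P [xP SP]]; exists (pscale a P); split=> [k|].
  by rewrite pm_scale xP.
by rewrite pop_scale SP.
Qed.

Lemma polypairB x y S T : polypair x S -> polypair y T ->
  polypair (fun k => x k - y k) (S - T).
Proof.
move=> hx hy; have [P [xP SP]] := polypairD hx (polypairZ (-1) hy).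
by exists P; split=> [k|]; rewrite -?xP -?SP scaleN1r.
Qed.

Lemma polypairM x y S T : polypair x S -> polypair y T ->
  polypair (fun k => x k *m y k) (bop_comp S T).
Proof.
move=> [P [xP SP]] [Q [yQ TQ]]; exists (pmul P Q); split=> [k|].
  by rewrite pm_mul xP yQ.
by rewrite pop_mul SP TQ.
Qed.

Lemma polypairJ x S : polypair x S -> polypair (fun k => mh (x k)) (adj S).
Proof.
move=> [P [xP SP]]; exists (pstar P); split=> [k|].
  by rewrite pm_star xP.
by rewrite pop_star SP.
Qed.

Lemma polypair_sum (J : Type) (r : seq J) (x : J -> forall k, 'M[C]_(dm k)) (S : J -> bop F) :
  (forall j, polypair (x j) (S j)) ->
  polypair (fun k => \sum_(j <- r) x j k) (\sum_(j <- r) S j).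
Proof.
move=> h; elim: r => [|j r IH].
  by exists [::]; split=> [k|]; rewrite /pm /pop !big_nil.
have [P [xP SP]] := polypairD (h j) IH.
by exists P; split=> [k|]; rewrite !big_cons.
Qed.

Lemma polypair_pop P : polypair (pm^~ P) (pop P).
Proof. by exists P. Qed.

Lemma polypair_lt x S (e : R) : polypair x S -> nr (S Om) < e -> U [set k | n2 (x k) < e].
Proof. by move=> [P [xP ->]] /n2_lt; apply: filterS => k /=; rewrite xP. Qed.

End Models.

Arguments ufilter {R F} M.

#[global] Opaque dm Bm ufilter rop nr n2 adj.

Lemma dep_choice (X : Type) (Y : X -> Type) (P : forall x, Y x -> Prop) :
  (forall x, exists y, P x y) -> exists f : forall x, Y x, forall x, P x (f x).
Proof.
move=> h; exists (fun x => projT1 (cid (h x))) => x.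
exact: (projT2 (cid (h x))).
Qed.

Lemma filter_bigI_all (T : Type) (F : set_system T) (FF : Filter F) (J : finType)
    (A : J -> set T) : (forall j, F (A j)) -> F [set t | forall j, A j t].
Proof.
move=> h; have : F [set t | forall j, j \in enum J -> A j t].
  elim: (enum J) => [|j s IH].
    by apply: filterS filterT => t _ j; rewrite in_nil.
  apply: filterS2 (h j) IH => t /= hj hs l; rewrite inE => /orP[/eqP ->//|].
  exact: hs.
by apply: filterS => t ht j; apply: ht; rewrite mem_enum.
Qed.

(** * Lifting contractions to sequences of matrices *)

Section KaplanskyFixpoint.
Variables (R : realType) (A : cstarAlgebra R).

(** The equation says [T = 2 S (1 + S^* S)^-1]: strict contractions are values of Kaplansky's
    function. On the unit ball the map sending S to half the right side is a contraction with factor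
    [nr T]. *)
Lemma kaplansky_fixpoint (T : A) : nr T < 1 ->
  exists S, S + S = T + cmul T (cmul (cstar S) S).
Proof.
move=> T1; pose f (S : A) := (2^-1)%:C *: (T + cmul T (cmul (cstar S) S)).
have [|||||||S [fS _ _]] := @ball_fixpoint R A 1 (nr T) f (fun=> True) => //.
- by rewrite nr_ge0 T1.
- move=> x x1; rewrite nrZ nr_real ger0_norm ?invr_ge0// mulrC.
  have h1 := ler_nrD T (cmul T (cmul (cstar x) x)).
  have h2 := nr_cmul T (cmul (cstar x) x); rewrite nr_cstar_mul in h2.
  have h3 : nr x ^+ 2 <= 1 by rewrite expr_le1// nr_ge0.
  have h4 := ler_wpM2l (nr_ge0 T) h3.
  lra.
- move=> x y x1 y1; rewrite -scalerBr nrZ nr_real ger0_norm ?invr_ge0//.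
  have -> : T + cmul T (cmul (cstar x) x) - (T + cmul T (cmul (cstar y) y)) =
      cmul T (cmul (cstar x) (x - y) + cmul (cstar (x - y)) y).
    rewrite opprD addrACA subrr add0r -cmulBr; congr cmul.
    by rewrite cmulBr cstarB cmulBl subrKA.
  have h1 := nr_cmul T (cmul (cstar x) (x - y) + cmul (cstar (x - y)) y).
  have h2 := ler_nrD (cmul (cstar x) (x - y)) (cmul (cstar (x - y)) y).
  have h3 := nr_cmul (cstar x) (x - y); have h4 := nr_cmul (cstar (x - y)) y.
  rewrite !nr_cstar in h3 h4.
  have h5 := ler_wpM2r (nr_ge0 (x - y)) x1.
  have h6 := ler_wpM2l (nr_ge0 (x - y)) y1.
  have h7 : nr (cmul (cstar x) (x - y) + cmul (cstar (x - y)) y) <= 2 * nr (x - y) by lra.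
  have h8 := ler_wpM2l (nr_ge0 T) h7.
  lra.
exists S; rewrite -{1 2}fS /f -scalerDl -rmorphD /=.
by rewrite -{1 2}div1r -splitr scale1r.
Qed.

End KaplanskyFixpoint.

Section Lifts.
Variables (R : realType) (F : complexHilbert R) (M : matricial F).
Local Notation C := R[i].
Local Notation ip := (inner F).
Local Notation Om := (vac M).
Local Notation U := (ufilter M).
#[local] Existing Instance ufilterP.
Implicit Types S T : bop F.

Lemma bop_unif (J : finType) (T : J -> bop F) :
  exists2 c : R, 0 <= c & forall j x, nr (T j x) <= c * nr x.
Proof.
have [c hc] : exists c : J -> R, forall j, 0 <= c j /\ forall x : F, nr (T j x) <= c j * nr x.
  apply: (@ex_choice _ _ (fun j (d : R) => 0 <= d /\ forall x : F, nr (T j x) <= d * nr x)) => j.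
  by have [d d0 h] := bop_bounded (T j); exists d.
have c0 j : 0 <= c j by case: (hc j).
exists (\sum_j c j) => [|j x]; first by rewrite sumr_ge0.
by rewrite (le_trans ((hc j).2 x))// ler_wpM2r ?nr_ge0// ler_sum_term.
Qed.

Variable n : nat.
Implicit Types X : forall k : idx M, 'I_n -> 'I_n -> 'M[C]_(dm k).

Lemma sum_const_le (f : 'I_n -> R) c : (forall i, f i <= c) -> \sum_i f i <= n%:R * c.
Proof.
move=> h; rewrite (le_trans (ler_sum _ (fun i _ => h i)))//.
by rewrite sumr_const card_ord mulr_natl.
Qed.

(* Given 2 S = T + T S^* S, approximate S Om by Y Om, and then T Om by R0 Om
   and T S^* Om by Q Om much better, with polynomials. *)
Lemma kaplansky_vectors (T S : 'I_n -> 'I_n -> bop F) (e : R) : 0 < e ->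
  (forall i j, Nset M (T i j)) -> (forall i j, Nset M (S i j)) ->
  (forall i j, S i j + S i j = T i j +
     \sum_k bop_comp (T i k) (\sum_l bop_comp (adj (S l k)) (S l j))) ->
  exists (Y R0 Q : 'I_n -> 'I_n -> ncpoly M), [/\
    (forall i j, nr (T i j Om - pv (R0 i j)) < e),
    (forall i l, nr ((pop (Q i l) - \sum_k bop_comp (pop (R0 i k)) (adj (pop (Y l k)))) Om) < e) &
    forall i j, nr ((2%:R *: pop (Y i j) - pop (R0 i j) -
        \sum_l bop_comp (pop (Q i l)) (pop (Y l j))) Om) < e].
Proof.
move=> e0 NT NS TS.
pose W i l := \sum_k bop_comp (T i k) (adj (S l k)).
have NW i l : Nset M (W i l).
  apply: (@opa_sum _ _ (Nalg M)) => k.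
  exact: NsetM (NT i k) (NsetJ (NS l k)).
have [cT cT0 hT] := bop_unif (fun p : 'I_n * 'I_n => T p.1 p.2).
have [cW cW0 hW] := bop_unif (fun p : 'I_n * 'I_n => W p.1 p.2).
have nn : 0 <= n%:R :> R by [].
(* [kT] collects the coefficients of the tolerance [d1], to which [Y] approximates [S], in the two
   error estimates. *)
pose kT := n%:R * (cT + cW) + 3.
have kT0 : 0 < kT by rewrite /kT ltr_wpDl ?mulr_ge0 ?addr_ge0.
pose d1 := e / (2 * kT); have d10 : 0 < d1 by rewrite divr_gt0// mulr_gt0.
have [Y0 hY0] : exists Y : 'I_n * 'I_n -> ncpoly M, forall p,
    nr (S p.1 p.2 Om - pv (Y p)) < d1.
  apply: (@ex_choice _ _ (fun (p : 'I_n * 'I_n) (Y : ncpoly M) =>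
    nr (S p.1 p.2 Om - pv Y) < d1)) => p.
  exact: cyclic.
pose Y i j := Y0 (i, j).
have hY i j : nr (S i j Om - pv (Y i j)) < d1 by exact: (hY0 (i, j)).
have [c1 c10 h1] := bop_unif (fun p : 'I_n * 'I_n => pop (Y p.1 p.2)).
have [c2 c20 h2] := bop_unif (fun p : 'I_n * 'I_n => adj (pop (Y p.1 p.2))).
(* The bounds [c1] and [c2] on the polynomials [Y] exist only once these are fixed; the tolerance
   [d2] for [R0] and [Q] is chosen after them. *)
pose kY := n%:R * (c1 + c2) + 1.
have kY0 : 0 < kY by rewrite /kY ltr_wpDl ?mulr_ge0 ?addr_ge0.
pose d2 := e / (2 * kY); have d20 : 0 < d2 by rewrite divr_gt0// mulr_gt0.
have d2e : d2 < e.
  rewrite /d2 ltr_pdivrMr ?mulr_gt0// ltr_pMr// /kY.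
  have h : 0 <= n%:R * (c1 + c2) by rewrite mulr_ge0 ?addr_ge0.
  by lra.
have [R1 hR1] : exists R1 : 'I_n * 'I_n -> ncpoly M, forall p,
    nr (T p.1 p.2 Om - pv (R1 p)) < d2.
  apply: (@ex_choice _ _ (fun (p : 'I_n * 'I_n) (Y : ncpoly M) =>
    nr (T p.1 p.2 Om - pv Y) < d2)) => p.
  exact: cyclic.
have [Q1 hQ1] : exists Q1 : 'I_n * 'I_n -> ncpoly M, forall p,
    nr (W p.1 p.2 Om - pv (Q1 p)) < d2.
  apply: (@ex_choice _ _ (fun (p : 'I_n * 'I_n) (Y : ncpoly M) =>
    nr (W p.1 p.2 Om - pv Y) < d2)) => p.
  exact: cyclic.
pose R0 i j := R1 (i, j); pose Q i j := Q1 (i, j).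
have hR i j : nr (T i j Om - pv (R0 i j)) < d2 by exact: (hR1 (i, j)).
have hQ i j : nr (W i j Om - pv (Q i j)) < d2 by exact: (hQ1 (i, j)).
have Npop P : Nset M (pop P) := @Nset_pop _ _ M P.
have NB S' T' : Nset M S' -> Nset M T' -> Nset M (S' - T').
  exact: (@opaB _ _ (Nalg M)).
have e1 : n%:R * ((c1 + c2) * d2) + n%:R * ((cT + cW) * d1) + 3 * d1 + d2 <= e.
  have -> : n%:R * ((c1 + c2) * d2) + n%:R * ((cT + cW) * d1) + 3 * d1 + d2 =
    kY * d2 + kT * d1 by rewrite /kY /kT; ring.
  have -> : kY * d2 = e / 2 by rewrite /d2; field; rewrite gt_eqF.
  have -> : kT * d1 = e / 2 by rewrite /d1; field; rewrite gt_eqF.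
  by rewrite -splitr.
have n0 : 0 <= n%:R * ((c1 + c2) * d2).
  by apply: mulr_ge0 => //; apply: mulr_ge0; [exact: addr_ge0 | exact: ltW].
have n1 : 0 <= n%:R * ((cT + cW) * d1).
  by apply: mulr_ge0 => //; apply: mulr_ge0; [exact: addr_ge0 | exact: ltW].
exists Y, R0, Q; split.
- by move=> i j; exact: lt_trans (hR i j) d2e.
- move=> i l.
  (* In matrix notation with [W = T S^*], this is [Q - R0 Y^* = - (W - Q) + (T - R0) Y^* + T (S -
     Y)^*]. *)
  have -> : (pop (Q i l) - \sum_k bop_comp (pop (R0 i k)) (adj (pop (Y l k)))) Om =
      - (W i l Om - pv (Q i l)) +
      \sum_k ((T i k - pop (R0 i k)) (adj (pop (Y l k)) Om) +
              T i k (adj (S l k - pop (Y l k)) Om)).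
    rewrite subbE sumbE opprB -/(pv _) -addrA; congr (_ + _).
    rewrite /W sumbE -sumrN -sumrN -big_split; apply: eq_bigr => k _ /=.
    transitivity (- T i k (adj (S l k) Om) + ((T i k (adj (pop (Y l k)) Om) -
      pop (R0 i k) (adj (pop (Y l k)) Om)) +
      (T i k (adj (S l k) Om) - T i k (adj (pop (Y l k)) Om)))); first by zmodule.
    congr (_ + (_ + _)); rewrite -bopB; congr (T i k _).
    by rewrite -[- pop (Y l k)]scaleN1r adjbD adjbZ rmorphN rmorph1 scaleN1r.
  apply: (@le_lt_trans _ _ (d2 + n%:R * (c1 * d2 + cT * d1))); last first.
    have : n%:R * (c1 * d2 + cT * d1) <= n%:R * ((c1 + c2) * d2) + n%:R * ((cT + cW) * d1).
      rewrite -mulrDr ler_wpM2l// lerD// ler_wpM2r ?(ltW d10) ?(ltW d20)//.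
        by rewrite lerDl.
      by rewrite lerDl.
    by move: e1 d10; lra.
  rewrite (le_trans (ler_nrD _ _))// nrN lerD//; first by rewrite ltW.
  rewrite (le_trans (ler_nr_sum _ _ _))// sum_const_le// => k.
  rewrite (le_trans (ler_nrD _ _))// lerD//.
    rewrite (le_trans (nr_mul_vac (c := c1) (NsetJ (Npop _)) (NB _ _ (NT _ _) (Npop _)) c10 _))//.
      by move=> x; rewrite adjbK; exact: (h1 (l, k)).
    by rewrite ler_wpM2l// subbE ltW.
  rewrite (le_trans (hT (i, k) _))//= ler_wpM2l//.
  by rewrite nr_adj_vac ?subbE 1?ltW//; exact: NB.
- move=> i j.
  (* Since [2 S = T + W S], this is [2 Y - R0 - Q Y = (T - R0) - 2 (S - Y) + (W - Q) Y + W (S -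
     Y)]. *)
  have -> : (2%:R *: pop (Y i j) - pop (R0 i j) -
        \sum_l bop_comp (pop (Q i l)) (pop (Y l j))) Om =
      (T i j Om - pv (R0 i j)) - 2%:R *: (S i j Om - pv (Y i j)) +
      \sum_l ((W i l - pop (Q i l)) (pop (Y l j) Om) +
              W i l (S l j Om - pv (Y l j))).
    have h : 2%:R *: S i j Om = T i j Om + \sum_l W i l (S l j Om).
      rewrite scaler_nat mulr2n -addbE TS addbE sumbE; congr (_ + _).
      transitivity (\sum_k \sum_l T i k (adj (S l k) (S l j Om))).
        by apply: eq_bigr => k _; rewrite /= sumbE bop_sum.
      by rewrite exchange_big; apply: eq_bigr => l _ /=; rewrite /W sumbE.
    rewrite !subbE scalebE scalerBr h sumbE -!/(pv _).
    have -> : \sum_l ((W i l - pop (Q i l)) (pop (Y l j) Om) +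
        W i l (S l j Om - pv (Y l j))) =
        \sum_l W i l (S l j Om) - \sum_l bop_comp (pop (Q i l)) (pop (Y l j)) Om.
      rewrite -sumrB; apply: eq_bigr => l _; rewrite subbE bopB -/(pv _); zmodule.
    zmodule.
  apply: (@le_lt_trans _ _ (d2 + 2 * d1 + n%:R * (c2 * d2 + cW * d1))); last first.
    have : n%:R * (c2 * d2 + cW * d1) <= n%:R * ((c1 + c2) * d2) + n%:R * ((cT + cW) * d1).
      rewrite -mulrDr ler_wpM2l// lerD// ler_wpM2r ?(ltW d10) ?(ltW d20)//.
        by rewrite lerDr.
      by rewrite lerDr.
    by move: e1 d10; lra.
  rewrite (le_trans (ler_nrD _ _))// lerD//.
    rewrite (le_trans (ler_nrB _ _))// lerD//; first by rewrite ltW.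
    by rewrite nrZ -(rmorph_nat (real_complex R)) nr_real ger0_norm// ler_wpM2l// ltW.
  rewrite (le_trans (ler_nr_sum _ _ _))// sum_const_le// => l.
  rewrite (le_trans (ler_nrD _ _))// lerD//.
    rewrite (le_trans (nr_mul_vac (c := c2) (Npop _) (NB _ _ (NW _ _) (Npop _)) c20 _))//.
      by move=> x; exact: (h2 (l, j)).
    by rewrite ler_wpM2l// subbE ltW.
  by rewrite (le_trans (hW (i, l) _))//= ler_wpM2l// ltW.
Qed.

Definition contractions X := forall k, mcb (X k) 1.

Lemma lift_step (T : 'I_n -> 'I_n -> bop F) (e : R) : 0 < e ->
  (forall i j, Nset M (T i j)) -> mxnorm T < 1 ->
  exists X (P : 'I_n -> 'I_n -> ncpoly M), [/\ contractions X,
    (forall i j, nr (T i j Om - pv (P i j)) < e) &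
    U [set k : idx M | forall i j, n2 (X k i j - pm k (P i j)) < e]].
Proof.
move=> e0 NT T1.
pose T' : mxcstar (Nalg M) n := @mk_mxop _ _ (Nalg M) n T NT.
have [S' hS] := @kaplansky_fixpoint R (mxcstar (Nalg M) n) T' T1.
pose S i j := (S' : mxop (Nalg M) n) i j.
have NS i j : Nset M (S i j) by exact: (mxop_in S').
have TS i j : S i j + S i j = T i j +
     \sum_k bop_comp (T i k) (\sum_l bop_comp (adj (S l k)) (S l j)).
  exact: (congr1 (fun Z : mxop (Nalg M) n => Z i j) hS).
have nn : 0 <= n%:R :> R by [].
(* [K - 1] is the factor that [kaplansky_block] produces: [n] times two double sums of [n ^ 2] terms
   each. *)
pose K := n%:R * (n%:R * (n%:R + n%:R)) + 1 : R.
have K0 : 0 < K by rewrite /K ltr_wpDl// !mulr_ge0// addr_ge0.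
have [Y [P [Q [hP hU hV]]]] := kaplansky_vectors (divr_gt0 e0 K0) NT NS TS.
have [X hX] : exists X, forall k, mcb (X k) 1 /\ forall i j,
    n2 (X k i j - pm k (P i j)) <= n%:R *
    (\sum_i \sum_j n2 (2%:R *: pm k (Y i j) - pm k (P i j) - \sum_l pm k (Q i l) *m pm k (Y l j)) +
     \sum_i \sum_l n2 (pm k (Q i l) - \sum_m pm k (P i m) *m mh (pm k (Y l m)))).
  suff h k : exists X : 'I_n -> 'I_n -> 'M[C]_(dm k), mcb X 1 /\ forall i j,
    n2 (X i j - pm k (P i j)) <= n%:R *
    (\sum_i \sum_j n2 (2%:R *: pm k (Y i j) - pm k (P i j) - \sum_l pm k (Q i l) *m pm k (Y l j)) +
     \sum_i \sum_l n2 (pm k (Q i l) - \sum_m pm k (P i m) *m mh (pm k (Y l m)))).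
    exact: (dep_choice h).
  have [X Xc hX] := kaplansky_block (fun i j => pm k (Y i j)).
  by exists X; split=> // i j; exact: hX (fun i j => pm k (P i j)) (fun i j => pm k (Q i j)) i j.
exists X, P; split.
- by move=> k; exact: (hX k).1.
- move=> i j; apply: lt_le_trans (hP i j) _.
  rewrite ler_pdivrMr// ler_peMr ?(ltW e0)// /K.
  by rewrite lerDr !mulr_ge0// addr_ge0.
- have vV i j : U [set k | n2 (2%:R *: pm k (Y i j) - pm k (P i j) -
      \sum_l pm k (Q i l) *m pm k (Y l j)) < e / K].
    apply: (polypair_lt _ (hV i j)).
    apply: polypairB; first by apply: polypairB; [apply: polypairZ|]; exact: polypair_pop.
    by apply: polypair_sum => l; apply: polypairM; exact: polypair_pop.
  have vU i l : U [set k | n2 (pm k (Q i l) - \sum_m pm k (P i m) *m mh (pm k (Y l m))) < e / K].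
    apply: (polypair_lt _ (hU i l)).
    apply: polypairB; first exact: polypair_pop.
    apply: polypair_sum => m; apply: polypairM; first exact: polypair_pop.
    by apply: polypairJ; exact: polypair_pop.
  apply: filterS (filter_bigI_all _ (fun p : 'I_n * 'I_n =>
    filterI (vV p.1 p.2) (vU p.1 p.2))) => k /= hk i j.
  rewrite (le_lt_trans ((hX k).2 i j))//.
  have eK : 0 <= e / K by rewrite ltW// divr_gt0.
  apply: (@le_lt_trans _ _ (n%:R * (n%:R * (n%:R * (e / K)) + n%:R * (n%:R * (e / K))))).
    rewrite ler_wpM2l// lerD//; apply: sum_const_le => i'; apply: sum_const_le => j'.
      by rewrite ltW//; have [] := hk (i', j').
    by rewrite ltW//; have [] := hk (i', j').
  have -> : n%:R * (n%:R * (n%:R * (e / K)) + n%:R * (n%:R * (e / K))) =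
      e * ((K - 1) / K) by rewrite /K; ring.
  by rewrite gtr_pMr// ltr_pdivrMr// mul1r gtrBl.
Qed.

(* Diagonal argument along the ultrafilter. *)
Lemma lift_contraction (T : 'I_n -> 'I_n -> bop F) :
  (forall i j, Nset M (T i j)) -> mxnorm T < 1 ->
  exists2 X, contractions X & forall i j, s1 (fun k => X k i j) (T i j).
Proof.
move=> NT T1.
pose ep m : R := m.+1%:R^-1.
have ep0 m : 0 < ep m by rewrite invr_gt0.
have [XP hXP] : exists XP : nat -> (forall k : idx M, 'I_n -> 'I_n -> 'M[C]_(dm k)) *
    ('I_n -> 'I_n -> ncpoly M), forall m,
    [/\ contractions (XP m).1, (forall i j, nr (T i j Om - pv ((XP m).2 i j)) < ep m) &
    U [set k : idx M | forall i j, n2 ((XP m).1 k i j - pm k ((XP m).2 i j)) < ep m]].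
  apply: (@ex_choice _ _ (fun m (XP : (forall k : idx M, 'I_n -> 'I_n -> 'M[C]_(dm k)) *
    ('I_n -> 'I_n -> ncpoly M)) => [/\ contractions XP.1,
    (forall i j, nr (T i j Om - pv (XP.2 i j)) < ep m) &
    U [set k : idx M | forall i j, n2 (XP.1 k i j - pm k (XP.2 i j)) < ep m]])) => m.
  by have [X [P h]] := lift_step (ep0 m) NT T1; exists (X, P).
(* At a good stage the contraction is close to its polynomial, and this polynomial is close in model
   [k] to those of all earlier stages. A later good stage therefore still serves every earlier
   precision. *)
pose good m k := forall i j, n2 ((XP m).1 k i j - pm k ((XP m).2 i j)) < ep m /\
  forall l, (l <= m)%N -> n2 (pm k ((XP m).2 i j) - pm k ((XP l).2 i j)) < ep m + ep l.
have Ugood m : U [set k | good m k].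
  have [_ hT hU] := hXP m.
  have h (p : 'I_n * 'I_n * 'I_m.+1) : U [set k : idx M | n2 (pm k ((XP m).2 p.1.1 p.1.2) -
      pm k ((XP p.2).2 p.1.1 p.1.2)) < ep m + ep p.2].
    apply: filterS (@n2_lt _ _ M ((XP m).2 p.1.1 p.1.2 ++
      pscale (-1) ((XP p.2).2 p.1.1 p.1.2)) (ep m + ep p.2) _) => [k /=|]; first by rewrite pmB.
    rewrite pvB (le_lt_trans (ler_nrT (T p.1.1 p.1.2 Om) _ _))// ltrD//.
      by rewrite nrBC.
    by have [_ hT' _] := hXP p.2.
  apply: filterS2 hU (filter_bigI_all _ h) => k /= hk hk' i j.
  split; first exact: hk.
  by move=> l lm; exact: (hk' (i, j, Ordinal (lm : (l < m.+1)%N))).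
(* stage k is the last good m <= k.2, if any *)
pose stage k := \max_(m < k.2.+1 | `[< good m k >]) (m : nat).
pose X k := (XP (stage k)).1 k.
exists X; first by move=> k; have [h _ _] := hXP (stage k); exact: h.
move=> i j e e0.
have [m hm] := inv_nat_lt (divr_gt0 e0 (ltr0Sn R 2)).
have m3 : ep m < e / 3 by [].
exists ((XP m).2 i j); split.
  have [_ h _] := hXP m; rewrite (lt_trans (h i j))// (lt_trans m3)//.
  by rewrite ltr_pdivrMr// ltr_pMr// ltr1n.
apply: filterS2 (Ugood m) (ufilter_idx M m) => k /= gm km.
have mk : (m < k.2.+1)%N by [].
have sm : (m <= stage k)%N.
  rewrite /stage (bigD1 (Ordinal mk))/= ?leq_maxl//.
  exact/asboolP.
have gs : good (stage k) k.
  have [i0 /asboolP Pi0 ->] : exists2 i0 : 'I_k.2.+1, `[< good i0 k >] & stage k = i0.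
    have [|i0 Pi0 E] := @eq_bigmax_cond _ [pred m0 : 'I_k.2.+1 | `[< good m0 k >]]
      (fun m0 => m0 : nat); last by exists i0.
    apply/card_gt0P; exists (Ordinal mk); rewrite inE; exact/asboolP.
  by [].
have [h1 h2] := gs i j.
rewrite (le_lt_trans (n2T (pm k ((XP (stage k)).2 i j)) _ _))//.
have h3 := h2 m sm; have h4 : ep (stage k) <= ep m by rewrite inv_nat_mono.
have : e / 3 + e / 3 + e / 3 = e by field.
move: h1 h3 h4 m3; rewrite -/(X k).
move: (n2 _) (n2 _) (ep m) (ep _) => a b c d; lra.
Qed.

End Lifts.

(** * Hilbert sums and block diagonal operators *)

Lemma ler_sum_sub (R : realType) (S : eqType) (f : S -> R) (r1 r2 : seq S) :
  (forall s, 0 <= f s) -> uniq r1 -> uniq r2 -> {subset r1 <= r2} ->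
  \sum_(s <- r1) f s <= \sum_(s <- r2) f s.
Proof.
move=> f0 u1 u2 sub.
rewrite [leRHS](bigID (fun s => s \in r1))/= -[leLHS]addr0 lerD ?sumr_ge0//.
rewrite -[leRHS]big_filter (perm_big (seq.filter [in r1] r2))//.
apply: uniq_perm; rewrite ?filter_uniq// => s.
by rewrite mem_filter andbC /=; case sr: (s \in r1); rewrite ?andbT ?andbF// sub.
Qed.

Section Ell2Blocks.
Variables (R : realType) (I : choiceType) (d : I -> nat).
Local Notation C := R[i].
Local Notation S := {k : I & 'I_(d k)}.

Definition blockH : complexHilbert R := ell2H R S.

Local Notation K := blockH.
Local Notation ip := (inner K).
Implicit Types (v w : K) (k l : I).

Definition coord v (s : S) : C := (v : ell2 R S) s.

Definition ell2_bv v k : 'cV[C]_(d k) := \col_a coord v (Tagged (fun k => 'I_(d k)) a).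

Lemma ell2_bvL (a : C) v w k : ell2_bv (a *: v + w) k = a *: ell2_bv v k + ell2_bv w k.
Proof. by apply/colP => b; rewrite !mxE. Qed.

Lemma ell2_bvD v w k : ell2_bv (v + w) k = ell2_bv v k + ell2_bv w k.
Proof. by apply/colP => b; rewrite !mxE. Qed.

Lemma ell2_bvZ (a : C) v k : ell2_bv (a *: v) k = a *: ell2_bv v k.
Proof. by apply/colP => b; rewrite !mxE. Qed.

Lemma ell2_bv0 k : ell2_bv 0 k = 0.
Proof. by apply/colP => b; rewrite !mxE. Qed.

Lemma ell2_bv_sum J (r : seq J) (f : J -> K) k : ell2_bv (\sum_(j <- r) f j) k = \sum_(j <- r) ell2_bv (f j) k.
Proof. by elim/big_rec2: _ => [|j x y _ <-]; rewrite ?ell2_bv0 ?ell2_bvD. Qed.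

Lemma ell2_bv_ext v w : (forall k, ell2_bv v k = ell2_bv w k) -> v = w.
Proof.
move=> h; apply: (@ell2_ext R S) => -[k a].
by have /colP/(_ a) := h k; rewrite !mxE.
Qed.

Lemma delta_ell2 (s : S) : exists c : R, forall A, psum (fun t => (t == s)%:R : C) A <= c.
Proof.
exists 1 => A; rewrite /psum (bigID (pred1 s))/= [X in _ + X]big1 ?addr0; last first.
  by move=> t /negbTE ->; rewrite nr0 expr0n.
rewrite big_mkcond (eq_bigr (fun t => (t == s)%:R)); last first.
  by move=> t _; case: eqP => // _; rewrite nr1 expr1n.
have := @ler_sum_sub R S (fun t => (t == s)%:R) A (s :: seq.rem s A).
move=> h; apply: le_trans (h _ _ _ _) _ => //.
- exact: fset_uniq.
- by rewrite /= rem_uniq ?fset_uniq// mem_rem_uniq ?fset_uniq// inE eqxx.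
- by move=> t tA; rewrite inE; case: eqP => //= /eqP ts; rewrite mem_rem_uniq ?fset_uniq// inE ts.
- rewrite big_cons eqxx big_seq big1 ?addr0// => t.
  by rewrite mem_rem_uniq ?fset_uniq// inE => /andP[/negbTE ->].
Qed.

Definition del (s : S) : K := mk_ell2 (delta_ell2 s).

Definition ell2_emb k (u : 'cV[C]_(d k)) : K :=
  \sum_a u a 0 *: del (Tagged (fun k => 'I_(d k)) a).

Lemma ip_del v s : ip v (del s) = coord v s.
Proof.
apply: (ucvg_uniq (fultraP S) (ell2H_ip v (del s))).
apply: (ucvg_near (fultraP S) _ (ucvg_cst (fultraP S) (coord v s))).
have [FF _] := fultraP S.
apply: filterS (fultra_above [fset s]%fset) => A /=; rewrite fsub1set => sA.
rewrite /pip (bigD1_seq s)//= ?fset_uniq// eqxx rmorph1 mulr1 big1 ?addr0// => t /negbTE ts.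
by rewrite ts rmorph0 mulr0.
Qed.

Lemma ell2_ip_emb v k (u : 'cV[C]_(d k)) : ip v (ell2_emb u) = cvip (ell2_bv v k) u.
Proof.
rewrite /ell2_emb ip_sumr; apply: eq_bigr => a _.
by rewrite ipZr ip_del mxE mulrC.
Qed.

Lemma ell2_bv_emb k (u : 'cV[C]_(d k)) : ell2_bv (ell2_emb u) k = u.
Proof.
apply/colP => a; rewrite /ell2_emb ell2_bv_sum summxE (bigD1 a)//= ell2_bvZ !mxE /coord /= eqxx mulr1.
rewrite big1 ?addr0// => b ba; rewrite ell2_bvZ !mxE /coord /= eq_Tagged /= eq_sym (negbTE ba).
by rewrite mulr0.
Qed.

Lemma ell2_bv_emb_neq k l (u : 'cV[C]_(d k)) : l != k -> ell2_bv (ell2_emb u) l = 0.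
Proof.
move=> lk; apply/colP => a; rewrite /ell2_emb ell2_bv_sum summxE big1 ?mxE// => b _.
rewrite ell2_bvZ !mxE /coord /=.
have -> : (Tagged (fun k => 'I_(d k)) a == Tagged (fun k => 'I_(d k)) b) = false.
  by apply/negP => /eqP/(congr1 (@tag _ _))/= /eqP; apply/negP.
by rewrite mulr0.
Qed.

(** A finite set of coordinates meets finitely many blocks, and [r] lists them; sums over
    coordinates are thus controlled by sums over whole blocks. *)
Lemma psum_blocks (A : {fset S}) : exists2 r : seq I, uniq r &
  forall f : S -> C, psum f A <=
    \sum_(k <- r) \sum_(a < d k) nr (f (Tagged (fun k => 'I_(d k)) a)) ^+ 2.
Proof.
exists (undup [seq tag s | s <- A]); first exact: undup_uniq.
move=> f; set r := undup _.
have := @ler_sum_sub R S (fun s => nr (f s) ^+ 2) A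
  [seq Tagged (fun k => 'I_(d k)) a | k <- r, a <- index_enum 'I_(d k)].
rewrite big_allpairs_dep; apply=> [s|||[k a] sA]; first exact: sqr_ge0.
- exact: fset_uniq.
- apply: allpairs_uniq_dep => [|k _|]; rewrite ?undup_uniq ?index_enum_uniq//.
  by move=> [k a] [l b] _ _ /=.
- apply/allpairsPdep; exists k, a; split=> //; rewrite ?mem_index_enum//.
  by rewrite mem_undup; apply/mapP; exists (Tagged (fun k => 'I_(d k)) a).
Qed.

Lemma ell2H_sum_le n (w : 'I_n -> K) c :
  (forall r, uniq r -> \sum_(k <- r) \sum_i vn2 (ell2_bv (w i) k) <= c) ->
  \sum_i nr (w i) ^+ 2 <= c.
Proof.
move=> h; have [FF _] := fultraP S.
have := ucvg_sum (fultraP S) (index_enum 'I_n) (fun i => ell2H_ip (w i) (w i)).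
move=> /(ucvg_Re_le (fultraP S)) hc.
have -> : \sum_i nr (w i) ^+ 2 = complex.Re (\sum_i ip (w i) (w i)).
  by rewrite cRe_sum; apply: eq_bigr => i _; rewrite nr_sqr_ip.
apply: hc; apply: filterS filterT => A _ /=.
have [r ur hr] := psum_blocks A.
apply: le_trans (h r ur); rewrite [leRHS]exchange_big cRe_sum /=; apply: ler_sum => i _ /=.
rewrite pip_psum /= (le_trans (hr _))// ler_sum// => k _.
by rewrite le_eqVlt; apply/orP; left; apply/eqP; apply: eq_bigr => a _; rewrite mxE.
Qed.


Lemma ell2_glue (u : forall k, 'cV[C]_(d k)) c :
  (forall r, uniq r -> \sum_(k <- r) vn2 (u k) <= c) -> exists v, forall k, ell2_bv v k = u k.
Proof.
move=> hc; pose g (s : S) : C := u (tag s) (tagged s) 0.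
have gc A : psum g A <= c.
  by have [r ur hr] := psum_blocks A; apply: (le_trans (hr _)); exact: hc.
by exists (mk_ell2 (ex_intro _ _ gc)) => k; apply/colP => a; rewrite mxE.
Qed.

End Ell2Blocks.

(* The Hilbert sum of the spaces C^(d k): [bv v k] is the component of v at k. *)
Record directSum (R : realType) (I : choiceType) (d : I -> nat) := DirectSum {
  ds_space :> complexHilbert R;
  bv : ds_space -> forall k, 'cV[R[i]]_(d k);
  emb : forall k, 'cV[R[i]]_(d k) -> ds_space;
  bvL : forall (a : R[i]) v w k, bv (a *: v + w) k = a *: bv v k + bv w k;
  bv_ext : forall v w, (forall k, bv v k = bv w k) -> v = w;
  ip_emb : forall v k (u : 'cV_(d k)), inner ds_space v (emb u) = cvip (bv v k) u;
  bv_emb : forall k (u : 'cV_(d k)), bv (emb u) k = u;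
  bv_emb_neq : forall k l (u : 'cV_(d k)), l != k -> bv (emb u) l = 0;
  ds_sum_le : forall n (w : 'I_n -> ds_space) (c : R),
    (forall r : seq I, uniq r -> \sum_(k <- r) \sum_i vn2 (bv (w i) k) <= c) ->
    \sum_i nr (w i) ^+ 2 <= c;
  ds_glue : forall (u : forall k, 'cV[R[i]]_(d k)) (c : R),
    (forall r : seq I, uniq r -> \sum_(k <- r) vn2 (u k) <= c) ->
    exists v, forall k, bv v k = u k }.

Arguments emb {R I d} _ {k} u.

(** Only existence is kept: what follows sees a Hilbert sum through the fields of [directSum] and
    never computes with its construction. *)
Lemma directSum_exists (R : realType) (I : choiceType) (d : I -> nat) :
  inhabited (directSum R d).
Proof.
exists; apply: (@DirectSum R I d (blockH R d) (@ell2_bv R I d) (@ell2_emb R I d)).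
- exact: ell2_bvL.
- exact: ell2_bv_ext.
- exact: ell2_ip_emb.
- exact: ell2_bv_emb.
- exact: ell2_bv_emb_neq.
- exact: ell2H_sum_le.
- exact: ell2_glue.
Qed.

Section BlockDiagonal.
Variables (R : realType) (I : choiceType) (d : I -> nat) (K : directSum R d).
Local Notation C := R[i].
Local Notation ip := (inner K).
Implicit Types (v w : K) (k l : I).

Lemma bv0 k : bv (0 : K) k = 0.
Proof. by have := bvL (-1) (0 : K) 0 k; rewrite scaler0 addr0 scaleN1r addNr. Qed.

Lemma bvD v w k : bv (v + w) k = bv v k + bv w k.
Proof. by rewrite -[v]scale1r bvL !scale1r. Qed.

Lemma bvZ (a : C) v k : bv (a *: v) k = a *: bv v k.
Proof. by rewrite -[_ *: _]addr0 bvL bv0 addr0. Qed.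

Lemma bv_sum J (r : seq J) (f : J -> K) k : bv (\sum_(j <- r) f j) k = \sum_(j <- r) bv (f j) k.
Proof. by elim/big_rec2: _ => [|j x y _ <-]; rewrite ?bv0 ?bvD. Qed.

Lemma embL k (a : C) (u w : 'cV[C]_(d k)) : emb K (a *: u + w) = a *: emb K u + emb K w.
Proof.
apply: bv_ext => l; rewrite bvL; have [->|lk] := eqVneq l k; first by rewrite !bv_emb.
by rewrite !bv_emb_neq// scaler0 addr0.
Qed.

Lemma emb0 k : emb K (0 : 'cV[C]_(d k)) = 0.
Proof. by have := embL (-1) (0 : 'cV[C]_(d k)) 0; rewrite scaler0 addr0 scaleN1r addNr. Qed.

Lemma nr_emb k (u : 'cV[C]_(d k)) : nr (emb K u) ^+ 2 = vn2 u.
Proof. by rewrite nr_sqr_ip ip_emb bv_emb cvipxx. Qed.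

(** Bessel's inequality: the truncation [w] of [v] to the blocks of [r] satisfies
    [<v, w> = |w|^2]. *)
Lemma sum_vn2_le v (r : seq I) : uniq r -> \sum_(k <- r) vn2 (bv v k) <= nr v ^+ 2.
Proof.
move=> ur; set s := \sum_(k <- r) _; pose w := \sum_(k <- r) emb K (bv v k).
have bw k : k \in r -> bv w k = bv v k.
  move=> kr; rewrite bv_sum (bigD1_seq k)//= bv_emb big1 ?addr0// => l lk.
  by rewrite bv_emb_neq// eq_sym.
have vw : ip v w = s%:C.
  rewrite ip_sumr rmorph_sum; apply: eq_bigr => k _.
  by rewrite ip_emb cvipxx.
have ww : nr w ^+ 2 = s.
  rewrite nr_sqr_ip {2}/w ip_sumr big_seq cRe_sum [RHS]big_seq; apply: eq_bigr => k kr.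
  by rewrite ip_emb bw// cvipxx.
have s0 : 0 <= s by rewrite -ww sqr_ge0.
have := cauchy_schwarz v w; rewrite vw nr_real ger0_norm// -ww => h.
rewrite ww -ww; have [->|w0] := eqVneq (nr w) 0; first by rewrite expr0n sqr_ge0.
have w1 : 0 < nr w by rewrite lt_def nr_ge0 w0.
rewrite ler_pXn2r ?nnegrE ?nr_ge0// -(ler_pM2r w1) -expr2.
exact: h.
Qed.

Lemma vn2_bv_le v k : vn2 (bv v k) <= nr v ^+ 2.
Proof. by have := sum_vn2_le v (r := [:: k]) isT; rewrite big_seq1. Qed.

Definition block (T : bop K) (X : forall k, 'M[C]_(d k)) :=
  forall v k, bv (T v) k = X k *m bv v k.

Lemma block_exists (X : forall k, 'M[C]_(d k)) (c : R) :
  (forall k, mbd (X k) c) -> exists T, block T X.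
Proof.
move=> Xc.
have gc v r : uniq r -> \sum_(k <- r) vn2 (X k *m bv v k) <= c ^+ 2 * nr v ^+ 2.
  move=> ur; rewrite (le_trans (_ : _ <= \sum_(k <- r) c ^+ 2 * vn2 (bv v k)))//.
    by apply: ler_sum => k _; exact: (Xc k (bv v k)).
  by rewrite -mulr_sumr ler_wpM2l ?sqr_ge0// sum_vn2_le.
have [f bf] := ex_choice (fun v => @ds_glue _ _ _ K _ _ (gc v)).
have lf : linear f.
  by move=> a v w; apply: bv_ext => k; rewrite bf !bvL !bf mulmxDr scalemxAr.
have [|T hT] := mkbop (c := `|c|) lf.
  move=> v; have h := @ds_sum_le _ _ _ K 1 (fun=> f v) (c ^+ 2 * nr v ^+ 2).
  rewrite -(ler_pXn2r (n := 2)) ?nnegrE ?mulr_ge0 ?nr_ge0// exprMn real_normK ?num_real//.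
  move: h; rewrite big_ord1; apply => r ur.
  apply: le_trans (gc v r ur); apply: ler_sum => k _.
  by rewrite big_ord1 bf.
by exists T => v k; rewrite hT bf.
Qed.

Lemma block_mcb n (T : 'I_n -> 'I_n -> bop K) (X : forall k, 'I_n -> 'I_n -> 'M[C]_(d k)) c :
  0 <= c -> (forall i j, block (T i j) (fun k => X k i j)) -> (forall k, mcb (X k) c) ->
  forall v : 'I_n -> K, l2 (act T v) <= c * l2 v.
Proof.
move=> c0 TX Xc v.
rewrite -(ler_pXn2r (n := 2)) ?nnegrE ?mulr_ge0 ?l2_ge0// exprMn !l2_sqr.
apply: ds_sum_le => r ur.
have h (k : I) : \sum_i vn2 (bv (act T v i) k) <= c ^+ 2 * \sum_j vn2 (bv (v j) k).
  have := Xc k (fun j => bv (v j) k); congr (_ <= _).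
  by apply: eq_bigr => i _; rewrite /act bv_sum; congr vn2; apply: eq_bigr => j _; rewrite TX.
rewrite (le_trans (ler_sum _ (fun k _ => h k)))// -mulr_sumr ler_wpM2l ?sqr_ge0//.
by rewrite exchange_big ler_sum// => j _ /=; rewrite sum_vn2_le.
Qed.

Lemma block_bound (T : bop K) X c : 0 <= c -> block T X -> (forall k, mbd (X k) c) ->
  forall v, nr (T v) <= c * nr v.
Proof.
move=> c0 TX Xc v.
have e (w : K) : l2 (fun _ : 'I_1 => w) = nr w.
  by rewrite /l2 big_ord1 sqrtr_sqr ger0_norm ?nr_ge0.
have := @block_mcb 1 (fun _ _ => T) (fun k _ _ => X k) c c0 (fun _ _ => TX) _ (fun=> v).
rewrite (eq_l2 (w := fun=> T v)); last by move=> i; rewrite /act big_ord1.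
rewrite !e; apply => k u; rewrite !big_ord1 /mact big_ord1; exact: Xc.
Qed.

Lemma blockL (a : C) S' T X Y : block S' X -> block T Y ->
  block (a *: S' + T) (fun k => a *: X k + Y k).
Proof.
by move=> SX TY v k; rewrite bvL SX TY mulmxDl scalemxAl.
Qed.

Lemma blockM S' T X Y : block S' X -> block T Y ->
  block (bop_comp S' T) (fun k => X k *m Y k).
Proof. by move=> SX TY v k; rewrite SX TY mulmxA. Qed.

Lemma block_emb T X k (u : 'cV[C]_(d k)) : block T X -> T (emb K u) = emb K (X k *m u).
Proof.
move=> TX; apply: bv_ext => l; rewrite TX; have [->|lk] := eqVneq l k.
  by rewrite !bv_emb.
by rewrite !bv_emb_neq// mulmx0.
Qed.

Lemma cvip_ext m (u w : 'cV[C]_m) : (forall z, cvip u z = cvip w z) -> u = w.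
Proof.
move=> h; apply: subr0_eq; apply: vn2_eq0.
have cvipBl (x y z : 'cV[C]_m) : cvip (x - y) z = cvip x z - cvip y z.
  by rewrite /cvip -sumrB; apply: eq_bigr => a _; rewrite !mxE mulrBl.
have : cvip (u - w) (u - w) = 0 by rewrite cvipBl h subrr.
by rewrite cvipxx => -[].
Qed.

Lemma blockJ T X : block T X -> block (adj T) (fun k => mh (X k)).
Proof.
move=> TX v k; apply: cvip_ext => u.
by rewrite -ip_emb -adjP' (block_emb _ TX) ip_emb cvip_mh mhK.
Qed.

Lemma block_uniq S' T X : block S' X -> block T X -> S' = T.
Proof. by move=> SX TX; apply: bop_ext => v; apply: bv_ext => k; rewrite SX TX. Qed.

Lemma block0 : block 0 (fun k => 0).
Proof. by move=> v k; rewrite zerobE bv0 mul0mx. Qed.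

Lemma block1 : block (bop_id K) (fun k => 1%:M).
Proof. by move=> v k; rewrite mul1mx. Qed.

(** The compression of an arbitrary operator to the summand [k]. Keeping all the compressions is the
    conditional expectation of B(K) onto the block diagonal operators. *)
Definition cmp (T : bop K) k : 'M[C]_(d k) :=
  \matrix_(a, b) bv (T (emb K (delta_mx b 0))) k a 0.

Lemma emb_sum k J (r : seq J) (a : J -> C) (u : J -> 'cV[C]_(d k)) :
  emb K (\sum_(j <- r) a j *: u j) = \sum_(j <- r) a j *: emb K (u j).
Proof.
elim: r => [|j r IH]; last by rewrite !big_cons embL IH.
by rewrite !big_nil emb0.
Qed.

Lemma cmp_mul T k u : cmp T k *m u = bv (T (emb K u)) k.
Proof.
have {2}-> : u = \sum_b u b 0 *: delta_mx b 0.
  apply/colP => a; rewrite summxE (bigD1 a)//= !mxE !eqxx mulr1 big1 ?addr0// => b.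
  by rewrite !mxE eq_sym => /negbTE ->; rewrite mulr0.
rewrite emb_sum bop_sum bv_sum; apply/colP => a; rewrite summxE mxE.
by apply: eq_bigr => b _; rewrite bopZ bvZ !mxE mulrC.
Qed.

Lemma block_cmp T X k : block T X -> cmp T k = X k.
Proof.
move=> TX; apply/matrixP => a b; rewrite mxE TX bv_emb -colE mxE.
by [].
Qed.

Lemma cmpL (a : C) S' T k : cmp (a *: S' + T) k = a *: cmp S' k + cmp T k.
Proof. by apply/matrixP => b b'; rewrite !mxE bvL !mxE. Qed.

Lemma mcb_cmp n (T : 'I_n -> 'I_n -> bop K) c k : 0 <= c ->
  (forall v : 'I_n -> K, l2 (act T v) <= c * l2 v) -> mcb (fun i j => cmp (T i j) k) c.
Proof.
move=> c0 Tc u; have := Tc (fun j => emb K (u j)).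
rewrite -(ler_pXn2r (n := 2)) ?nnegrE ?mulr_ge0 ?l2_ge0// exprMn !l2_sqr.
rewrite [in X in _ <= X -> _](eq_bigr (fun j => vn2 (u j))) => [h|j _]; last exact: nr_emb.
apply: le_trans h; apply: ler_sum => i _.
have -> : mact (fun i j => cmp (T i j) k) u i = bv (act T (fun j => emb K (u j)) i) k.
  by rewrite /act bv_sum; apply: eq_bigr => j _; rewrite cmp_mul.
exact: vn2_bv_le.
Qed.

Lemma mbd_cmp (T : bop K) c k : (forall v, nr (T v) <= c * nr v) -> mbd (cmp T k) c.
Proof.
move=> Tc u; rewrite cmp_mul (le_trans (vn2_bv_le _ _))// -nr_emb -exprMn.
have c0 := le_trans (nr_ge0 _) (Tc (emb K u)).
by rewrite ler_pXn2r ?nnegrE ?nr_ge0.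
Qed.

End BlockDiagonal.

#[global] Opaque cmp.

(** * The conditional expectation onto N *)

Section Families.
Variables (R : realType) (d n : nat).
Local Notation C := R[i].
Implicit Types (a b : 'I_n -> 'M[C]_d).

Definition fip a b : C := \sum_i mip (a i) (b i).

Lemma fipL (c : C) a b z : fip (c *: a + b) z = c * fip a z + fip b z.
Proof. by rewrite /fip mulr_sumr -big_split; apply: eq_bigr => i _; exact: mipL. Qed.

Lemma fipH a b : fip a b = Num.conj (fip b a).
Proof. by rewrite /fip rmorph_sum; apply: eq_bigr => i _; exact: mipH. Qed.

Lemma fipxx a : fip a a = (\sum_i n2 (a i) ^+ 2)%:C.
Proof. by rewrite rmorph_sum; apply: eq_bigr => i _; rewrite /mip -n2_tau. Qed.

Lemma fip_ge0 a : 0 <= complex.Re (fip a a).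
Proof. by rewrite fipxx sumr_ge0// => i _; rewrite sqr_ge0. Qed.

Lemma fip_cs a b (p q : R) : 0 <= p -> 0 <= q -> \sum_i n2 (a i) ^+ 2 <= p ^+ 2 ->
  \sum_i n2 (b i) ^+ 2 <= q ^+ 2 -> nr (fip a b) <= p * q.
Proof.
move=> p0 q0 ap bq; apply: le_trans (semi_cs fipL fipH fip_ge0 a b) _.
by rewrite ler_pM ?seminorm_ge0// -(ler_pXn2r (n := 2)) ?nnegrE ?seminorm_ge0//
  seminorm_sqr fipxx.
Qed.

Lemma mcb_n2 (X : 'I_n -> 'I_n -> 'M[C]_d) c a : mcb X c ->
  \sum_i n2 (\sum_j X i j *m a j) ^+ 2 <= c ^+ 2 * \sum_j n2 (a j) ^+ 2.
Proof.
move=> Xc; under eq_bigr do rewrite n2_col.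
under [in leRHS]eq_bigr do rewrite n2_col.
rewrite -!mulr_sumr mulrCA ler_wpM2l ?invr_ge0//.
rewrite exchange_big [in leRHS]exchange_big mulr_sumr ler_sum// => b _ /=.
rewrite (le_trans _ (Xc (fun j => col b (a j))))//.
rewrite le_eqVlt; apply/orP; left; apply/eqP; apply: eq_bigr => i _; congr vn2.
rewrite /mact; apply/colP => r; rewrite mxE !summxE; apply: eq_bigr => j _.
by rewrite !mxE; apply: eq_bigr => s _; rewrite mxE.
Qed.

End Families.

Section Expectation.
Variables (R : realType) (F : complexHilbert R) (M : matricial F).
Variable (K : directSum R (@dm R F M)).
Local Notation C := R[i].
Local Notation ip := (inner F).
Local Notation Om := (vac M).
Local Notation U := (ufilter M).
Local Notation cmp := (@cmp R _ _ K).
Local Notation block := (@block R _ _ K).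
#[local] Existing Instance ufilterP.
Implicit Types (S T : bop F) (x y : bop K) (P Q : ncpoly M).
Implicit Types X Y : forall k : idx M, 'M[C]_(dm k).

Lemma le_eps_mul (a c p q : R) : 0 <= c -> 0 <= p -> 0 <= q ->
  (forall e, 0 < e -> a <= c * ((p + e) * (q + e))) -> a <= c * (p * q).
Proof.
move=> c0 p0 q0 h; apply: le_eps => e e0.
pose t := c * (p + q + 1) + 1.
have t0 : 0 < t by rewrite /t ltr_wpDl// mulr_ge0// !addr_ge0.
pose m := Num.min 1 (e / t).
have m0 : 0 < m by rewrite lt_min ltr01 divr_gt0.
have m1 : m <= 1 by rewrite ge_min lexx.
have mt : m * t <= e by rewrite -ler_pdivlMr// ge_min lexx orbT.
apply: le_trans (h _ m0) _.
have h1 : m * m <= m by rewrite ler_piMl// ltW.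
have h2 := ler_wpM2l c0 h1.
move: mt; rewrite /t; move: (m) m0 m1 h1 h2 => z z0 z1 h1 h2; lra.
Qed.

(** Cauchy-Schwarz for families of matrices, passed to the ultralimit. For [n = 1] it bounds the
    form that defines the expectation; for general [n] it gives complete contractivity. *)
Lemma form_bound n (X : forall k : idx M, 'I_n -> 'I_n -> 'M[C]_(dm k)) c
    (P Q : 'I_n -> ncpoly M) L :
  0 <= c -> (forall k, mcb (X k) c) ->
  ucvg U (fun k => fip (fun i => \sum_j X k i j *m pm k (P j)) (fun i => pm k (Q i))) L ->
  nr L <= c * (l2 (fun j => pv (P j)) * l2 (fun i => pv (Q i))).
Proof.
move=> c0 Xc hL; apply: le_eps_mul => //; [exact: l2_ge0|exact: l2_ge0|].
move=> e e0; apply: (ucvg_nr_le (ufilterP M) hL).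
have ev (Z : 'I_n -> ncpoly M) : U [set k |
    \sum_i n2 (pm k (Z i)) ^+ 2 <= (l2 (fun i => pv (Z i)) + e) ^+ 2].
  have := ucvg_sum (ufilterP M) (index_enum 'I_n) (fun i => mip_cvg (Z i) (Z i)).
  move=> /(_ _ (exprn_gt0 2 e0)); apply: filterS => k /= h.
  have := le_lt_trans (ler_Re_nr _) h; rewrite cReB -/(ip2 _ _) -l2_ip.
  rewrite -[X in complex.Re X - _]/(fip (fun i => pm k (Z i)) (fun i => pm k (Z i))) fipxx /=.
  have := mulr_ge0 (l2_ge0 (fun i => pv (Z i))) (ltW e0).
  by move: (l2 _) (\sum_i _) => s t; lra.
apply: filterS2 (ev P) (ev Q) => k /= hP hQ; rewrite mulrA.
apply: fip_cs => //; rewrite ?mulr_ge0 ?addr_ge0 ?l2_ge0 ?(ltW e0)//.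
by rewrite (le_trans (mcb_n2 _ (Xc k)))// exprMn ler_wpM2l// sqr_ge0.
Qed.

Lemma mcb1 d (x : 'M[C]_d) c : mbd x c -> mcb (fun _ _ : 'I_1 => x) c.
Proof. by move=> xc u; rewrite !big_ord1 /mact big_ord1; exact: xc. Qed.

Lemma l21 (H : complexHilbert R) (v : H) : l2 (fun _ : 'I_1 => v) = nr v.
Proof. by rewrite /l2 big_ord1 sqrtr_sqr ger0_norm ?nr_ge0. Qed.

(** The blocks of [x] act on the ultraproduct of the Hilbert-Schmidt spaces by left multiplication;
    this is the form of the compression of that action to the copy of [F]. *)
Definition Eform x P Q : C := ulim U (fun k => mip (cmp x k *m pm k P) (pm k Q)).

Lemma mip_le d (x y z : 'M[C]_d) c : 0 <= c -> mbd x c -> nr (mip (x *m y) z) <= c * (n2 y * n2 z).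
Proof.
move=> c0 xc; rewrite (le_trans (n2_cs _ _))// mulrA ler_wpM2r ?n2_ge0//.
exact: n2_mull.
Qed.

Lemma Eform_cvg x P Q :
  ucvg U (fun k => mip (cmp x k *m pm k P) (pm k Q)) (Eform x P Q).
Proof.
have [c c0 xc] := bop_bounded x.
apply: (ulimP (ufilterP M) (c := c * ((nr (pv P) + 1) * (nr (pv Q) + 1)))).
apply: filterS2 (n2_cvg P ltr01) (n2_cvg Q ltr01) => k /=.
rewrite !ltr_norml => /andP[_ hP] /andP[_ hQ].
rewrite (le_trans (mip_le _ _ c0 (mbd_cmp xc)))// ler_wpM2l// ler_pM ?n2_ge0//.
  by rewrite ltW// -ltrBlDl.
by rewrite ltW// -ltrBlDl.
Qed.

Lemma Eform_le x P Q c : 0 <= c -> (forall v : K, nr (x v) <= c * nr v) ->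
  nr (Eform x P Q) <= c * nr (pv P) * nr (pv Q).
Proof.
move=> c0 xc; rewrite -mulrA -!l21.
apply: (@form_bound 1 (fun k _ _ => cmp x k) c (fun=> P) (fun=> Q) _ c0) => [k|].
  by apply: mcb1; exact: mbd_cmp.
apply: (ucvg_near (ufilterP M) _ (Eform_cvg x P Q)); apply: ufilter_all => k /=.
by rewrite /fip !big_ord1.
Qed.

Lemma Eform_Ll (a : C) x P P' Q : Eform x (pscale a P ++ P') Q = a * Eform x P Q + Eform x P' Q.
Proof.
apply: (ulimE (ufilterP M)).
apply: (ucvg_near (ufilterP M) _ (ucvgD (ufilterP M)
  (ucvgM (ufilterP M) a (Eform_cvg x P Q)) (Eform_cvg x P' Q))).
by apply: ufilter_all => k /=; rewrite pm_cat pm_scale mulmxDr -scalemxAr mipL.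
Qed.

Lemma Eform_Lr (a : C) x P Q Q' :
  Eform x P (pscale a Q ++ Q') = Num.conj a * Eform x P Q + Eform x P Q'.
Proof.
apply: (ulimE (ufilterP M)).
apply: (ucvg_near (ufilterP M) _ (ucvgD (ufilterP M)
  (ucvgM (ufilterP M) (Num.conj a) (Eform_cvg x P Q)) (Eform_cvg x P Q'))).
apply: ufilter_all => k /=; rewrite pm_cat pm_scale.
by rewrite [RHS]mipH mipL rmorphD rmorphM /= -!mipH.
Qed.

Lemma expect_exists x : exists T, forall P Q, ip (T (pv P)) (pv Q) = Eform x P Q.
Proof.
have [c c0 xc] := bop_bounded x.
have [||||T [hT _]] := @form_bop R F (ncpoly M) (@pv R F M) (Eform x) c; last by exists T.
- exact: c0.
- by move=> z e; exact: cyclic.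
- move=> a P Q; exists (pscale a P ++ Q); split=> [|Q'|Q'].
  + by rewrite /pv pop_cat pop_scale.
  + exact: Eform_Ll.
  + exact: Eform_Lr.
- by move=> P Q; exact: Eform_le.
Qed.

Definition expect x : bop F := projT1 (cid (expect_exists x)).

Lemma expectP x P Q :
  ucvg U (fun k => mip (cmp x k *m pm k P) (pm k Q)) (ip (expect x (pv P)) (pv Q)).
Proof. by rewrite (projT2 (cid (expect_exists x))); exact: Eform_cvg. Qed.

Lemma bop_ext_form S T : (forall P Q, ip (S (pv P)) (pv Q) = ip (T (pv P)) (pv Q)) -> S = T.
Proof. by move=> h; apply: bop_ext_pv => P; apply: ip_ext_pv. Qed.

Lemma expect_uniq x T : (forall P Q,
  ucvg U (fun k => mip (cmp x k *m pm k P) (pm k Q)) (ip (T (pv P)) (pv Q))) -> expect x = T.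
Proof.
move=> h; apply: bop_ext_form => P Q.
exact: (ucvg_uniq (ufilterP M) (expectP x P Q) (h P Q)).
Qed.

Lemma expectL (a : C) x y : expect (a *: x + y) = a *: expect x + expect y.
Proof.
apply: expect_uniq => P Q; rewrite addbE scalebE ipDl ipZl.
apply: (ucvg_near (ufilterP M) _ (ucvgD (ufilterP M)
  (ucvgM (ufilterP M) a (expectP x P Q)) (expectP y P Q))).
by apply: ufilter_all => k /=; rewrite cmpL mulmxDl -scalemxAl mipL.
Qed.

(** In each model left multiplications commute with right ones, and the trace moves a right factor
    to the other argument as its star. *)
Lemma expect_Nset x : Nset M (expect x).
Proof.
apply: Nset_comm => Q P; apply: (@ip_ext_pv _ _ M) => P'.
rewrite ropE [in RHS]adjP rop_adj ropE.
apply: (ucvg_uniq (ufilterP M) (expectP x _ _)).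
apply: (ucvg_near (ufilterP M) _ (expectP x P (pmul P' (pstar Q)))).
apply: ufilter_all => k /=; rewrite !pm_mul pm_star /mip mhM mhK.
by rewrite -mulmxA tauC -!mulmxA.
Qed.

Section Density.
Variable n : nat.
Implicit Types (u w : 'I_n -> F).

Lemma pv_dense w (e : R) : 0 < e ->
  exists P : 'I_n -> ncpoly M, l2 (fun i => w i - pv (P i)) <= e.
Proof.
move=> e0; have d0 : 0 < e / n.+1%:R by rewrite divr_gt0.
have [P hP] := ex_choice (fun i => cyclic M (w i) d0).
exists P; rewrite (le_trans (l2_le_sum _))// (le_trans (sum_const_le (fun i => ltW (hP i))))//.
have n1 : n.+1%:R != 0 :> R by rewrite pnatr_eq0.
by rewrite mulrCA ler_piMr ?(ltW e0)// ler_pdivrMr// mul1r ler_nat.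
Qed.

Lemma l2_dual u c : 0 <= c -> (forall Q : 'I_n -> ncpoly M,
  nr (ip2 u (fun i => pv (Q i))) <= c * l2 (fun i => pv (Q i))) -> l2 u <= c.
Proof.
move=> c0 h; have [->//|u0] := eqVneq (l2 u) 0.
have u1 : 0 < l2 u by rewrite lt_def l2_ge0 u0.
rewrite -(ler_pM2l u1); apply: le_eps => e e0.
have t0 : 0 < l2 u + c by rewrite ltr_wpDr.
have [Q hQ] := pv_dense u (divr_gt0 e0 t0).
have e1 : l2 u * l2 u = complex.Re (ip2 u (fun i => u i - pv (Q i))) +
    complex.Re (ip2 u (fun i => pv (Q i))).
  rewrite -expr2 l2_ip -cReD; congr complex.Re; rewrite /ip2 -big_split.
  by apply: eq_bigr => i _ /=; rewrite -ipDr subrK.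
have h1 := Re_ip2_le u (fun i => u i - pv (Q i)).
have h2 := le_trans (ler_Re_nr _) (h Q).
have h3 : l2 (fun i => pv (Q i)) <= l2 u + l2 (fun i => u i - pv (Q i)).
  have := l2D u (fun i => -1 *: (u i - pv (Q i))); rewrite l2Z nrN nr1 mul1r.
  by rewrite (@eq_l2 _ _ _ _ (fun i => pv (Q i)))// => i; rewrite scaleN1r; zmodule.
have h4 := ler_wpM2l c0 h3.
have h5 : (l2 u + c) * l2 (fun i => u i - pv (Q i)) <= e by rewrite mulrC -ler_pdivlMr.
rewrite e1; lra.
Qed.

Lemma act_bound_dense (T : 'I_n -> 'I_n -> bop F) c : 0 <= c ->
  (forall P : 'I_n -> ncpoly M, l2 (act T (fun i => pv (P i))) <= c * l2 (fun i => pv (P i))) ->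
  forall w, l2 (act T w) <= c * l2 w.
Proof.
move=> c0 h w; apply: le_eps => e e0.
have [b b0 hb] := act_bounded T.
have t0 : 0 < b + c + 1 by rewrite ltr_wpDl ?addr_ge0.
have [P hP] := pv_dense w (divr_gt0 e0 t0).
have h1 := hb (fun i => w i - pv (P i)).
have h2 := h P.
have h3 : l2 (fun i => pv (P i)) <= l2 w + l2 (fun i => w i - pv (P i)).
  have := l2D w (fun i => -1 *: (w i - pv (P i))); rewrite l2Z nrN nr1 mul1r.
  by rewrite (@eq_l2 _ _ _ _ (fun i => pv (P i)))// => i; rewrite scaleN1r; zmodule.
have h4 := ler_wpM2l c0 h3.
have h5 : l2 (act T w) <= l2 (act T (fun i => w i - pv (P i))) + l2 (act T (fun i => pv (P i))).
  rewrite (le_trans _ (l2D _ _))// le_eqVlt; apply/orP; left; apply/eqP; apply: eq_l2 => i.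
  by rewrite -actD; congr (act T _ i); apply/funext => j; rewrite subrK.
have h6 : (b + c + 1) * l2 (fun i => w i - pv (P i)) <= e by rewrite mulrC -ler_pdivlMr.
have := l2_ge0 (fun i => w i - pv (P i)).
lra.
Qed.

Lemma expect_cc (x : 'I_n -> 'I_n -> bop K) c : 0 <= c ->
  (forall v : 'I_n -> K, l2 (act x v) <= c * l2 v) ->
  forall w, l2 (act (fun i j => expect (x i j)) w) <= c * l2 w.
Proof.
move=> c0 xc; apply: act_bound_dense => // P; apply: l2_dual => [|Q].
  by rewrite mulr_ge0 ?l2_ge0.
rewrite -mulrA; 
apply: (@form_bound n (fun k i j => cmp (x i j) k) c P Q _ c0) => [k|].
  exact: mcb_cmp.
have -> : ip2 (act (fun i j => expect (x i j)) (fun i => pv (P i))) (fun i => pv (Q i)) =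
    \sum_i \sum_j ip (expect (x i j) (pv (P j))) (pv (Q i)).
  by apply: eq_bigr => i _; rewrite ip_suml.
apply: (ucvg_near (ufilterP M) _ (ucvg_sum (ufilterP M) (index_enum 'I_n) (fun i =>
  ucvg_sum (ufilterP M) (index_enum 'I_n) (fun j => expectP (x i j) (P j) (Q i))))).
  apply: ufilter_all => k /=; apply: eq_bigr => i _.
  rewrite /mip mulmx_sumr tau_sum; exact: eq_bigr.
Qed.

End Density.

Lemma expect_bound x c : 0 <= c -> (forall v : K, nr (x v) <= c * nr v) ->
  forall w, nr (expect x w) <= c * nr w.
Proof.
move=> c0 xc w.
have := @expect_cc 1 (fun _ _ => x) c c0 _ (fun=> w).
rewrite l21 (@eq_l2 _ _ _ _ (fun=> expect x w)) ?l21; last by move=> i; rewrite /act big_ord1.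
apply => v; rewrite (@eq_l2 _ _ _ _ (fun=> x (v 0))); last first.
  by move=> i; rewrite /act big_ord1.
rewrite l21 (@eq_l2 _ _ _ v (fun=> v 0)) ?l21// => i; by rewrite ord1.
Qed.

End Expectation.

#[global] Opaque expect.

(** * The algebra C of convergent sequences and its ideal J *)

Section Corona.
Variables (R : realType) (F : complexHilbert R) (M : matricial F).
Variable (K : directSum R (@dm R F M)).
Local Notation C := R[i].
Local Notation ip := (inner F).
Local Notation Om := (vac M).
Local Notation U := (ufilter M).
Local Notation cmp := (@cmp R _ _ K).
Local Notation block := (@block R _ _ K).
Local Notation expect := (@expect R F M K).
#[local] Existing Instance ufilterP.
Implicit Types (S T : bop F) (x y : bop K) (P Q : ncpoly M).
Implicit Types X Y : forall k : idx M, 'M[C]_(dm k).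

Lemma s1_eq X Y T : (forall k, X k = Y k) -> s1 X T -> s1 Y T.
Proof.
move=> XY h e e0; have [P [hP hU]] := h e e0; exists P; split; first exact: hP.
by apply: filterS hU => k /=; rewrite XY.
Qed.

(* |(X - R) Q|_2^2 <= |X - R|_2 |(X - R) Q Q^*|_2 *)
Lemma n2_mulr_sqr d (z p : 'M[C]_d) : n2 (z *m p) ^+ 2 <= n2 z * n2 (z *m (p *m mh p)).
Proof.
have := n2_cs (z *m (p *m mh p)) z; rewrite mulrC.
apply: le_trans; have -> : tau (mh z *m (z *m (p *m mh p))) = (n2 (z *m p) ^+ 2)%:C.
  by rewrite n2_tau mhM -[RHS]tauC -!mulmxA [LHS]tauC -!mulmxA tauC -!mulmxA.
by rewrite nr_real ler_norm.
Qed.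

(** Convergence at the vacuum extends to every polynomial vector. The matrices [pm k Q] have no
    uniform operator bound; [n2_mulr_sqr] absorbs them at the price of a square root. *)
Lemma s1_vector X T c : 0 <= c -> (forall k, mbd (X k) c) -> Nset M T -> s1 X T ->
  forall Q (e : R), 0 < e -> exists P, nr (T (pv Q) - pv P) < e /\
    U [set k : idx M | n2 (X k *m pm k Q - pm k P) < e].
Proof.
move=> c0 Xc NT hX Q e e0.
pose W := pmul Q (pstar Q).
have [b b0 hb] := bop_bounded (rop Q); have [b' b'0 hb'] := bop_bounded (rop W).
(* [t] bounds [(X - P) Q Q^*] in [n2]: the first summand accounts for [X], the others for [P]. *)
pose t := c * (nr (pv W) + 1) + b' * (nr (T Om) + 1) + 1.
have t1 : 1 <= t.
  by rewrite /t lerDr addr_ge0// mulr_ge0// addr_ge0 ?nr_ge0.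
have t0 : 0 < t by exact: lt_le_trans t1.
pose m := Num.min 1 (Num.min (e / (b + 1)) (e ^+ 2 / t)).
have b1 : 0 < b + 1 by rewrite ltr_wpDl.
have m0 : 0 < m by rewrite !lt_min ltr01 !divr_gt0// exprn_gt0.
have m1 : m <= 1 by rewrite ge_min lexx.
have mb : m * (b + 1) <= e by rewrite -ler_pdivlMr// !ge_min lexx !orbT.
have mt : m * t <= e ^+ 2 by rewrite -ler_pdivlMr// !ge_min lexx !orbT.
have [P [hP hU]] := hX m m0.
exists (pmul P Q); split.
  rewrite (Nset_vac _ NT) -ropE -bopB (le_lt_trans (hb _))//.
  have h1 := ler_wpM2l b0 (ltW hP).
  apply: (le_lt_trans h1); apply: lt_le_trans mb.
  by rewrite mulrDr mulr1 mulrC ltrDl.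
have e1 : nr (pv (pmul P W)) < b' * (nr (T Om) + 1) + 1.
  rewrite -ropE (le_lt_trans (hb' _))//.
  have h1 : nr (pv P) <= nr (T Om) + 1.
    rewrite -[X in nr X <= _](subKr (T Om)) (le_trans (ler_nrB _ _))// lerD2l.
    by rewrite (le_trans (ltW hP)).
  by rewrite (le_lt_trans (ler_wpM2l b'0 h1))// ltrDl.
have e2 : nr (pv W) < nr (pv W) + 1 by rewrite ltrDl.
apply: filterS2 (filterI hU (n2_lt e1)) (n2_lt e2) => k /= [h1 h2] h3.
rewrite pm_mul -mulmxBl -(ltr_pXn2r (n := 2)) ?nnegrE ?n2_ge0 ?(ltW e0)//.
rewrite (le_lt_trans (n2_mulr_sqr _ _))//.
have h4 : n2 ((X k - pm k P) *m (pm k Q *m mh (pm k Q))) < t.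
  rewrite -pm_star -pm_mul -/W mulmxBl -pm_mul (le_lt_trans (n2B _ _))// /t -addrA.
  by rewrite ler_ltD// (le_trans (n2_mull _ c0 (Xc k)))// ler_wpM2l// ltW.
rewrite (lt_le_trans _ mt)//.
rewrite (le_lt_trans (ler_wpM2l (n2_ge0 _) (ltW h4)))//.
by rewrite ltr_pM2r.
Qed.

(** The expectation recovers the limit of a bounded convergent sequence, so membership in C can be
    stated with [expect x] in place of an unspecified limit. *)
Lemma s1_expect x X T : block x X -> Nset M T -> s1 X T -> expect x = T.
Proof.
move=> xX NT hX; apply: expect_uniq => P Q e e0.
have [c c0 xc] := bop_bounded x.
have Xc k : mbd (X k) c by rewrite -(block_cmp k xX); exact: mbd_cmp.
pose t := nr (pv Q) + 1.
have t0 : 0 < t by rewrite ltr_wpDl ?nr_ge0.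
have d0 : 0 < e / (3 * t) by rewrite divr_gt0// mulr_gt0.
have e3 : 0 < e / 3 by rewrite divr_gt0.
have [P' [hP hU]] := s1_vector c0 Xc NT hX P d0.
have tQ : nr (pv Q) < t by rewrite ltrDl.
apply: filterS2 (filterI hU (n2_lt tQ)) (mip_cvg P' Q e3) => k /= [h1 h2] h3.
rewrite (block_cmp k xX).
have -> : mip (X k *m pm k P) (pm k Q) - ip (T (pv P)) (pv Q) =
    mip (X k *m pm k P - pm k P') (pm k Q) + (mip (pm k P') (pm k Q) - ip (pv P') (pv Q)) -
    ip (T (pv P) - pv P') (pv Q).
  have -> : mip (X k *m pm k P - pm k P') (pm k Q) = mip (X k *m pm k P) (pm k Q) - mip (pm k P') (pm k Q).
    by have := mipL (-1) (pm k P') (X k *m pm k P) (pm k Q); rewrite scaleN1r mulN1r addrC [RHS]addrC.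
  by rewrite ipBl; ring.
have h4 : nr (mip (X k *m pm k P - pm k P') (pm k Q)) <= e / 3.
  rewrite (le_trans (n2_cs _ _))//.
  have := ler_pM (n2_ge0 _) (n2_ge0 _) (ltW h1) (ltW h2); rewrite mulrC => /le_trans; apply.
  by rewrite le_eqVlt; apply/orP; left; apply/eqP; field; rewrite gt_eqF.
have h5 : nr (ip (T (pv P) - pv P') (pv Q)) <= e / 3.
  rewrite (le_trans (cauchy_schwarz _ _))//.
  have := ler_pM (nr_ge0 _) (nr_ge0 _) (ltW hP) (ltW tQ) => /le_trans; apply.
  by rewrite le_eqVlt; apply/orP; left; apply/eqP; field; rewrite gt_eqF.
rewrite (le_lt_trans (ler_nrB _ _))//.
have h6 := ler_nrD (mip (X k *m pm k P - pm k P') (pm k Q)) (mip (pm k P') (pm k Q) - ip (pv P') (pv Q)).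
have e33 : e / 3 + e / 3 + e / 3 = e by field.
rewrite -e33 ltr_leD// (le_lt_trans h6)// ler_ltD//.
Qed.

Lemma s1L (a : C) X Y S T : s1 X S -> s1 Y T -> s1 (fun k => a *: X k + Y k) (a *: S + T).
Proof.
move=> hX hY e e0.
have a1 : 0 < nr a + 1 by rewrite ltr_wpDl ?nr_ge0.
have d0 : 0 < e / (nr a + 1) by rewrite divr_gt0.
have [P [hP UP]] := hX _ d0; have [Q [hQ UQ]] := hY _ d0.
have eE : nr a * (e / (nr a + 1)) + e / (nr a + 1) = e by field; rewrite gt_eqF.
exists (pscale a P ++ Q); split.
  rewrite addbE scalebE /pv pop_cat pop_scale addbE scalebE opprD addrACA -scalerBr.
  apply: (le_lt_trans (ler_nrD _ _)).
  rewrite nrZ -eE; apply: ler_ltD hQ.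
  by apply: ler_wpM2l; [exact: nr_ge0 | exact: ltW hP].
apply: filterS2 UP UQ => k /= h1 h2.
rewrite pm_cat pm_scale opprD addrACA -scalerBr; apply: (le_lt_trans (n2D _ _)).
rewrite n2Z -eE; apply: ler_ltD h2.
by apply: ler_wpM2l; [exact: nr_ge0 | exact: ltW h1].
Qed.

Lemma s1_0 : s1 (fun k : idx M => 0) 0.
Proof.
move=> e e0; exists [::]; split.
  by rewrite zerobE /pv /pop big_nil zerobE subrr nr0.
apply: ufilter_all => k /=; rewrite /pm big_nil subrr.
by rewrite -(scale0r (0 : 'M[C]_(dm k))) n2Z nr0 mul0r.
Qed.

(** Split [X Y - P = X (Y - Q) + (X Q - P)]: the bound on [X] controls the first term and
    [s1_vector] the second. *)
Lemma s1M X Y S T c : 0 <= c -> (forall k, mbd (X k) c) -> Nset M S ->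
  s1 X S -> s1 Y T -> s1 (fun k => X k *m Y k) (bop_comp S T).
Proof.
move=> c0 Xc NS hX hY e e0.
have [b b0 hb] := bop_bounded S.
pose t := 2 * (b + c + 1); have t0 : 0 < t by rewrite mulr_gt0// ltr_wpDl ?addr_ge0.
have d0 : 0 < e / t by rewrite divr_gt0.
have e2 : 0 < e / 2 by rewrite divr_gt0.
have [Q [hQ UQ]] := hY _ d0.
have [P [hP UP]] := s1_vector c0 Xc NS hX Q e2.
have eE : (b + c + 1) * (e / t) = e / 2.
  by rewrite /t; field; rewrite gt_eqF// ltr_wpDl ?addr_ge0.
exists P; split.
  rewrite (le_lt_trans (ler_nrT (S (pv Q)) _ _))// (splitr e) ler_ltD//= -bopB.
  rewrite (le_trans (hb _))// -eE.
  by rewrite ler_pM ?nr_ge0// ?(ltW hQ)// -addrA lerDl addr_ge0.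
apply: filterS2 UQ UP => k /= h1 h2.
apply: (le_lt_trans (n2T (X k *m pm k Q) _ _)); rewrite (splitr e); apply: ler_ltD h2.
rewrite -mulmxBr.
rewrite (le_trans (n2_mull _ c0 (Xc k)))// -eE.
by rewrite ler_pM ?n2_ge0// ?(ltW h1)// addrAC lerDr addr_ge0.
Qed.

Lemma s1J X T : Nset M T -> s1 X T -> s1 (fun k => mh (X k)) (adj T).
Proof.
move=> NT hX e e0; have [P [hP UP]] := hX e e0; exists (pstar P); split.
  have -> : adj T Om - pv (pstar P) = adj (T - pop P) Om.
    by rewrite /pv pop_star -[- pop P]scaleN1r adjbD adjbZ rmorphN rmorph1 scaleN1r.
  rewrite nr_adj_vac//; apply: (@opaB _ _ (Nalg M)) => //; exact: Nset_pop.
by apply: filterS UP => k /=; rewrite pm_star -mhN -mhD n2_mh.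
Qed.

Variant Cset x : Prop := Cset_of of block x (cmp x) & s1 (cmp x) (expect x).

Lemma Cset_intro x X T : block x X -> Nset M T -> s1 X T -> Cset x /\ expect x = T.
Proof.
move=> xX NT hX; have eT := s1_expect xX NT hX.
have h k : X k = cmp x k by rewrite (block_cmp k xX).
split; last exact: eT.
by split; [move=> v k; rewrite xX h | rewrite eT; exact: s1_eq h hX].
Qed.

Lemma Cset0 : Cset 0.
Proof. by have [] := Cset_intro (@block0 _ _ _ K) (@Nset0 _ _ M) s1_0. Qed.

Lemma CsetL (a : C) x y : Cset x -> Cset y -> Cset (a *: x + y).
Proof.
move=> [bx sx] [bY sy].
have [] // := Cset_intro (blockL a bx bY) (NsetL a (expect_Nset x) (expect_Nset y)) (s1L a sx sy).
Qed.

Lemma CsetM_expect x y : Cset x -> Cset y ->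
  Cset (bop_comp x y) /\ expect (bop_comp x y) = bop_comp (expect x) (expect y).
Proof.
move=> [bx sx] [bY sy]; have [c c0 xc] := bop_bounded x.
apply: Cset_intro (blockM bx bY) (NsetM (expect_Nset x) (expect_Nset y)) _.
by apply: (s1M c0 _ (expect_Nset x) sx sy) => k; exact: mbd_cmp.
Qed.

Lemma CsetJ_expect x : Cset x -> Cset (adj x) /\ expect (adj x) = adj (expect x).
Proof.
move=> [bx sx].
exact: Cset_intro (blockJ bx) (NsetJ (expect_Nset x)) (s1J (expect_Nset x) sx).
Qed.

Lemma expectB x y : expect (x - y) = expect x - expect y.
Proof.
have := expectL (-1) y x; rewrite !scaleN1r addrC => ->; exact: addrC.
Qed.

Lemma mbd_n2 d (x : 'M[C]_d) (c : R) : 0 <= c -> mbd x c -> n2 x <= c.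
Proof.
move=> c0 xc; rewrite -[x]mulmx1 (le_trans (n2_mull _ c0 xc))//.
rewrite -[leRHS]mulr1 ler_wpM2l//.
rewrite -(ler_pXn2r (n := 2)) ?nnegrE ?n2_ge0// expr1n n2_sqr.
rewrite (eq_bigr (fun=> 1)) => [|b _]; last first.
  rewrite (bigD1 b)//= mxE eqxx nr1 expr1n big1 ?addr0// => a /negbTE ab.
  by rewrite mxE ab nr0 expr0n.
rewrite sumr_const card_ord -(mulr_natr 1) mul1r.
by case: (d) => [|m]; rewrite ?invr0 ?mul0r// mulVf// pnatr_eq0.
Qed.

Lemma Cset_closed x : (forall e : R, 0 < e -> exists2 y, Cset y &
    forall v : K, nr (x v - y v) <= e * nr v) -> Cset x.
Proof.
move=> h; split.
  move=> v k; apply: subr0_eq; apply: vn2_eq0; apply/eqP.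
  rewrite eq_le vn2_ge0 andbT; apply: le_eps => e e0.
  pose t := 4 * (nr v ^+ 2 + 1); have t0 : 0 < t by rewrite mulr_gt0// ltr_wpDl ?sqr_ge0.
  have d0 : 0 < Num.min 1 (e / t) by rewrite lt_min ltr01 divr_gt0.
  have [y [bY _] hy] := h _ d0.
  set m := Num.min 1 (e / t) in hy d0; have m1 : m <= 1 by rewrite ge_min lexx.
  have mt : m * t <= e by rewrite -ler_pdivlMr// ge_min lexx orbT.
  have mm : m ^+ 2 <= m by rewrite expr2 ler_piMl// ltW.
  have hxy (w : K) : nr ((x - y) w) <= m * nr w by exact: hy.
  have -> : bv (x v) k - cmp x k *m bv v k = bv (x v - y v) k - cmp (x - y) k *m bv v k.
    have bvB (w w' : K) : bv (w - w') k = bv w k - bv w' k.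
      by have := bvL (-1) w' w k; rewrite !scaleN1r addrC => ->; exact: addrC.
    have -> : cmp (x - y) k = cmp x k - cmp y k.
      by have := cmpL (-1) y x k; rewrite !scaleN1r addrC => ->; exact: addrC.
    by rewrite mulmxBl bvB (bY v k); zmodule.
  have h1 : vn2 (bv (x v - y v) k) <= m ^+ 2 * nr v ^+ 2.
    by rewrite (le_trans (vn2_bv_le _ _))// -exprMn ler_pXn2r ?nnegrE ?mulr_ge0 ?nr_ge0 ?(ltW d0).
  have h2 : vn2 (cmp (x - y) k *m bv v k) <= m ^+ 2 * nr v ^+ 2.
    rewrite (le_trans (mbd_cmp hxy _))// ler_wpM2l ?sqr_ge0//.
    exact: vn2_bv_le.
  have h3 (u w : 'cV[C]_(dm k)) : vn2 (u - w) <= 2 * vn2 u + 2 * vn2 w.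
    have := vn2_ge0 (u + w); rewrite vn2_cvipD vn2_cvipB; lra.
  rewrite add0r (le_trans (h3 _ _))//.
  have h4 := ler_wpM2r (sqr_ge0 (nr v)) mm.
  move: mt; rewrite /t; move: h1 h2 h4 d0; lra.
move=> e e0; have e3 : 0 < e / 3 by rewrite divr_gt0.
pose t := 3 * (nr Om + 1); have t0 : 0 < t by rewrite mulr_gt0// ltr_wpDl ?nr_ge0.
have d0 : 0 < Num.min (e / 3) (e / t) by rewrite lt_min e3 divr_gt0.
have [y [bY sy] hy] := h _ d0.
set m := Num.min (e / 3) (e / t) in hy d0.
have m3 : m <= e / 3 by rewrite ge_min lexx.
have mt : m * t <= e by rewrite -ler_pdivlMr// ge_min lexx orbT.
have hxy (w : K) : nr ((x - y) w) <= m * nr w by exact: hy.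
have [P [hP UP]] := sy _ e3.
exists P; split.
  rewrite (le_lt_trans (ler_nrT (expect y Om) _ _))//.
  have := expect_bound (ltW d0) hxy Om; rewrite expectB subbE.
  move: mt hP d0; rewrite /t; have := nr_ge0 Om; lra.
apply: filterS UP => k /= hk.
rewrite (le_lt_trans (n2T (cmp y k) _ _))//.
have -> : cmp x k - cmp y k = cmp (x - y) k.
  by have := cmpL (-1) y x k; rewrite !scaleN1r addrC => ->; exact: addrC.
have e33 : e / 3 + e / 3 <= e by rewrite -mulr2n -mulr_natr; move: e0; lra.
apply: lt_le_trans e33; apply: ler_ltD hk.
exact: le_trans (mbd_n2 (ltW d0) (mbd_cmp (k := k) hxy)) m3.
Qed.

Definition Calg : opAlgebra K := @OpAlgebra _ _ Cset Cset0 CsetL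
  (fun x y hx hy => (CsetM_expect hx hy).1) (fun x hx => (CsetJ_expect hx).1) Cset_closed.

Lemma expect_lift n (T : 'I_n -> 'I_n -> bop F) :
  (forall i j, Nset M (T i j)) -> mxnorm T < 1 ->
  exists a : 'I_n -> 'I_n -> bop K, [/\ forall i j, Cset (a i j),
    forall i j, expect (a i j) = T i j & forall v : 'I_n -> K, l2 (act a v) <= l2 v].
Proof.
move=> NT T1; have [X Xc sX] := lift_contraction NT T1.
have [a ha] : exists a : 'I_n * 'I_n -> bop K, forall p, block (a p) (fun k => X k p.1 p.2).
  apply: (@ex_choice _ _ (fun (p : 'I_n * 'I_n) (a : bop K) =>
    block a (fun k => X k p.1 p.2))) => p.
  by apply: (@block_exists _ _ _ K _ 1) => k; exact: mcb_entry (Xc k).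
have hC i j := Cset_intro (ha (i, j)) (NT i j) (sX i j).
exists (fun i j => a (i, j)); split=> [i j|i j|v]; [exact: (hC i j).1|exact: (hC i j).2|].
rewrite -[leRHS]mul1r.
exact: (@block_mcb _ _ _ K n (fun i j => a (i, j)) X 1 ler01 (fun i j => ha (i, j)) Xc).
Qed.

(** The kernel of [expect] on C; [Jset_intro] and [Jset_n2] identify it with the block diagonal
    operators whose blocks tend to 0 in [n2]. *)
Variant Jset x : Prop := Jset_of of Cset x & expect x = 0.

Lemma Jset_intro x X : block x X -> (forall e : R, 0 < e -> U [set k : idx M | n2 (X k) < e]) -> Jset x.
Proof.
move=> bx hX; have [|Cx ex] := Cset_intro bx (@Nset0 _ _ M); last by split.
move=> e e0; exists [::]; split.
  by rewrite zerobE /pv /pop big_nil zerobE subrr nr0.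
by apply: filterS (hX e e0) => k /=; rewrite /pm big_nil subr0.
Qed.

Lemma Jset_n2 x : Jset x -> forall e : R, 0 < e -> U [set k : idx M | n2 (cmp x k) < e].
Proof.
move=> [[bx sx] ex] e e0; have e2 : 0 < e / 2 by rewrite divr_gt0.
have [P [hP UP]] := sx _ e2; rewrite ex zerobE sub0r nrN in hP.
apply: filterS2 UP (n2_lt hP) => k /= h1 h2.
by rewrite -[cmp x k](subrK (pm k P)) (le_lt_trans (n2D _ _))// (splitr e) ltrD.
Qed.

Lemma Jset_L (a : C) x y : Jset x -> Jset y -> Jset (a *: x + y).
Proof.
move=> [Cx ex] [Cy ey]; split; first exact: CsetL.
by rewrite expectL ex ey scaler0 addr0.
Qed.

Lemma Jset_Ml x y : Cset x -> Jset y -> Jset (bop_comp x y).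
Proof.
move=> Cx [Cy ey]; have [h1 h2] := CsetM_expect Cx Cy.
by split; [exact: h1 | rewrite h2 ey compb0].
Qed.

Lemma Jset_Mr x y : Jset x -> Cset y -> Jset (bop_comp x y).
Proof.
move=> [Cx ex] Cy; have [h1 h2] := CsetM_expect Cx Cy.
by split; [exact: h1 | rewrite h2 ex comp0b].
Qed.

Lemma Jset_J x : Jset x -> Jset (adj x).
Proof.
move=> [Cx ex]; have [h1 h2] := CsetJ_expect Cx.
by split; [exact: h1 | rewrite h2 ex adjb0].
Qed.

Lemma Jset_Cset x : Jset x -> Cset x. Proof. by case. Qed.

Lemma Jset_expect x : Jset x -> expect x = 0. Proof. by case. Qed.

Lemma Cset_block x : Cset x -> block x (cmp x). Proof. by case. Qed.

Lemma Jset_block x : Jset x -> block x (cmp x). Proof. by move=> [[]]. Qed.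

Lemma Jset0 : Jset 0.
Proof.
split; first exact: Cset0.
by have := expectL (-1) (0 : bop K) 0; rewrite scaler0 addr0 scaleN1r addNr.
Qed.

Lemma Jset_LC (t : C) x y : Cset x -> Cset y -> t *: expect x + expect y = 0 ->
  Jset (t *: x + y).
Proof. by move=> Cx Cy h; split; [exact: CsetL | rewrite expectL]. Qed.

End Corona.

(** * An approximate unit of projections *)

Section SpectralCut.
Variables (R : realType) (d : nat).
Local Notation C := R[i].
Implicit Types (x y e : 'M[C]_d) (u : 'cV[C]_d).

Lemma unitary_vn2 x u : mh x *m x = 1%:M -> vn2 (x *m u) = vn2 u.
Proof.
move=> h; have : cvip (x *m u) (x *m u) = cvip u u by rewrite cvip_mh mulmxA h mul1mx.
by rewrite !cvipxx => -[].
Qed.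

Lemma unitary_mbd x : mh x *m x = 1%:M -> mbd x 1.
Proof. by move=> h u; rewrite unitary_vn2// expr1n mul1r. Qed.

Lemma projection_mbd e : mh e = e -> e *m e = e -> mbd e 1.
Proof.
move=> eJ ee u; rewrite expr1n mul1r.
have h : cvip u (e *m u) = (vn2 (e *m u))%:C.
  by rewrite -cvipxx [RHS]cvip_mh eJ mulmxA ee.
have := vn2_ge0 (u - e *m u); rewrite vn2_cvipB h /=; lra.
Qed.

Lemma gram_diagonalization y : exists W : 'M[C]_d,
  [/\ mh W *m W = 1%:M, W *m mh W = 1%:M &
      forall a b, a != b -> (mh (y *m mh W) *m (y *m mh W)) a b = 0].
Proof.
pose h := mh y *m y.
have hJ : mh h = h by rewrite /h mhM mhK.
have hN : h \is normalmx by apply/normalmxP; rewrite -[(h ^t* )%sesqui]/(mh h) hJ.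
pose W := spectralmx h.
have WW : W *m mh W = 1%:M by apply/unitarymxP; exact: spectral_unitarymx.
have WW' : mh W *m W = 1%:M by exact: mulmx1C.
have Wi : invmx W = mh W.
  by rewrite -[LHS]mulmx1 -WW mulmxA mulVmx ?mul1mx//; case/mulmx1_unit: WW.
exists W; split=> // a b ab.
have -> : mh (y *m mh W) *m (y *m mh W) = W *m h *m mh W by rewrite mhM mhK !mulmxA.
have /orthomx_spectralP -> := hN.
rewrite -/W Wi !mulmxA WW mul1mx -mulmxA WW mulmx1 mxE.
by rewrite (negbTE ab).
Qed.

(** [e] is the spectral projection of [y^* y] for eigenvalues above [r ^ 2]. Off [e] the matrix is
    bounded by [r]; on it [y^* y] dominates [r ^ 2], which gives a Chebyshev inequality for the
    trace. *)
Lemma spectral_cut y (r : R) : 0 < r -> exists e,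
  [/\ mh e = e, e *m e = e, mbd (y *m (1%:M - e)) r & r * n2 e <= n2 y].
Proof.
move=> r0; have [W [WW' WW zD]] := gram_diagonalization y.
pose z := y *m mh W; pose g a := vn2 (col a z).
pose P : 'M[C]_d := diag_mx (\row_(a < d) (r ^+ 2 < g a)%R%:R).
have PJ : mh P = P.
  apply/matrixP => a b; rewrite !mxE rmorphMn /= rmorph_nat.
  by case: eqVneq => [->|ab]; rewrite ?eqxx// !mulr0n.
have PP : P *m P = P.
  rewrite mulmx_diag; congr diag_mx; apply/rowP => a; rewrite !mxE.
  by case: (_ < _); rewrite ?mulr1 ?mulr0.
have P1 t a : ((1%:M - P) *m t) a 0 = (g a <= r ^+ 2)%R%:R * t a 0 :> C.
  rewrite mulmxBl mul1mx mul_diag_mx !mxE leNgt.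
  by case: (_ < _); rewrite ?mul1r ?mul0r ?subrr ?subr0.
have zt t : vn2 (z *m t) = \sum_a g a * nr (t a 0) ^+ 2.
  apply: (@complexI R); rewrite -cvipxx cvip_mh mulmxA rmorph_sum; apply: eq_bigr => a _.
  rewrite mxE (bigD1 a)//= big1 ?addr0 => [|b ba]; last by rewrite zD ?mul0r// eq_sym.
  have -> : (mh z *m z) a a = (g a)%:C.
    rewrite mxE rmorph_sum; apply: eq_bigr => b _.
    by rewrite mhE [col a z b 0]mxE /= -mulCJ mulrC.
  by rewrite [Num.conj _]rmorphM /= conj_real mulrCA mulCJ -rmorphM.
exists (mh W *m P *m W); split.
- by rewrite !mhM mhK PJ mulmxA.
- by rewrite !mulmxA -[mh W *m P *m W *m mh W]mulmxA WW mulmx1 -[mh W *m P *m P]mulmxA PP.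
- move=> u; pose s := W *m u.
  have -> : y *m (1%:M - mh W *m P *m W) *m u = z *m ((1%:M - P) *m s).
    rewrite /z /s -!mulmxA; congr (_ *m _).
    by rewrite !mulmxBl !mul1mx mulmxBr !mulmxA WW' mul1mx.
  rewrite zt -(unitary_vn2 u WW') -/s /vn2 mulr_sumr ler_sum// => a _.
  rewrite P1; case: (leP (g a) (r ^+ 2)) => h; first by rewrite mulr1n mul1r ler_wpM2r ?sqr_ge0.
  by rewrite mulr0n mul0r nr0 expr0n mulr0 mulr_ge0 ?sqr_ge0.
- have W1 := unitary_mbd WW'; have W2 : mbd (mh W) 1 by apply: unitary_mbd; rewrite mhK.
  have h1 : n2 (mh W *m P *m W) <= n2 P.
    rewrite (le_trans (n2_mulr _ ler01 W1))// mul1r (le_trans (n2_mull _ ler01 W2))//.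
    by rewrite mul1r.
  have h2 : n2 z <= n2 y by rewrite (le_trans (n2_mulr _ ler01 W2))// mul1r.
  apply: le_trans (ler_wpM2l (ltW r0) h1) _; apply: le_trans h2.
  rewrite -(ler_pXn2r (n := 2)) ?nnegrE ?mulr_ge0 ?n2_ge0 ?(ltW r0)// exprMn.
  rewrite n2_sqr n2_col mulrCA ler_wpM2l ?invr_ge0// mulr_sumr ler_sum// => b _.
  rewrite (bigD1 b)//= big1 ?addr0 => [|a ab]; last first.
    by rewrite !mxE (negbTE ab) mulr0n nr0 expr0n.
  rewrite !mxE eqxx mulr1n -/(g b); case: (ltP (r ^+ 2) (g b)) => h.
    by rewrite mulr1n nr1 expr1n mulr1 ltW.
  by rewrite mulr0n nr0 expr0n mulr0 vn2_ge0.
Qed.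

End SpectralCut.

Section ApproximateUnit.
Variables (R : realType) (F : complexHilbert R) (M : matricial F).
Variable (K : directSum R (@dm R F M)).
Local Notation C := R[i].
Local Notation ip := (inner K).
Local Notation U := (ufilter M).
Local Notation cmp := (@cmp R _ _ K).
Local Notation block := (@block R _ _ K).
Local Notation Cset := (@Cset R F M K).
Local Notation Jset := (@Jset R F M K).
#[local] Existing Instance ufilterP.
Implicit Types (x y e j : bop K).

Lemma adj_bound (H : complexHilbert R) (T : bop H) (c : R) : 0 <= c ->
  (forall v : H, nr (T v) <= c * nr v) -> forall v, nr (adj T v) <= c * nr v.
Proof.
move=> c0 h v; have [->|Tv0] := eqVneq (nr (adj T v)) 0; first by rewrite mulr_ge0 ?nr_ge0.
have t0 : 0 < nr (adj T v) by rewrite lt_def nr_ge0 Tv0.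
rewrite -(ler_pM2r t0) -expr2 nr_sqr_ip -adjP (le_trans (Re_ip_le _ _))//.
have := ler_wpM2r (nr_ge0 v) (h (adj T v)); lra.
Qed.

Variant jproj e : Prop := Jproj of Jset e & adj e = e & bop_comp e e = e.

Lemma jproj_ip e v : jproj e -> ip (e v) v = ((nr (e v)) ^+ 2)%:C.
Proof.
move=> [_ eJ ee]; rewrite -ipxx.
have -> : ip (e v) (e v) = ip (e (e v)) v by rewrite adjP' eJ.
by rewrite -[e (e v)]/(bop_comp e e v) ee.
Qed.

Lemma jproj_pyth e v : jproj e -> nr (e v) ^+ 2 + nr (v - e v) ^+ 2 = nr v ^+ 2.
Proof.
move=> he; rewrite nr_sqrB.
have -> : complex.Re (ip v (e v)) = nr (e v) ^+ 2 by rewrite ipC cRe_conj jproj_ip.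
by ring.
Qed.

Lemma jproj_le e v : jproj e -> nr (e v) <= nr v.
Proof.
move=> /(jproj_pyth v) h; rewrite -(ler_pXn2r (n := 2)) ?nnegrE ?nr_ge0// -h.
by rewrite lerDl sqr_ge0.
Qed.

Lemma jproj_leC e v : jproj e -> nr (v - e v) <= nr v.
Proof.
move=> /(jproj_pyth v) h; rewrite -(ler_pXn2r (n := 2)) ?nnegrE ?nr_ge0// -h.
by rewrite lerDr sqr_ge0.
Qed.

Lemma jproj_cut j (r : R) : Jset j -> 0 < r ->
  exists2 e, jproj e & forall v : K, nr (j (v - e v)) <= r * nr v.
Proof.
move=> Jj r0.
have [X hX] : exists X : forall k : idx M, 'M[C]_(dm k), forall k,
    [/\ mh (X k) = X k, X k *m X k = X k, mbd (cmp j k *m (1%:M - X k)) r &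
        r * n2 (X k) <= n2 (cmp j k)].
  exact: (dep_choice (fun k => spectral_cut (cmp j k) r0)).
have [e be] : exists e : bop K, block e X.
  apply: (@block_exists _ _ _ K _ 1) => k; have [h1 h2 _ _] := hX k.
  exact: projection_mbd.
have bj := Jset_block Jj.
exists e; first split.
- apply: (Jset_intro be) => t t0.
  apply: filterS (Jset_n2 Jj (mulr_gt0 r0 t0)) => k /= hk; have [_ _ _ h4] := hX k.
  by rewrite -(ltr_pM2l r0); exact: le_lt_trans h4 hk.
- apply: (block_uniq (blockJ be)) => v k; rewrite be.
  by have [-> _ _ _] := hX k.
- apply: (block_uniq (blockM be be)) => v k; rewrite be.
  by have [_ -> _ _] := hX k.
- have bb : block (bop_comp j (bop_id K - e)) (fun k => cmp j k *m (1%:M - X k)).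
    apply: blockM bj _; have := blockL (-1) be (@block1 _ _ _ K).
    move=> h v k; have := h v k; rewrite !scaleN1r addrC => ->; by rewrite addrC.
  move=> v; apply: (block_bound (ltW r0) bb) => k; by have [_ _ h _] := hX k.
Qed.

(** The conditions are directed: for [j = j1^* j1 + j2^* j2] one has
    [|j1 w|^2 + |j2 w|^2 = <j w, w>], so a cut of [j] at the square of the smaller tolerance serves
    both. *)
Lemma approximate_unit : exists V : set_system (bop K),
  [/\ UltraFilter V, V [set e | jproj e] &
      forall j, Jset j -> forall r : R, 0 < r ->
        V [set e | forall v : K, nr (j (v - e v)) <= r * nr v]].
Proof.
pose I := {p : bop K * R | Jset p.1 /\ 0 < p.2}.
pose D (i : I) := [set e : bop K | jproj e /\
  forall v : K, nr ((proj1_sig i).1 (v - e v)) <= (proj1_sig i).2 * nr v].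
have J0 : Jset 0 by exact: Jset0.
have i0 : I by exists (0, 1); split.
have [|i|V [UV hV]] := @ultra_of_base _ I D i0.
- move=> [[j1 r1] /= [J1 r10]] [[j2 r2] /= [J2 r20]].
  pose j := bop_comp (adj j1) j1 + bop_comp (adj j2) j2.
  have Jj : Jset j.
    rewrite /j -[X in X + _]scale1r; apply: Jset_L; apply: Jset_Ml => //.
      exact: Jset_Cset (Jset_J J1).
    exact: Jset_Cset (Jset_J J2).
  pose r := Num.min r1 r2; have r0 : 0 < r by rewrite lt_min r10.
  exists (exist _ (j, r ^+ 2) (conj Jj (exprn_gt0 2 r0))) => e /= [he hj].
  have main v : nr (j1 (v - e v)) ^+ 2 + nr (j2 (v - e v)) ^+ 2 <= (r * nr v) ^+ 2.
    have -> : nr (j1 (v - e v)) ^+ 2 + nr (j2 (v - e v)) ^+ 2 =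
        complex.Re (ip (j (v - e v)) (v - e v)).
      by rewrite !nr_sqr_ip -cReD [j _]addbE ipDl /= -!adjP'.
    rewrite (le_trans (Re_ip_le _ _))// exprMn [nr v ^+ 2]expr2 mulrA.
    by rewrite ler_pM ?nr_ge0//; exact: jproj_leC.
  split=> /=; split=> // v.
    rewrite (@le_trans _ _ (r * nr v))//; last by rewrite ler_wpM2r ?nr_ge0// ge_min lexx.
    rewrite -(ler_pXn2r (n := 2)) ?nnegrE ?mulr_ge0 ?nr_ge0 ?(ltW r0)//.
    by apply: le_trans (main v); rewrite lerDl sqr_ge0.
  rewrite (@le_trans _ _ (r * nr v))//; last by rewrite ler_wpM2r ?nr_ge0// ge_min lexx orbT.
  rewrite -(ler_pXn2r (n := 2)) ?nnegrE ?mulr_ge0 ?nr_ge0 ?(ltW r0)//.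
  by apply: le_trans (main v); rewrite lerDr sqr_ge0.
- case: i => -[j r] /= [Jj r0]; have [e he hj] := jproj_cut Jj r0.
  by exists e.
exists V; split=> //; first by apply: filterS (hV i0) => e [].
move=> j Jj r r0.
by apply: filterS (hV (exist _ (j, r) (conj Jj r0))) => e [].
Qed.

End ApproximateUnit.

(** * Weak expectation and quotient *)

Section WeakExpectation.
Variables (R : realType) (F : complexHilbert R) (M : matricial F).
Variable (K : directSum R (@dm R F M)).
Local Notation C := R[i].
Local Notation ip := (inner K).
Local Notation cmp := (@cmp R _ _ K).
Local Notation block := (@block R _ _ K).
Local Notation Cset := (@Cset R F M K).
Local Notation Jset := (@Jset R F M K).
Local Notation jproj := (@jproj R F M K).
Local Notation expect := (@expect R F M K).
Local Notation I1 := (bop_id K).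
#[local] Existing Instance ufilterP.
Implicit Types (x y e a : bop K).

Definition vfilter : set_system (bop K) := projT1 (cid (approximate_unit K)).
Local Notation V := vfilter.

Lemma vfilterP : UltraFilter V.
Proof. by have [] := projT2 (cid (approximate_unit K)). Qed.
#[local] Existing Instance vfilterP.

Lemma vfilter_jproj : V [set e | jproj e].
Proof. by have [] := projT2 (cid (approximate_unit K)). Qed.

Lemma vfilter_cut (j : bop K) (r : R) : Jset j -> 0 < r ->
  V [set e | forall v : K, nr (j (v - e v)) <= r * nr v].
Proof. by have [_ _ h] := projT2 (cid (approximate_unit K)) => /h; exact. Qed.

Definition normle x (c : R) := forall v : K, nr (x v) <= c * nr v.

Lemma normle_comp x y b c : 0 <= b -> normle x b -> normle y c -> normle (bop_comp x y) (b * c).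
Proof.
move=> b0 hx hy v; apply: (le_trans (hx _)).
by rewrite -mulrA; apply: ler_wpM2l.
Qed.

Lemma normleD x y b c : normle x b -> normle y c -> normle (x + y) (b + c).
Proof.
move=> hx hy v; apply: (le_trans (ler_nrD _ _)); rewrite mulrDl.
by apply: lerD; [exact: hx | exact: hy].
Qed.

Lemma normle_proj e : jproj e -> normle e 1.
Proof. by move=> he v; rewrite mul1r; exact: jproj_le. Qed.

Lemma normle_projC e : jproj e -> normle (I1 - e) 1.
Proof. by move=> he v; rewrite mul1r; exact: (jproj_leC v he). Qed.

Lemma Cset1 : Cset I1.
Proof.
have [] // := @Cset_intro _ _ _ K I1 (fun k => 1%:M) (bop_id F) (@block1 _ _ _ K) (@Nset1 _ _ _).
move=> t t0; exists (pone M); split; first by rewrite pv_one subrr nr0.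
apply: ufilter_all => k /=; rewrite pm_one subrr.
by rewrite -(scale0r (0 : 'M[C]_(dm k))) n2Z nr0 mul0r.
Qed.

Lemma CsetB x y : Cset x -> Cset y -> Cset (x - y).
Proof. exact: (@opaB _ _ (Calg K)). Qed.

Lemma CsetD x y : Cset x -> Cset y -> Cset (x + y).
Proof. exact: (@opaD _ _ (Calg K)). Qed.

Lemma CsetZ (t : C) x : Cset x -> Cset (t *: x).
Proof. exact: (@opaZ _ _ (Calg K)). Qed.

Lemma CsetM x y : Cset x -> Cset y -> Cset (bop_comp x y).
Proof. exact: (@opaM _ _ (Calg K)). Qed.

Lemma CsetJ x : Cset x -> Cset (adj x).
Proof. exact: (@opaJ _ _ (Calg K)). Qed.

Lemma Cset_jproj e : jproj e -> Cset e.
Proof. by move=> [/Jset_Cset]. Qed.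

Lemma Cset_projC e : jproj e -> Cset (I1 - e).
Proof. by move=> he; apply: CsetB; [exact: Cset1 | exact: Cset_jproj]. Qed.

(** Bounded functionals on C, represented by functions on all of B(K) whose values outside [Cset]
    are arbitrary. *)
Variant cfunc (g : bop K -> C) (b : R) : Prop := Cfunc of 0 <= b &
  (forall (t : C) x y, Cset x -> Cset y -> g (t *: x + y) = t * g x + g y) &
  (forall x (c : R), 0 <= c -> Cset x -> normle x c -> nr (g x) <= b * c).

Lemma cfunc0 g b : cfunc g b -> g 0 = 0.
Proof.
move=> [_ gL _]; have := gL 1 0 0 (Cset0 K) (Cset0 K); rewrite scaler0 addr0 mul1r.
by move=> /eqP; rewrite -subr_eq subrr => /eqP.
Qed.

Lemma cfuncD g b x y : cfunc g b -> Cset x -> Cset y -> g (x + y) = g x + g y.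
Proof. by move=> [_ gL _] hx hy; have := gL 1 x y hx hy; rewrite scale1r mul1r. Qed.

Lemma cfuncB g b x y : cfunc g b -> Cset x -> Cset y -> g (x - y) = g x - g y.
Proof.
by move=> [_ gL _] hx hy; have := gL (-1) y x hy hx; rewrite scaleN1r mulN1r !(addrC (- _)).
Qed.

Definition corner e a := bop_comp (bop_comp e a) (I1 - e).

Lemma Jset_corner e a : jproj e -> Cset a -> Jset (corner e a).
Proof.
move=> he Ca; have [Je _ _] := he.
by apply: Jset_Mr; [exact: Jset_Mr | exact: Cset_projC].
Qed.

Lemma corner_adj e a v : jproj e -> adj (corner e a) v = adj a (e v) - e (adj a (e v)).
Proof.
move=> [_ eJ _]; rewrite /corner !adjbM eJ /=.
have -> : adj (I1 - e) = I1 - e.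
  by rewrite -[- e]scaleN1r adjbD adjbZ rmorphN rmorph1 adjb1 eJ.
by [].
Qed.

(* The corners e a (1 - e), for e taken successively larger, have nearly
   orthogonal initial spaces: the norm of a sum of n of them is O(sqrt n). *)
Lemma corner_sum g b a k L : cfunc g b -> 0 <= k -> Cset a -> normle a k ->
  ucvg V (fun e => g (corner e a)) L -> forall t : R, 0 < t -> forall n : nat,
  exists Y, [/\ Jset Y, forall v, nr (adj Y v) ^+ 2 <= n%:R * (k ^+ 2 + 1) * nr v ^+ 2 &
    nr (g Y - n%:R * L) <= n%:R * t].
Proof.
move=> gb k0 Ca ak gL t t0; elim=> [|n [Y [JY hY gY]]].
  exists 0; split; [exact: Jset0| |].
    by move=> v; rewrite adjb0 zerobE nr0 expr0n !mul0r.
  by rewrite (cfunc0 gb) !mul0r subrr nr0.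
(* The cross term between [adj Y] and the adjoint of the new corner is at most [r k |v|^2]; this [r]
   makes twice that at most [|v|^2], whence the [+ 1] beside [k ^ 2]. *)
pose r := (2 * k + 1)^-1; have k1 : 0 < 2 * k + 1 by rewrite ltr_wpDl ?mulr_ge0.
have r0 : 0 < r by rewrite invr_gt0.
have rk : 2 * (r * k) <= 1.
  rewrite mulrCA -ler_pdivlMl// invrK mulr1; lra.
have [e /= [[he hg] hc]] := ultra_ex vfilterP
  (filterI (filterI vfilter_jproj (gL t t0)) (vfilter_cut JY r0)).
exists (Y + corner e a); split.
- by rewrite -[Y]scale1r; apply: Jset_L; [exact: JY | exact: Jset_corner].
- move=> v; rewrite adjbD addbE nr_sqrD corner_adj//.
  set w := adj a (e v).
  have hw : nr w <= k * nr v.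
    rewrite (le_trans (adj_bound k0 ak _))//; apply: ler_wpM2l => //.
    exact: jproj_le.
  have h1 : nr (w - e w) ^+ 2 <= k ^+ 2 * nr v ^+ 2.
    rewrite -exprMn ler_pXn2r ?nnegrE ?nr_ge0 ?mulr_ge0 ?nr_ge0//.
    exact: le_trans (jproj_leC w he) hw.
  have h2 : complex.Re (ip (adj Y v) (w - e w)) <= r * k * nr v ^+ 2.
    rewrite adjP adjbK (le_trans (Re_ip_le _ _))//.
    apply: le_trans (ler_wpM2l (nr_ge0 v) (le_trans (hc w) (ler_wpM2l (ltW r0) hw))) _.
    by rewrite le_eqVlt; apply/orP; left; apply/eqP; ring.
  have h3 := ler_wpM2r (sqr_ge0 (nr v)) rk.
  have := hY v; rewrite -natr1; move: h1 h2 h3; lra.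
- rewrite (cfuncD gb (Jset_Cset JY) (Jset_Cset (Jset_corner he Ca))).
  have -> : g Y + g (corner e a) - n.+1%:R * L = (g Y - n%:R * L) + (g (corner e a) - L).
    by rewrite -natr1; ring.
  apply: (le_trans (ler_nrD _ _)); rewrite -[n.+1%:R]natr1 mulrDl mul1r.
  by apply: lerD; [exact: gY | exact: ltW].
Qed.

Lemma corner_normle e a k : 0 <= k -> normle a k -> jproj e -> normle (corner e a) k.
Proof.
move=> k0 ak he; rewrite -[k]mul1r -[1 * k]mulr1.
apply: normle_comp (normle_projC he); first by rewrite mul1r.
by apply: normle_comp ak => //; exact: normle_proj.
Qed.

(** A nonzero limit [L] would give [n |L| / 2 <= |g Y| <= b sqrt (n (k^2 + 1))] for every [n], by
    [corner_sum]. Thus the projections are asymptotically central against every bounded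
    functional. *)
Lemma corner_cvg g b a : cfunc g b -> Cset a -> ucvg V (fun e => g (corner e a)) 0.
Proof.
move=> gb Ca; have [k k0 ak] := bop_bounded a; have [b0 _ gbd] := gb.
have [|L hL] := @ucvg_exists _ _ _ vfilterP (fun e => g (corner e a)) (b * k).
  apply: filterS vfilter_jproj => e /= he; apply: gbd => //.
    by apply: Jset_Cset; exact: Jset_corner.
  exact: corner_normle.
suff L0 : L = 0 by rewrite -L0.
apply/eqP; rewrite -nr_eq0; apply/negP => /negP L0.
have l0 : 0 < nr L by rewrite lt_def nr_ge0 L0.
have l2 : 0 < nr L / 2 by rewrite divr_gt0.
pose s := k ^+ 2 + 1; have s0 : 0 < s by rewrite ltr_wpDl ?sqr_ge0.
have q0 : 0 < (nr L / 2) ^+ 2 / (b ^+ 2 * s + 1).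
  by rewrite divr_gt0 ?exprn_gt0// ltr_wpDl// mulr_ge0 ?sqr_ge0 ?(ltW s0).
have [n hn] := inv_nat_lt q0.
have [Y [JY hY gY]] := corner_sum gb k0 Ca ak hL l2 n.+1.
have N0 : 0 < n.+1%:R :> R by [].
pose N : R := n.+1%:R.
have Yn : normle Y (Num.sqrt (N * s)).
  rewrite -[Y]adjbK; apply: adj_bound => [|v]; first exact: sqrtr_ge0.
  rewrite -(ler_pXn2r (n := 2)) ?nnegrE ?mulr_ge0 ?nr_ge0 ?sqrtr_ge0// exprMn sqr_sqrtr.
    exact: hY.
  by rewrite mulr_ge0// ltW.
have h1 := gbd _ _ (sqrtr_ge0 _) (Jset_Cset JY) Yn.
have h2 : N * (nr L / 2) <= b * Num.sqrt (N * s).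
  have h3 : nr (n.+1%:R * L) <= nr (g Y) + nr (g Y - n.+1%:R * L).
    by rewrite -[X in nr X <= _](subKr (g Y)) ler_nrB.
  move: h3; rewrite nrM -(rmorph_nat (real_complex R)) nr_real ger0_norm// rmorph_nat -/N.
  move: gY h1; rewrite -/N; lra.
have h3 : (N * (nr L / 2)) ^+ 2 <= (b * Num.sqrt (N * s)) ^+ 2.
  by rewrite ler_pXn2r ?nnegrE ?mulr_ge0 ?sqrtr_ge0// ltW// mulr_gt0.
rewrite !exprMn sqr_sqrtr ?mulr_ge0 ?(ltW s0)// in h3.
move: hn; rewrite ltr_pdivlMr ?ltr_wpDl ?mulr_ge0 ?sqr_ge0 ?(ltW s0)//.
rewrite mulrC ltr_pdivrMr// -/N => h4.
have h5 : N * (b ^+ 2 * s + 1) < N * ((nr L / 2) ^+ 2 * N) by rewrite ltr_pM2l.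
move: h3 h5; rewrite exprMn; move: (nr L) (b ^+ 2) N0; rewrite -/N; move: (N) => p q z p0; nra.
Qed.

Lemma cfunc_conj g b : cfunc g b -> cfunc (fun x => Num.conj (g (adj x))) b.
Proof.
move=> [b0 gL gb]; split=> // [t x y Cx Cy|x c c0 Cx xc].
  by rewrite adjbD adjbZ gL ?rmorphD ?rmorphM /= ?conjCK//; exact: CsetJ.
by rewrite nr_conj; apply: gb => //; [exact: CsetJ | exact: adj_bound].
Qed.

Lemma cornerC_cvg g b a : cfunc g b -> Cset a ->
  ucvg V (fun e => g (bop_comp (bop_comp (I1 - e) a) e)) 0.
Proof.
move=> gb Ca; have := ucvg_conj vfilterP (corner_cvg (cfunc_conj gb) (CsetJ Ca)).
rewrite rmorph0; apply: (ucvg_near vfilterP).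
apply: filterS vfilter_jproj => e [_ eJ _] /=; rewrite conjCK; congr g.
rewrite /corner !adjbM adjbK eJ -[- e]scaleN1r adjbD adjbZ rmorphN rmorph1 adjb1 eJ.
by rewrite compbA.
Qed.

Lemma diag_exists x : exists y, block y (cmp x).
Proof.
have [c c0 xc] := bop_bounded x.
by apply: (@block_exists _ _ _ K _ c) => k; exact: mbd_cmp.
Qed.

Definition diag x : bop K := projT1 (cid (diag_exists x)).

Lemma diag_block x : block (diag x) (cmp x).
Proof. exact: (projT2 (cid (diag_exists x))). Qed.

Lemma diagL (t : C) x y : diag (t *: x + y) = t *: diag x + diag y.
Proof.
apply: (block_uniq (diag_block _)) => v k.
by rewrite (blockL t (diag_block x) (diag_block y)) cmpL.
Qed.

Lemma diag_Cset x : Cset x -> diag x = x.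
Proof. by move=> Cx; apply: (block_uniq (diag_block x)); exact: Cset_block. Qed.

Definition glue e x a : bop K :=
  bop_comp (bop_comp e (diag x)) e + bop_comp (bop_comp (I1 - e) a) (I1 - e).

(** The blocks of [e] are small in [n2] and those of [x] are bounded. Here an arbitrary operator on
    [K] enters the algebra C. *)
Lemma Jset_compress e x : jproj e -> Jset (bop_comp (bop_comp e (diag x)) e).
Proof.
move=> he; have [Je _ _] := he; have be := Jset_block Je.
apply: (Jset_intro (blockM (blockM be (diag_block x)) be)) => t t0.
have [c c0 xc] := bop_bounded x.
have c1 : 0 < c + 1 by rewrite ltr_wpDl.
apply: filterS (Jset_n2 Je (divr_gt0 t0 c1)) => k /= hk.
rewrite -mulmxA; apply: (le_lt_trans (n2_mull _ ler01 (mbd_cmp (normle_proj he)))).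
rewrite mul1r; apply: (le_lt_trans (n2_mull _ c0 (mbd_cmp xc))).
move: hk; rewrite ltr_pdivlMr// mulrDr mulr1 mulrC; apply: le_lt_trans.
by rewrite lerDl n2_ge0.
Qed.

Lemma Cset_glue e x a : jproj e -> Cset a -> Cset (glue e x a).
Proof.
move=> he Ca; apply: CsetD; first by apply: Jset_Cset; exact: Jset_compress.
by apply: CsetM (Cset_projC he); apply: CsetM Ca; exact: Cset_projC.
Qed.

Lemma glueL e (t : C) x y a a' :
  glue e (t *: x + y) (t *: a + a') = t *: glue e x a + glue e y a'.
Proof.
rewrite /glue diagL; move: (I1 - e) => c; rewrite !compbDr !compbZr !compbDl !compbZl scalerDr.
exact: addrACA.
Qed.

Lemma cut_normle e x c : 0 <= c -> normle x c -> jproj e ->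
  normle (bop_comp (bop_comp (I1 - e) x) (I1 - e)) c.
Proof.
move=> c0 xc he; rewrite -[c]mul1r -[1 * c]mulr1.
apply: normle_comp (normle_projC he); first by rewrite mul1r.
by apply: normle_comp xc => //; exact: normle_projC.
Qed.

Lemma diag_normle x c : 0 <= c -> normle x c -> normle (diag x) c.
Proof.
by move=> c0 xc; apply: (block_bound c0 (diag_block x)) => k; exact: mbd_cmp.
Qed.

Lemma glue_normle e x a b c : 0 <= b -> 0 <= c -> normle x b -> normle a c -> jproj e ->
  normle (glue e x a) (b + c).
Proof.
move=> b0 c0 xb ac he; apply: normleD; last exact: cut_normle.
rewrite -[b]mul1r -[1 * b]mulr1; apply: normle_comp (normle_proj he); first by rewrite mul1r.
by apply: normle_comp (diag_normle b0 xb) => //; exact: normle_proj.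
Qed.

(** Only strict contractions are lifted, whence the factor [t]; it is sent to 1 in [wexp_cc]. *)
Lemma expect_lift_contraction n (x : 'I_n -> 'I_n -> bop K) (t : R) : 0 <= t < 1 ->
  (forall v : 'I_n -> K, l2 (act x v) <= l2 v) ->
  exists a : 'I_n -> 'I_n -> bop K, [/\ forall i k, Cset (a i k),
    forall i k, expect (a i k) = expect (t%:C *: x i k) &
    forall v : 'I_n -> K, l2 (act a v) <= l2 v].
Proof.
move=> /andP[t0 t1] xc.
have eZ y : expect (t%:C *: y) = t%:C *: expect y.
  have e0 : expect 0 = 0 by apply: Jset_expect; exact: Jset0.
  by have := expectL t%:C y 0; rewrite !addr0 e0 addr0.
apply: (expect_lift K) => [i j|]; first exact: expect_Nset.
apply: le_lt_trans t1; apply: mxnorm_le => // w.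
have h : l2 (act (fun i k => expect (x i k)) w) <= 1 * l2 w.
  by apply: expect_cc => // v; rewrite mul1r.
rewrite (@eq_l2 _ _ _ _ (fun i => t%:C *: act (fun i k => expect (x i k)) w i)).
  by rewrite l2Z nr_real ger0_norm// ler_wpM2l// (le_trans h)// mul1r.
by move=> i; rewrite /act scaler_sumr; apply: eq_bigr => j _; rewrite eZ.
Qed.

Lemma expect_surj (T : bop F) : Nset M T -> exists2 a, Cset a & expect a = T.
Proof.
move=> NT; have [c c0 hc] := bop_bounded T.
pose s := 2 * (c + 1); have s0 : 0 < s by rewrite mulr_gt0// ltr_wpDl.
have [||a [Ca ea _]] := @expect_lift _ _ M K 1 (fun _ _ => (s^-1)%:C *: T).
- by move=> i k; exact: (@opaZ _ _ (Nalg M)).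
- have t1 : (2^-1 : R) < 1 by rewrite invf_lt1 ?ltr1n ?ltr0n.
  apply: le_lt_trans t1; apply: mxnorm_le => [|v]; first by rewrite invr_ge0.
  rewrite (@eq_l2 _ _ _ _ (fun=> (s^-1)%:C *: T (v 0))); last first.
    by move=> i; rewrite /act big_ord1.
  rewrite l21 (@eq_l2 _ _ _ v (fun=> v 0)) ?l21; last by move=> i; rewrite ord1.
  rewrite nrZ nr_real ger0_norm ?invr_ge0 ?(ltW s0)// mulrC ler_pdivrMr//.
  apply: (le_trans (hc _)); rewrite -mulrA [nr _ * _]mulrC mulrA.
  apply: ler_wpM2r; [exact: nr_ge0 | rewrite /s mulKf ?lerDl//].
exists (s%:C *: a 0 0); first exact: CsetZ.
have e0 : expect 0 = 0 by apply: Jset_expect; exact: Jset0.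
have := expectL s%:C (a 0 0) 0; rewrite !addr0 e0 addr0 => ->.
by rewrite ea scalerA -rmorphM /= mulfV ?gt_eqF// rmorph1 scale1r.
Qed.

#[local] Opaque diag.

Lemma lft_exists : exists l : bop K -> bop K,
  forall x, Cset (l x) /\ expect (l x) = expect x.
Proof.
apply: (@ex_choice _ _ (fun x y : bop K => Cset y /\ expect y = expect x)) => x.
by have [a Ca ea] := expect_surj (expect_Nset x); exists a; split; [exact: Ca | exact: ea].
Qed.

Definition lft : bop K -> bop K := projT1 (cid lft_exists).

Lemma lft_Cset x : Cset (lft x).
Proof. exact: (projT2 (cid lft_exists) x).1. Qed.

Lemma expect_lft x : expect (lft x) = expect x.
Proof. exact: (projT2 (cid lft_exists) x).2. Qed.

#[local] Opaque lft.

(** [lft x] is an arbitrary lift, chosen entry by entry without control of norms. By [Phi_cvg] the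
    value does not depend on it, so contractive lifts of whole matrices may be substituted. *)
Definition Phi x (g : bop K -> C) : C := ulim V (fun e => g (glue e x (lft x))).

Lemma glue_bound x a : exists2 c : R, 0 <= c & forall g b e, cfunc g b -> Cset a -> jproj e ->
  nr (g (glue e x a)) <= b * c.
Proof.
have [b b0 xb] := bop_bounded x; have [c c0 ac] := bop_bounded a.
exists (b + c) => [|g d e [d0 _ gd] Ca he]; first exact: addr_ge0.
by apply: gd; [exact: addr_ge0 | exact: Cset_glue | exact: glue_normle].
Qed.

(** Two lifts differ by some j in J, and [(1 - e) j (1 - e)] tends to 0 in norm by the choice of the
    approximate unit. *)
Lemma Phi_cvg g b x a : cfunc g b -> Cset a -> expect a = expect x ->
  ucvg V (fun e => g (glue e x a)) (Phi x g).
Proof.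
move=> gb Ca ea; have [c c0 hc] := glue_bound x (lft x).
have cv : ucvg V (fun e => g (glue e x (lft x))) (Phi x g).
  apply: (ulimP vfilterP (c := b * c)); apply: filterS vfilter_jproj => e /= he.
  exact: hc gb (lft_Cset x) he.
have Jd : Jset (a - lft x).
  rewrite addrC -scaleN1r; apply: Jset_LC (lft_Cset x) Ca _.
  by rewrite expect_lft ea scaleN1r addNr.
have d0 : ucvg V (fun e => g (bop_comp (bop_comp (I1 - e) (a - lft x)) (I1 - e))) 0.
  move=> t t0; have [b0 _ gbd] := gb; have b1 : 0 < b + 1 by rewrite ltr_wpDl.
  have r0 : 0 < t / (b + 1) by rewrite divr_gt0.
  have bt : b * (t / (b + 1)) < t.
    rewrite mulrA (ltr_pdivrMr _ _ b1) mulrC (ltr_pM2l t0) ltrDl; exact: ltr01.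
  apply: filterS2 vfilter_jproj (vfilter_cut Jd r0) => e he hr /=; rewrite subr0.
  apply: le_lt_trans bt; apply: gbd; first exact: ltW.
    apply: CsetM (Cset_projC he); apply: CsetM (Jset_Cset Jd); exact: Cset_projC.
  move=> v; apply: le_trans (hr v); exact: (jproj_leC ((a - lft x) (v - e v)) he).
have := ucvgD vfilterP cv d0; rewrite addr0; apply: (ucvg_near vfilterP).
apply: filterS vfilter_jproj => e /= he.
rewrite -(cfuncD gb); first last.
- apply: CsetM (Cset_projC he); apply: CsetM (Jset_Cset Jd); exact: Cset_projC.
- exact: Cset_glue he (lft_Cset x).
congr g; rewrite /glue -addrA; congr (_ + _).
by rewrite -compbDl -compbDr; congr (bop_comp (bop_comp _ _) _); rewrite addrC subrK.
Qed.

(** An element of C is its own lift. Of its four corners the diagonal ones make up [glue], and the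
    others disappear in the limit. *)
Lemma PhiE g b a : cfunc g b -> Cset a -> Phi a g = g a.
Proof.
move=> gb Ca; apply: (ucvg_uniq vfilterP (Phi_cvg gb Ca (erefl _))).
have := ucvgB vfilterP (ucvgB vfilterP (ucvg_cst vfilterP (g a)) (corner_cvg gb Ca))
  (cornerC_cvg gb Ca); rewrite !subr0; apply: (ucvg_near vfilterP).
apply: filterS vfilter_jproj => e /= he.
have C1 := Jset_Cset (Jset_corner he Ca).
have C2 : Cset (bop_comp (bop_comp (I1 - e) a) e).
  by apply: CsetM (Cset_jproj he); apply: CsetM Ca; exact: Cset_projC.
rewrite -(cfuncB gb Ca C1) -(cfuncB gb (CsetB Ca C1) C2); congr g.
rewrite /glue /corner diag_Cset//; set c := I1 - e.
have {1}-> : a = bop_comp (bop_comp (e + c) a) (e + c).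
  have -> : e + c = I1 by rewrite addrC subrK.
  exact: bop_ext.
clear C1 C2; move: c => c; rewrite !(compbDl, compbDr).
by zmodule.
Qed.

Lemma PhiL (t : C) x y g b : cfunc g b -> Phi (t *: x + y) g = t * Phi x g + Phi y g.
Proof.
move=> gb; have [_ gL _] := gb.
have C1 := CsetL t (lft_Cset x) (lft_Cset y).
have e1 : expect (t *: lft x + lft y) = expect (t *: x + y).
  by rewrite expectL [RHS]expectL (expect_lft x) (expect_lft y).
apply: (ucvg_uniq vfilterP (Phi_cvg gb C1 e1)).
apply: (ucvg_near vfilterP _ (ucvgD vfilterP
  (ucvgM vfilterP t (Phi_cvg gb (lft_Cset x) (expect_lft x)))
  (Phi_cvg gb (lft_Cset y) (expect_lft y)))).
apply: filterS vfilter_jproj => e /= he.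
by rewrite glueL (gL _ _ _ (Cset_glue x he (lft_Cset x)) (Cset_glue y he (lft_Cset y))).
Qed.

Lemma Phi_Lr (t : C) x g h b c : cfunc g b -> cfunc h c ->
  Phi x (fun y => t * g y + h y) = t * Phi x g + Phi x h.
Proof.
move=> gb hc; apply: (ulimE vfilterP).
exact: (ucvgD vfilterP
  (ucvgM vfilterP t (Phi_cvg gb (lft_Cset x) (expect_lft x)))
  (Phi_cvg hc (lft_Cset x) (expect_lft x))).
Qed.

Lemma Phi_bound x : exists2 c : R, 0 <= c & forall g b, cfunc g b -> nr (Phi x g) <= b * c.
Proof.
have [c c0 hc] := glue_bound x (lft x); exists c => // g b gb.
apply: (ucvg_nr_le vfilterP (Phi_cvg gb (lft_Cset x) (expect_lft x))).
by apply: filterS vfilter_jproj => e /= he; apply: hc => //; exact: lft_Cset.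
Qed.

(** The two summands act between orthogonal pairs: inputs split by [e] and [1 - e], and outputs in
    their ranges. A direct sum of contractions is a contraction. *)
Lemma glue_contraction n e (x a : 'I_n -> 'I_n -> bop K) : jproj e ->
  (forall v : 'I_n -> K, l2 (act x v) <= l2 v) ->
  (forall v : 'I_n -> K, l2 (act a v) <= l2 v) ->
  forall v : 'I_n -> K, l2 (act (fun i k => glue e (x i k) (a i k)) v) <= l2 v.
Proof.
move=> he xc ac v.
have dc w : l2 (act (fun i k => diag (x i k)) w) <= l2 w.
  rewrite -[leRHS]mul1r.
  apply: (@block_mcb _ _ _ K n (fun i k => diag (x i k)) (fun l i k => cmp (x i k) l) 1 ler01).
    by move=> i k; exact: diag_block.
  by move=> k; apply: mcb_cmp => // u; rewrite mul1r.
pose p i := act (fun i k => diag (x i k)) (fun j => e (v j)) i.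
pose q i := act a (fun j => v j - e (v j)) i.
have E i : act (fun i k => glue e (x i k) (a i k)) v i = e (p i) + (q i - e (q i)).
  rewrite /act /glue; transitivity (\sum_j (e (diag (x i j) (e (v j))) +
    (a i j (v j - e (v j)) - e (a i j (v j - e (v j)))))).
    by apply: eq_bigr => j _.
  by rewrite big_split sumrB /p /q /act -!bop_sum.
have orth w z : ip (e w) (z - e z) = 0.
  have [_ eJ ee] := he; rewrite adjP eJ bopB -[e (e z)]/(bop_comp e e z) ee subrr.
  exact: ip0r.
rewrite -(ler_pXn2r (n := 2)) ?nnegrE ?l2_ge0// !l2_sqr.
have -> : \sum_i nr (act (fun i k => glue e (x i k) (a i k)) v i) ^+ 2 =
    \sum_i nr (e (p i)) ^+ 2 + \sum_i nr (q i - e (q i)) ^+ 2.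
  rewrite -big_split; apply: eq_bigr => i _; rewrite E nr_sqrD orth /=; ring.
have -> : \sum_j nr (v j) ^+ 2 = \sum_j nr (e (v j)) ^+ 2 + \sum_j nr (v j - e (v j)) ^+ 2.
  by rewrite -big_split; apply: eq_bigr => j _; rewrite -(jproj_pyth (v j) he).
apply: lerD.
  rewrite (@le_trans _ _ (\sum_i nr (p i) ^+ 2))//.
    by apply: ler_sum => i _; rewrite ler_pXn2r ?nnegrE ?nr_ge0//; exact: jproj_le.
  have := dc (fun j => e (v j)).
  by rewrite -(ler_pXn2r (n := 2)) ?nnegrE ?l2_ge0// !l2_sqr.
rewrite (@le_trans _ _ (\sum_i nr (q i) ^+ 2))//.
  by apply: ler_sum => i _; rewrite ler_pXn2r ?nnegrE ?nr_ge0//; exact: jproj_leC.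
have := ac (fun j => v j - e (v j)).
by rewrite -(ler_pXn2r (n := 2)) ?nnegrE ?l2_ge0// !l2_sqr.
Qed.

End WeakExpectation.

(** * C has the WEP and N is its quotient by J *)

Section QuotientOfWEP.
Variables (R : realType) (F : complexHilbert R) (M : matricial F).
Local Notation C := R[i].

Section Extension.
Variable (K : directSum R (@dm R F M)).
Local Notation Cset := (@Cset R F M K).
Local Notation Jset := (@Jset R F M K).
Local Notation expect := (@expect R F M K).

Definition coronaAlg : cstarAlgebra R := mxcstar (Calg K) 1.
Local Notation B := coronaAlg.
Local Notation X := (cstar_opSpace B).

Definition toB (T : bop K) : B :=
  if pselect (Cset T) is left h then @mk_mxop _ _ (Calg K) 1 (fun _ _ => T) (fun _ _ => h) else 0.

Lemma entry_toB T : Cset T -> entry (toB T) = T.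
Proof. by move=> h; rewrite /toB; case: pselect. Qed.

Lemma Cset_entry (x : B) : Cset (entry x).
Proof. exact: (entry_in x). Qed.

Lemma toB_entry (x : B) : toB (entry x) = x.
Proof. by apply: entry_inj; rewrite entry_toB//; exact: Cset_entry. Qed.

Lemma toBL (t : C) S T : Cset S -> Cset T -> toB (t *: S + T) = t *: toB S + toB T.
Proof.
move=> CS CT; apply: entry_inj.
rewrite entryL (entry_toB CS) (entry_toB CT) entry_toB//.
exact: CsetL.
Qed.

Lemma mball1 (x : B) : nr x <= 1 -> mball X 1 (fun _ _ => x).
Proof.
move=> x1; apply: mball_amp => v.
rewrite (@eq_l2 _ _ _ _ (fun=> entry x (v 0))); last by move=> i; rewrite /act big_ord1.
rewrite l21 (@eq_l2 _ _ _ v (fun=> v 0)) ?l21; last by move=> i; rewrite ord1.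
by rewrite (le_trans (entry_norm _ _))// ler_piMl ?nr_ge0.
Qed.

Lemma cfunc_ball (f : dual X) (b : R) : 0 <= b ->
  (forall x : B, mball X 1 (fun _ _ => x) -> nr (f x : C) <= b) -> cfunc (fun T => f (toB T) : C) b.
Proof.
have /asboolP[lf _] := dualP f.
have f0 : f 0 = 0 by have := lf (-1) 0 0; rewrite scaler0 addr0 scaleN1r addNr.
have fZ (t : C) (x : X) : f (t *: x) = t * f x.
  by have := lf t x 0; rewrite !addr0 f0 addr0.
move=> b0 fb; split=> [//|t S T CS CT|T c c0 CT Tc].
  by rewrite (toBL t CS CT); exact: lf.
have hx : nr (toB T) <= c by apply: norm_entry_le => // w; rewrite entry_toB.
have [T0|T0] := eqVneq (nr (toB T)) 0.
  have -> : toB T = 0 by apply/eqP; rewrite -nr_eq0 T0.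
  by rewrite f0 nr0 mulr_ge0.
have t0 : 0 < nr (toB T) by rewrite lt_def nr_ge0 T0.
apply: (@le_trans _ _ (b * nr (toB T))); last by rewrite ler_wpM2l.
have := fb ((nr (toB T))^-1%:C *: toB T) _.
rewrite fZ nrM nr_real ger0_norm ?invr_ge0 ?nr_ge0// => h.
rewrite -ler_pdivrMr// mulrC; apply: h; apply: mball1.
by rewrite nrZ nr_real ger0_norm ?invr_ge0 ?nr_ge0// mulVf.
Qed.

Lemma cfunc_dual (f : dual X) : exists b, cfunc (fun T => f (toB T) : C) b.
Proof.
have /asboolP[_ [c fc]] := dualP f.
exists (nr c); apply: cfunc_ball => [|x hx]; first exact: nr_ge0.
have := fc x hx; rewrite norm_nr => h.
have cr : (nr (f x : C))%:C <= `|c|.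
  apply: (le_trans h); apply: real_ler_norm; apply: ger0_real; apply: le_trans h.
  by rewrite (lecR 0) nr_ge0.
by move: cr; rewrite norm_nr lecR.
Qed.

Lemma cfunc_dual_ball (f : dual X) : mball (dual_opSpace X) 1 (fun _ _ => f) ->
  cfunc (fun T => f (toB T) : C) 1.
Proof.
move=> fb; apply: cfunc_ball => // x hx; have := fb 1%N (fun _ _ => x) hx (fun=> 1).
have E (V : nmodType) (h : 'I_1 * 'I_1 -> V) : \sum_p h p = h (0, 0).
  by rewrite (bigD1 (0, 0))//= big1 ?addr0// => -[i j]; rewrite !ord1 eqxx.
rewrite !E mulr1 normr1 expr1n norm_nr -rmorphXn /= -(rmorph1 (real_complex R)) lecR.
by rewrite expr_le1// nr_ge0.
Qed.

Definition Phid (x : bop K) (f : dual X) : C := Phi x (fun T => f (toB T) : C).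

Lemma Phid_bounded (x : bop K) :
  (Phid x : dual_opSpace X -> C^o) \in @bounded_functional R (dual_opSpace X).
Proof.
apply/asboolP; split.
  move=> t f g; have [b hb] := cfunc_dual f; have [c hc] := cfunc_dual g.
  transitivity (Phi x (fun T => t * (f (toB T) : C) + g (toB T))); first by [].
  exact: (@Phi_Lr _ _ M K t x _ _ _ _ hb hc).
have [c c0 hc] := Phi_bound x; exists c%:C => f /cfunc_dual_ball /hc.
by rewrite mul1r norm_nr lecR.
Qed.

Definition wexp (x : bop_opSpace K) : dual_opSpace (dual_opSpace X) := Dual (Phid_bounded x).

Lemma wexp_linear : linear wexp.
Proof.
move=> t x y; apply: val_inj; apply/funext => f /=.
have [b hb] := cfunc_dual f; exact: (PhiL t x y hb).
Qed.

(** Lower semicontinuity of the Hilbert norm: pair the family with its limit and apply the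
    arithmetic-geometric mean inequality, so that only linear limits are taken. *)
Lemma ucvg_sum_sqr_le (T : Type) (U : set_system T) (UU : UltraFilter U) (I : finType)
    (z : I -> T -> C) (l : I -> C) (c : R) : (forall i, ucvg U (z i) (l i)) ->
  U [set t | \sum_i nr (z i t) ^+ 2 <= c] -> \sum_i nr (l i) ^+ 2 <= c.
Proof.
move=> zl zc; set L := \sum_i _.
have h := ucvg_sum UU (index_enum I) (fun i => ucvgM UU (Num.conj (l i)) (zl i)).
have e : \sum_i Num.conj (l i) * l i = L%:C.
  by rewrite rmorph_sum; apply: eq_bigr => i _; rewrite mulrC mulCJ.
rewrite e in h; suff : L <= (L + c) / 2 by lra.
apply: (ucvg_Re_le UU h); have [FF _] := UU; apply: filterS zc => t /= hc.
suff : complex.Re (\sum_i Num.conj (l i) * z i t) <= (L + \sum_i nr (z i t) ^+ 2) / 2.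
  by move: hc; lra.
rewrite /L -big_split mulr_suml cRe_sum ler_sum// => i _.
apply: (le_trans (ler_Re_nr _)); rewrite nrM nr_conj /=.
have := sqr_ge0 (nr (l i) - nr (z i t)); rewrite sqrrB; lra.
Qed.

Lemma mball_bop n (x : 'I_n -> 'I_n -> bop_opSpace K) :
  mball (bop_opSpace K) n x <-> forall v : 'I_n -> K, l2 (act x v) <= l2 v.
Proof.
have sq (v : 'I_n -> K) : \sum_i `|v i| ^+ 2 = (l2 v ^+ 2)%:C.
  by rewrite l2_sqr rmorph_sum; apply: eq_bigr => i _; rewrite norm_nr -rmorphXn.
have E v : (\sum_i `|\sum_j x i j (v j)| ^+ 2 <= \sum_j `|v j| ^+ 2) =
    (l2 (act x v) <= l2 v).
  by rewrite (sq v) (sq (act x v)) lecR ler_pXn2r ?nnegrE ?l2_ge0.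
by split=> h v; [rewrite -E | rewrite /= E]; exact: h.
Qed.

Lemma scalar_contractionP (I : finType) (a : I -> I -> C) :
  scalar_contraction a <-> forall v : I -> C,
    \sum_i nr (\sum_j a i j * v j) ^+ 2 <= \sum_j nr (v j) ^+ 2.
Proof.
have sq (v : I -> C) : \sum_i `|v i| ^+ 2 = (\sum_i nr (v i) ^+ 2)%:C.
  by rewrite rmorph_sum; apply: eq_bigr => i _; rewrite norm_nr -rmorphXn.
by split=> h v; have := h v; rewrite !sq lecR.
Qed.

(** For [t < 1], a contractive lift of [t x] is glued to [t x], which gives a matrix in the unit
    ball of C for each projection. The matrix of functionals is evaluated there, before the limit
    along [vfilter] and then the limit in [t]. *)
Lemma wexp_cc : completely_contractive wexp.
Proof.
split=> [|m x /mball_bop xc n f fb]; first exact: wexp_linear.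
apply/scalar_contractionP => w; apply: le_eps => e e0.
set S := \sum_i _; set W := \sum_i _.
have W0 : 0 <= W by apply: sumr_ge0 => i _; exact: sqr_ge0.
have main t : 0 <= t < 1 -> t ^+ 2 * S <= W.
  move=> t1; have [a [Ca ea ac]] := expect_lift_contraction t1 xc.
  have tc (v : 'I_m -> K) : l2 (act (fun i j => t%:C *: (x i j : bop K)) v) <= l2 v.
    rewrite (@eq_l2 _ _ _ _ (fun i => t%:C *: act x v i)); last first.
      by move=> i; rewrite /act scaler_sumr.
    case/andP: t1 => t0 t1.
    rewrite l2Z nr_real ger0_norm//; apply: le_trans (xc v).
    by apply: ler_piMl; [exact: l2_ge0 | exact: ltW].
  pose z (p : 'I_m * 'I_n) (g : bop K) : C := \sum_(r : 'I_m * 'I_n)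
    (f p.2 r.2 (toB (glue g (t%:C *: (x p.1 r.1 : bop K)) (a p.1 r.1))) : C) * w r.
  pose l (p : 'I_m * 'I_n) : C := \sum_(r : 'I_m * 'I_n)
    (Phi (t%:C *: (x p.1 r.1 : bop K)) (fun T => f p.2 r.2 (toB T) : C)) * w r.
  have zl p : ucvg (@vfilter _ _ M K) (z p) (l p).
    apply: (ucvg_sum (vfilterP K)) => r; have [b hb] := cfunc_dual (f p.2 r.2).
    rewrite [X in ucvg _ _ X]mulrC; apply: (ucvg_near (vfilterP K) _
      (ucvgM (vfilterP K) (w r) (Phi_cvg hb (Ca p.1 r.1) (ea p.1 r.1)))).
    by have [FF _] := vfilterP K; apply: filterS filterT => g _ /=; rewrite mulrC.
  have -> : t ^+ 2 * S = \sum_p nr (l p) ^+ 2.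
    rewrite mulr_sumr; apply: eq_bigr => p _.
    have -> : l p = t%:C * \sum_(r : 'I_m * 'I_n) (wexp (x p.1 r.1) (f p.2 r.2) : C) * w r.
      rewrite mulr_sumr; apply: eq_bigr => r _; have [b hb] := cfunc_dual (f p.2 r.2).
      have h0 : Phi (0 : bop K) (fun T => f p.2 r.2 (toB T) : C) = 0.
        by have := PhiL (-1) 0 0 hb; rewrite scaler0 addr0 mulN1r addNr.
      by have := PhiL t%:C (x p.1 r.1) 0 hb; rewrite !addr0 h0 addr0 => ->; rewrite mulrA.
    by rewrite nrM exprMn nr_real real_normK ?num_real.
  apply: (ucvg_sum_sqr_le (vfilterP K) zl).
  have [FF _] := vfilterP K; apply: filterS (vfilter_jproj K) => g /= hg.
  have yb : mball X m (fun i j => toB (glue g (t%:C *: (x i j : bop K)) (a i j))).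
    apply: mball_amp => v; apply: le_trans (glue_contraction hg tc ac v).
    rewrite le_eqVlt; apply/orP; left; apply/eqP; apply: eq_l2 => i.
    apply: eq_bigr => j _; rewrite entry_toB; first by [].
    exact: Cset_glue hg (Ca i j).
  have /scalar_contractionP/(_ (fun p => w (p.2, p.1))) := fb m _ yb.
  (* In the ball of the dual the index of the functionals comes first, in that of the bidual it
     comes second. *)
  have sw (V : nmodType) (h : 'I_n * 'I_m -> V) : \sum_p h p = \sum_(r : 'I_m * 'I_n) h (r.2, r.1).
    rewrite (reindex (fun r : 'I_m * 'I_n => (r.2, r.1)))//=.
    by exists (fun r => (r.2, r.1)) => -[].
  rewrite !sw /= -/W.
  have -> : \sum_(j : 'I_m * 'I_n) nr (w (j.1, j.2)) ^+ 2 = W by apply: eq_bigr => -[].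
  apply: le_trans; rewrite le_eqVlt; apply/orP; left; apply/eqP; apply: eq_bigr => p _.
  by rewrite sw; congr (nr _ ^+ 2); apply: eq_bigr => -[].
have S0 : 0 <= S by apply: sumr_ge0 => i _; exact: sqr_ge0.
(* For [t = S / (S + d)] one has [S - t ^ 2 S = t d + t ^ 2 d], at most [2 d = e]. *)
pose d := e / 2; have d0 : 0 < d by rewrite divr_gt0.
have t0 : 0 < S + d by rewrite ltr_wpDl.
have h : 0 <= S / (S + d) < 1 by rewrite divr_ge0 ?(ltW t0)//= ltr_pdivrMr// mul1r ltrDl.
have := main _ h; set t := S / (S + d) => ht.
have tS : t * (S + d) = S by rewrite /t divfK// gt_eqF.
have key (r s p : R) : r * (s + p) = s -> r ^+ 2 * s = s - r * p - r ^+ 2 * p.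
  by move=> hr; have := congr1 (fun z => r * z) hr; move: hr; lra.
have tS2 := key _ _ _ tS.
case/andP: h => h0 h1; rewrite -/t in h0 h1.
have h2 : t * d <= d by rewrite ler_piMl// ltW.
have h3 : t ^+ 2 * d <= d.
  by apply: ler_piMl (ltW d0) _; rewrite expr2; exact: (mulr_ile1 h0 h0 (ltW h1) (ltW h1)).
have -> : e = d + d by rewrite /d -splitr.
by rewrite -lerBlDr opprD addrA; apply: le_trans ht; rewrite tS2 lerB// lerB.
Qed.

Definition incl (x : X) : bop_opSpace K := entry x.

(** The hypothesis supplies some C*-algebra of matrices, not necessarily the concrete one; a
    *-representation is contractive for any such norm. *)
Lemma incl_cc : completely_contractive incl.
Proof.
split=> [|n x [A [e [[le [e' ee' e'e] eM eJ] e1]]]]; first by [].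
apply/mball_bop; pose p (m : A) i j := entry (e' m i j).
have := @star_rep_contractive R A K n p _ _ _ (e x) _.
rewrite /p ee'; apply.
- move=> t a b i j; rewrite -entryL; congr entry.
  have -> : e' (t *: a + b) = t *: e' a + e' b by apply: (can_inj ee'); rewrite le !e'e.
  by [].
- move=> a b i j; have -> : e' (cmul a b) = fun i j => \sum_k cmul (e' a i k) (e' b k j).
    by apply: (can_inj ee'); rewrite eM !e'e.
  elim/big_rec2: _ => [//|k S T _ <-]; by rewrite -entryM.
- move=> a i j; have -> : e' (cstar a) = fun i j => cstar (e' a j i).
    by apply: (can_inj ee'); rewrite eJ !e'e.
  by rewrite entryJ.
- by move: e1; rewrite norm_nr -(rmorph1 (real_complex R)) lecR.
Qed.

Lemma corona_WEP : WEP B.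
Proof.
exists K, incl, wexp; split; [exact: incl_cc | exact: wexp_cc |].
move=> b f; have [c hc] := cfunc_dual f.
by rewrite /= /Phid (PhiE hc (Cset_entry b)) toB_entry.
Qed.

Definition quo (x : B) : mxcstar (Nalg M) 1 :=
  @mk_mxop _ _ (Nalg M) 1 (fun _ _ => expect (entry x)) (fun _ _ => expect_Nset (entry x)).

Lemma entry_quo x : entry (quo x) = expect (entry x).
Proof. by []. Qed.

Lemma quo_quotient : is_quotient [set x : B | Jset (entry x)] quo.
Proof.
split; first split.
- by move=> t x y; apply: entry_inj; rewrite entryL !entry_quo entryL expectL.
- move=> x y; apply: entry_inj; rewrite entryM !entry_quo entryM.
  by have [_ ->] := CsetM_expect (Cset_entry x) (Cset_entry y).
- move=> x; apply: entry_inj; rewrite entryJ !entry_quo entryJ.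
  by have [_ ->] := CsetJ_expect (Cset_entry x).
- apply/seteqP; split=> // y _.
  have [a Ca ea] := expect_surj K (entry_in y : Nset M (entry y)).
  by exists (toB a) => //; apply: entry_inj; rewrite entry_quo entry_toB.
- move=> x; split=> [/Jset_expect h|h]; first by apply: entry_inj; rewrite entry_quo h.
  by split; [exact: Cset_entry | rewrite -entry_quo h].
Qed.

Lemma corona_ideal : closed_ideal [set x : B | Jset (entry x)].
Proof.
split.
- move=> x xJ; split; first exact: Cset_entry.
  apply: bop_ext => w; rewrite zerobE; apply: small_zero => e e0.
  have w1 : 0 < nr w + 1 by rewrite ltr_wpDl ?nr_ge0.
  have d0 : 0 < e / (nr w + 1) by rewrite divr_gt0.
  have [|y [/= Jy]] := xJ (ball x (e / (nr w + 1))%:C).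
    by apply: nbhsx_ballx; rewrite (ltcR 0).
  rewrite -ball_normE /= norm_nr ltcR => hy.
  have -> : expect (entry x) w = expect (entry (x - y)) w.
    have -> : entry (x - y) = entry x - entry y by [].
    by rewrite expectB (Jset_expect Jy) subr0.
  have := @expect_bound _ _ M K (entry (x - y)) _ (ltW d0).
  move=> h; apply: le_trans (h _ w) _.
    move=> v; apply: le_trans (entry_norm _ _) _.
    by rewrite ler_wpM2r ?nr_ge0// ltW.
  by rewrite mulrAC ler_pdivrMr// ler_wpM2l ?(ltW e0)// lerDl.
- exact: Jset0.
- by move=> t x y Jx Jy; exact: (Jset_L t Jx Jy).
- move=> b x Jx; split.
    have : Jset (entry (cmul b x)); last by [].
    rewrite entryM.
    exact: Jset_Ml (Cset_entry b) Jx.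
  have : Jset (entry (cmul x b)); last by [].
  rewrite entryM.
  exact: Jset_Mr Jx (Cset_entry b).
Qed.

End Extension.

Lemma matricial_QWEP : QWEP (mxcstar (Nalg M) 1).
Proof.
have [K] := directSum_exists R (@dm R F M).
exists (coronaAlg K), [set x : coronaAlg K | Jset (entry x)], (@quo K).
by split; [exact: corona_WEP | exact: corona_ideal | exact: quo_quotient].
Qed.

Lemma matricial_QWEP_operator_algebra (N : set (bop F)) :
  N = [set T | Nset M T] -> QWEP_operator_algebra N.
Proof.
move=> ->; exists (mxcstar (Nalg M) 1), (@entry _ _ (Nalg M)); split; last exact: matricial_QWEP.
split.
- by move=> t x y; exact: entryL.
- exact: entry_inj.
- apply/seteqP; split=> [T [x _ <-]|T NT]; first exact: (entry_in x).
  by have [x xT] := @entry_surj _ _ (Nalg M) T NT; exists x.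
- exact: entryM.
- by move=> x; exact: adjoint_adj.
Qed.

End QuotientOfWEP.

(** * Generated von Neumann algebras *)

Section StrongClosure.
Variables (R : realType) (H : complexHilbert R).
Implicit Types (N : set (bop H)) (S T : bop H) (x y : H).

(** Two points at once are what it takes to test a commutation relation on the closure: a vector and
    its image. *)
Lemma ptws_closure_approx N T x y (e : R) : 0 < e ->
  closure (@bop_fun _ _ H @` N : set {ptws H -> H}) (T : H -> H) ->
  exists S, [/\ N S, nr (T x - S x) < e & nr (T y - S y) < e].
Proof.
move=> e0; rewrite closureEcvg => -[G PG [GT NG]].
have /pointwise_cvgP h : {ptws, G --> (T : H -> H)} by exact: GT.
have ev z : G [set g | nr (T z - g z) < e].
  have e0' : (0 : R[i]) < e%:C by rewrite (ltcR 0).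
  have /cvgrPdist_lt /(_ _ e0') := h z; apply: filterS => g /=.
  by rewrite norm_nr ltcR.
have GN : G (@bop_fun _ _ H @` N) by apply: NG.
have [_ [[[S NS <-] hx] hy]] := filter_ex (filterI (filterI GN (ev x)) (ev y)).
by exists S.
Qed.

Lemma tends_ptws_closure N T (X : nat -> bop H) : (forall n, N (X n)) ->
  (forall x, tends (fun n => X n x) (T x)) ->
  closure (@bop_fun _ _ H @` N : set {ptws H -> H}) (T : H -> H).
Proof.
move=> NX XT; rewrite closureEcvg.
exists ((fun n => X n : H -> H) @ \oo); first exact: fmap_proper_filter.
split; last first.
  by move=> A hA; exists 0%N => // n _ /=; apply: hA; exists (X n).
suff : {ptws, (fun n => X n : H -> H) @ \oo --> (T : H -> H)} by [].
apply/pointwise_cvgP => x; apply/cvgrPdist_lt => e e0.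
have eE : e = (complex.Re e)%:C.
  by move: e0; rewrite ltcE; case: e => a b /= /andP[/eqP -> _].
move: e0; rewrite eE (ltcR 0) => /(XT x)[n0 hn].
exists n0 => // n /= n0n; rewrite norm_nr ltcR nrBC; exact: hn.
Qed.

End StrongClosure.

Section Generated.
Variables (R : realType) (H : complexHilbert R) (G : set (bop H)).
Implicit Types (S T : bop H).
Local Notation W := (von_neumann_generated G).

Lemma vn_generated_sub : G `<=` W.
Proof. by move=> T GT A [_]; apply. Qed.

Lemma von_neumann_generated_algebra : von_neumann_algebra W.
Proof.
split.
- by move=> A [[]].
- by move=> a S T WS WT A hA; have [[_ h _ _ _] _] := hA; apply: h; [exact: WS | exact: WT].
- by move=> S T WS WT A hA; have [[_ _ h _ _] _] := hA; apply: h; [exact: WS | exact: WT].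
- move=> S WS; exists (adj S); last exact: adjoint_adj.
  move=> A hA; have [[_ _ _ h _] _] := hA.
  by have [T AT /adjoint_uniq <-] := h S (WS A hA).
- move=> T clT A hA; have [[_ _ _ _ h] _] := hA; apply: h.
  apply: (closure_subset _ clT) => f [S WS <-]; exists S => //.
  exact: WS.
Qed.

End Generated.

Section VonNeumann.
Variables (R : realType) (H : complexHilbert R) (W : set (bop H)).
Hypothesis vnW : von_neumann_algebra W.
Implicit Types (S T Y : bop H).

Lemma vn1 : W (bop_id H). Proof. by case: vnW. Qed.

Lemma vnL a S T : W S -> W T -> W (a *: S + T). Proof. by case: vnW => _ h _ _ _; exact: h. Qed.

Lemma vnM S T : W S -> W T -> W (bop_comp S T). Proof. by case: vnW => _ _ h _ _; exact: h. Qed.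

Lemma vnJ S : W S -> W (adj S).
Proof. by case: vnW => _ _ _ h _ /h[T WT /adjoint_uniq <-]. Qed.

Lemma vn_closed T : closure (@bop_fun _ _ H @` W : set {ptws H -> H}) (T : H -> H) -> W T.
Proof. by case: vnW => _ _ _ _; apply. Qed.

Lemma vn0 : W 0.
Proof. by have := vnL (-1) vn1 vn1; rewrite scaleN1r addNr. Qed.

Lemma vnZ a S : W S -> W (a *: S).
Proof. by move=> WS; rewrite -[_ *: _]addr0; apply: vnL WS vn0. Qed.

Lemma vn_norm_closed T : (forall e : R, 0 < e -> exists2 S, W S &
    forall x : H, nr (T x - S x) <= e * nr x) -> W T.
Proof.
move=> h.
have [X hX] : exists X : nat -> bop H, forall n, W (X n) /\
    forall x : H, nr (T x - X n x) <= n.+1%:R^-1 * nr x.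
  apply: (@ex_choice _ _ (fun n (X : bop H) => W X /\
    forall x : H, nr (T x - X x) <= n.+1%:R^-1 * nr x)) => n.
  have e0 : 0 < n.+1%:R^-1 :> R by rewrite invr_gt0.
  by have [S WS hS] := h _ e0; exists S.
apply: vn_closed; apply: (@tends_ptws_closure _ _ _ _ X) => [n|x e e0]; first exact: (hX n).1.
have x1 : 0 < nr x + 1 by rewrite ltr_wpDl ?nr_ge0.
have [n0 hn] := inv_nat_lt (divr_gt0 e0 x1).
exists n0 => n n0n; rewrite nrBC (le_lt_trans ((hX n).2 x))//.
have h1 : n.+1%:R^-1 < e / (nr x + 1) by rewrite (le_lt_trans _ hn)// inv_nat_mono.
move: h1; rewrite ltr_pdivlMr// mulrDr mulr1; apply: le_lt_trans.
by rewrite lerDl invr_ge0.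
Qed.

Definition vnAlg : opAlgebra H :=
  @OpAlgebra _ _ W vn0 vnL vnM vnJ vn_norm_closed.

(** Polarization bounds [Re <T v, y>] by the numerical radius, for self-adjoint [T]. *)
Lemma numerical_bound T (r : R) : adj T = T -> 0 <= r ->
  (forall v : H, `|complex.Re (inner H (T v) v)| <= r * nr v ^+ 2) ->
  forall v : H, nr (T v) <= r * nr v.
Proof.
move=> TJ r0 h v.
have pol (y : H) : 4 * complex.Re (inner H (T v) y) =
    complex.Re (inner H (T (v + y)) (v + y)) - complex.Re (inner H (T (v - y)) (v - y)).
  have e1 : complex.Re (inner H (T y) v) = complex.Re (inner H (T v) y).
    by rewrite adjP TJ ipC cRe_conj.
  rewrite bopD bopB ipDl ipBl !ipDr !ipNr !(cReD, cReB, cReN) e1; ring.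
have bd y : 4 * complex.Re (inner H (T v) y) <= 2 * r * (nr v ^+ 2 + nr y ^+ 2).
  have := h (v + y); have := h (v - y); rewrite !ler_norml pol nr_sqrB nr_sqrD.
  move=> /andP[h1 _] /andP[_ h2]; move: h1 h2.
  by move: (complex.Re (inner H (T (v - y)) _)) (complex.Re (inner H (T (v + y)) _)) (complex.Re _) => a b c; lra.
have [->|Tv0] := eqVneq (nr (T v)) 0; first by rewrite mulr_ge0 ?nr_ge0.
have [v0|v0] := eqVneq v 0; first by rewrite v0 bop0 nr0 mulr0.
have t0 : 0 < nr (T v) by rewrite lt_def nr_ge0 Tv0.
have n0 : 0 < nr v by rewrite lt_def nr_ge0 nr_eq0 v0.
(* The test vector is [T v] rescaled to the length of [v], which balances the two squares in
   [bd]. *)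
have := bd ((nr v / nr (T v))%:C *: T v).
rewrite ipZr conj_real cReMr -nr_sqr_ip nrZ nr_real ger0_norm ?divr_ge0 ?nr_ge0//.
have -> : nr v / nr (T v) * nr (T v) = nr v by rewrite divfK.
have -> : nr v / nr (T v) * nr (T v) ^+ 2 = nr v * nr (T v) by rewrite expr2 mulrA divfK.
move=> h1; rewrite -(ler_pM2l n0); lra.
Qed.

(** The inverse of [1 + Y^* Y] is found inside [W] as the solution of [z = k z + t] with
    [k = 1 - t (1 + Y^* Y)]. For [t = 1 / (1 + c^2)] the operator [k] lies between 0 and [1 - t]. *)
Lemma vn_inverse Y : W Y -> exists Z, [/\ W Z,
  Z + bop_comp (adj Y) (bop_comp Y Z) = bop_id H & forall v : H, nr (Z v) <= nr v].
Proof.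
move=> WY; have [c c0 hc] := bop_bounded Y.
pose t := (1 + c ^+ 2)^-1; have c1 : 0 < 1 + c ^+ 2 by rewrite ltr_pwDl ?sqr_ge0.
have t0 : 0 < t by rewrite invr_gt0.
have tc : t + t * c ^+ 2 = 1 by rewrite -{1}[t]mulr1 -mulrDr mulVf ?gt_eqF.
have t1 : t <= 1 by rewrite -tc lerDl mulr_ge0 ?sqr_ge0// ltW.
pose k := (1 - t)%:C *: bop_id H - t%:C *: bop_comp (adj Y) Y.
have Wk : W k.
  have -> : k = (- t%:C) *: bop_comp (adj Y) Y + (1 - t)%:C *: bop_id H.
    by rewrite scaleNr addrC.
  by apply: vnL; [apply: vnM => //; exact: vnJ | apply: vnZ; exact: vn1].
have kE v : k v = (1 - t)%:C *: v - t%:C *: adj Y (Y v) by [].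
have kn v : nr (k v) <= (1 - t) * nr v.
  apply: numerical_bound => [||w]; last 1 first.
  - rewrite kE ipBl !ipZl cReB !cReMr -nr_sqr_ip -adjP' -nr_sqr_ip.
    have h1 : nr (Y w) ^+ 2 <= c ^+ 2 * nr w ^+ 2.
      by rewrite -exprMn ler_pXn2r ?nnegrE ?mulr_ge0 ?nr_ge0.
    have h2 := ler_wpM2l (ltW t0) h1.
    have h3 : 0 <= t * nr (Y w) ^+ 2 by rewrite mulr_ge0 ?sqr_ge0// ltW.
    have h4 : t * nr (Y w) ^+ 2 <= (1 - t) * nr w ^+ 2.
      by rewrite -tc addrC addKr -mulrA.
    have h5 : 0 <= (1 - t) * nr w ^+ 2 by rewrite mulr_ge0 ?sqr_ge0 ?subr_ge0.
    by rewrite ler_norml; apply/andP; split; lra.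
  - rewrite /k -[- (_ *: _)]scaleNr adjbD !adjbZ adjbM adjbK adjb1 rmorphN /= !conj_real.
    by [].
  - by rewrite subr_ge0.
have [k' k'E] := @entry_surj _ _ vnAlg k Wk.
have [i iE] := @entry_surj _ _ vnAlg (bop_id H) vn1.
have nk' : nr k' <= 1 - t.
  by apply: norm_entry_le; [rewrite subr_ge0 | move=> w; rewrite k'E].
have ni : nr i <= 1.
  by apply: norm_entry_le => // w; rewrite iE mul1r.
have [|||||||z [fz z1 _]] := @ball_fixpoint R (mxcstar vnAlg 1) 1 (1 - t)
  (fun z => cmul k' z + t%:C *: i) (fun=> True) => //.
- by rewrite subr_ge0 t1 gtrBl.
- move=> x x1; rewrite (le_trans (ler_nrD _ _))// nrZ nr_real (gtr0_norm t0).
  have h1 := nr_cmul k' x; have h2 := ler_pM (nr_ge0 k') (nr_ge0 x) nk' x1.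
  have h3 := ler_wpM2l (ltW t0) ni; lra.
- move=> x y _ _; rewrite opprD addrACA subrr addr0 -cmulBr (le_trans (nr_cmul _ _))//.
  by rewrite ler_wpM2r ?nr_ge0.
exists (entry z); split; first exact: (entry_in z).
- have zE : (entry z : bop H) = bop_comp k (entry z) + t%:C *: bop_id H.
    rewrite -{1}fz.
    have -> : entry (cmul k' z + t%:C *: i) = entry (cmul k' z) + t%:C *: entry i by [].
    by rewrite entryM k'E iE.
  apply: bop_ext => v; set w := entry z v; set u := adj Y (Y w).
  have e1 : w = (1 - t)%:C *: w - t%:C *: u + t%:C *: v := congr1 (fun S : bop H => S v) zE.
  have e2 : t%:C *: (w + u) = t%:C *: v.
    have -> : t%:C *: v = w - (1 - t)%:C *: w + t%:C *: u.
      by rewrite [X in X - _ + _]e1; zmodule.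
    by rewrite rmorphB rmorph1 scalerBl scale1r scalerDr; zmodule.
  apply: (@scalerI _ _ t%:C); last exact: e2.
  by rewrite fmorph_eq0 gt_eqF.
- by move=> v; rewrite (le_trans (entry_norm z v))// ler_piMl ?nr_ge0.
Qed.

(* X = 2 Y (1 + Y^* Y)^-1 *)
Lemma vn_kaplansky Y : W Y -> exists X Z, [/\ W X, W Z, X = 2%:R *: bop_comp Y Z,
  Z + bop_comp (adj Y) (bop_comp Y Z) = bop_id H &
  (forall v : H, nr (X v) <= nr v) /\ (forall v : H, nr (Z v) <= nr v)].
Proof.
move=> WY; have [Z [WZ hZ nZ]] := vn_inverse WY.
exists (2%:R *: bop_comp Y Z), Z; split=> //; first by apply: vnZ; exact: vnM.
split=> // v; have vE : v = Z v + adj Y (Y (Z v)).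
  by have := congr1 (fun S : bop H => S v) hZ; rewrite addbE /= => ->.
rewrite scalebE /= -(ler_pXn2r (n := 2)) ?nnegrE ?nr_ge0// nrZ exprMn.
have -> : nr (2%:R : R[i]) = 2 by rewrite -(rmorph_nat (real_complex R)) nr_real ger0_norm.
rewrite [in leRHS]vE nr_sqrD.
have := sqr_ge0 (nr (Z v - adj Y (Y (Z v)))); rewrite nr_sqrB.
rewrite [inner H (Z v) _]ipC cRe_conj -adjP' -nr_sqr_ip.
by move: (nr _ ^+ 2) (nr _ ^+ 2) (nr (Y _)) => a b y; rewrite -natrX; lra.
Qed.

End VonNeumann.

Section GeneratedByMatricial.
Variables (R : realType) (F : complexHilbert R) (M : matricial F).
Local Notation C := R[i].
Local Notation Om := (vac M).
Local Notation W := (von_neumann_generated (range (genop M))).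
Implicit Types (S T : bop F) (P Q : ncpoly M).

Lemma Nset_von_neumann : von_neumann_algebra [set T | Nset M T].
Proof.
split.
- exact: Nset1.
- by move=> a S T NS NT; exact: NsetL.
- by move=> S T NS NT; exact: NsetM.
- by move=> S NS; exists (adj S); [exact: NsetJ | exact: adjoint_adj].
- move=> T clT Q x; apply: subr0_eq; apply: small_zero => e e0.
  have [c c0 hc] := bop_bounded (rop Q).
  have d0 : 0 < e / (c + 1) by rewrite divr_gt0// ltr_wpDl.
  have [S [NS h1 h2]] := ptws_closure_approx (rop Q x) x d0 clT.
  have e1 : e / (c + 1) + c * (e / (c + 1)) = e by field; rewrite gt_eqF// ltr_wpDl.
  rewrite nrBC in h2; have h3 := le_trans (hc (S x - T x)) (ler_wpM2l c0 (ltW h2)).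
  rewrite (le_trans (ler_nrT (S (rop Q x)) _ _))// -e1 lerD//; first exact: ltW.
  by rewrite NS -bopB.
Qed.

Lemma vn_pop P : W (pop P).
Proof.
have vW := von_neumann_generated_algebra (range (genop M)).
have Ww (w : seq (gen M)) : W (bw w).
  elim: w => [|i w IH]; first exact: vn1 vW.
  by apply: (vnM vW) IH; apply: vn_generated_sub; exists i.
rewrite /pop; elim: P => [|p P IH]; first by rewrite big_nil; exact: vn0 vW.
by rewrite big_cons; apply: (vnL vW).
Qed.

(** The counterpart of [kaplansky_block] with operators in place of matrices: a density theorem with
    control of norms. Traciality, through [nr_mul_vac], replaces the Hilbert-Schmidt estimates. *)
Lemma kaplansky_approx T (e : R) : 0 < e -> Nset M T ->
  mxnorm (fun _ _ : 'I_1 => T) < 1 ->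
  exists X, [/\ W X, forall v : F, nr (X v) <= nr v & nr (X Om - T Om) <= 3 * e].
Proof.
move=> e0 NT T1; have vW := von_neumann_generated_algebra (range (genop M)).
have WN S : W S -> Nset M S.
  move=> WS; apply: WS; split; first exact: Nset_von_neumann.
  move=> _ [i _ <-]; have -> : genop M i = pop [:: (1, [:: i])].
    by rewrite /pop big_seq1 scale1r; exact: bop_ext.
  exact: Nset_pop.
pose T' : mxcstar (Nalg M) 1 := @mk_mxop _ _ (Nalg M) 1 (fun _ _ => T) (fun _ _ => NT).
have [S' hS] := @kaplansky_fixpoint R (mxcstar (Nalg M) 1) T' T1.
have [Y' [R' [Q' [h1 h2 h3]]]] := @kaplansky_vectors R F M 1 (fun _ _ => T)
  (S' : mxop (Nalg M) 1) e e0 (fun _ _ => NT) (mxop_in S')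
  (fun i j => congr1 (fun Z : mxop (Nalg M) 1 => Z i j) hS).
move: (h1 0 0) (h2 0 0) (h3 0 0); rewrite !big_ord1.
move: (Y' 0 0) (R' 0 0) (Q' 0 0) => Y R0 Q {}h1 {}h2 {}h3.
have [X [Z [WX WZ XE ZE [nX nZ]]]] := vn_kaplansky vW (vn_pop Y).
exists X; split=> //.
pose V := 2%:R *: pop Y - pop R0 - bop_comp (pop Q) (pop Y).
pose U := pop Q - bop_comp (pop R0) (adj (pop Y)).
have NB S1 S2 : Nset M S1 -> Nset M S2 -> Nset M (S1 - S2) by exact: (@opaB _ _ (Nalg M)).
have NY P : Nset M (pop P) by exact: Nset_pop.
have NU : Nset M U by apply: (NB) => //; apply: NsetM => //; exact: NsetJ.
have NV : Nset M V.
  apply: (NB); last exact: NsetM.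
  by apply: (NB) => //; apply: (@opaZ _ _ (Nalg M)); exact: NY.
(* The identity behind [kaplansky_block], evaluated at the vacuum. *)
have E : X Om - pv R0 = V (Z Om) + (2%:R)^-1 *: U (X Om).
  have z1 : pop R0 (Z Om) + pop R0 (adj (pop Y) (pop Y (Z Om))) = pv R0.
    by rewrite -bopD; congr (pop R0 _); exact: (congr1 (fun S : bop F => S Om) ZE).
  have UX : (2%:R)^-1 *: U (X Om) = U (pop Y (Z Om)).
    by rewrite XE scalebE bopZ scalerA mulVf ?pnatr_eq0// scale1r.
  rewrite UX {1}XE -z1.
  have -> : V (Z Om) = 2%:R *: pop Y (Z Om) - pop R0 (Z Om) - pop Q (pop Y (Z Om)) by [].
  have -> : U (pop Y (Z Om)) = pop Q (pop Y (Z Om)) - pop R0 (adj (pop Y) (pop Y (Z Om))) by [].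
  by rewrite scalebE; zmodule.
have a1 (v : F) S : (forall v : F, nr (S v) <= nr v) -> nr (adj S v) <= 1 * nr v.
  by move=> hS1; apply: adj_bound => // u; rewrite mul1r.
have b1 : nr (V (Z Om)) <= 1 * nr (V Om).
  by apply: (nr_mul_vac (WN _ WZ) NV) => // v; exact: a1.
have b2 : nr (U (X Om)) <= 1 * nr (U Om).
  by apply: (nr_mul_vac (WN _ WX) NU) => // v; exact: a1.
rewrite (le_trans (ler_nrT (pv R0) _ _))//.
have n2i : nr ((2%:R)^-1 : C) = 2^-1.
  by rewrite -(rmorph_nat (real_complex R)) -fmorphV nr_real ger0_norm ?invr_ge0.
have b3 : nr (X Om - pv R0) <= nr (V (Z Om)) + 2^-1 * nr (U (X Om)).
  by rewrite E (le_trans (ler_nrD _ _))// nrZ n2i.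
rewrite nrBC in h1; move: b1 b2 b3 (ltW h1) (ltW h2) (ltW h3) e0; rewrite -/V -/U !mul1r.
rewrite [nr (pv R0 - _)]nrBC nrBC.
move: (nr (V Om)) (nr (U Om)) (nr (V (Z Om))) (nr (U (X Om))) (nr (X Om - _)) (nr (pv R0 - _)).
by move=> a b c d f g; lra.
Qed.

(** Contractions of the generated algebra that converge at the vacuum converge on each [pv P], since
    they commute with [rop P], and then strongly by boundedness. *)
Lemma Nset_sub_generated T : Nset M T -> W T.
Proof.
have vW := von_neumann_generated_algebra (range (genop M)).
have main S : Nset M S -> mxnorm (fun _ _ : 'I_1 => S) < 1 -> W S.
  move=> NS S1.
  have [X hX] : exists X : nat -> bop F, forall n,
      [/\ W (X n), forall v : F, nr (X n v) <= nr v & nr (X n Om - S Om) <= 3 * n.+1%:R^-1].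
    apply: (@ex_choice _ _ (fun n (X : bop F) =>
      [/\ W X, forall v : F, nr (X v) <= nr v & nr (X Om - S Om) <= 3 * n.+1%:R^-1])) => n.
    by apply: kaplansky_approx => //; rewrite invr_gt0.
  have WN S' : W S' -> Nset M S'.
    move=> WS; apply: WS; split; first exact: Nset_von_neumann.
    move=> _ [i _ <-]; have -> : genop M i = pop [:: (1, [:: i])].
      by rewrite /pop big_seq1 scale1r; exact: bop_ext.
    exact: Nset_pop.
  apply: (vn_closed vW); apply: (@tends_ptws_closure _ _ _ _ X) => [n|x e e0].
    by case: (hX n).
  have [b b0 hb] := bop_bounded S.
  have d0 : 0 < e / (2 * (b + 1)) by rewrite divr_gt0// mulr_gt0// ltr_wpDl.
  have [P hP] := cyclic M x d0.
  have [c c0 hc] := bop_bounded (rop P).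
  have q0 : 0 < e / (2 * (3 * (c + 1))) by rewrite divr_gt0// !mulr_gt0// ltr_wpDl.
  have [n0 hn] := inv_nat_lt q0.
  exists n0 => n n0n; have [WX nX XO] := hX n.
  have en : n.+1%:R^-1 < e / (2 * (3 * (c + 1))) by rewrite (le_lt_trans _ hn)// inv_nat_mono.
  have h1 : nr (X n (pv P) - S (pv P)) <= c * nr (X n Om - S Om).
    by rewrite (Nset_vac _ (WN _ WX)) (Nset_vac _ NS) -bopB.
  have h2 := nX (x - pv P); have h3 := hb (x - pv P).
  have -> : X n x - S x = X n (x - pv P) - S (x - pv P) + (X n (pv P) - S (pv P)).
    by rewrite !bopB; zmodule.
  have h4 := ler_nrD (X n (x - pv P) - S (x - pv P)) (X n (pv P) - S (pv P)).
  have h5 := ler_nrB (X n (x - pv P)) (S (x - pv P)).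
  have e1 : (b + 1) * (e / (2 * (b + 1))) = e / 2 by field; rewrite gt_eqF// ltr_wpDl.
  have e2 : (c + 1) * (3 * (e / (2 * (3 * (c + 1))))) = e / 2 by field; rewrite gt_eqF// ltr_wpDl.
  have b1 : 0 < b + 1 by rewrite ltr_wpDl.
  have c1 : 0 < c + 1 by rewrite ltr_wpDl.
  have h6 : (b + 1) * nr (x - pv P) < e / 2 by rewrite -e1 ltr_pM2l.
  have h7 : c * nr (X n Om - S Om) <= e / 2.
    rewrite -e2; apply: ler_pM => //; first exact: nr_ge0.
      by rewrite lerDl.
    by rewrite (le_trans XO)// ler_wpM2l// ltW.
  apply: (le_lt_trans h4); rewrite [X in _ < X](splitr e).
  apply: ltr_leD; last exact: le_trans h1 h7.
  apply: (le_lt_trans h5); apply: le_lt_trans h6; rewrite mulrDl mul1r addrC.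
  exact: lerD.
move=> NT; have [c c0 hc] := bop_bounded T.
pose s := 2 * (c + 1); have s0 : 0 < s by rewrite mulr_gt0// ltr_wpDl.
have -> : T = s%:C *: ((s^-1)%:C *: T).
  by rewrite scalerA -rmorphM /= mulfV ?gt_eqF// rmorph1 scale1r.
apply: (vnZ vW); apply: main; first exact: (@opaZ _ _ (Nalg M)).
have t1 : (2^-1 : R) < 1 by rewrite invf_lt1 ?ltr1n ?ltr0n.
apply: le_lt_trans t1; apply: mxnorm_le => [|v]; first by rewrite invr_ge0.
rewrite (@eq_l2 _ _ _ _ (fun=> (s^-1)%:C *: T (v 0))); last first.
  by move=> i; rewrite /act big_ord1.
rewrite l21 (@eq_l2 _ _ _ v (fun=> v 0)) ?l21; last by move=> i; rewrite ord1.
rewrite nrZ nr_real ger0_norm ?invr_ge0 ?(ltW s0)// mulrC ler_pdivrMr//.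
apply: (le_trans (hc _)); rewrite -mulrA [nr _ * _]mulrC mulrA.
apply: ler_wpM2r; [exact: nr_ge0 | rewrite /s mulKf ?lerDl//].
Qed.

Lemma generated_Nset : W = [set T | Nset M T].
Proof.
apply/seteqP; split=> [T WT|T]; last exact: Nset_sub_generated.
apply: WT; split; first exact: Nset_von_neumann.
move=> _ [i _ <-]; have -> : genop M i = pop [:: (1, [:: i])].
  by rewrite /pop big_seq1 scale1r; exact: bop_ext.
exact: Nset_pop.
Qed.

Lemma generated_QWEP : QWEP_operator_algebra W.
Proof. exact: matricial_QWEP_operator_algebra generated_Nset. Qed.

End GeneratedByMatricial.

(** * The baby Fock model *)

(* The basis vectors are indexed by the subsets J of 'I_m, and w attaches a
   sign to every unordered pair of indices. *)
Section BabyFock.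
Variables (R : realType) (q : R) (m : nat).
Hypothesis hq : -1 < q < 1.
Local Notation T := {ffun 'I_m -> bool}.
Local Notation Sg := {ffun 'I_m * 'I_m -> bool}.
Implicit Types (w : Sg) (J : T) (i j k : 'I_m) (c d : 'I_m -> R) (x y : T -> R).
Implicit Types X Y : Sg -> T -> R.

Definition flip i J : T := [ffun j => (j == i) (+) J j].

Lemma flipK i : involutive (flip i).
Proof. by move=> J; apply/ffunP => j; rewrite !ffunE addbA addbb. Qed.

Lemma flipC i j J : flip i (flip j J) = flip j (flip i J).
Proof. by apply/ffunP => k; rewrite !ffunE addbCA. Qed.

Lemma flip_same i J : flip i J i = ~~ J i.
Proof. by rewrite ffunE eqxx. Qed.

Lemma flip_neq i j J : j != i -> flip i J j = J j.
Proof. by move=> /negbTE ji; rewrite ffunE ji. Qed.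

Lemma sum_flip i (f : T -> R) : \sum_J f (flip i J) = \sum_J f J.
Proof. by rewrite [RHS](reindex_inj (inv_inj (flipK i))). Qed.

Definition pr i j : 'I_m * 'I_m := if (i < j)%N then (i, j) else (j, i).

Lemma prC i j : pr i j = pr j i.
Proof.
rewrite /pr; case: ltngtP => // h.
by have -> : i = j by exact: val_inj.
Qed.

Definition sg w p : R := if w p then 1 else -1.

Definition eps w i j : R := sg w (pr i j).

Lemma epsC w i j : eps w i j = eps w j i.
Proof. by rewrite /eps prC. Qed.

Lemma sg_sqr w p : sg w p * sg w p = 1.
Proof. by rewrite /sg; case: (w p); rewrite ?mulr1// mulrNN mulr1. Qed.

Lemma eps_sqr w i j : eps w i j * eps w i j = 1.
Proof. exact: sg_sqr. Qed.

(** A phase of Jordan-Wigner type: the product of the signs met when [i] crosses the elements of [J]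
    below it. [rsgn] crosses those above, as multiplication from the right does. *)
Definition sgn w i J : R := \prod_(k < m | (k < i)%N && J k) eps w i k.
Definition rsgn w i J : R := \prod_(k < m | (i < k)%N && J k) eps w i k.

Lemma prod_flip (P : pred 'I_m) (e : 'I_m -> R) j J : (forall k, e k * e k = 1) ->
  \prod_(k | P k && flip j J k) e k = \prod_(k | P k && J k) e k * (if P j then e j else 1).
Proof.
move=> ee; case: ifP => Pj; last first.
  rewrite mulr1; apply: eq_bigl => k; case: (eqVneq k j) => [->|kj]; first by rewrite Pj.
  by rewrite flip_neq.
have e1 (J' : T) : \prod_(k | P k && J' k) e k =
    (if J' j then e j else 1) * \prod_(k | [&& P k, J' k & k != j]) e k.
  case: ifP => Jj.
    rewrite (bigD1 j) ?Pj//=; congr (_ * _); apply: eq_bigl => k; by rewrite andbA.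
  rewrite mul1r; apply: eq_bigl => k; case: (eqVneq k j) => [->|_]; first by rewrite Jj !andbF.
  by rewrite andbT.
rewrite !e1 flip_same.
have -> : \prod_(k | [&& P k, flip j J k & k != j]) e k = \prod_(k | [&& P k, J k & k != j]) e k.
  apply: eq_bigl => k; case: (eqVneq k j) => [->|kj]; first by rewrite !andbF.
  by rewrite flip_neq.
case: (J j) => /=; last by rewrite mul1r mulrC.
by rewrite mul1r mulrAC ee mul1r.
Qed.

Lemma sgn_flip w i j J : sgn w i (flip j J) = sgn w i J * (if (j < i)%N then eps w i j else 1).
Proof. by apply: (prod_flip (fun k => (k < i)%N)) => k; exact: eps_sqr. Qed.

Lemma rsgn_flip w i j J : rsgn w i (flip j J) = rsgn w i J * (if (i < j)%N then eps w i j else 1).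
Proof. by apply: (prod_flip (fun k => (i < k)%N)) => k; exact: eps_sqr. Qed.

Lemma prod_sqr1 (P : pred 'I_m) (e : 'I_m -> R) : (forall k, e k * e k = 1) ->
  \prod_(k | P k) e k * \prod_(k | P k) e k = 1.
Proof. by move=> ee; rewrite -big_split big1// => k _; exact: ee. Qed.

Lemma sgn_sqr w i J : sgn w i J * sgn w i J = 1.
Proof. by apply: prod_sqr1 => k; exact: eps_sqr. Qed.

Lemma rsgn_sqr w i J : rsgn w i J * rsgn w i J = 1.
Proof. by apply: prod_sqr1 => k; exact: eps_sqr. Qed.

Lemma sgn_flip_same w i J : sgn w i (flip i J) = sgn w i J.
Proof. by rewrite sgn_flip ltnn mulr1. Qed.

Lemma rsgn_flip_same w i J : rsgn w i (flip i J) = rsgn w i J.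
Proof. by rewrite rsgn_flip ltnn mulr1. Qed.

Definition cre w c x J : R := \sum_i c i * (J i)%:R * sgn w i J * x (flip i J).
Definition ann w c x J : R := \sum_i c i * (~~ J i)%:R * sgn w i J * x (flip i J).
Definition fld w c x J : R := \sum_i c i * sgn w i J * x (flip i J).

Lemma fldE w c x J : fld w c x J = cre w c x J + ann w c x J.
Proof.
rewrite -big_split; apply: eq_bigr => i _ /=.
by case: (J i); rewrite /= ?mulr1 ?mulr0 ?mul0r ?addr0 ?add0r.
Qed.

(* Right multiplications, which commute with the fields. *)
Definition rfl w j x J : R := rsgn w j J * x (flip j J).

(** Flipping [j] changes the left phase of [i] by [eps i j] exactly when [j < i], and flipping [i]
    changes the right phase of [j] in the same case; the two signs cancel. *)
Lemma fld_rfl w c j x J : fld w c (rfl w j x) J = rfl w j (fld w c x) J.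
Proof.
rewrite /rfl /fld mulr_sumr; apply: eq_bigr => i _.
rewrite flipC rsgn_flip sgn_flip (epsC w j i).
by case: ifP => _; ring.
Qed.

Definition dlt I J : R := (J == I)%:R.

Lemma rfl_dlt w j I J : rfl w j (dlt I) J = rsgn w j I * dlt (flip j I) J.
Proof.
rewrite /rfl /dlt; have -> : (flip j J == I) = (J == flip j I).
  by apply/eqP/eqP => [<-|->]; rewrite flipK.
by case: eqP => [->|_]; rewrite ?mulr0// rsgn_flip_same.
Qed.

Lemma fldZ w c a x J : fld w c (fun I => a * x I) J = a * fld w c x J.
Proof. by rewrite mulr_sumr; apply: eq_bigr => i _; ring. Qed.

Definition wfld w (cs : seq ('I_m -> R)) x : T -> R := foldr (fun c y => fld w c y) x cs.

Lemma wfld_ext w cs x y : (forall J, x J = y J) -> forall J, wfld w cs x J = wfld w cs y J.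
Proof.
move=> xy; elim: cs => [|c cs IH] J //=.
by apply: eq_bigr => i _; rewrite IH.
Qed.

Lemma wfld_rfl w cs j x J : wfld w cs (rfl w j x) J = rfl w j (wfld w cs x) J.
Proof.
elim: cs J => [|c cs IH] J //=.
by rewrite -fld_rfl; apply: eq_bigr => i _; rewrite IH.
Qed.

Lemma wfldZ w cs a x J : wfld w cs (fun I => a * x I) J = a * wfld w cs x J.
Proof.
elim: cs J => [|c cs IH] J //=.
by rewrite -fldZ; apply: eq_bigr => i _; rewrite IH.
Qed.

Definition emp : T := [ffun=> false].

(** [rfl j] commutes with words in the fields and sends the basis vector of [I] to that of
    [flip j I] up to a sign, which occurs twice. *)
Lemma diag_flip w cs j I : wfld w cs (dlt (flip j I)) (flip j I) = wfld w cs (dlt I) I.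
Proof.
have e1 : forall J, dlt (flip j I) J = rsgn w j I * rfl w j (dlt I) J.
  by move=> J; rewrite rfl_dlt mulrA rsgn_sqr mul1r.
rewrite (wfld_ext _ _ e1) wfldZ wfld_rfl /rfl flipK rsgn_flip_same mulrA rsgn_sqr.
by rewrite mul1r.
Qed.

Definition deg J : nat := #|[pred i | J i]|.

Lemma sum_deg J : \sum_i (J i)%:R = (deg J)%:R :> R.
Proof.
rewrite /deg -sum1_card natr_sum big_mkcond [RHS]big_mkcond; apply: eq_bigr => i _.
by rewrite inE; case: (J i).
Qed.

Lemma deg_flipT i J : J i -> deg J = (deg (flip i J)).+1.
Proof.
move=> Ji; rewrite /deg (cardD1 i) inE Ji; congr _.+1; apply: eq_card => k.
by rewrite !inE ffunE; case: (eqVneq k i) => [->|]; rewrite ?Ji.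
Qed.

Lemma deg_flipF i J : ~~ J i -> deg (flip i J) = (deg J).+1.
Proof. by move=> Ji; rewrite (@deg_flipT i) ?flipK// flip_same. Qed.

(* The trace is the vacuum state. *)
Lemma diag_const w cs I : wfld w cs (dlt I) I = wfld w cs (dlt emp) emp.
Proof.
have [n] := ubnP (deg I); elim: n I => // n IH I.
have [i Ii|I0] := pickP (fun i => I i).
  by rewrite ltnS (deg_flipT Ii) => hn; rewrite -(diag_flip _ _ i I) IH.
by move=> _; have -> : I = emp by apply/ffunP => i; rewrite I0 ffunE.
Qed.

Definition suppl n x := forall J, (n < deg J)%N -> x J = 0.

Lemma suppl_cre n w c x : suppl n x -> suppl n.+1 (cre w c x).
Proof.
move=> hx J hJ; apply: big1 => i _; case Ji : (J i); last by rewrite mulr0 !mul0r.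
by rewrite hx ?mulr0//; move: hJ; rewrite (deg_flipT Ji) ltnS.
Qed.

Lemma suppl_ann n w c x : suppl n x -> suppl n (ann w c x).
Proof.
move=> hx J hJ; apply: big1 => i _; case Ji : (J i); first by rewrite mulr0 !mul0r.
by rewrite hx ?mulr0// deg_flipF ?Ji// leqW.
Qed.

Definition nsq x : R := \sum_J x J ^+ 2.
Definition csq c : R := \sum_i c i ^+ 2.

Lemma nsq_ge0 x : 0 <= nsq x.
Proof. by apply: sumr_ge0 => J _; exact: sqr_ge0. Qed.

Lemma csq_ge0 c : 0 <= csq c.
Proof. by apply: sumr_ge0 => J _; exact: sqr_ge0. Qed.

Lemma cauchy_schwarz_sum (A : finType) (a b : A -> R) :
  (\sum_i a i * b i) ^+ 2 <= (\sum_i a i ^+ 2) * (\sum_i b i ^+ 2).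
Proof.
have h : 0 <= \sum_i \sum_j (a i * b j - a j * b i) ^+ 2.
  by apply: sumr_ge0 => i _; apply: sumr_ge0 => j _; exact: sqr_ge0.
have e : \sum_i \sum_j (a i * b j - a j * b i) ^+ 2 =
    2 * ((\sum_i a i ^+ 2) * (\sum_i b i ^+ 2)) - 2 * (\sum_i a i * b i) ^+ 2.
  rewrite mulr2n mulrDl !mul1r {1}mulrC expr2 !mulr_suml !mulr_sumr -big_split -sumrB.
  apply: eq_bigr => i _; rewrite !mulr_sumr -big_split -sumrB; apply: eq_bigr => j _ /=; ring.
rewrite e in h; lra.
Qed.

Lemma nsqD_le x y : nsq (fun J => x J + y J) <= 2 * nsq x + 2 * nsq y.
Proof.
rewrite /nsq !mulr_sumr -big_split ler_sum// => J _ /=.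
have := sqr_ge0 (x J - y J); rewrite sqrrB sqrrD; lra.
Qed.

Lemma nsqZ a x : nsq (fun J => a * x J) = a ^+ 2 * nsq x.
Proof. by rewrite /nsq mulr_sumr; apply: eq_bigr => J _; rewrite exprMn. Qed.

(** Cauchy-Schwarz over the at most [n + 1] elements of [J]; each value of [x] is then counted with
    total weight [csq c]. *)
Lemma nsq_cre n w c x : suppl n x -> nsq (cre w c x) <= n.+1%:R * csq c * nsq x.
Proof.
move=> hx.
rewrite /nsq; apply: (@le_trans _ _ (\sum_(J : T) n.+1%:R * \sum_i (c i) ^+ 2 * x (flip i J) ^+ 2)).
  apply: ler_sum => J _; have [hJ|hJ] := leqP (deg J) n.+1; last first.
    rewrite (suppl_cre w c hx hJ) expr0n /=.
    by rewrite mulr_ge0// sumr_ge0// => i _; rewrite mulr_ge0 ?sqr_ge0.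
  have -> : cre w c x J = \sum_i (J i)%:R * (c i * sgn w i J * x (flip i J)).
    by apply: eq_bigr => i _; ring.
  apply: (le_trans (cauchy_schwarz_sum _ _)).
  apply: ler_pM; [by apply: sumr_ge0 => i _; exact: sqr_ge0|by apply: sumr_ge0 => i _; exact: sqr_ge0| |].
    rewrite (eq_bigr (fun i => (J i)%:R)) ?sum_deg ?ler_nat// => i _.
    by case: (J i); rewrite ?expr1n ?expr0n.
  apply: ler_sum => i _; rewrite !exprMn [sgn w i J ^+ 2]expr2 sgn_sqr mulr1//.
rewrite -mulr_sumr -mulrA ler_wpM2l// exchange_big /csq mulr_suml ler_sum// => i _ /=.
by rewrite -mulr_sumr (sum_flip i (fun J => x J ^+ 2)).
Qed.

(** Cauchy-Schwarz against the coefficients [c]; the value at [J] is then counted [deg J] times, at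
    most [n]. *)
Lemma nsq_ann n w c x : suppl n x -> nsq (ann w c x) <= n%:R * csq c * nsq x.
Proof.
move=> hx.
rewrite /nsq; apply: (@le_trans _ _ (\sum_(J : T) csq c * \sum_i (~~ J i)%:R * x (flip i J) ^+ 2)).
  apply: ler_sum => J _.
  have -> : ann w c x J = \sum_i c i * ((~~ J i)%:R * sgn w i J * x (flip i J)).
    by apply: eq_bigr => i _; ring.
  apply: (le_trans (cauchy_schwarz_sum _ _)); apply: ler_wpM2l; first exact: csq_ge0.
  apply: ler_sum => i _; rewrite !exprMn [sgn w i J ^+ 2]expr2 sgn_sqr mulr1.
  by case: (J i); rewrite ?expr1n ?expr0n.
rewrite -mulr_sumr mulrAC [leRHS]mulrC ler_wpM2l ?csq_ge0// exchange_big /=.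
have -> : \sum_i \sum_(J : T) (~~ J i)%:R * x (flip i J) ^+ 2 = \sum_i \sum_(J : T) (J i)%:R * x J ^+ 2.
  apply: eq_bigr => i _; rewrite -(sum_flip i (fun J => (J i)%:R * _)).
  by apply: eq_bigr => J _; rewrite flip_same.
rewrite exchange_big /nsq mulr_sumr ler_sum// => J _ /=.
rewrite -mulr_suml sum_deg; have [hJ|hJ] := leqP (deg J) n.
  by rewrite ler_wpM2r ?sqr_ge0// ler_nat.
by rewrite hx// expr0n !mulr0.
Qed.

Definition tw w i j J : R := sgn w j J * sgn w i (flip j J).

(** The part of the commutation defect that carries the centred signs [eps - q], grouped by the
    annihilated index [i]. *)
Definition Yv w d x i J : R :=
  \sum_j d j * (J j)%:R * (eps w i j - q) * tw w i j J * x (flip i (flip j J)).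

(** For distinct indices, exchanging annihilation and creation costs [eps i j], whence the factor
    [eps - q] in [Yv]. Equal indices give the scalar product, corrected by the indices already
    present in [J]. *)
Lemma q_commutation w c d x J :
  ann w c (cre w d x) J - q * cre w d (ann w c x) J - (\sum_i c i * d i) * x J =
  \sum_i c i * (~~ J i)%:R * Yv w d x i J - (1 + q) * (\sum_i c i * d i * (J i)%:R) * x J.
Proof.
have e1 : ann w c (cre w d x) J = \sum_i c i * (~~ J i)%:R * d i * x J +
    \sum_i \sum_j c i * (~~ J i)%:R * (d j * (J j)%:R * eps w i j * tw w i j J * x (flip i (flip j J))).
  rewrite -big_split; apply: eq_bigr => i _ /=; case Ji : (J i).
    by rewrite !mulr0 !mul0r add0r big1// => j _; rewrite !mul0r.
  rewrite !mulr1 /cre (bigD1 i)//= [X in _ = _ + X](bigD1 i)//= flip_same Ji flipK.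
  rewrite sgn_flip_same !(mulr0, mul0r, add0r, mulr1) mulrDr; congr (_ + _).
    by rewrite -[RHS]mulr1 -(sgn_sqr w i J); ring.
  rewrite mulr_sumr; apply: eq_bigr => j ji; rewrite flip_neq// flipC /tw !sgn_flip (epsC w j i).
  have : (i < j)%N || (j < i)%N by rewrite -neq_ltn eq_sym.
  case: (ltngtP (i : nat) (j : nat)) => // _ _; rewrite ?mulr1; first by ring.
  by rewrite -[LHS]mulr1 -(eps_sqr w i j); ring.
have e2 : cre w d (ann w c x) J = \sum_i c i * (J i)%:R * d i * x J +
    \sum_i \sum_j c i * (~~ J i)%:R * (d j * (J j)%:R * tw w i j J * x (flip i (flip j J))).
  rewrite exchange_big -big_split; apply: eq_bigr => j _ /=; case Jj : (J j); last first.
    by rewrite !(mulr0, mul0r) add0r big1// => i _; rewrite !(mulr0, mul0r).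
  rewrite !mulr1 /ann (bigD1 j)//= [X in _ = _ + X](bigD1 j)//= flip_same Jj flipK /=.
  rewrite sgn_flip_same !(mulr0, mul0r, add0r, mulr1) mulrDr; congr (_ + _).
    by rewrite -[RHS]mulr1 -(sgn_sqr w j J); ring.
  by rewrite mulr_sumr; apply: eq_bigr => i ij; rewrite flip_neq// /tw; ring.
have e3 : \sum_i c i * (~~ J i)%:R * d i * x J =
    (\sum_i c i * d i) * x J - (\sum_i c i * d i * (J i)%:R) * x J.
  rewrite !mulr_suml -sumrB; apply: eq_bigr => i _.
  by case: (J i); rewrite /= ?mulr1 ?mulr0 ?mul0r ?subrr ?subr0.
have e4 : \sum_i c i * (J i)%:R * d i * x J = (\sum_i c i * d i * (J i)%:R) * x J.
  by rewrite mulr_suml; apply: eq_bigr => i _; ring.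
have e5 : \sum_i c i * (~~ J i)%:R * Yv w d x i J =
    \sum_i \sum_j c i * (~~ J i)%:R * (d j * (J j)%:R * eps w i j * tw w i j J * x (flip i (flip j J))) -
    q * (\sum_i \sum_j c i * (~~ J i)%:R * (d j * (J j)%:R * tw w i j J * x (flip i (flip j J)))).
  rewrite mulr_sumr -sumrB; apply: eq_bigr => i _; rewrite mulr_sumr mulr_sumr -sumrB.
  by apply: eq_bigr => j _; ring.
rewrite e1 e2 e3 e4 e5; ring.
Qed.

(** The law on two signs whose mean is [q]; [wt] is the product law and [EE] its expectation. *)
Definition wt1 (b : bool) : R := if b then (1 + q) / 2 else (1 - q) / 2.
Definition wt w : R := \prod_p wt1 (w p).
Definition EE (f : Sg -> R) : R := \sum_w wt w * f w.

Lemma wt1_ge0 b : 0 <= wt1 b.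
Proof. by case/andP: hq => h1 h2; rewrite /wt1; case: b; rewrite divr_ge0//; lra. Qed.

Lemma wt_ge0 w : 0 <= wt w.
Proof. by apply: prodr_ge0 => p _; exact: wt1_ge0. Qed.

Lemma wt_sum : \sum_w wt w = 1.
Proof.
rewrite /wt -(bigA_distr_bigA (fun _ (b : bool) => wt1 b)) big1// => p _.
by rewrite big_bool /wt1 /=; field.
Qed.

Lemma EE_le f g : (forall w, f w <= g w) -> EE f <= EE g.
Proof. by move=> h; apply: ler_sum => w _; rewrite ler_wpM2l ?wt_ge0. Qed.

Lemma EE_exists f a : EE f < a -> exists w, f w < a.
Proof.
move=> h; have [w hw|hf] := pickP (fun w => f w < a); first by exists w.
move: h; rewrite ltNge => /negP[]; rewrite -[a]mul1r -wt_sum mulr_suml.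
by apply: ler_sum => w _; rewrite ler_wpM2l ?wt_ge0// leNgt hf.
Qed.

Definition tog p w : Sg := [ffun r => (r == p) (+) w r].

Lemma togK p : involutive (tog p).
Proof. by move=> w; apply/ffunP => r; rewrite !ffunE addbA addbb. Qed.

(** [f] is independent of the sign at [p], whose centred value has mean zero; pairing [w] with
    [tog p w] makes this explicit. *)
Lemma EE_indep p (f : Sg -> R) : (forall w, f (tog p w) = f w) ->
  EE (fun w => (sg w p - q) * f w) = 0.
Proof.
move=> ft; rewrite /EE; set S := \sum_w _.
suff : S + S = 0 by lra.
rewrite /S {1}(reindex_inj (inv_inj (togK p))) -big_split; apply: big1 => w _ /=.
have e (w' : Sg) : wt w' = wt1 (w' p) * \prod_(r | r != p) wt1 (w' r) by rewrite /wt (bigD1 p).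
have -> : wt (tog p w) = wt1 (~~ w p) * \prod_(r | r != p) wt1 (w r).
  rewrite e ffunE eqxx /=; congr (_ * _); apply: eq_bigr => r rp.
  by rewrite ffunE (negbTE rp).
rewrite e ft /sg ffunE eqxx /= /wt1; case: (w p) => /=; by field.
Qed.

Lemma pr_eq i j a b : pr a b = pr i j -> ((i == a) || (i == b)) && ((j == a) || (j == b)).
Proof.
by rewrite /pr; case: ifP => _; case: ifP => _ [-> ->]; rewrite !eqxx ?orbT.
Qed.

Lemma eps_tog i j w a b : ((i != a) && (i != b)) || ((j != a) && (j != b)) ->
  eps (tog (pr i j) w) a b = eps w a b.
Proof.
move=> h; rewrite /eps /sg ffunE; case: eqP => // /pr_eq.
by move: h; case: (i == a); case: (i == b); case: (j == a); case: (j == b).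
Qed.

(* The vector X w at J only depends on the signs of the pairs inside J. *)
Definition local X := forall w i j J, i != j -> ~~ (J i && J j) -> X (tog (pr i j) w) J = X w J.

Lemma sgn_tog w i j (a : 'I_m) J : i != j ->
  (forall k, (k < a)%N -> J k -> ((i != a) && (i != k)) || ((j != a) && (j != k))) ->
  sgn (tog (pr i j) w) a J = sgn w a J.
Proof. by move=> ij h; apply: eq_bigr => k /andP[ka Jk]; rewrite eps_tog// h. Qed.

Lemma local_cre c X : local X -> local (fun w => cre w c (X w)).
Proof.
move=> lX w i j J ij hJ; apply: eq_bigr => k _; case Jk : (J k); last by rewrite !(mulr0, mul0r).
rewrite sgn_tog//; last first.
  move=> l _ Jl; case: (eqVneq i k) => [ik|_].
    rewrite -ik in Jk; have jF : ~~ J j by move: hJ; rewrite Jk.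
    by rewrite -ik [j == i]eq_sym ij /=; apply: contraNneq jF => ->.
  case: (eqVneq i l) => [il|//]; rewrite -il in Jl; have jF : ~~ J j by move: hJ; rewrite Jl.
  by rewrite -il [j == i]eq_sym ij andbT; apply: contraNneq jF => ->; rewrite Jk.
congr (_ * _); apply: lX => //; apply: contra hJ => /andP[].
by rewrite !ffunE; case: (eqVneq i k) => [->|_]; case: (eqVneq j k) => [->|_] //=; rewrite ?Jk//= => -> ->.
Qed.

Lemma EE_sum (A : finType) (f : A -> Sg -> R) :
  EE (fun w => \sum_a f a w) = \sum_a EE (f a).
Proof.
rewrite /EE exchange_big; apply: eq_bigr => w _ /=; by rewrite mulr_sumr.
Qed.

Lemma EEZ a f : EE (fun w => a * f w) = a * EE f.
Proof. by rewrite /EE mulr_sumr; apply: eq_bigr => w _; ring. Qed.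

Lemma eq_EE f g : (forall w, f w = g w) -> EE f = EE g.
Proof. by move=> h; apply: eq_bigr => w _; rewrite h. Qed.

(* Toggling the sign of the pair {i, j} changes nothing else in the product. *)
Lemma Yv_orthogonal d X i i' J : local X -> i != i' -> ~~ J i -> ~~ J i' ->
  EE (fun w => Yv w d (X w) i J * Yv w d (X w) i' J) = 0.
Proof.
move=> lX ii Ji Ji'.
transitivity (EE (fun w => \sum_j (sg w (pr i j) - q) * (d j * (J j)%:R * tw w i j J *
    X w (flip i (flip j J)) * Yv w d (X w) i' J))).
  by apply: eq_EE => w; rewrite mulr_suml; apply: eq_bigr => j _; rewrite -/(eps w i j); ring.
rewrite EE_sum big1// => j _; apply: EE_indep => w.
case Jj : (J j); last by rewrite !(mulr0, mul0r).
have ij : i != j by apply: contraNneq Ji => ->.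
have i'j : i' != j by apply: contraNneq Ji' => ->.
have iJ k : J k -> i != k by move=> Jk; apply: contraNneq Ji => ->.
congr (_ * _); first congr (_ * _ * _).
- rewrite /tw; congr (_ * _); apply: sgn_tog => // k _ hk.
    by rewrite ij iJ.
  have kj : k != j by apply: contraTneq hk => ->; rewrite flip_same Jj.
  by rewrite [_ && _ in X in _ || X](_ : _ = true) ?orbT// eq_sym ij eq_sym kj.
- by apply: lX => //; rewrite (flip_neq _ (_ : j != i)) ?flip_same ?Jj ?andbF// eq_sym.
apply: eq_bigr => l _; case Jl : (J l); last by rewrite !(mulr0, mul0r).
rewrite eps_tog; last by rewrite ii iJ.
congr (_ * _ * _).
- rewrite /tw; congr (_ * _); apply: sgn_tog => // k _ hk.
    by rewrite (iJ l) ?iJ.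
  rewrite ii /=; have : flip l J k -> i != k.
    by rewrite ffunE; case: (eqVneq k l) => [->|_] /= h; apply: iJ.
  by move=> ->.
- apply: lX => //; rewrite (flip_neq _ ii) flip_neq ?(negbTE Ji)//.
  exact: iJ.
Qed.

(** Cauchy-Schwarz over the elements of [J]; the factor 4 bounds [(eps - q) ^ 2]. *)
Lemma Yv_sqr_le w d x i J : Yv w d x i J ^+ 2 <=
  4 * ((deg J)%:R * \sum_j (J j)%:R * d j ^+ 2 * x (flip i (flip j J)) ^+ 2).
Proof.
have -> : Yv w d x i J = \sum_j (J j)%:R *
    ((J j)%:R * d j * (eps w i j - q) * tw w i j J * x (flip i (flip j J))).
  by apply: eq_bigr => j _; case: (J j); rewrite ?(mulr0, mul0r, mulr1, mul1r).
apply: (le_trans (cauchy_schwarz_sum _ _)).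
rewrite (eq_bigr (fun j => (J j)%:R)) ?sum_deg => [|j _]; last first.
  by case: (J j); rewrite ?expr1n ?expr0n.
rewrite mulrCA ler_wpM2l// mulr_sumr ler_sum// => j _.
have t1 : tw w i j J ^+ 2 = 1.
  by rewrite /tw expr2 mulrACA !sgn_sqr mulr1.
have h : (eps w i j - q) ^+ 2 <= 4.
  by case/andP: hq => h1 h2; rewrite /eps /sg; case: ifP => _; rewrite expr2; nra.
move: t1; move: (tw w i j J) => t t1.
rewrite !exprMn t1 mulr1; case: (J j); rewrite ?expr1n ?expr0n /= ?mul1r ?mul0r ?mulr0//.
rewrite -mulrA [leRHS]mulrCA; apply: ler_wpM2l; first exact: sqr_ge0.
by apply: ler_wpM2r => //; exact: sqr_ge0.
Qed.

Definition EN X : R := EE (fun w => nsq (X w)).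

Definition Zv w c d x J : R :=
  ann w c (cre w d x) J - q * cre w d (ann w c x) J - (\sum_i c i * d i) * x J.

(** Distinct [i] are orthogonal in L2 of the signs, so the sum of the [c i Yv i] costs the sum of
    the [c i ^ 2] times squared norms, and every [c i ^ 2] is at most [eta ^ 2]. In the diagonal
    correction at most [n] indices occur, each with a small product [c i * d i]. *)
Lemma EN_Z n c d X (eta : R) : 0 <= eta <= 1 -> local X -> (forall w, suppl n (X w)) ->
  (forall i, `|c i| <= eta) -> (forall i, `|d i| <= eta) ->
  EN (fun w => Zv w c d (X w)) <= (8 * csq d + 8) * n%:R ^+ 2 * eta ^+ 2 * EN X.
Proof.
move=> /andP[eta0 eta1] lX sX ce de.
pose Q1 w J := \sum_i c i * (~~ J i)%:R * Yv w d (X w) i J.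
pose Q2 w J := - (1 + q) * (\sum_i c i * d i * (J i)%:R) * X w J.
have E0 : EN (fun w => Zv w c d (X w)) <= 2 * EN Q1 + 2 * EN Q2.
  rewrite /EN -!EEZ -big_split; apply: (ler_sum) => w _ /=; rewrite -mulrDr ler_wpM2l ?wt_ge0//.
  apply: le_trans (nsqD_le _ _); rewrite le_eqVlt; apply/orP; left; apply/eqP; apply: eq_bigr => J _.
  by rewrite /Zv q_commutation /Q2 !mulNr.
have ENX0 : 0 <= EN X by apply: sumr_ge0 => w _; rewrite mulr_ge0 ?wt_ge0 ?nsq_ge0.
have e2 : eta ^+ 2 <= 1 by rewrite expr_le1.
have c2 i : c i ^+ 2 <= eta ^+ 2 by rewrite -[c i ^+ 2]real_normK ?num_real// ler_pXn2r ?nnegrE.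
have E2 : EN Q2 <= 4 * n%:R ^+ 2 * eta ^+ 2 * EN X.
  rewrite /EN -EEZ; apply: EE_le => w; rewrite /nsq mulr_sumr ler_sum// => J _.
  rewrite /Q2 exprMn; have [hJ|hJ] := leqP (deg J) n; last by rewrite (sX w)// expr0n !mulr0.
  rewrite ler_wpM2r ?sqr_ge0// exprMn -mulrA ler_pM ?sqr_ge0//.
    by case/andP: hq => h1 h2; rewrite expr2; nra.
  have h1 : `|\sum_i c i * d i * (J i)%:R| <= n%:R * eta.
    rewrite (le_trans (ler_norm_sum _ _ _))// (@le_trans _ _ (\sum_i (J i)%:R * eta))//.
      apply: ler_sum => i _; rewrite !normrM [X in _ * X]ger0_norm// mulrC ler_wpM2l//.
      by rewrite (le_trans (ler_pM _ _ (ce i) (de i)))// ler_piMl.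
    by rewrite -mulr_suml sum_deg ler_wpM2r// ler_nat.
  by rewrite -exprMn -[X in X <= _]real_normK ?num_real// ler_pXn2r ?nnegrE ?mulr_ge0.
have E1 : EN Q1 <= 4 * n%:R ^+ 2 * eta ^+ 2 * csq d * EN X.
  have -> : EN Q1 = \sum_(J : T) \sum_i c i ^+ 2 * (~~ J i)%:R * EE (fun w => Yv w d (X w) i J ^+ 2).
    rewrite /EN /nsq EE_sum; apply: eq_bigr => J _.
    transitivity (\sum_i \sum_i' c i * (~~ J i)%:R * (c i' * (~~ J i')%:R) *
        EE (fun w => Yv w d (X w) i J * Yv w d (X w) i' J)).
      transitivity (EE (fun w => \sum_i \sum_i' c i * (~~ J i)%:R * (c i' * (~~ J i')%:R) *
          (Yv w d (X w) i J * Yv w d (X w) i' J))).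
        apply: eq_EE => w; rewrite expr2 mulr_suml; apply: eq_bigr => i _.
        by rewrite mulr_sumr; apply: eq_bigr => i' _; ring.
      rewrite EE_sum; apply: eq_bigr => i _; rewrite EE_sum; apply: eq_bigr => i' _.
      by rewrite EEZ.
    apply: eq_bigr => i _; rewrite (bigD1 i)//= [X in _ + X]big1 ?addr0.
      congr (_ * _); first by case: (J i); rewrite /= ?(mulr0, mul0r)// !mulr1 expr2.
    move=> i' ii; case Ji : (J i); first by rewrite !(mulr0, mul0r).
    case Ji' : (J i'); first by rewrite !(mulr0, mul0r).
    by rewrite Yv_orthogonal ?mulr0 ?Ji ?Ji'// eq_sym.
  apply: (@le_trans _ _ (\sum_(J : T) \sum_i \sum_j EE (fun w => 4 * n%:R * eta ^+ 2 *
      ((~~ J i)%:R * (J j)%:R * d j ^+ 2 * X w (flip i (flip j J)) ^+ 2)))).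
    apply: ler_sum => J _; apply: ler_sum => i _; rewrite -EE_sum -EEZ; apply: EE_le => w.
    case Ji : (J i) => /=.
      by rewrite mulr0 mul0r sumr_ge0// => j _; rewrite !mul0r mulr0.
    rewrite mulr1 -mulr_sumr; apply: (le_trans (ler_wpM2r (sqr_ge0 _) (c2 i))).
    rewrite [4 * _ * _]mulrC -[leRHS]mulrA.
    apply: ler_wpM2l; first exact: sqr_ge0.
    apply: (le_trans (Yv_sqr_le _ _ _ _ _)); rewrite -[leRHS]mulrA ler_wpM2l// !mulr_sumr.
    apply: ler_sum => j _; rewrite mul1r; case Jj : (J j); last by rewrite !(mul0r, mulr0).
    have [hJ|hJ] := leqP (deg J) n.
      apply: ler_wpM2r; last by rewrite ler_nat.
      by rewrite /= mul1r mulr_ge0 ?sqr_ge0.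
    rewrite (sX w); first by rewrite expr0n !mulr0.
    rewrite deg_flipF ?flip_neq ?Ji//; last by apply: contraFneq Ji => ->.
    by rewrite -(deg_flipT Jj).
  rewrite exchange_big; under eq_bigr do rewrite exchange_big.
  (* Substituting [flip i (flip j J)] for [J] moves [i] inside the set, so that the sum over [i]
     produces the degree. *)
  have E3 i j : \sum_(J : T) EE (fun w => 4 * n%:R * eta ^+ 2 *
      ((~~ J i)%:R * (J j)%:R * d j ^+ 2 * X w (flip i (flip j J)) ^+ 2)) <=
      4 * n%:R * eta ^+ 2 * d j ^+ 2 * EE (fun w => \sum_(J : T) (J i)%:R * X w J ^+ 2).
    rewrite -EE_sum -EEZ; apply: EE_le => w; rewrite -mulr_sumr -[leRHS]mulrA.
    rewrite ler_wpM2l ?mulr_ge0 ?sqr_ge0// -(sum_flip i (fun J => (J i)%:R * _)).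
    rewrite -(sum_flip j (fun J => (flip i J i)%:R * _)) mulr_sumr ler_sum// => J _.
    rewrite flip_same; case: (eqVneq i j) => [->|ij].
      rewrite flip_same; case: (J j); rewrite /= !(mulr0, mul0r)//.
      by rewrite mul1r mulr_ge0 ?sqr_ge0.
    rewrite (flip_neq _ ij); case: (J i); rewrite /= ?(mulr0, mul0r)// !mul1r.
    by case: (J j); rewrite /= ?(mul1r, mul0r)// mulr_ge0 ?sqr_ge0.
  apply: (le_trans (ler_sum _ (fun i _ => ler_sum _ (fun j _ => E3 i j)))).
  have -> : \sum_i \sum_j 4 * n%:R * eta ^+ 2 * d j ^+ 2 * EE (fun w => \sum_(J : T) (J i)%:R * X w J ^+ 2) =
      4 * n%:R * eta ^+ 2 * csq d * EE (fun w => \sum_(J : T) (deg J)%:R * X w J ^+ 2).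
    transitivity (\sum_i 4 * n%:R * eta ^+ 2 * csq d * EE (fun w => \sum_(J : T) (J i)%:R * X w J ^+ 2)).
      apply: eq_bigr => i _; rewrite -mulr_suml; congr (_ * _).
      by rewrite /csq mulr_sumr.
    rewrite -mulr_sumr -EE_sum; congr (_ * _); apply: eq_EE => w.
    rewrite exchange_big; apply: eq_bigr => J _ /=.
    by rewrite -mulr_suml sum_deg.
  have -> : 4 * n%:R ^+ 2 * eta ^+ 2 * csq d * EN X = 4 * n%:R * eta ^+ 2 * csq d * (n%:R * EN X).
    by ring.
  rewrite ler_wpM2l ?mulr_ge0 ?csq_ge0 ?sqr_ge0//.
  rewrite -EEZ; apply: EE_le => w; rewrite /nsq mulr_sumr ler_sum// => J _.
  have [hJ|hJ] := leqP (deg J) n; first by rewrite ler_wpM2r ?sqr_ge0// ler_nat.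
  by rewrite (sX w)// expr0n !mulr0.
apply: (le_trans E0); move: E1 E2; move: (EN Q1) (EN Q2) => a b.
by move: (n%:R ^+ 2) => s; lra.
Qed.

End BabyFock.

(** * Words of Gaussians *)

(* [annw f s] is the annihilation operator of f applied to the tensor s, and
   [wick w] is the product of the Gaussians of w applied to the vacuum. *)
Section FormalWords.
Variables (R : comNzRingType) (G : eqType) (ga : G -> G -> R) (q : R).
Implicit Types (f g : G) (s t w : seq G) (P : seq (R * seq G)).

Fixpoint annw f s : seq (R * seq G) :=
  if s is g :: t then (ga f g, t) :: [seq (q * p.1, g :: p.2) | p <- annw f t] else [::].

Definition annP f P : seq (R * seq G) :=
  flatten [seq [seq (p.1 * r.1, r.2) | r <- annw f p.2] | p <- P].

Definition creP f P : seq (R * seq G) := [seq (p.1, f :: p.2) | p <- P].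

Fixpoint wick w : seq (R * seq G) :=
  if w is f :: w' then creP f (wick w') ++ annP f (wick w') else [:: (1, [::])].

Lemma annw_size f s p : p \in annw f s -> size s = (size p.2).+1.
Proof.
elim: s p => [//|g t IH] p /=; rewrite inE => /orP[/eqP->//|/mapP[r rt ->]] /=.
by rewrite (IH r).
Qed.

Lemma wick_size w p : p \in wick w -> (size p.2 <= size w)%N.
Proof.
elim: w p => [|f w IH] p /=; first by rewrite inE => /eqP->.
rewrite mem_cat => /orP[/mapP[r rt ->]|/flatten_mapP[r rt /mapP[u ut ->]]] /=.
  by rewrite ltnS IH.
by apply: leqW; apply: leq_trans (IH _ rt); rewrite (annw_size ut) leqnSn.
Qed.

Lemma sum_annP (V : zmodType) (F : R * seq G -> V) f P :
  \sum_(p <- annP f P) F p = \sum_(p <- P) \sum_(r <- annw f p.2) F (p.1 * r.1, r.2).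
Proof. by rewrite big_flatten big_map; apply: eq_bigr => p _; rewrite big_map. Qed.

Definition vcoef P : R := \sum_(p <- P) p.1 * (p.2 == [::])%:R.

End FormalWords.

(** Moments see only the covariances of the letters that occur, so the covariance may be set to zero
    outside a finite list of vectors. *)
Lemma wick_eq (R : comNzRingType) (G : eqType) (q : R) (ga gb : G -> G -> R) (fs : seq G) w :
  {in fs &, forall f g, ga f g = gb f g} -> {subset w <= fs} -> wick ga q w = wick gb q w.
Proof.
move=> e; have ae f s : f \in fs -> {subset s <= fs} -> annw ga q f s = annw gb q f s.
  move=> ff; elim: s => [//|g s IH] sf /=.
  rewrite IH ?e//; first by apply: sf; rewrite mem_head.
  by move=> x xs; apply: sf; rewrite inE xs orbT.
have se f s p : {subset s <= fs} -> p \in annw gb q f s -> {subset p.2 <= fs}.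
  elim: s p => [//|g s IH] p sf /=; have sf' : {subset s <= fs}.
    by move=> x xs; apply: sf; rewrite inE xs orbT.
  rewrite inE => /orP[/eqP->//|/mapP[r rt ->]] x /=.
  rewrite inE => /orP[/eqP->|]; first by apply: sf; rewrite mem_head.
  exact: (IH r).
suff H : {subset w <= fs} -> wick ga q w = wick gb q w /\
  forall p, p \in wick gb q w -> {subset p.2 <= fs} by move=> /H[].
elim: w => [_|f w IH wf] /=; first by split=> // p; rewrite inE => /eqP->.
have ff : f \in fs by apply: wf; rewrite mem_head.
have [|e1 s1] := IH; first by move=> x xw; apply: wf; rewrite inE xw orbT.
rewrite e1; split; last first.
  move=> p; rewrite mem_cat => /orP[/mapP[r rt ->]|/flatten_mapP[r rt /mapP[u ut ->]]] x /=.
    by rewrite inE => /orP[/eqP->//|]; apply: s1 rt _.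
  by apply: se ut _; exact: s1 rt.
congr (_ ++ _); rewrite /annP; congr flatten; apply/eq_in_map => p pw.
by rewrite ae//; exact: s1 pw.
Qed.

Section BabyWick.
Variables (R : realType) (q : R) (m : nat).
Hypothesis hq : -1 < q < 1.
Local Notation T := {ffun 'I_m -> bool}.
Local Notation Sg := {ffun 'I_m * 'I_m -> bool}.
Variables (G : eqType) (cf : G -> 'I_m -> R) (ga : G -> G -> R) (eta : R).
Hypothesis eta01 : 0 <= eta <= 1.
Hypothesis cfga : forall f g, \sum_i cf f i * cf g i = ga f g.
Hypothesis cfeta : forall f i, `|cf f i| <= eta.
Implicit Types (f g : G) (s w : seq G) (P : seq (R * seq G)) (X Y : Sg -> T -> R) (o : Sg).

Lemma eq_EN X Y : (forall o J, X o J = Y o J) -> EN q X = EN q Y.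
Proof. by move=> h; apply: eq_EE => o; apply: eq_bigr => J _; rewrite h. Qed.

Lemma END X Y : EN q (fun o J => X o J + Y o J) <= 2 * EN q X + 2 * EN q Y.
Proof.
rewrite /EN -!EEZ -big_split; apply: ler_sum => o _ /=.
rewrite -mulrDr; apply: ler_wpM2l; [exact: wt_ge0|exact: nsqD_le].
Qed.

Lemma EN_scale a X : EN q (fun o J => a * X o J) = a ^+ 2 * EN q X.
Proof. by rewrite /EN -EEZ; apply: eq_EE => o; rewrite nsqZ. Qed.

Lemma EN_cre n c X : (forall o, suppl n (X o)) ->
  EN q (fun o => cre o c (X o)) <= n.+1%:R * csq c * EN q X.
Proof. by move=> sX; rewrite /EN -EEZ; apply: EE_le => // o; exact: nsq_cre. Qed.

Lemma EN_ann n c X : (forall o, suppl n (X o)) ->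
  EN q (fun o => ann o c (X o)) <= n%:R * csq c * EN q X.
Proof. by move=> sX; rewrite /EN -EEZ; apply: EE_le => // o; exact: nsq_ann. Qed.

Lemma EN_ge0 X : 0 <= EN q X.
Proof. by apply: sumr_ge0 => o _; rewrite mulr_ge0 ?wt_ge0 ?nsq_ge0. Qed.

Lemma csq_cf f : csq (cf f) = ga f f.
Proof. by rewrite -cfga; apply: eq_bigr => i _; rewrite expr2. Qed.

Lemma ga_ge0 f : 0 <= ga f f.
Proof. by rewrite -csq_cf csq_ge0. Qed.

Definition uvec o s : T -> R := foldr (fun g x => cre o (cf g) x) (dlt R (emp m)) s.
Definition upol o P J : R := \sum_(p <- P) p.1 * uvec o p.2 J.

Lemma suppl_uvec o s : suppl (size s) (uvec o s).
Proof.
elim: s => [|g s IH]; last exact: suppl_cre.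
move=> J; rewrite /= /dlt; case: eqP => // ->.
by rewrite /deg (eq_card0 (A := [pred i | (emp m) i]))// => i; rewrite !inE ffunE.
Qed.

Lemma suppl_leq n n' (x : T -> R) : (n <= n')%N -> suppl n x -> suppl n' x.
Proof. by move=> h hx J hJ; apply: hx; exact: leq_ltn_trans hJ. Qed.

Lemma suppl_upol n o P : (forall p, p \in P -> (size p.2 <= n)%N) -> suppl n (upol o P).
Proof.
move=> h J hJ; apply: big1_seq => p /andP[_ pP].
by rewrite (suppl_leq (h p pP) (@suppl_uvec o p.2) hJ) mulr0.
Qed.

Lemma local_uvec s : local (fun o => uvec o s).
Proof. by elim: s => [|g s IH]; [|exact: local_cre]. Qed.

(** This and the later bounds depend on the words, on [q] and on the covariance, but not on the
    number of coordinates or on [eta]; hence [eta] can be chosen after them. *)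
Fixpoint ubound s : R := if s is g :: t then (size t).+1%:R * ga g g * ubound t else 1.

Lemma EN_uvec s : EN q (fun o => uvec o s) <= ubound s.
Proof.
elim: s => [|g s IH] /=.
  rewrite /EN /EE -[leRHS](wt_sum q m) ler_sum// => o _; rewrite /nsq (bigD1 (emp m))//= big1.
    by rewrite /dlt eqxx expr1n addr0 mulr1.
  by move=> J /negbTE hJ; rewrite /dlt hJ expr0n.
apply: (le_trans (EN_cre (cf g) (fun o => @suppl_uvec o s))).
by rewrite csq_cf ler_wpM2l// mulr_ge0// ga_ge0.
Qed.

Definition aerr f s o J : R := ann o (cf f) (uvec o s) J - upol o (annw ga q f s) J.

Lemma creB o c (x y : T -> R) J : cre o c (fun I => x I - y I) J = cre o c x J - cre o c y J.
Proof. by rewrite -sumrB; apply: eq_bigr => i _; ring. Qed.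

Lemma cre_upol o g P J : cre o (cf g) (upol o P) J = \sum_(p <- P) p.1 * uvec o (g :: p.2) J.
Proof.
rewrite /cre /upol; under eq_bigr do rewrite mulr_sumr.
rewrite exchange_big; apply: eq_bigr => p _ /=; rewrite mulr_sumr.
by apply: eq_bigr => i _; ring.
Qed.

(** Moving the annihilation past [g] leaves the commutation defect [Zv]; the error for the tail
    reappears under the creation of [g], multiplied by [q]. *)
Lemma aerr_cons f g s o J : aerr f (g :: s) o J =
  Zv q o (cf f) (cf g) (uvec o s) J + q * cre o (cf g) (aerr f s o) J.
Proof.
rewrite /aerr creB cre_upol /upol /= big_cons big_map /= /Zv cfga.
have -> : \sum_(j <- annw ga q f s) q * j.1 * cre o (cf g) (uvec o j.2) J =
   q * \sum_(p <- annw ga q f s) p.1 * cre o (cf g) (uvec o p.2) J.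
  by rewrite mulr_sumr; apply: eq_bigr => p _; ring.
ring.
Qed.

Lemma suppl_aerr f s o : suppl (size s) (aerr f s o).
Proof.
move=> J hJ; rewrite /aerr (suppl_ann o (cf f) (@suppl_uvec o s) hJ).
rewrite (@suppl_upol (size s) o _ _ J hJ) ?subrr// => p /annw_size ->; exact: leqnSn.
Qed.

Fixpoint abound f s : R := if s is g :: t then
  2 * ((8 * ga g g + 8) * (size t)%:R ^+ 2 * ubound t) +
  2 * ((size t).+1%:R * ga g g * abound f t) else 0.

Lemma EN_aerr f s : EN q (aerr f s) <= abound f s * eta ^+ 2.
Proof.
elim: s => [|g s IH].
  rewrite mul0r le_eqVlt; apply/orP; left; apply/eqP; rewrite /EN /EE big1// => o _.
  rewrite /nsq big1 ?mulr0// => J _; rewrite /aerr /upol big_nil subr0 /ann big1 ?expr0n//.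
  move=> i _ /=; rewrite /dlt; case: eqP => [e|_]; last by rewrite mulr0.
  suff -> : J i = true by rewrite !(mulr0, mul0r).
  by move/ffunP/(_ i): e; rewrite flip_same ffunE; case: (J i).
rewrite (eq_EN (aerr_cons f g s)); apply: (le_trans (END _ _)).
rewrite [abound _ _]/= [leRHS]mulrDl; apply: lerD; rewrite -[leRHS]mulrA; apply: ler_wpM2l => //.
  apply: (le_trans (EN_Z hq eta01 (local_uvec s) (fun o => @suppl_uvec o s) (cfeta f) (cfeta g))).
  rewrite csq_cf [leRHS]mulrAC; apply: ler_wpM2l; last exact: EN_uvec.
  apply: mulr_ge0; last exact: sqr_ge0.
  apply: mulr_ge0; last exact: sqr_ge0.
  by rewrite addr_ge0// mulr_ge0// ga_ge0.
rewrite EN_scale -[leRHS]mul1r; apply: ler_pM; [exact: sqr_ge0|exact: EN_ge0| |].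
  by case/andP: hq => h1 h2; rewrite expr2; nra.
apply: (le_trans (EN_cre (cf g) (@suppl_aerr f s))).
rewrite csq_cf -[leRHS]mulrA; apply: ler_wpM2l => //.
by rewrite mulr_ge0// ga_ge0.
Qed.

Definition serr f P o J : R := \sum_(p <- P) p.1 * aerr f p.2 o J.

Fixpoint sbound f P : R :=
  if P is p :: P' then 2 * (p.1 ^+ 2 * abound f p.2) + 2 * sbound f P' else 0.

Lemma EN_serr f P : EN q (serr f P) <= sbound f P * eta ^+ 2.
Proof.
elim: P => [|p P IH].
  rewrite mul0r le_eqVlt; apply/orP; left; apply/eqP; rewrite /EN /EE big1// => o _.
  by rewrite /nsq big1 ?mulr0// => J _; rewrite /serr big_nil expr0n.
have e o J : serr f (p :: P) o J = p.1 * aerr f p.2 o J + serr f P o J.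
  by rewrite /serr big_cons.
rewrite (eq_EN e); apply: (le_trans (END _ _)).
rewrite [sbound _ _]/= [leRHS]mulrDl; apply: lerD; rewrite -[leRHS]mulrA; apply: ler_wpM2l => //.
rewrite EN_scale -[leRHS]mulrA; apply: ler_wpM2l; [exact: sqr_ge0|exact: EN_aerr].
Qed.

Definition werr w o J : R :=
  wfld o (map cf w) (dlt R (emp m)) J - upol o (wick ga q w) J.

Lemma fldB o c (x y : T -> R) J : fld o c (fun I => x I - y I) J = fld o c x J - fld o c y J.
Proof. by rewrite -sumrB; apply: eq_bigr => i _; ring. Qed.

Lemma ann_upol o g P J : ann o (cf g) (upol o P) J = \sum_(p <- P) p.1 * ann o (cf g) (uvec o p.2) J.
Proof.
rewrite /ann /upol; under eq_bigr do rewrite mulr_sumr.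
rewrite exchange_big; apply: eq_bigr => p _ /=; rewrite mulr_sumr.
by apply: eq_bigr => i _; ring.
Qed.

Lemma werr_cons f w o J :
  werr (f :: w) o J = fld o (cf f) (werr w o) J + serr f (wick ga q w) o J.
Proof.
rewrite /werr fldB [fld _ _ (upol _ _) _]fldE cre_upol ann_upol /=.
rewrite /serr /upol big_cat /= big_map sum_annP /=.
have -> : \sum_(p <- wick ga q w) p.1 * aerr f p.2 o J =
    \sum_(p <- wick ga q w) p.1 * ann o (cf f) (uvec o p.2) J -
    \sum_(p <- wick ga q w) \sum_(r <- annw ga q f p.2) p.1 * r.1 * uvec o r.2 J.
  rewrite -sumrB; apply: eq_bigr => p _; rewrite /aerr mulrBr; congr (_ - _).
  by rewrite /upol mulr_sumr; apply: eq_bigr => r _; rewrite mulrA.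
ring.
Qed.

Lemma suppl_werr w o : suppl (size w) (werr w o).
Proof.
move=> J hJ; rewrite /werr (@suppl_upol (size w) o _ _ J hJ); last exact: wick_size.
rewrite subr0; elim: w J hJ => [|f w IH] J hJ.
  exact: (@suppl_uvec o [::] J hJ).
rewrite /= fldE (@suppl_cre _ _ (size w))//.
rewrite (@suppl_ann _ _ (size w)) ?addr0//.
by apply: leq_ltn_trans hJ; rewrite /= leqnSn.
Qed.

Fixpoint wbound w : R := if w is f :: w' then
  2 * (4 * (size w').+1%:R * ga f f * wbound w') + 2 * sbound f (wick ga q w') else 0.

Lemma EN_werr w : EN q (werr w) <= wbound w * eta ^+ 2.
Proof.
elim: w => [|f w IH].
  rewrite mul0r le_eqVlt; apply/orP; left; apply/eqP; rewrite /EN /EE big1// => o _.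
  rewrite /nsq big1 ?mulr0// => J _.
  by rewrite /werr /upol big_cons big_nil /= mul1r addr0 subrr expr0n.
rewrite (eq_EN (werr_cons f w)); apply: (le_trans (END _ _)).
rewrite [wbound _]/= [leRHS]mulrDl; apply: lerD; rewrite -[leRHS]mulrA; apply: ler_wpM2l => //; last exact: EN_serr.
rewrite (eq_EN (fun o J => fldE o (cf f) (werr w o) J)); apply: (le_trans (END _ _)).
have h1 := EN_cre (cf f) (@suppl_werr w); have h2 := EN_ann (cf f) (@suppl_werr w).
rewrite csq_cf in h1 h2.
have h3 : (size w)%:R * ga f f * EN q (werr w) <= (size w).+1%:R * ga f f * EN q (werr w).
  by rewrite ler_wpM2r ?EN_ge0// ler_wpM2r ?ga_ge0// ler_nat leqnSn.
have h4 : (size w).+1%:R * ga f f * EN q (werr w) <= (size w).+1%:R * ga f f * (wbound w * eta ^+ 2).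
  by rewrite ler_wpM2l// mulr_ge0// ga_ge0.
have -> : 4 * (size w).+1%:R * ga f f * wbound w * eta ^+ 2 = 4 * ((size w).+1%:R * ga f f * (wbound w * eta ^+ 2)).
  by ring.
move: (le_trans h1 h4) (le_trans h2 (le_trans h3 h4)); move: (_ * (_ * eta ^+ 2)) => d h5 h6.
apply: (@le_trans _ _ (2 * d + 2 * d)); last by lra.
by apply: lerD; apply: ler_wpM2l.
Qed.

Lemma upol_emp o P : upol o P (emp m) = vcoef P.
Proof.
apply: eq_bigr => -[a s] _ /=; congr (_ * _); case: s => [|g s] /=; first by rewrite /dlt eqxx.
by rewrite /cre big1// => i _; rewrite ffunE mulr0 !mul0r.
Qed.

(** Some choice of signs does no worse than the mean. The squared errors are summed over [L] first,
    so that one choice serves all its words; the moment is the vacuum coordinate of the word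
    vector. *)
Lemma baby_moments (L : seq (seq G)) (e : R) : (\sum_(w <- L) wbound w) * eta ^+ 2 < e ^+ 2 -> 0 < e ->
  exists o : Sg, forall w, w \in L ->
    `|wfld o (map cf w) (dlt R (emp m)) (emp m) - vcoef (wick ga q w)| < e.
Proof.
move=> h e0; have : EE q (fun o => \sum_(w <- L) nsq (werr w o)) < e ^+ 2.
  apply: le_lt_trans h; rewrite mulr_suml.
  have -> : EE q (fun o => \sum_(w <- L) nsq (werr w o)) = \sum_(w <- L) EN q (werr w).
    by rewrite /EN /EE exchange_big; apply: eq_bigr => o _ /=; rewrite mulr_sumr.
  by apply: ler_sum => w _; exact: EN_werr.
case/(EE_exists hq) => o ho; exists o => w wL; rewrite -(upol_emp o) -/(werr w o (emp m)).
have : werr w o (emp m) ^+ 2 < e ^+ 2.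
  apply: le_lt_trans ho; apply: (@le_trans _ _ (nsq (werr w o))).
    by rewrite /nsq (bigD1 (emp m))//= lerDl sumr_ge0// => J _; exact: sqr_ge0.
  by rewrite (big_rem w)//= lerDl sumr_ge0// => v _; exact: nsq_ge0.
by rewrite -[X in X < _ -> _]real_normK ?num_real// ltr_pXn2r ?nnegrE// ltW.
Qed.

End BabyWick.

(** * Frames with small coefficients and matrix models *)

Section RealHilbert.
Variables (R : realType) (H : realHilbert R).
Local Notation ip := (inner H).
Implicit Types (f g h u v : H).

Lemma ripDl f g h : ip (f + g) h = ip f h + ip g h.
Proof. exact: linearDl. Qed.

Lemma ripZl (a : R) f h : ip (a *: f) h = a * ip f h.
Proof. exact: linearZl_LR. Qed.

Lemma ripC f g : ip f g = ip g f.
Proof. by rewrite (@hermC _ false idfun) expr0 mul1r. Qed.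

Lemma ripZr (a : R) f h : ip h (a *: f) = a * ip h f.
Proof. by rewrite ripC ripZl ripC. Qed.

Lemma rip0l h : ip 0 h = 0.
Proof. by rewrite -(scale0r 0) ripZl mul0r. Qed.

Lemma ripNl f h : ip (- f) h = - ip f h.
Proof. by rewrite -scaleN1r ripZl mulN1r. Qed.

Lemma rip_suml (s : seq H) (F : H -> H) h :
  ip (\sum_(v <- s) F v) h = \sum_(v <- s) ip (F v) h.
Proof. by elim/big_rec2: _ => [|v y1 y2 _ <-]; rewrite ?rip0l ?ripDl. Qed.

Definition frame_op (vs : seq H) f : H := \sum_(v <- vs) ip f v *: v.

Lemma frame_op_sym vs f g : ip (frame_op vs f) g = ip f (frame_op vs g).
Proof.
rewrite (ripC f) !rip_suml; apply: eq_bigr => v _; rewrite !ripZl (ripC v).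
by rewrite mulrC (ripC v).
Qed.

(** The [vs] built here are orthonormal, but only the reproducing property is recorded: [frame_op]
    is symmetric and fixes the [fs], which is Parseval's identity for them. *)
Lemma gram_schmidt (fs : seq H) : exists vs : seq H,
  (forall f, f \in fs -> frame_op vs f = f) /\ (forall v, v \in vs -> frame_op vs v = v).
Proof.
elim: fs => [|f fs [vs [hf hv]]]; first by exists [::].
pose r := f - frame_op vs f.
have [r0|r0] := eqVneq r 0.
  exists vs; split=> // g; rewrite inE => /orP[/eqP->|]; last exact: hf.
  by apply/esym/eqP; rewrite -subr_eq0 -/r r0.
have rv v : v \in vs -> ip r v = 0.
  by move=> vv; rewrite /r ripDl ripNl frame_op_sym hv// subrr.
have nr0 : `|r| != 0 by rewrite normr_eq0.
pose u := `|r|^-1 *: r.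
have uv v : v \in vs -> ip u v = 0 by move=> vv; rewrite /u ripZl rv// mulr0.
have uu : ip u u = 1.
  by rewrite /u ripZl ripZr -norm_inner expr2 mulKf// mulVf.
have ru : ip r u = `|r| by rewrite /u ripZr -norm_inner expr2 mulrA mulVf// mul1r.
have fu g : frame_op (u :: vs) g = ip g u *: u + frame_op vs g by rewrite /frame_op big_cons.
have pu : frame_op vs u = 0.
  by apply: big1_seq => v /andP[_ vv]; rewrite uv// scale0r.
have pvu g : ip (frame_op vs g) u = 0 by rewrite frame_op_sym pu ripC rip0l.
exists (u :: vs); split=> g; rewrite inE => /orP[/eqP->|gs]; rewrite fu.
- have -> : ip f u = `|r|.
    have -> : f = r + frame_op vs f by rewrite /r subrK.
    by rewrite ripDl pvu addr0 ru.
  by rewrite /u scalerA mulfV// scale1r /r subrK.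
- by rewrite -{1}(hf g gs) pvu scale0r add0r hf.
- by rewrite uu scale1r pu addr0.
- by rewrite -{1}(hv g gs) pvu scale0r add0r hv.
Qed.

Lemma sum_flatten_nseq (F : H -> R) (s : seq H) k :
  \sum_(v <- flatten (nseq k s)) F v = k%:R * \sum_(v <- s) F v.
Proof.
elim: k => [|k IH]; first by rewrite big_nil mul0r.
by rewrite /= big_cat IH /= -natr1 mulrDl mul1r addrC.
Qed.

(* Repeating an orthonormal system [k ^ 2] times, scaled by [1 / k]. *)
Lemma small_frame (fs : seq H) (eta : R) : 0 < eta -> exists vs : seq H,
  {in fs &, forall f g, \sum_(v <- vs) ip f v * ip g v = ip f g} /\
  {in fs & vs, forall f v, `|ip f v| <= eta}.
Proof.
move=> eta0; have [vs [hf hv]] := gram_schmidt fs.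
pose b : R := \sum_(f <- fs) \sum_(v <- vs) `|ip f v|.
have b0 : 0 <= b by apply: sumr_ge0 => f _; apply: sumr_ge0.
have [k hk] : exists k, k.+1%:R^-1 < eta / (b + 1).
  by apply: inv_nat_lt; rewrite divr_gt0// ltr_wpDl.
set c : R := k.+1%:R^-1 in hk.
have c0 : 0 < c by rewrite invr_gt0.
have ck : (k.+1 ^ 2)%:R * (c * c) = 1 :> R by rewrite /c natrX; field.
exists (flatten (nseq (k.+1 ^ 2) (map ( *:%R c) vs))); split=> f g.
  move=> ff gg; rewrite sum_flatten_nseq big_map -{2}(hf g gg) ripC rip_suml mulr_sumr.
  apply: eq_bigr => v _; rewrite !ripZr ripZl (ripC v).
  have aux (x y z t : R) : x * (y * z * (y * t)) = x * (y * y) * (t * z) by ring.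
  by rewrite aux ck mul1r.
move=> ff /flattenP[s /nseqP[-> _] /mapP[v vv ->]].
rewrite ripZr normrM gtr0_norm//.
have h1 : `|ip f v| <= b.
  rewrite /b (big_rem f)//= (big_rem v vv)/= -addrA lerDl addr_ge0//.
    by apply: sumr_ge0.
  by apply: sumr_ge0 => ? _; apply: sumr_ge0.
apply: (@le_trans _ _ (eta / (b + 1) * (b + 1))).
  apply: ler_pM => //; [exact: ltW|exact: ltW|].
  by rewrite (le_trans h1)// lerDl.
by rewrite divfK// gt_eqF// ltr_wpDl.
Qed.

Lemma baby_microstate (q : R) (L : seq (seq H)) (e : R) : -1 < q < 1 -> 0 < e ->
  exists (m : nat) (o : {ffun 'I_m * 'I_m -> bool}) (cf : H -> 'I_m -> R),
    forall w, w \in L ->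
      `|wfld o (map cf w) (dlt R (emp m)) (emp m) - vcoef (wick (fun f g => ip f g) q w)| < e.
Proof.
move=> hq e0; pose fs := flatten L.
(* Both the covariance and the coefficients are cut off outside [fs], so that Parseval's identity
   and the bound by [eta] hold for all vectors. *)
pose ga f g := if (f \in fs) && (g \in fs) then ip f g else 0.
pose K := \sum_(w <- L) wbound q ga w.
pose A := `|K| + 1.
have A1 : 1 <= A by rewrite /A lerDr.
have A0 : 0 < A by apply: lt_le_trans A1.
(* With [A >= 1] above [K], this gives [K eta^2 <= e^2 / (4 A) < e^2]. *)
pose eta := Num.min 1 (e / (2 * A)).
have eta0 : 0 < eta by rewrite lt_min ltr01 divr_gt0// mulr_gt0.
have etaK : K * eta ^+ 2 < e ^+ 2.
  apply: (@le_lt_trans _ _ (A * (e / (2 * A)) ^+ 2)).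
    apply: (@le_trans _ _ (A * eta ^+ 2)).
      rewrite ler_wpM2r ?sqr_ge0// /A (le_trans (ler_norm _))//.
      by rewrite lerDl.
    apply: ler_wpM2l; first exact: ltW.
    rewrite ler_pXn2r// ?nnegrE ?(ltW eta0)//.
      by rewrite ge_min lexx orbT.
    by rewrite divr_ge0 ?mulr_ge0// ltW.
  have -> : A * (e / (2 * A)) ^+ 2 = e ^+ 2 * (4 * A)^-1 by field; rewrite gt_eqF.
  rewrite -[ltRHS]mulr1 ltr_pM2l ?exprn_gt0// invf_lt1 ?mulr_gt0//.
  by lra.
have [vs [hvs hes]] := small_frame fs eta0.
pose cf f (i : 'I_(size vs)) : R := if f \in fs then ip f (tnth (in_tuple vs) i) else 0.
have cfga f g : \sum_i cf f i * cf g i = ga f g.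
  rewrite /cf /ga; case: (boolP (f \in fs)) => ff; last by apply: big1 => i _; rewrite mul0r.
  case: (boolP (g \in fs)) => gg; last by apply: big1 => i _; rewrite mulr0.
  by rewrite /= -(hvs f g ff gg) [RHS]big_tnth.
have cfeta f i : `|cf f i| <= eta.
  rewrite /cf; case: ifP => ff; last by rewrite normr0 ltW.
  by apply: hes => //; apply: (mem_tnth i (in_tuple vs)).
have eta01 : 0 <= eta <= 1 by rewrite ltW// ge_min lexx.
have [og ho] := baby_moments hq eta01 cfga cfeta etaK e0.
exists (size vs), og, cf => w wL.
rewrite -(@wick_eq _ _ q ga _ fs); first exact: ho.
  by move=> f g ff gg; rewrite /ga ff gg.
by move=> x xw; apply/flattenP; exists w.
Qed.

End RealHilbert.

Section BabyMatrices.
Variables (R : realType) (m : nat) (G : Type) (o : {ffun 'I_m * 'I_m -> bool}).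
Variable cf : G -> 'I_m -> R.
Local Notation T := {ffun 'I_m -> bool}.

Definition bmat (f : G) : 'M[R[i]]_#|T| :=
  \matrix_(a, b) (fld o (cf f) (dlt R (enum_val b)) (enum_val a))%:C.

Lemma bmat_mh f : mh (bmat f) = bmat f.
Proof.
apply/matrixP => a b; rewrite !mxE conj_real; congr (_%:C).
rewrite /fld; apply: eq_bigr => i _; rewrite /dlt.
case: eqP => [<-|ne]; first by rewrite sgn_flip_same flipK eqxx.
case: eqP => [e|_]; last by rewrite !mulr0.
by case: ne; rewrite -e flipK.
Qed.

Lemma fld_expand (c : 'I_m -> R) (y : T -> R) J : fld o c y J = \sum_I fld o c (dlt R I) J * y I.
Proof.
rewrite /fld; under [RHS]eq_bigr do rewrite mulr_suml.
rewrite exchange_big; apply: eq_bigr => i _ /=.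
rewrite (bigD1 (flip i J))//= big1 ?addr0; first by rewrite /dlt eqxx mulr1.
by move=> I /negbTE IJ; rewrite /dlt eq_sym IJ mulr0 mul0r.
Qed.

Lemma bmat_word w a b :
  foldr (fun f x => bmat f *m x) 1%:M w a b =
  (wfld o (map cf w) (dlt R (enum_val b)) (enum_val a))%:C.
Proof.
elim: w a => [|f w IH] a; first by rewrite mxE /= /dlt (inj_eq enum_val_inj); case: eqP.
rewrite /= mxE fld_expand rmorph_sum (reindex (fun k : 'I_#|T| => enum_val k)); last first.
  by apply: onW_bij; exact: enum_val_bij.
by apply: eq_bigr => k _; rewrite IH mxE rmorphM.
Qed.

Lemma bmat_tau w :
  tau (foldr (fun f x => bmat f *m x) 1%:M w) =
  (wfld o (map cf w) (dlt R (emp m)) (emp m))%:C.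
Proof.
rewrite /tau /mxtrace; under eq_bigr do rewrite bmat_word diag_const.
rewrite sumr_const card_ord -[X in _ * X]mulr_natl mulrA -(rmorph_nat (real_complex R)) -rmorphM mulVf ?rmorph1 ?mul1r//.
by rewrite pnatr_eq0 -lt0n; apply/card_gt0P; exists (emp m).
Qed.

End BabyMatrices.

Lemma q_microstate (R : realType) (H : realHilbert R) (q : R) (L : seq (seq H)) (n : nat) :
  -1 < q < 1 -> exists (d : nat) (B : H -> 'M[R[i]]_d), (forall f, mh (B f) = B f) /\
    forall w, w \in L -> nr (tau (foldr (fun f x => B f *m x) 1%:M w) -
      (vcoef (wick (fun f g => inner H f g) q w))%:C) < n.+1%:R^-1.
Proof.
move=> hq; have [|m [og [cf h]]] := @baby_microstate R H q L n.+1%:R^-1 hq.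
  by rewrite invr_gt0.
exists #|{ffun 'I_m -> bool}|, (bmat og cf); split; first exact: bmat_mh.
by move=> w /h; rewrite bmat_tau -rmorphB nr_real.
Qed.

(** * Permutations, inversions and annihilation *)

Lemma inversions_sum n (s : 'S_n) :
  inversions s = (\sum_(a < n) \sum_(b < n) ((a < b) && (s b < s a) : nat))%N.
Proof.
rewrite /inversions -sum1_card big_mkcond pair_big /=; apply: eq_bigr => p _.
rewrite (_ : (p \in _) = (p.1 < p.2)%N && (s p.2 < s p.1)%N); first by case: (_ && _).
by apply/idP/idP => [/set_mem|h]; [|exact: mem_set].
Qed.

Lemma sum_ltn_ord n k : (\sum_(j < n) (j < k : nat) = minn n k)%N.
Proof.
elim: n => [|n IH]; first by rewrite big_ord0 min0n.
rewrite big_ord_recr /= IH /minn; have [h|h] := ltnP n k.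
  by rewrite addn1; case: ltnP => // h'; apply/eqP; rewrite eqn_leq h h'.
by rewrite addn0 ltnNge (leqW h).
Qed.

(** The first position, sent to [k], forms an inversion with each of the [k] smaller values; the
    other positions keep their relative order. *)
Lemma inversions_lift n (k : 'I_n.+1) (s : 'S_n) :
  inversions (lift_perm ord0 k s) = (k + inversions s)%N.
Proof.
rewrite !inversions_sum big_ord_recl; congr (_ + _)%N.
  rewrite big_ord_recl ltnn add0n lift_perm_id.
  rewrite (eq_bigr (fun j : 'I_n => (s j < k)%N : nat)) => [|j _].
    transitivity (\sum_(j < n) (j < k : nat))%N; first by rewrite [RHS](reindex_inj (@perm_inj _ s)).
    by rewrite sum_ltn_ord; apply/minn_idPr; rewrite -ltnS.
  rewrite lift_perm_lift /= /bump; case: (leqP k (s j)) => h; last by rewrite /= add0n h.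
  by rewrite /= add1n ltnNge (leqW h).
apply: eq_bigr => a _; rewrite big_ord_recl add0n; apply: eq_bigr => b _.
have lb m (i : 'I_m.+1) (x y : 'I_m) : (lift i x < lift i y)%N = (x < y)%N.
  by rewrite !ltnNge leq_bump2.
by rewrite !lift_perm_lift !lb.
Qed.

Lemma sum_lift_perm (V : nmodType) n (k : 'I_n.+1) (f : 'S_n.+1 -> V) :
  \sum_(p : 'S_n.+1 | p ord0 == k) f p = \sum_(s : 'S_n) f (lift_perm ord0 k s).
Proof.
rewrite (reindex (lift_perm ord0 k)); last first.
  pose g (s : 'S_n.+1) j := odflt j (unlift (s ord0) (s (lift ord0 j))).
  have gK (s : 'S_n.+1) j : lift (s ord0) (g s j) = s (lift ord0 j).
    rewrite /g; have := neq_lift ord0 j.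
    by rewrite -(can_eq (permK s)) => /unlift_some[] ? ? ->.
  have gI s : injective (g s).
    by move=> i j ij; apply: (@lift_inj _ ord0); apply: (@perm_inj _ s); rewrite -!gK ij.
  exists (fun s => perm (gI s)) => [s _|s].
    by apply/permP => j; rewrite permE /g lift_perm_lift lift_perm_id liftK.
  move/eqP => sk; apply/permP => j.
  case: (unliftP ord0 j) => [j'|] ->; rewrite ?lift_perm_id//.
  by rewrite lift_perm_lift -sk permE gK.
by apply: eq_bigl => s; rewrite lift_perm_id eqxx.
Qed.

(** The letter at position [k] is contracted after [f] has passed [k] letters, whence the factor
    [q ^+ k]. *)
Lemma sum_annw (A : comNzRingType) (G : eqType) (ga : G -> G -> A) (q : A) (V : nmodType)
    (F : A * seq G -> V) f g0 t :
  \sum_(r <- annw ga q f t) F r =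
  \sum_(k < size t) F (q ^+ k * ga f (nth g0 t k), take k t ++ drop k.+1 t).
Proof.
elim: t F => [|g t IH] F /=; first by rewrite big_nil big_ord0.
rewrite big_cons big_map IH big_ord_recl /= expr0 mul1r drop0; congr (_ + _).
by apply: eq_bigr => k _; rewrite /= exprS mulrA.
Qed.

(** * The q-Fock space *)

Section FockCreation.
Variables (R : realType) (H : realHilbert R) (q : R).
Hypothesis hq : -1 < q < 1.
Variable F : fockSpace H q.
Local Notation C := R[i].
Local Notation K := (complexification H).
Local Notation ci := (@complexification_inner R H).
Local Notation ip := (inner F).
Local Notation ten := (tensor F).
Implicit Types (s t : seq K) (P Q : seq (C * seq K)).

(** Sort the permutations by the image [k] of the first position: [inversions_lift] splits off
    [q ^ k], and what remains pairs [s] with [t] deprived of its [k]-th letter. *)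
Lemma q_inner_cons (f : K) s t : q_inner q (f :: s) t =
  \sum_(r <- annw (fun f g => ci f g) q%:C f t) r.1 * q_inner q s r.2.
Proof.
have [e|ne] := eqVneq (size t) (size s).+1; last first.
  rewrite /q_inner /= eq_sym (negbTE ne) big1_seq// => r /andP[_ /annw_size rt].
  by rewrite rt eqSS eq_sym in ne; rewrite (negbTE ne) mulr0.
rewrite (sum_annw _ _ _ _ 0) e /q_inner /= e eqxx.
rewrite (partition_big (fun p : 'S_(size s).+1 => p ord0) xpredT)//=.
apply: eq_bigr => k _; have kt : (k < size t)%N by rewrite e.
rewrite sum_lift_perm size_cat size_take kt size_drop e subSS.
have -> : size s == (k + (size s - k))%N by rewrite subnKC// -ltnS.
rewrite mulr_sumr; apply: eq_bigr => p _.
rewrite big_ord_recl /= lift_perm_id inversions_lift exprD.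
have -> : \prod_(i < size s) ci s`_i (take k t ++ drop k.+1 t)`_(p i) =
    \prod_(i < size s) ci s`_i t`_(lift_perm ord0 k p (lift ord0 i)).
  apply: eq_bigr => i _; congr (ci _ _); rewrite lift_perm_lift /= /bump.
  rewrite nth_cat size_take kt; case: ltnP => h; first by rewrite nth_take.
  by rewrite nth_drop addSn subnKC.
by rewrite mulrACA mulrA.
Qed.

Definition tens P : F := \sum_(p <- P) p.1 *: ten p.2.

(** The arguments are exchanged because annihilation by [f] is antilinear in [f], and [ci] is
    antilinear in its second argument. *)
Definition gac (f g : K) : C := ci g f.

Lemma ci_conj (f g : K) : Num.conj (ci f g) = ci g f.
Proof.
rewrite /complexification_inner /=; apply/eqP; rewrite eq_complex /=.
by rewrite (ripC f.1) (ripC f.2) (ripC f.2) (ripC f.1) opprB !eqxx.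
Qed.

Lemma annw_conj (f : K) t : annw (fun f g => ci f g) q%:C f t =
  [seq (Num.conj p.1, p.2) | p <- annw gac q%:C f t].
Proof.
elim: t => [//|g t IH] /=; rewrite IH ci_conj -!map_comp; congr (_ :: _).
by apply: eq_map => p /=; rewrite rmorphM /= conj_real.
Qed.

Lemma ip_cons (f : K) s t : ip (ten (f :: s)) (ten t) = ip (ten s) (tens (annw gac q%:C f t)).
Proof.
rewrite tensor_inner q_inner_cons ip_sumr.
rewrite annw_conj big_map.
by apply: eq_bigr => r _ /=; rewrite ipZr tensor_inner.
Qed.

Lemma tens_cat P Q : tens (P ++ Q) = tens P + tens Q.
Proof. by rewrite /tens big_cat. Qed.

Definition sclP (a : C) P : seq (C * seq K) := [seq (a * p.1, p.2) | p <- P].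

Lemma tens_scl a P : tens (sclP a P) = a *: tens P.
Proof.
by rewrite /tens big_map scaler_sumr; apply: eq_bigr => p _; rewrite scalerA.
Qed.

Lemma tens_cre_scl a (f : K) P : tens (creP f (sclP a P)) = a *: tens (creP f P).
Proof.
by rewrite /tens !big_map scaler_sumr; apply: eq_bigr => p _; rewrite scalerA.
Qed.

Lemma tens_ann (f : K) P : tens (annP gac q%:C f P) =
  \sum_(p <- P) p.1 *: tens (annw gac q%:C f p.2).
Proof.
rewrite /tens sum_annP; apply: eq_bigr => p _; rewrite scaler_sumr.
by apply: eq_bigr => r _; rewrite scalerA.
Qed.

Lemma ip_cre (f : K) P Q : ip (tens (creP f P)) (tens Q) = ip (tens P) (tens (annP gac q%:C f Q)).
Proof.
rewrite tens_ann /tens big_map !ip_suml; apply: eq_bigr => p _ /=.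
rewrite !ipZl !ip_sumr; congr (_ * _); apply: eq_bigr => r _.
by rewrite !ipZr ip_cons.
Qed.

Lemma tens_ann_cre (f : K) P : tens (annP gac q%:C f (creP f P)) =
  ci f f *: tens P + q%:C *: tens (creP f (annP gac q%:C f P)).
Proof.
have -> : tens (creP f (annP gac q%:C f P)) =
    \sum_(p <- P) p.1 *: tens (creP f (annw gac q%:C f p.2)).
  rewrite /tens big_map sum_annP; apply: eq_bigr => p _; rewrite big_map scaler_sumr.
  by apply: eq_bigr => r _; rewrite scalerA.
rewrite tens_ann big_map [tens P]/tens !scaler_sumr -big_split; apply: eq_bigr => p _ /=.
rewrite /tens big_cons !big_map /= scalerDr !scalerA [_ * p.1]mulrC; congr (_ + _).
rewrite [q%:C * _]mulrC -scalerA; congr (_ *: _); rewrite scaler_sumr.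
by apply: eq_bigr => r _; rewrite scalerA.
Qed.

Lemma tens_dense x (e : R) : 0 < e -> exists P, nr (x - tens P) < e.
Proof.
move=> e0; have e0' : (0 : C) < e%:C by rewrite (ltcR 0).
have [||y [yb [n [c [s ys]]]]] := @tensor_dense _ _ _ F (interior (ball x e%:C)).
- by exists x; exact: nbhsx_ballx.
- exact: open_interior.
exists [seq (c i, s i) | i <- enum 'I_n].
have -> : tens [seq (c i, s i) | i <- enum 'I_n] = y.
  by rewrite ys /tens big_map big_enum.
by move: (interior_subset yb); rewrite -ball_normE /= norm_nr ltcR.
Qed.

Lemma tens_orthogonal x : (forall P, ip (tens P) x = 0) -> x = 0.
Proof.
move=> h; apply: small_zero => e e0; have [P hP] := tens_dense x e0.
have : nr x ^+ 2 <= nr x * e.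
  rewrite nr_sqr_ip -[X in ip X x](subrK (tens P)) ipDl h addr0.
  apply: (le_trans (Re_ip_le _ _)); rewrite mulrC ler_wpM2l ?nr_ge0//.
  exact: ltW.
have [->|x0] := eqVneq (nr x) 0; first by move=> _; exact: ltW.
by rewrite expr2 ler_pM2l// lt_neqAle eq_sym x0 nr_ge0.
Qed.

(** Induction on the degree, from [|a^* P|^2 = |f|^2 |P|^2 + q |a P|^2]. The vector [a P] has lower
    degree, and by duality the bound of [a^*] there bounds [|a P|] by [c |P|]. The constant solves
    [c^2 = |f|^2 + |q| c^2]. *)
Lemma cre_bound (f : H) P :
  nr (tens (creP (of_real f) P)) <= Num.sqrt (inner H f f / (1 - `|q|)) * nr (tens P).
Proof.
set h := of_real f; set c := Num.sqrt _.
have q1 : 0 < 1 - `|q| by case/andP: hq => h1 h2; rewrite subr_gt0 ltr_norml h1.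
have ff0 : 0 <= inner H f f by rewrite -norm_inner sqr_ge0.
have c0 : 0 <= c by exact: sqrtr_ge0.
have c2 : c ^+ 2 * (1 - `|q|) = inner H f f.
  by rewrite sqr_sqrtr ?divr_ge0 ?(ltW q1)// divfK// gt_eqF.
have hh : ci h h = (inner H f f)%:C.
  by rewrite /complexification_inner /h /of_real /= !rip0l (ripC f 0) rip0l subrr addr0.
have key Q : nr (tens (creP h Q)) ^+ 2 =
    inner H f f * nr (tens Q) ^+ 2 + q * nr (tens (annP gac q%:C h Q)) ^+ 2.
  rewrite [LHS]nr_sqr_ip ip_cre tens_ann_cre ipDr !ipZr hh !conj_real cReD !cReMr.
  by rewrite -nr_sqr_ip Re_ipC ip_cre -nr_sqr_ip.
have step Q : nr (tens (annP gac q%:C h Q)) <= c * nr (tens Q) ->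
    nr (tens (creP h Q)) <= c * nr (tens Q).
  move=> hA; rewrite -(@ler_pXn2r _ 2) ?nnegrE ?mulr_ge0 ?nr_ge0// key exprMn -c2.
  have h1 : nr (tens (annP gac q%:C h Q)) ^+ 2 <= c ^+ 2 * nr (tens Q) ^+ 2.
    by rewrite -exprMn ler_pXn2r ?nnegrE ?mulr_ge0 ?nr_ge0.
  have h2 : q * nr (tens (annP gac q%:C h Q)) ^+ 2 <= `|q| * (c ^+ 2 * nr (tens Q) ^+ 2).
    by apply: (le_trans (ler_wpM2r (sqr_ge0 _) (ler_norm q))); rewrite ler_wpM2l.
  rewrite -subr_ge0; move: h2; rewrite -subr_ge0; move: (nr _ ^+ 2) (nr _ ^+ 2) => a d.
  by congr (0 <= _); ring.
have [n] : exists n, forall p, p \in P -> (size p.2 <= n)%N.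
  by exists (\max_(p <- P) size p.2)%N => p pP; apply: leq_bigmax_seq.
elim: n P => [|n IH] P hP; apply: step.
  rewrite tens_ann big1_seq ?nr0 ?mulr_ge0 ?nr_ge0// => p /andP[_ pP].
  by have := hP p pP; rewrite leqn0 size_eq0 => /eqP->; rewrite /tens big_nil scaler0.
set A := annP _ _ _ _.
have hA : nr (tens (creP h A)) <= c * nr (tens A).
  apply: IH => p /flatten_mapP[r rP /mapP[u ur ->]] /=.
  by rewrite -ltnS -(annw_size ur); exact: hP.
have : nr (tens A) ^+ 2 <= nr (tens P) * (c * nr (tens A)).
  rewrite nr_sqr_ip {2}/A -ip_cre; apply: (le_trans (Re_ip_le _ _)).
  by rewrite mulrC ler_wpM2l ?nr_ge0.
have [->|x0] := eqVneq (nr (tens A)) 0; first by rewrite mulr_ge0 ?nr_ge0.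
rewrite mulrA expr2 ler_pM2r; first by rewrite mulrC.
by rewrite lt_neqAle eq_sym x0 nr_ge0.
Qed.

Local Notation gr := (fun f g : H => inner H f g).
Local Notation re := (map (@of_real R H)).

Implicit Types f : H.

Lemma creation_exists f : exists T : bop F, is_creation (of_real f) T.
Proof.
have [||||T [lT bT TE]] := @dense_extension R F F
  (fun x y => exists2 P, x = tens P & y = tens (creP (of_real f) P))
  (Num.sqrt (inner H f f / (1 - `|q|))).
- exact: sqrtr_ge0.
- move=> a x y x' y' [P -> ->] [Q -> ->]; exists (sclP a P ++ Q).
    by rewrite tens_cat tens_scl.
  by rewrite /creP map_cat tens_cat tens_cre_scl.
- move=> x y [P -> ->]; exact: cre_bound.
- by move=> x e /(tens_dense x)[P hP]; exists (tens P), (tens (creP (of_real f) P)); split=> //; exists P.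
have [S hS] := mkbop lT bT; exists S => s; rewrite hS; apply: TE.
by exists [:: (1, s)]; rewrite /tens big_seq1 scale1r.
Qed.

Definition creop (f : H) : bop F := projT1 (cid (creation_exists f)).

Lemma creopP f : is_creation (of_real f) (creop f).
Proof. exact: projT2 (cid (creation_exists f)). Qed.

Lemma creation_tens (f : K) (T : bop F) P : is_creation f T -> T (tens P) = tens (creP f P).
Proof.
by move=> h; rewrite bop_sum /tens big_map; apply: eq_bigr => p _; rewrite bopZ h.
Qed.

Lemma creation_uniq (f : K) (S T : bop F) : is_creation f S -> is_creation f T -> S = T.
Proof.
move=> hS hT; rewrite -[S]adjbK -[T]adjbK; congr adj; apply: bop_ext => x.
apply/eqP; rewrite -subr_eq0; apply/eqP; apply: tens_orthogonal => P.
by rewrite ipBr -!adjP (creation_tens P hS) (creation_tens P hT) subrr.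
Qed.

Lemma adj_creop f s : adj (creop f) (ten s) = tens (annw gac q%:C (of_real f) s).
Proof.
apply/eqP; rewrite -subr_eq0; apply/eqP; apply: tens_orthogonal => P.
rewrite ipBr -adjP (creation_tens P (creopP f)).
have := ip_cre (of_real f) P [:: (1, s)].
rewrite tens_ann [tens [:: (1, s)]]/tens !big_seq1 !scale1r /= => ->.
by rewrite subrr.
Qed.

Definition gauss (f : H) : bop F := creop f + adj (creop f).

Lemma gauss_adj f : adj (gauss f) = gauss f.
Proof. by rewrite /gauss adjbD adjbK addrC. Qed.

Lemma range_gauss : range gauss = @gaussians R H q F.
Proof.
apply/seteqP; split=> [_ [f _ <-]|_ [f [T [S [cT aTS ->]]]]].
  by exists f, (creop f), (adj (creop f)); split; [exact: creopP|exact: adjoint_adj|].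
exists f => //; rewrite /gauss (creation_uniq (creopP f) cT); congr (_ + _).
exact: esym (adjoint_uniq aTS).
Qed.

(** Gaussians preserve the real span of tensors of real vectors, so vacuum moments are computed with
    the same real lists [wick] as in the baby model. *)
Definition rtens (P : seq (R * seq H)) : F := \sum_(p <- P) p.1%:C *: ten (re p.2).

Lemma annw_real (f : H) (s : seq H) : annw gac q%:C (of_real f) (re s) =
  [seq (p.1%:C, re p.2) | p <- annw gr q f s].
Proof.
elim: s => [//|g s IH] /=; rewrite IH -!map_comp; congr ((_, _) :: _).
  rewrite /gac /complexification_inner /of_real /=.
  by rewrite (ripC g 0) !rip0l subrr addr0 ripC.
by apply: eq_map => p /=; rewrite rmorphM.
Qed.

Lemma gauss_rtens (f : H) (P : seq (R * seq H)) :
  gauss f (rtens P) = rtens (creP f P ++ annP gr q f P).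
Proof.
rewrite bop_sum /rtens big_cat [RHS]/= big_map sum_annP -big_split.
apply: eq_bigr => p _; rewrite [RHS]/=.
rewrite bopZ addbE creopP adj_creop annw_real scalerDr /tens big_map; congr (_ + _).
by rewrite scaler_sumr; apply: eq_bigr => r _; rewrite scalerA -rmorphM.
Qed.

Local Notation Om := (ten [::]).
Local Notation gword := (foldr (fun f T => bop_comp (gauss f) T) (bop_id F)).

Lemma gword_vac (w : seq H) : gword w Om = rtens (wick gr q w).
Proof.
elim: w => [|f w IH]; first by rewrite /rtens big_seq1 scale1r.
by rewrite -[LHS]/(gauss f (gword w Om)) IH gauss_rtens.
Qed.

Lemma gword_moment (w : seq H) : ip (gword w Om) Om = (vcoef (wick gr q w))%:C.
Proof.
rewrite gword_vac ip_suml rmorph_sum; apply: eq_bigr => -[a s] _ /=.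
rewrite ipZl rmorphM tensor_inner; congr (_ * _); case: s => [|g s] //=.
rewrite /q_inner /= (bigD1 (1%g : 'S_0))//= [X in _ + X]big1 ?addr0.
  by rewrite big_ord0 mulr1 inversions_sum big_ord0 expr0.
by move=> p /eqP[]; apply/permP => -[].
Qed.

Definition gspan (x : F) := exists P : seq (C * seq H), x = \sum_(p <- P) p.1 *: gword p.2 Om.

Lemma gspanL a x y : gspan x -> gspan y -> gspan (a *: x + y).
Proof.
move=> [P ->] [Q ->]; exists ([seq (a * p.1, p.2) | p <- P] ++ Q).
rewrite big_cat big_map scaler_sumr; congr (_ + _).
by apply: eq_bigr => p _; rewrite scalerA.
Qed.

Lemma gspan0 : gspan 0.
Proof. by exists [::]; rewrite big_nil. Qed.

Lemma gspan_sum (A : eqType) (s : seq A) (c : A -> C) (x : A -> F) :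
  (forall a, a \in s -> gspan (x a)) -> gspan (\sum_(a <- s) c a *: x a).
Proof.
elim: s => [|a s IH] h; first by rewrite big_nil; exact: gspan0.
rewrite big_cons; apply: gspanL; first by apply: h; rewrite mem_head.
by apply: IH => b bs; apply: h; rewrite inE bs orbT.
Qed.

Lemma gspan_gauss f x : gspan x -> gspan (gauss f x).
Proof.
move=> [P ->]; exists [seq (p.1, f :: p.2) | p <- P]; rewrite bop_sum big_map.
by apply: eq_bigr => p _; rewrite bopZ.
Qed.

(** Creation by [f] is the Gaussian minus annihilation; on a tensor [s] the annihilation produces
    shorter tensors, so induction on the length applies. *)
Lemma gspan_real (s : seq H) : gspan (ten (re s)).
Proof.
have [n] := ubnP (size s); elim: n s => // n IH [|f s] sn.
  by exists [:: (1, [::])]; rewrite big_seq1 scale1r.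
have -> : ten (re (f :: s)) = (-1) *: rtens (annw gr q f s) + gauss f (ten (re s)).
  rewrite addbE creopP adj_creop annw_real /tens big_map -/(rtens _) scaleN1r.
  by rewrite addrC addrK.
apply: gspanL; last by apply/gspan_gauss/IH.
apply: gspan_sum => p /annw_size ps; apply: IH.
by move: sn; rewrite /= ps ltnS => /ltnW.
Qed.

(** Entries are split into real and imaginary parts one at a time by multilinearity; [r] is the
    initial segment that is already real. *)
Lemma gspan_tensor s : gspan (ten s).
Proof.
suff h (r : seq H) : gspan (ten (re r ++ s)) by exact: (h [::]).
elim: s r => [|k s IH] r; first by rewrite cats0; exact: gspan_real.
have -> : k = 'i *: of_real k.2 + of_real k.1.
  case: k => x y; transitivity ((0 *: y - 1 *: 0 + x, 0 *: 0 + 1 *: y + 0) : K); last by [].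
  by rewrite !(scale0r, scale1r, scaler0, subr0, addr0, add0r).
rewrite tensor_linear.
have e (f : H) : re r ++ of_real f :: s = re (rcons r f) ++ s by rewrite map_rcons cat_rcons.
by rewrite !e; apply: gspanL; exact: IH.
Qed.

Lemma gauss_cyclic (x : F) (e : R) : 0 < e -> exists P : seq (C * seq H),
  nr (x - \sum_(p <- P) p.1 *: gword p.2 Om) < e.
Proof.
move=> /(tens_dense x)[P hP].
have [|Q hQ] := @gspan_sum _ P (fun p => p.1) (fun p => ten p.2).
  by move=> p _; exact: gspan_tensor.
by exists Q; rewrite -hQ.
Qed.

Lemma gauss_microstate (L : seq (seq H)) (n : nat) : exists (d : nat) (B : H -> 'M[C]_d),
  (forall f, mh (B f) = B f) /\ forall w, w \in L ->
    nr (tau (foldr (fun f x => B f *m x) 1%:M w) - ip (gword w Om) Om) < n.+1%:R^-1.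
Proof.
have [d [B [hB h]]] := q_microstate L n hq; exists d, B; split=> // w /h.
by rewrite gword_moment.
Qed.

Definition fock_matricial : matricial F :=
  Matricial gauss_adj gauss_cyclic gauss_microstate.

End FockCreation.

Theorem theorem3p3 (R : realType) (H : realHilbert R) (q : R)
    (hq : -1 < q < 1) (F : fockSpace H q) :
  QWEP_operator_algebra (q_gaussian_algebra F).
Proof.
rewrite /q_gaussian_algebra -(range_gauss hq F).
exact: (generated_QWEP (fock_matricial hq F)).
Qed.
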